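(* Let $L,T>0$, let $\rho,\alpha,\lambda,\mu,\rho_1,K,\gamma,b,\rho_3,\delta,\kappa>0$ and $\beta\neq0$ be real constants. Let $(u,\varphi,\psi,w)$ be a solution on $[0,T]$ of $$\begin{cases} \rho u_{tt}-\alpha u_{xx}-\lambda(\varphi-u)+\mu u_t=0,\\ \rho_1\varphi_{tt}-K(\varphi_x+\psi)_x+\lambda(\varphi-u)+\gamma\varphi_t+\beta w_{xt}=0,\\ -b\psi_{xx}+K(\varphi_x+\psi)=0,\\ \rho_3 w_{tt}-\delta w_{xx}+\beta\varphi_{xt}-\kappa w_{xxt}=0, \end{cases}\qquad x\in(0,L),$$ with $u=\varphi=\psi=w=0$ at $x=0,L$ and initial data $u(0)=u_0$, $u_t(0)=u_1$, $\varphi(0)=\varphi_0$, $\varphi_t(0)=\varphi_1$, $\psi(0)=\psi_0$, $w(0)=w_0$, $w_t(0)=w_1$, and suppose that $$u,\varphi,w\in H^3(0,T;L^2(0,L))\cap H^2(0,T;H^1(0,L))\cap W^{1,\infty}(0,T;H^2(0,L)),\qquad \psi\in H^1(0,T;H^2(0,L)).$$ Put $\xi=u_t$, $\Phi=\varphi_t$, $\vartheta=w_t$. Then there is a constant $C>0$, independent of $\Delta t$ and $h$, such that, for all positive integers $M,N$, with $h=L/M$, $\Delta t=T/N$, $t_n=n\Delta t$, the solution $(u_h^n,\xi_h^n,\varphi_h^n,\Phi_h^n,\psi_h^n,w_h^n,\vartheta_h^n)$ of the fully discrete scheme described in the context satisfies, for $n=1,\ldots,N$, $$\begin{aligned} &\|\xi_h^n-\xi(t_n)\|^2+\|u_{hx}^n-(u(t_n))_x\|^2+\|\varphi_h^n-u_h^n-(\varphi(t_n)-u(t_n))\|^2+\|\Phi_h^n-\Phi(t_n)\|^2\\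 &+\|\varphi_{hx}^n+\psi_h^n-((\varphi(t_n))_x+\psi(t_n))\|^2+\|\psi_{hx}^n-(\psi(t_n))_x\|^2\\ &+\|\vartheta_h^n-\vartheta(t_n)\|^2+\|w_{hx}^n-(w(t_n))_x\|^2\le C\left(h^2+(\Delta t)^2\right). \end{aligned}$$
   Context: $(\cdot,\cdot)$ and $\|\cdot\|$ denote the inner product and norm of $L^2(0,L)$; a subscript $x$ denotes the derivative in $x$. Let $0=x_0<x_1<\cdots<x_M=L$ be the uniform partition of $[0,L]$ with $x_{i+1}-x_i=h$. $S_h$ is the space of $v_h\in H_0^1(0,L)$ whose restriction to each $[x_i,x_{i+1}]$ is a polynomial of degree at most $1$. Projection: $P_h:H_0^1(0,L)\to S_h$ is defined by $((P_h\eta-\eta)_x,\chi_{hx})=0$ for all $\chi_h\in S_h$. Discrete initial data: $u_h^0=P_hu_0$, $\xi_h^0=P_hu_1$, $\varphi_h^0=P_h\varphi_0$, $\Phi_h^0=P_h\varphi_1$, $\psi_h^0=P_h\psi_0$, $w_h^0=P_hw_0$, $\vartheta_h^0=P_hw_1$. Scheme: for $n=1,\ldots,N$, find $\xi_h^n,\Phi_h^n,\psi_h^n,\vartheta_h^n\in S_h$ such that for all $\bar u_h,\bar\varphi_h,\bar\psi_h,\bar w_h\in S_h$, $$\begin{cases} \frac{\rho}{\Delta t}(\xi_h^n-\xi_h^{n-1},\bar u_h)+\alpha(u_{hx}^n,\bar u_{hx})-\lambda(\varphi_h^n-u_h^n,\bar u_h)+\mu(\xi_h^n,\bar u_h)=0,\\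 \frac{\rho_1}{\Delta t}(\Phi_h^n-\Phi_h^{n-1},\bar\varphi_h)+K(\varphi_{hx}^n+\psi_h^n,\bar\varphi_{hx})+\lambda(\varphi_h^n-u_h^n,\bar\varphi_h)+\gamma(\Phi_h^n,\bar\varphi_h)+\beta(\vartheta_{hx}^n,\bar\varphi_h)=0,\\ b(\psi_{hx}^n,\bar\psi_{hx})+K(\varphi_{hx}^n+\psi_h^n,\bar\psi_h)=0,\\ \frac{\rho_3}{\Delta t}(\vartheta_h^n-\vartheta_h^{n-1},\bar w_h)+\delta(w_{hx}^n,\bar w_{hx})+\beta(\Phi_{hx}^n,\bar w_h)+\kappa(\vartheta_{hx}^n,\bar w_{hx})=0, \end{cases}$$ where $u_h^n=u_h^{n-1}+\Delta t\,\xi_h^n$, $\varphi_h^n=\varphi_h^{n-1}+\Delta t\,\Phi_h^n$, $w_h^n=w_h^{n-1}+\Delta t\,\vartheta_h^n$. (This system is uniquely solvable at each step.) *)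

(* Defs.v *)
From HB Require Import structures.
From mathcomp Require Import all_boot all_order all_algebra.
From mathcomp Require Import all_classical all_reals all_analysis.

Set Implicit Arguments.
Unset Strict Implicit.
Unset Printing Implicit Defensive.

Import Order.TTheory GRing.Theory Num.Theory.
Import numFieldNormedType.Exports.

Local Open Scope classical_set_scope.
Local Open Scope ring_scope.

(* C_c^1(0, a) *)
Definition test_fun {R : realType} (a : R) (phi : R -> R) : Prop :=
  [/\ forall x : R, derivable phi x 1, continuous (derive1 phi) &
      exists c d : R, [/\ 0 < c, d < a & forall x : R, x \notin `[c, d] -> phi x = 0]].

Section spaces_in_x.
Context {R : realType}.
Variable L : R.
Implicit Types f g eta : R -> R.
Local Notation mu := (@lebesgue_measure R).

(* Elements of L^2(0,L), H^1(0,L), H^2(0,L) are represented by functions on R,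
   of which only the values a.e. in (0,L) matter. *)

Definition ip f g : R := \int[mu]_(x in `]0, L[) (f x * g x).

Definition nrm f : R := Num.sqrt (ip f f).

Definition inL2 : set (R -> R) :=
  [set f | (f \_ `]0, L[) \in Lfun mu 2%:E].

Definition weak_deriv f g : Prop :=
  forall phi, test_fun L phi -> ip f (derive1 phi) = - ip g phi.

Definition eq_ae f g : Prop :=
  \forall x \ae mu, x \in `]0, L[ -> f x = g x.

(* The weak derivative, unique up to a null set; junk if there is none. *)
Definition Dx f : R -> R := xget (fun=> 0) [set g | inL2 g /\ weak_deriv f g].

Definition inH1 : set (R -> R) :=
  [set f | inL2 f /\ exists2 g, inL2 g & weak_deriv f g].

Definition inH2 : set (R -> R) := [set f | inH1 f /\ inH1 (Dx f)].

(* Unlike in inH1, f is here the representative that is continuous on [0,L]. *)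
Definition inH10 : set (R -> R) :=
  [set f | [/\ inH1 f, {within `[0, L], continuous f}, f 0 = 0 & f L = 0]].

Definition inSh (M : nat) : set (R -> R) :=
  [set v | inH10 v /\ forall i, (i < M)%N ->
     exists p : {poly R}, (size p <= 2)%N /\
       forall x : R, x \in `[i%:R * (L / M%:R), i.+1%:R * (L / M%:R)] -> v x = p.[x]].

(* v = P_h eta *)
Definition is_Ph (M : nat) eta v : Prop :=
  inSh M v /\
  forall chi, inSh M chi -> ip (Dx (fun x => v x - eta x)) (Dx chi) = 0.

End spaces_in_x.

(* A seminormed space of functions of x, standing for its quotient by the
   functions of seminorm 0. *)
Record fspace (R : realType) := FSpace {
  fmem : set (R -> R);
  fnorm : (R -> R) -> R }.

Definition L2 {R : realType} (L : R) : fspace R := FSpace (inL2 L) (nrm L).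

Definition H1 {R : realType} (L : R) : fspace R :=
  FSpace (inH1 L) (fun f => Num.sqrt (nrm L f ^+ 2 + nrm L (Dx L f) ^+ 2)).

Definition H2 {R : realType} (L : R) : fspace R :=
  FSpace (inH2 L) (fun f => Num.sqrt (nrm L f ^+ 2 + nrm L (Dx L f) ^+ 2
                                      + nrm L (Dx L (Dx L f)) ^+ 2)).

(* A function of (t, x) is seen as the X-valued function t |-> u t, 0 < t < T. *)
Section bochner.
Context {R : realType}.
Variables (X : fspace R) (T : R).
Implicit Types (u v : R -> R -> R) (y : R -> R).
Local Notation mu := (@lebesgue_measure R).

Record step := Step {
  step_size : nat;
  step_set : 'I_step_size -> set R;
  step_val : 'I_step_size -> R -> R;
  step_meas : forall i, measurable (step_set i : set (measurableTypeR R));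
  step_sub : forall i, step_set i `<=` `]0, T[;
  step_mem : forall i, fmem X (step_val i) }.

Arguments step_set : clear implicits.
Arguments step_val : clear implicits.

Definition step_fun (s : step) (t x : R) : R :=
  \sum_(i < step_size s) \1_(step_set s i) t * step_val s i x.

Definition step_int (s : step) (x : R) : R :=
  \sum_(i < step_size s) fine (mu (step_set s i)) * step_val s i x.

Definition strongly_measurable u : Prop :=
  exists s : nat -> step, \forall t \ae mu, t \in `]0, T[ ->
    fmem X (u t) /\
    fnorm X (fun x => u t x - step_fun (s n) t x) @[n --> \oo] --> (0 : R).

(* y is the Bochner integral of u over (0,T) *)
Definition is_bochner_int u y : Prop :=
  [/\ strongly_measurable u, fmem X y &
   exists s : nat -> step,
     (\int[mu]_(t in `]0%R, T[)
        (fnorm X (fun x => u t x - step_fun (s n) t x)%R)%:E)%E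
        @[n --> \oo] --> 0%E /\
     fnorm X (fun x => y x - step_int (s n) x) @[n --> \oo] --> (0 : R)].

(* L^p(0,T;X) *)
Definition bochner_Lp (p : \bar R) u : Prop :=
  strongly_measurable u /\
  (Lnorm mu p (EFin \o ((fun t => fnorm X (u t)) \_ `]0%R, T[)) < +oo)%E.

Definition time_deriv u v : Prop :=
  forall phi, test_fun T phi ->
    exists2 y, is_bochner_int (fun t x => derive1 phi t * u t x) y &
               is_bochner_int (fun t x => phi t * v t x) (fun x => - y x).

(* W^{k,p}(0,T;X) *)
Fixpoint Wkp (k : nat) (p : \bar R) u : Prop :=
  if k is k'.+1 then
    bochner_Lp p u /\ exists2 v, time_deriv u v & Wkp k' p v
  else bochner_Lp p u.

(* C([0,T];X) *)
Definition C0 u : Prop :=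
  forall t : R, t \in `[0, T] ->
    fmem X (u t) /\
    fnorm X (fun x => u s x - u t x) @[s --> within `[0, T] (nbhs t)] --> (0 : R).

End bochner.

(* u_t in L^2(0,L), unique for a.e. t; junk if there is none. *)
Definition Dt {R : realType} (L T : R) (u : R -> R -> R) : R -> R -> R :=
  xget (fun _ _ => 0) [set v | time_deriv (L2 L) T u v].

(* Main.v *)
Require Import Defs.
From HB Require Import structures.
From mathcomp Require Import all_boot all_order all_algebra.
From mathcomp Require Import all_classical all_reals all_analysis.
From mathcomp Require Import measurable_realfun ess_sup_inf ring lra.

(** The discrete solution is compared with the Ritz projection P of the exact one.
In one dimension P f is nodal interpolation: (P f)_x is the L^2 projection of
f_x on piecewise constants, so that P f - f and, for f in H^2, its derivative
are of size h. It remains to bound the errors u_h^n - P u(t_n), and so on,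
which lie in S_h and vanish at n = 0.

These errors satisfy the equations of the scheme up to residuals. The
equations for u, phi and w are tested with the errors of the velocities, and
the equation for psi, which is elliptic, with the increment of its own error
over the step. The backward difference quotients then produce increments of a
quadratic energy, the two coupling terms with the factor beta cancel after an
integration by parts, and the dampings mu, gamma and kappa absorb what is
linear in the velocities. The residual of the elliptic equation is of size h
but is paired with an increment in time, so it is summed by parts in time;
what survives is its own increment, which is of size h times that of the
exact solution. Evaluating the summed inequality at the index where the
energy is largest closes the estimate without a discrete Gronwall lemma
(sum_bound, energy_bound, error_energy_bound, discrete_error).

The residuals over a step from s to t are measured by a single nondecreasing
function G with |f(t) - f(s)|^2 <= (t - s) (G(t) - G(s)) in the norm of L^2,
for f any of the solution components, of their velocities and of the x
derivatives involved (modulus). Such a G exists because f is a primitive of a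
square integrable function of time (regularity), and then the defect of a
difference quotient against the rate at the end of the step is at most
((t - s) (G(t) - G(s)))^(1/2) (mean_slope). The squares of these bounds,
multiplied by the step dt, add up to dt^2 (G(T) - G(0)), which is the first
order in time (sum_mesh_rate).

The equations hold for almost every t, whereas the scheme uses every t_n. For
u and phi the spatial terms are continuous in time with values in L^2, so that
the rates rho u_tt and rho1 phi_tt, replaced by these terms, satisfy mean_slope
at every time. The equation for w contains w_xxt, which exists only for almost
every t, and is used in the tested form obtained by an integration by parts
(weak_w_consistent). The elliptic equation extends to every t by continuity
(weak_psi).

Two analytic facts precede this. A Bochner integral is determined by scalar
integrals against elements of L^2 (bochner_scalar), so that du Bois-Reymond's
lemma on an interval applies in time as well as in space; it gives the
uniqueness of the derivative in time (time_deriv_unique), which identifies the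
velocities with the weak derivatives whose integrability is assumed. And the
velocities vanish at the two ends of the interval, being limits in H^1 of
difference quotients that do (velocity_H10). *)

Set Implicit Arguments.
Unset Strict Implicit.
Unset Printing Implicit Defensive.

Import Order.TTheory GRing.Theory Num.Theory.
Import numFieldNormedType.Exports.

Local Open Scope classical_set_scope.
Local Open Scope ring_scope.

(** * Primitives of integrable functions *)

Section real_integrable.
Context {R : realType}.
Local Notation mu := (@lebesgue_measure R).
Local Notation itg D f := (mu.-integrable D (EFin \o f)).
Variables (D : set R) (mD : measurable (D : set (measurableTypeR R))).
Implicit Types (f g : R -> R).

Lemma eq_itg f g : {in D, f =1 g} -> itg D f -> itg D g.
Proof. by move=> fg; apply: eq_integrable => // x xD /=; rewrite fg. Qed.

Lemma itgZl c f : itg D f -> itg D (fun x => c * f x).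
Proof. by move=> fi; have := integrableZl mD c fi; apply: eq_integrable. Qed.

Lemma itgZr c f : itg D f -> itg D (fun x => f x * c).
Proof.
by move=> /(itgZl c); apply: eq_integrable => // x _; rewrite /= mulrC.
Qed.

Lemma itgD f g : itg D f -> itg D g -> itg D (fun x => f x + g x).
Proof. by move=> fi gi; have := integrableD mD fi gi; apply: eq_integrable. Qed.

Lemma itgN f : itg D f -> itg D (fun x => - f x).
Proof.
by move=> /(itgZl (-1)); apply: eq_integrable => // x _; rewrite /= mulN1r.
Qed.

Lemma itgB f g : itg D f -> itg D g -> itg D (fun x => f x - g x).
Proof. by move=> fi gi; exact: (itgD fi (itgN gi)). Qed.

Lemma itg_norm f : itg D f -> itg D (fun x => `|f x|).
Proof. by move=> fi; have := integrable_abse fi; apply: eq_integrable. Qed.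

Lemma itg_measurable f : itg D f -> measurable_fun D f.
Proof. by move=> fi; apply/measurable_EFinP; exact: measurable_int fi. Qed.

Lemma le_itg f g : measurable_fun D f -> (forall x, D x -> `|f x| <= g x) ->
  itg D g -> itg D f.
Proof.
move=> mf fg gi; apply: (le_integrable mD _ _ gi); first exact/measurable_EFinP.
by move=> x Dx /=; rewrite lee_fin (le_trans (fg x Dx))// ler_norm.
Qed.

End real_integrable.

Section primitive.
Context {R : realType}.
Local Notation mu := (@lebesgue_measure R).
Implicit Types (f g : R -> R) (a b c x : R).

Definition prim f x : R := \int[mu]_(t in `]0, x[) f t.

Lemma integrable_sub f a b c d : a <= c -> d <= b ->
  mu.-integrable `]a, b[ (EFin \o f) -> mu.-integrable `]c, d[ (EFin \o f).
Proof.
move=> ac db; apply: integrableS => //.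
by move=> x /=; rewrite !in_itv/= => /andP[cx xd]; rewrite (le_lt_trans ac cx) (lt_le_trans xd db).
Qed.

Lemma Rintegral_cat f a b c : a <= c -> c <= b ->
  mu.-integrable `]a, b[ (EFin \o f) ->
  \int[mu]_(t in `]a, b[) f t = \int[mu]_(t in `]a, c[) f t + \int[mu]_(t in `]c, b[) f t.
Proof.
move=> ac; rewrite le_eqVlt => /predU1P[->|cb] fi.
  by rewrite [X in _ + X](_ : _ = 0) ?addr0// set_itv_ge ?Rintegral_set0// bnd_simp ltxx.
rewrite -(Rintegral_itvB fi (x := c))//.
have -> : \int[mu]_(t in `]a, c[) f t = \int[mu]_(t in `]a, c]) f t.
  by apply: Rintegral_itv_bndo_bndc; apply: integrable_sub fi => //; exact: ltW.
by rewrite addrC subrK.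
Qed.

Lemma primB f a x y : 0 <= x -> x <= y -> y <= a ->
  mu.-integrable `]0, a[ (EFin \o f) -> prim f y - prim f x = \int[mu]_(t in `]x, y[) f t.
Proof.
move=> x0 xy ya fi; rewrite /prim (@Rintegral_cat f 0 y x)// 1?addrC ?addKr//.
exact: integrable_sub fi.
Qed.

Lemma integrable_patch f (D : set R) : measurable D ->
  mu.-integrable D (EFin \o f) -> mu.-integrable setT (EFin \o (f \_ D)).
Proof. by move=> mD fi; rewrite -restrict_EFin; apply/integrable_restrict => //; rewrite setTI. Qed.

Lemma integrable_unpatch f g (D : set R) : measurable D -> {in D, f =1 g} ->
  mu.-integrable setT (EFin \o f) -> mu.-integrable D (EFin \o g).
Proof.
move=> mD fg fi; have fiD : mu.-integrable D (EFin \o f) by exact: integrableS fi.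
by apply: eq_integrable fiD => // x xD /=; rewrite fg.
Qed.

Lemma prim_patch f a x : 0 < x <= a ->
  prim f x = \int[mu]_y (if y < x then (f \_ `]0, a[) y else 0).
Proof.
move=> /andP[x0 xa]; rewrite /prim Rintegral_mkcond; apply: eq_Rintegral => y _.
rewrite !patchE; case: ifPn; case: ltP => yx; rewrite ?inE/= ?notin_setE/= ?in_itv/=.
- by move=> /andP[y0 _]; rewrite mem_set//= in_itv/= y0 (lt_le_trans yx).
- by move=> /andP[_]; rewrite ltNge yx.
- rewrite ?andbT => y0; case: ifPn => //; rewrite inE/= in_itv/= => /andP[y0' _].
  by exfalso; apply: y0; rewrite y0' yx.
- by [].
Qed.

Section ibp.
Variables (f g : R -> R) (a : R).
Hypothesis a0 : 0 < a.
Hypothesis fi : mu.-integrable `]0, a[ (EFin \o f).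
Hypothesis gi : mu.-integrable `]0, a[ (EFin \o g).
Let f' := f \_ `]0, a[.
Let g' := g \_ `]0, a[.
Let h (z : R * R) : R := if z.2 < z.1 then f' z.1 * g' z.2 else 0.

Let f'i : mu.-integrable setT (EFin \o f'). Proof. exact: integrable_patch. Qed.
Let g'i : mu.-integrable setT (EFin \o g'). Proof. exact: integrable_patch. Qed.
Let mf' : measurable_fun setT f'. Proof. by apply/measurable_EFinP; exact: measurable_int f'i. Qed.
Let mg' : measurable_fun setT g'. Proof. by apply/measurable_EFinP; exact: measurable_int g'i. Qed.

Let mh : measurable_fun setT h.
Proof.
apply: measurable_fun_ifT => //.
  apply: measurable_fun_ltr; [exact: measurable_snd|exact: measurable_fst].
apply: measurable_funM; first exact: measurableT_comp.
exact: measurableT_comp.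
Qed.

Let hi : (mu \x mu)%E.-integrable setT (EFin \o h).
Proof.
apply/integrable12ltyP; first exact/measurable_EFinP.
apply: (@le_lt_trans _ _ (\int[mu]_x (`|f' x|%:E * \int[mu]_y `|g' y|%:E))%E).
  apply: ge0_le_integral => //.
  - by move=> x _; exact: integral_ge0.
  - apply: (@measurable_fun_fubini_tonelli_F _ _ _ _ _ mu (fun z => `|(EFin \o h) z|)%E) => //.
    by apply: measurableT_comp => //; exact/measurable_EFinP.
  - apply: emeasurable_funM => //; apply/measurable_EFinP.
    exact: measurableT_comp.
  - move=> x _; rewrite -ge0_integralZl//; last first.
      by apply/measurable_EFinP; exact: measurableT_comp.
    apply: ge0_le_integral => //.
    + apply: measurableT_comp => //; apply/measurable_EFinP.
      exact: (measurableT_comp mh (measurable_pair1 x)).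
    + apply: emeasurable_funM => //; apply/measurable_EFinP; exact: measurableT_comp.
    + by move=> y _; rewrite /h/= -EFinM lee_fin -normrM; case: ifP; rewrite ?normr0.
rewrite ge0_integralZr//; last 2 first.
  by apply/measurable_EFinP; exact: measurableT_comp.
  by apply: integral_ge0.
apply: lte_mul_pinfty; first exact: integral_ge0.
  rewrite ge0_fin_numE; last exact: integral_ge0.
  by case/integrableP : f'i.
by case/integrableP : g'i.
Qed.

Let measx x : measurable_fun setT (fun y : R => if y < x then g' y else 0 : R).
Proof.
by apply: measurable_fun_ifT => //; apply: measurable_fun_ltr.
Qed.
Let measy y : measurable_fun setT (fun x : R => if y < x then f' x else 0 : R).
Proof.
by apply: measurable_fun_ifT => //; apply: measurable_fun_ltr.
Qed.
Let intx x : mu.-integrable setT (EFin \o (fun y : R => if y < x then g' y else 0 : R)).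
Proof.
apply: le_integrable g'i => //; first by apply/measurable_EFinP; exact: measx.
by move=> y _ /=; case: ifP; rewrite lee_fin ?normr0.
Qed.
Let inty y : mu.-integrable setT (EFin \o (fun x : R => if y < x then f' x else 0 : R)).
Proof.
apply: le_integrable f'i => //; first by apply/measurable_EFinP; exact: measy.
by move=> x _ /=; case: ifP; rewrite lee_fin ?normr0.
Qed.

Let innerx x : (\int[mu]_y (h (x, y))%:E = (f' x * prim g x)%:E)%E.
Proof.
rewrite /h/=; have [x0|x0] := boolP (x \in `]0, a[%classic); last first.
  rewrite /f' patchE (negbTE x0) mul0r; apply: integral0_eq => y _.
  by rewrite mul0r if_same.
move: (x0); rewrite inE/= in_itv/= => /andP[x1 x2].
rewrite (@prim_patch g a); last by rewrite x1 ltW.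
rewrite /Rintegral EFinM fineK; last by apply: integrable_fin_num => //; exact: intx.
rewrite -(integralZl measurableT (intx x)); apply: eq_integral => y _.
by rewrite -EFinM; case: ifP; rewrite ?mulr0.
Qed.

Let innery y : (\int[mu]_x (h (x, y))%:E = (g' y * (prim f a - prim f y))%:E)%E.
Proof.
rewrite /h/=; have [y0|y0] := boolP (y \in `]0, a[%classic); last first.
  rewrite /g' patchE (negbTE y0) mul0r; apply: integral0_eq => x _.
  by rewrite mulr0 if_same.
move: (y0); rewrite inE/= in_itv/= => /andP[y1 y2].
rewrite (primB (a := a)) ?lexx ?ltW//.
rewrite [X in g' y * X](_ : _ = \int[mu]_x (if y < x then f' x else 0)); last first.
  rewrite Rintegral_mkcond; apply: eq_Rintegral => x _.
  rewrite /f' !patchE; case: ltP => xy.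
    do 2 (case: ifPn; rewrite ?inE/= ?notin_setE/= ?in_itv/=) => //.
      by move=> + /andP[_ xa]; rewrite (lt_trans y1 xy) xa.
    by move=> /andP[_ xa]; rewrite xy xa.
  by case: ifPn => //; rewrite inE/= in_itv/= ltNge xy.
rewrite /Rintegral EFinM fineK; last by apply: integrable_fin_num => //; exact: inty.
rewrite -(integralZl measurableT (inty y)); apply: eq_integral => x _.
by rewrite /= -EFinM; case: ifP; rewrite ?mulr0// mulrC.
Qed.

Lemma integrable_prim_mul :
  mu.-integrable `]0, a[ (EFin \o (fun x => f x * prim g x)).
Proof.
have := integrable_fubini_F hi; rewrite /fubini_F.
under [X in integrable _ _ X -> _]eq_fun do rewrite innerx.
apply: integrable_unpatch => // x xD.
by rewrite /f' patchE xD.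
Qed.

(** Both sides integrate f x * g y over the triangle 0 < y < x < a. *)
Lemma fubini_prim : \int[mu]_(x in `]0, a[) (f x * prim g x) =
  \int[mu]_(y in `]0, a[) (g y * (prim f a - prim f y)).
Proof.
have := Fubini hi.
under [X in X = _ -> _]eq_integral do rewrite innerx.
under [X in _ = X -> _]eq_integral do rewrite innery.
move=> H; rewrite [LHS]Rintegral_mkcond [RHS]Rintegral_mkcond /Rintegral.
apply: (congr1 fine); transitivity (\int[mu]_x (f' x * prim g x)%:E)%E.
  by apply: eq_integral => x _; rewrite /f' !patchE; case: ifP => //; rewrite mul0r.
rewrite H; apply: eq_integral => x _.
by rewrite /g' !patchE; case: ifP => //; rewrite mul0r.
Qed.

End ibp.

Lemma prim_ibp f g a : 0 < a ->
  mu.-integrable `]0, a[ (EFin \o f) -> mu.-integrable `]0, a[ (EFin \o g) ->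
  \int[mu]_(x in `]0, a[) (f x * prim g x) + \int[mu]_(x in `]0, a[) (g x * prim f x) =
  prim f a * prim g a.
Proof.
move=> a0 fi gi.
rewrite (fubini_prim fi gi).
have gfi := integrable_prim_mul gi fi.
under eq_Rintegral do rewrite mulrBr.
rewrite RintegralB//; last first.
  by apply: itgZr.
by rewrite subrK RintegralZr// mulrC.
Qed.

End primitive.

(** * Du Bois-Reymond's lemma on an interval *)

Section test_functions.
Context {R : realType}.
Local Notation mu := (@lebesgue_measure R).
Local Notation itg D f := (mu.-integrable D (EFin \o f)).
Implicit Types (a c d e p q x : R).

Lemma itg_continuous (f : R -> R) a b : {within `[a, b], continuous f} -> itg `]a, b[ f.
Proof.
move=> cf; have : itg `[a, b] f.
  by apply: continuous_compact_integrable => //; exact: segment_compact.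
by apply: integrableS => //; exact: subset_itv_oo_cc.
Qed.

Definition pos x : R := Num.max x 0.

Lemma pos_eq0 x : x <= 0 -> pos x = 0. Proof. by rewrite /pos => /max_idPr. Qed.

Lemma pos_id x : 0 <= x -> pos x = x. Proof. by rewrite /pos => /max_idPl. Qed.

Lemma continuous_pos : continuous pos.
Proof.
move=> x; rewrite /pos; apply: (@continuous_max _ _ (fun x => x) (fun=> 0)) => //.
exact: cvg_cst.
Qed.

Lemma sqr_pos_taylor (x h : R) :
  `|pos (h + x) ^+ 2 - pos x ^+ 2 - 2 * pos x * h| <= h ^+ 2.
Proof.
rewrite ler_norml; case: (leP x 0) => x0; case: (leP (h + x) 0) => hx0.
- rewrite (pos_eq0 x0) (pos_eq0 hx0); apply/andP; split; nra.
- rewrite (pos_eq0 x0) (pos_id (ltW hx0)); apply/andP; split; nra.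
- rewrite (pos_id (ltW x0)) (pos_eq0 hx0); apply/andP; split; nra.
- rewrite (pos_id (ltW x0)) (pos_id (ltW hx0)); apply/andP; split; nra.
Qed.

Lemma is_derive_sqr_pos c x :
  is_derive x (1 : R) (fun y => pos (y + c) ^+ 2) (2 * pos (x + c)).
Proof.
have lim : h^-1 *: (pos (h *: (1 : R) + x + c) ^+ 2 - pos (x + c) ^+ 2)
    @[h --> 0^'] --> 2 * pos (x + c).
  apply/cvgrPdist_le => e e0; near=> h.
  have h0 : h != 0 by near: h; exact: nbhs_dnbhs_neq.
  have he : `|h| <= e by near: h; apply: dnbhs0_le.
  have h1 : `|h|^-1 * `|h| = 1 by rewrite mulVf// normr_eq0.
  rewrite [h *: 1]mulr1 -(addrA h x c).
  have -> : 2 * pos (x + c) - h^-1 *: (pos (h + (x + c)) ^+ 2 - pos (x + c) ^+ 2) =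
    - (h^-1 * (pos (h + (x + c)) ^+ 2 - pos (x + c) ^+ 2 - 2 * pos (x + c) * h)).
    by rewrite /GRing.scale/=; field.
  rewrite normrN normrM normfV (le_trans _ he)// ler_pdivrMl ?normr_gt0//.
  by rewrite -expr2 real_normK ?num_real//; exact: sqr_pos_taylor.
split; first by apply/cvg_ex; exists (2 * pos (x + c)).
by apply: cvg_lim.
Unshelve. all: by end_near. Qed.

(** The second difference of the square of the positive part: C^1, constant
    outside (- e, e), with derivative twice the tent of half-width e. *)
Definition hump e x : R := pos (x + e) ^+ 2 - 2 * pos (x + 0) ^+ 2 + pos (x + - e) ^+ 2.
Definition tent e x : R := pos (x + e) - 2 * pos x + pos (x - e).

Lemma is_derive_hump e p x :
  is_derive x (1 : R) (fun y => hump e (y - p)) (2 * tent e (x - p)).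
Proof.
rewrite /hump /tent.
have -> : (fun y : R => pos (y - p + e) ^+ 2 - 2 * pos (y - p + 0) ^+ 2 + pos (y - p - e) ^+ 2) =
  (fun y => pos (y + (- p + e)) ^+ 2) - (2 : R) \*: (fun y => pos (y + (- p)) ^+ 2)
   + (fun y => pos (y + (- p - e)) ^+ 2).
  by apply/funext => y; rewrite !addrfctE opprfctE/= addr0 -!addrA.
have H := is_derive_sqr_pos.
apply: is_derive_eq.
rewrite /GRing.scale/= !addrA; ring.
Qed.

Lemma continuous_tent e p : continuous (fun x => tent e (x - p)).
Proof.
have H (c : R) : continuous (fun x => pos (x + c)).
  move=> x; apply: (@continuous_comp _ _ _ (fun x => x + c) pos); last exact: continuous_pos.
  by apply: cvgD; [exact: cvg_id|exact: cvg_cst].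
rewrite (_ : (fun x => _) = fun x => pos (x + (- p + e)) - 2 * pos (x - p) + pos (x + (- p - e))); last first.
  by apply/funext => y; rewrite /tent !addrA.
move=> x; apply: cvgD; last exact: H.
apply: cvgB; first exact: H.
by apply: cvgM; [exact: cvg_cst|exact: H].
Qed.

Lemma hump_lt e x : 0 < e -> x <= - e -> hump e x = 0.
Proof. by move=> e0 xe; rewrite /hump !pos_eq0; try lra; ring. Qed.

Lemma hump_gt e x : 0 < e -> e <= x -> hump e x = 2 * e ^+ 2.
Proof. by move=> e0 xe; rewrite /hump !pos_id; try lra; ring. Qed.

Lemma tent_out e x : 0 < e -> ~~ (- e < x < e) -> tent e x = 0.
Proof.
move=> e0; rewrite negb_and -!leNgt => /orP[] xe; rewrite /tent.
  by rewrite !pos_eq0; try lra; ring.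
by rewrite !pos_id; try lra; ring.
Qed.

Lemma tent_ge0 e x : 0 < e -> 0 <= tent e x <= e.
Proof.
move=> e0; rewrite /tent; have H y : (pos y = y /\ 0 <= y) \/ (pos y = 0 /\ y <= 0).
  by case: (leP y 0) => [/[dup] h /pos_eq0|/ltW /[dup] h /pos_id]; [right|left].
have [[-> h1]|[-> h1]] := H (x + e); have [[-> h2]|[-> h2]] := H x;
have [[-> h3]|[-> h3]] := H (x - e); apply/andP; split; lra.
Qed.

(** A single hump ends at the constant 2 e^2; the difference of two humps of the
    same width is compactly supported. *)
Lemma test_fun_hump a p q e : 0 < e -> e < p -> e < q -> p < a - e -> q < a - e ->
  test_fun a (fun x => hump e (x - p) - hump e (x - q)).
Proof.
move=> e0 ep eq pa qa.
have D x : is_derive x (1 : R) (fun x => hump e (x - p) - hump e (x - q))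
    (2 * tent e (x - p) - 2 * tent e (x - q)).
  by apply: is_deriveB; exact: is_derive_hump.
split.
- by move=> x; have [] := D x.
- rewrite (_ : derive1 _ = fun x => 2 * tent e (x - p) - 2 * tent e (x - q)); last first.
    by apply/funext => x; rewrite derive1E; have [_ ->] := D x.
  move=> x; apply: cvgB; apply: cvgM; try exact: cvg_cst; exact: continuous_tent.
- exists (Num.min p q - e), (Num.max p q + e); split.
  + by rewrite subr_gt0 lt_min ep eq.
  + by rewrite -ltrBrDr gt_max pa qa.
  + move=> x; rewrite in_itv/= negb_and -!ltNge => /orP[|].
      rewrite ltrBrDr lt_min => /andP[h1 h2].
      by rewrite !hump_lt// ?subr0//; lra.
    rewrite -ltrBrDr gt_max => /andP[h1 h2].
    by rewrite !hump_gt// ?subrr//; lra.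
Qed.

Lemma derive1_hump p q e :
  derive1 (fun x => hump e (x - p) - hump e (x - q)) = fun x => 2 * (tent e (x - p) - tent e (x - q)).
Proof.
apply/funext => x; rewrite derive1E mulrBr.
have D : is_derive x (1 : R) (fun x => hump e (x - p) - hump e (x - q))
    (2 * tent e (x - p) - 2 * tent e (x - q)).
  by apply: is_deriveB; exact: is_derive_hump.
by have [_ ->] := D.
Qed.

Lemma measurable_tent e p (D : set R) : measurable D -> measurable_fun D (fun x => tent e (x - p)).
Proof. by move=> mD; apply: measurable_funTS; apply: continuous_measurable_fun; exact: continuous_tent. Qed.

Lemma integral_tent a e p : 0 < e -> e < p -> p < a - e ->
  \int[mu]_(x in `]0, a[) tent e (x - p) = e ^+ 2.
Proof.
move=> e0 ep pa.
have a0 : 0 < a by lra.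
have := @continuous_FTC2 R (fun x => 2 * tent e (x - p)) (fun x => hump e (x - p)) 0 a a0.
have D x := is_derive_hump e p x.
have ct := @continuous_tent e p.
have ch : continuous (fun x => hump e (x - p)).
  by move=> x; apply: differentiable_continuous; apply/derivable1_diffP; have [] := D x.
rewrite integral_itv_bndoo; last first.
  by apply/measurable_EFinP; apply: measurable_funM => //; exact: measurable_tent.
have -> : hump e (a - p) = 2 * e ^+ 2 by rewrite hump_gt//; lra.
have -> : hump e (0 - p) = 0 by rewrite hump_lt//; lra.
move=> H; apply: (mulfI (_ : (2 : R) != 0)) => //.
rewrite -RintegralZl//.
  rewrite /Rintegral H/= ?oppr0 ?addr0//.
  - by apply: continuous_subspaceT => x; apply: cvgM; [exact: cvg_cst|exact: ct].
  - split.
    + by move=> x _; have [] := D x.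
    + exact/cvg_at_right_filter/ch.
    + exact/cvg_at_left_filter/ch.
  - by move=> x _; rewrite derive1E; have [_ ->] := D x.
by apply: itg_continuous; exact: continuous_subspaceT.
Qed.

(** Unnormalized because the tents, too, have an integral that depends on their width. *)
Lemma lebesgue_pt_avg (f : R -> R) p n : lebesgue_pt f p -> 0 < n ->
  \forall e \near 0^'+, \int[mu]_(x in `]p - e, p + e[) `|f x - f p| <= n * e.
Proof.
move=> fp n0.
move/fine_cvgP : (fp : _ --> (0%R)%:E) => [finavg /cvgrPdist_lt/(_ (n / 2))].
rewrite divr_gt0// => /(_ erefl) small; near=> e.
have e0 : 0 < e by near: e; exact: nbhs_right_gt.
have : `|0 - fine (davg f p e)| < n / 2 by near: e; exact: small.
have : davg f p e \is a fin_num by near: e; exact: finavg.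
have -> : davg f p e =
    (((e *+ 2)^-1)%:E * \int[mu]_(x in `](p - e)%R, (p + e)%R[) (`|f x - f p|%R)%:E)%E.
  rewrite /davg /iavg lebesgue_measure_ball ?ltW// inver mulrn_eq0/= gt_eqF//.
  by rewrite ball_itv.
rewrite /Rintegral; set I := (X in (_ * X)%E).
have I0 : (0 <= I)%E by exact: integral_ge0.
have e2 : 0 < e *+ 2 by rewrite mulrn_wgt0.
have -> : fine (\int[mu]_(x in `](p - e)%R, (p + e)%R[) (`|f x - f p|%R)%:E) = fine I by [].
case: I I0 => [r||]//= r0; last first.
  by rewrite mulry gtr0_sg ?invr_gt0// mul1e.
move=> _; rewrite sub0r normrN ger0_norm; last by rewrite mulr_ge0// invr_ge0 ltW.
rewrite ltr_pdivrMl// => h; apply/ltW; lra.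
Unshelve. all: by end_near. Qed.

End test_functions.

Section du_bois_reymond.
Context {R : realType}.
Local Notation mu := (@lebesgue_measure R).
Local Notation itg D f := (mu.-integrable D (EFin \o f)).
Variables (a : R) (f : R -> R).
Hypothesis a0 : 0 < a.
Hypothesis fi : itg `]0, a[ f.
Let F := f \_ `]0, a[.

Let FE x : x \in `]0, a[ -> F x = f x.
Proof. by move=> xa; rewrite /F patchE mem_set. Qed.

Let lF : locally_integrable setT F.
Proof. exact: integrable_locally. Qed.

Let Fi : itg `]0, a[ F.
Proof. by apply: eq_itg fi => // x; rewrite inE => /FE. Qed.

Let itg_mul_tent e p : 0 < e -> itg `]0, a[ (fun x => F x * tent e (x - p)).
Proof.
move=> e0; apply: (@le_itg _ _ _ _ (fun x => `|F x| * e)) => //.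
- by apply: measurable_funM; [exact: itg_measurable Fi|exact: measurable_tent].
- move=> x _; rewrite normrM ler_wpM2l//.
  by have /andP[t0 t1] := tent_ge0 (x - p) e0; rewrite ger0_norm.
- by apply: itgZr => //; exact: itg_norm.
Qed.

Let tent_avg e p : 0 < e -> e < p -> p < a - e ->
  `|\int[mu]_(x in `]0, a[) (F x * tent e (x - p)) - F p * e ^+ 2| <=
  e * \int[mu]_(x in `]p - e, p + e[) `|F x - F p|.
Proof.
move=> e0 ep pa.
have ct q : itg `]0, a[ (fun x => tent e (x - q)).
  by apply: itg_continuous; apply: continuous_subspaceT; exact: continuous_tent.
rewrite -(integral_tent e0 ep pa) -RintegralZl// -RintegralB//; last 2 first.
  exact: itg_mul_tent.
  exact: itgZl.
have sub : `]p - e, p + e[ `<=` `]0, a[.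
  by move=> x /=; rewrite !in_itv/= => /andP[h1 h2]; apply/andP; split; lra.
have iFp : itg `]0, a[ (fun x => `|F x - F p|).
  apply: itg_norm => //; apply: itgB => //.
  by apply: itg_continuous; apply: continuous_subspaceT => x; exact: cvg_cst.
apply: (le_trans (le_normr_Rintegral _ _)) => //.
  by apply: itgB => //; [exact: itg_mul_tent|exact: itgZl].
have -> : e * \int[mu]_(x in `]p - e, p + e[) `|F x - F p| =
    \int[mu]_(x in `]0, a[) ((fun x => e * `|F x - F p|) \_ `]p - e, p + e[) x.
  rewrite -RintegralZl//; last by apply: integrableS iFp.
  by rewrite -Rintegral_mkcondr; congr Rintegral; rewrite setIidr.
apply: le_Rintegral => //.
- apply: itg_norm => //.
  by apply: itgB => //; [exact: itg_mul_tent|exact: itgZl].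
- rewrite -restrict_EFin; apply/integrable_restrict => //.
  by rewrite setIidr//; apply: integrableS (itgZl _ e iFp).
- move=> x _; rewrite patchE -mulrBl normrM mulrC.
  have /andP[t0 t1] := tent_ge0 (x - p) e0; rewrite ger0_norm//.
  case: ifPn => [_|]; first by rewrite ler_wpM2r.
  rewrite notin_setE/= in_itv/= => xp; rewrite tent_out ?mul0r//.
  by apply/negP => /andP[h1 h2]; apply: xp; apply/andP; split; lra.
Qed.

Let arith (A P Q e n I1 I2 : R) : 0 < e -> I1 <= n / 2 * e -> I2 <= n / 2 * e ->
  `|A - Q * e ^+ 2| <= e * I2 -> `|A - P * e ^+ 2| <= e * I1 -> `|P - Q| <= n.
Proof.
move=> e0 h1 h2; rewrite !ler_norml => /andP[h3 h4] /andP[h5 h6].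
have e2 : 0 < e ^+ 2 by rewrite exprn_gt0.
have k1 : e * I1 <= n / 2 * e ^+ 2 by rewrite expr2 mulrA mulrC ler_pM2r.
have k2 : e * I2 <= n / 2 * e ^+ 2 by rewrite expr2 mulrA mulrC ler_pM2r.
rewrite -(ler_pM2r e2) -[X in _ && X](ler_pM2r e2).
by apply/andP; split; lra.
Qed.

(** The difference of two humps is a test function, so the averages of f against
    the tents at p and at q agree for every small width. At Lebesgue points these
    averages, divided by e^2, converge to f p and f q. *)
Lemma du_bois_reymond :
  (forall phi, test_fun a phi -> \int[mu]_(x in `]0, a[) (f x * derive1 phi x) = 0) ->
  exists c, \forall x \ae mu, x \in `]0, a[ -> f x = c.
Proof.
move=> fphi.
have const p q : p \in `]0, a[ -> q \in `]0, a[ -> lebesgue_pt F p -> lebesgue_pt F q -> F p = F q.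
  rewrite !in_itv/= => /andP[p0 pa] /andP[q0 qa] lp lq.
  apply/eqP; rewrite -subr_eq0 -normr_le0; apply/ler_addgt0Pl => n n0; rewrite addr0.
  near (0:R)^'+ => e.
  have e0 : 0 < e by [].
  have ep : e < p by near: e; exact: nbhs_right_lt.
  have eq : e < q by near: e; exact: nbhs_right_lt.
  have pe : p < a - e.
    by rewrite ltrBrDr -ltrBrDl; near: e; apply: nbhs_right_lt; rewrite subr_gt0.
  have qe : q < a - e.
    by rewrite ltrBrDr -ltrBrDl; near: e; apply: nbhs_right_lt; rewrite subr_gt0.
  have := tent_avg e0 ep pe; have := tent_avg e0 eq qe.
  have : \int[mu]_(x in `]q - e, q + e[) `|F x - F q| <= (n / 2) * e.
    by near: e; apply: lebesgue_pt_avg => //; rewrite divr_gt0.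
  have : \int[mu]_(x in `]p - e, p + e[) `|F x - F p| <= (n / 2) * e.
    by near: e; apply: lebesgue_pt_avg => //; rewrite divr_gt0.
  have : \int[mu]_(x in `]0, a[) (F x * tent e (x - p)) =
         \int[mu]_(x in `]0, a[) (F x * tent e (x - q)).
    have := fphi _ (test_fun_hump e0 ep eq pe qe); rewrite derive1_hump => H.
    apply/eqP; rewrite -subr_eq0 -RintegralB//; [|exact: itg_mul_tent..].
    apply/eqP; apply: (mulfI (_ : (2 : R) != 0)) => //; rewrite mulr0 -RintegralZl//; last first.
      by apply: itgB => //; exact: itg_mul_tent.
    rewrite -[RHS]H; apply: eq_Rintegral => x; rewrite inE => xa.
    by rewrite FE//; ring.
  move=> AB h1 h2 h3 h4; apply: (arith e0 h1 h2 h3); rewrite -AB; exact: h4.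
have [N [mN N0 sN]] := lebesgue_differentiation lF.
(* One Lebesgue point suffices to name the constant. *)
have [p pa lp] : exists2 p, p \in `]0, a[ & lebesgue_pt F p.
  apply: contrapT => H.
  have : (mu `]0%R, a[%classic <= mu N)%E.
    by apply: le_measure; rewrite ?inE// => x xa; apply: sN => lx; apply: H; exists x.
  by rewrite N0 lebesgue_measure_itv/= lte_fin a0 sube0 lee_fin leNgt a0.
exists (F p); exists N; split => // x /=.
move=> /not_implyP [xa fx]; apply: sN => lx; apply: fx.
by rewrite -FE//; exact: const.
Unshelve. all: by end_near. Qed.

End du_bois_reymond.

(** * Almost everywhere statements and weak derivatives *)

Section ae_everywhere.
Context {R : realType}.
Local Notation mu := (@lebesgue_measure R).

Lemma ae_mono (P Q : R -> Prop) : (forall x, P x -> Q x) ->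
  (\forall x \ae mu, P x) -> \forall x \ae mu, Q x.
Proof. by move=> PQ [N [mN N0 sN]]; exists N; split => // x /= Qx; apply: sN => /PQ. Qed.

Lemma ae_conj (P Q : R -> Prop) : (\forall x \ae mu, P x) -> (\forall x \ae mu, Q x) ->
  \forall x \ae mu, P x /\ Q x.
Proof.
move=> aP aQ; apply: (@filterI _ _ (ae_filter_ringOfSetsType mu)).
  exact: aP.
exact: aQ.
Qed.

Lemma ae_forall (P : R -> Prop) : (forall x, P x) -> \forall x \ae mu, P x.
Proof. by move=> H; apply: (ae_mono (P := fun=> True)) => //; exact: (@filterT _ _ (ae_filter_ringOfSetsType mu)). Qed.

(** A set of full measure meets every nonempty open interval. *)
Lemma ae_dense (P : R -> Prop) (a b x e : R) : a < b -> x \in `[a, b] -> 0 < e ->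
  (\forall y \ae mu, y \in `]a, b[ -> P y) ->
  exists y, [/\ y \in `]a, b[, `|y - x| < e & P y].
Proof.
rewrite in_itv/= => ab /andP[ax xb] e0 [N [mN N0 sN]].
apply: contrapT => /forallNP H.
have lu : Num.max a (x - e) < Num.min b (x + e).
  by rewrite lt_min !gt_max ab/=; repeat (apply/andP; split); lra.
have : (mu `](Num.max a (x - e))%R, (Num.min b (x + e))%R[%classic <= mu N)%E.
  apply: le_measure; rewrite ?inE// => y /=.
  rewrite in_itv/= gt_max lt_min => /andP[/andP[h1 h2] /andP[h3 h4]].
  apply: sN => Py; apply: (H y).
  have yab : y \in `]a, b[ by rewrite in_itv/= h1 h3.
  by split => //; [rewrite ltr_distl; lra|exact: Py].
by rewrite N0 lebesgue_measure_itv/= lte_fin lu -EFinB lee_fin leNgt subr_gt0 lu.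
Qed.

Lemma ae_le_everywhere (f : R -> R) (a b c : R) : a < b ->
  {within `[a, b], continuous f} ->
  (\forall y \ae mu, y \in `]a, b[ -> f y <= c) ->
  forall x, x \in `[a, b] -> f x <= c.
Proof.
move=> ab /subspace_continuousP cf aef x xab; apply/ler_addgt0Pl => e e0.
have /cvgrPdist_lt/(_ e e0)[d /= d0 fd] := cf x xab.
have [y [yab yx fy]] := ae_dense ab xab d0 aef.
have yab' : y \in `[a, b] by apply: subset_itv_oo_cc.
have : `|f x - f y| < e by apply: fd => //; rewrite /ball/= distrC.
by rewrite ltr_distlC => /andP[h1 h2]; lra.
Qed.

Lemma ae_eq_everywhere (f : R -> R) (a b c : R) : a < b ->
  {within `[a, b], continuous f} ->
  (\forall y \ae mu, y \in `]a, b[ -> f y = c) ->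
  forall x, x \in `[a, b] -> f x = c.
Proof.
move=> ab cf aef x xab; apply/eqP; rewrite eq_le; apply/andP; split.
  apply: (ae_le_everywhere ab cf) => //.
  by apply: ae_mono aef => y h /h ->.
rewrite -lerN2; apply: (@ae_le_everywhere (fun x => - f x) a b) => //.
  by move=> z; apply: cvgN; exact: cf.
by apply: ae_mono aef => y h /h ->.
Qed.

End ae_everywhere.

Section weak_derivative_1d.
Context {R : realType}.
Local Notation mu := (@lebesgue_measure R).
Local Notation itg D f := (mu.-integrable D (EFin \o f)).
Implicit Types (f g phi : R -> R).

Lemma prim_continuous f a : 0 <= a -> itg `]0, a[ f -> {within `[0, a], continuous (prim f)}.
Proof.
move=> a0 fi.
have fic : itg `[0, a] (f \_ `]0, a[).
  apply: (@integrableS _ _ _ mu setT) => //; exact: integrable_patch.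
have := parameterized_integral_continuous a0 fic.
apply: subspace_eq_continuous => x; rewrite inE/= in_itv/= => /andP[x0 xa].
rewrite /parameterized_integral /prim /Rintegral; congr fine.
have sub : `]0, x[ `<=` `]0, a[ by apply: subset_itvl; rewrite bnd_simp.
rewrite integral_itv_bndoo; last first.
  apply/measurable_EFinP; apply: measurable_funTS.
  by apply: (@itg_measurable _ setT); exact: integrable_patch.
by apply: eq_integral => y; rewrite inE => yx; rewrite patchE mem_set//; exact: sub.
Qed.

Section test.
Variables (a : R) (phi : R -> R).
Hypothesis a0 : 0 < a.
Hypothesis tphi : test_fun a phi.

Lemma test_fun_cvg x : phi y @[y --> x] --> phi x.
Proof.
by apply: differentiable_continuous; apply/derivable1_diffP; have [] := tphi.
Qed.

Lemma test_fun_out x : ~~ (0 < x < a) -> phi x = 0.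
Proof.
have [_ _ [c [d [c0 da out]]]] := tphi => xa; apply: out.
rewrite in_itv/=; apply/negP => /andP[cx xd]; move: xa.
by rewrite (lt_le_trans c0 cx) (le_lt_trans xd da).
Qed.

Lemma itg_derive_test_fun : itg `]0, a[ (derive1 phi).
Proof. by apply: itg_continuous; apply: continuous_subspaceT; have [] := tphi. Qed.

Lemma test_fun_prim x : 0 <= x -> prim (derive1 phi) x = phi x.
Proof.
have [d c _] := tphi.
rewrite le_eqVlt => /predU1P[<-|x0].
  by rewrite /prim set_itv_ge ?bnd_simp ?ltxx// Rintegral_set0 test_fun_out// ltxx.
have := @continuous_FTC2 R (derive1 phi) phi 0 x x0 (continuous_subspaceT c).
rewrite integral_itv_bndoo; last first.
  by apply/measurable_EFinP; apply: measurable_funTS; exact: continuous_measurable_fun.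
rewrite /prim /Rintegral => -> //=.
  by rewrite [X in _ - X]test_fun_out ?ltxx// subr0.
split=> //.
- exact/cvg_at_right_filter/test_fun_cvg.
- exact/cvg_at_left_filter/test_fun_cvg.
Qed.

Lemma itg_mul_bounded f g C : itg `]0, a[ f -> measurable_fun `]0, a[ g ->
  (forall x, x \in `]0, a[ -> `|g x| <= C) -> itg `]0, a[ (fun x => f x * g x).
Proof.
move=> fi mg gC; apply: (@le_itg _ _ _ _ (fun x => `|f x| * C)) => //.
- by apply: measurable_funM => //; exact: itg_measurable fi.
- by move=> x xa; rewrite normrM ler_wpM2l//; exact: gC.
- by apply: itgZr => //; exact: itg_norm.
Qed.

Lemma prim_weak f : itg `]0, a[ f ->
  \int[mu]_(x in `]0, a[) (prim f x * derive1 phi x) = - \int[mu]_(x in `]0, a[) (f x * phi x).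
Proof.
move=> fi; have := prim_ibp a0 fi itg_derive_test_fun.
rewrite [prim (derive1 phi) a]test_fun_prim ?ltW// test_fun_out ?ltxx ?andbF// mulr0.
rewrite [X in X + _](_ : _ = \int[mu]_(x in `]0, a[) (f x * phi x)); last first.
  by apply: eq_Rintegral => x; rewrite inE/= in_itv/= => /andP[x0 _]; rewrite test_fun_prim// ltW.
rewrite [X in _ + X](_ : _ = \int[mu]_(x in `]0, a[) (prim f x * derive1 phi x)); last first.
  by apply: eq_Rintegral => x _; rewrite mulrC.
by move/eqP; rewrite addrC addr_eq0 => /eqP.
Qed.

End test.

Lemma test_fun_derive_bounded a phi : test_fun a phi -> exists2 C, 0 < C &
  forall x, x \in `]0, a[ -> `|phi x| <= C /\ `|derive1 phi x| <= C.
Proof.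
move=> tphi; have [_ cd _] := tphi.
have bnd (g : R -> R) : continuous g -> exists2 C, 0 < C & forall x, x \in `]0, a[ -> `|g x| <= C.
  move=> cg; have : compact (g @` `[0, a]).
    by apply: continuous_compact; [exact: continuous_subspaceT|exact: segment_compact].
  move/compact_bounded => -[M [_ HM]].
  exists (`|M| + 1) => [|x xa]; first by rewrite ltr_wpDl.
  apply: (HM (`|M| + 1)); first by rewrite (le_lt_trans (ler_norm M))// ltrDl.
  by exists x => //; exact: subset_itv_oo_cc.
have [C1 C10 H1] := bnd phi (test_fun_cvg tphi).
have [C2 C20 H2] := bnd (derive1 phi) cd.
exists (C1 + C2) => [|x xa]; first exact: addr_gt0.
split; first by rewrite (le_trans (H1 _ xa))// lerDl ltW.
by rewrite (le_trans (H2 _ xa))// lerDr ltW.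
Qed.

Lemma test_fun_measurable a phi D : test_fun a phi -> measurable D ->
  measurable_fun D phi /\ measurable_fun D (derive1 phi).
Proof.
move=> tphi mD; have [_ cd _] := tphi.
have cphi : continuous phi by exact: test_fun_cvg tphi.
by split; apply: measurable_funTS; apply: continuous_measurable_fun.
Qed.

(** Integration by parts shows that f - prim g has weak derivative 0. *)
Lemma weak_derivative_prim a f g : 0 < a -> itg `]0, a[ f -> itg `]0, a[ g ->
  (forall phi, test_fun a phi ->
    \int[mu]_(x in `]0, a[) (f x * derive1 phi x) = - \int[mu]_(x in `]0, a[) (g x * phi x)) ->
  exists c, \forall x \ae mu, x \in `]0, a[ -> f x = c + prim g x.
Proof.
move=> a0 fi gi fg.
have pi : itg `]0, a[ (prim g) by apply: itg_continuous; apply: prim_continuous => //; exact: ltW.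
have [|phi tphi|c H] := @du_bois_reymond R a (fun x => f x - prim g x) a0.
- exact: itgB.
- have [C C0 HC] := test_fun_derive_bounded tphi.
  have [mp mdp] := test_fun_measurable tphi (measurable_itv `]0, a[).
  under eq_Rintegral do rewrite mulrBl.
  rewrite RintegralB//.
  + by rewrite fg// prim_weak// opprK addNr.
  + exact: (itg_mul_bounded fi mdp (fun x xa => (HC x xa).2)).
  + exact: (itg_mul_bounded pi mdp (fun x xa => (HC x xa).2)).
- by exists c; apply: ae_mono H => x H /H <-; rewrite subrK.
Qed.

Lemma Rintegral_cst_oo (c x y : R) : x <= y -> \int[mu]_(_ in `]x, y[) c = c * (y - x).
Proof.
move=> xy; rewrite (@Rintegral_cst _ _ _ mu `]x, y[)//; congr (_ * _).
have H : mu `]x, y[%classic = (y - x)%:E.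
  rewrite lebesgue_measure_itv/= lte_fin; case: ltP => //= yx.
  by apply/eqP; rewrite eqe eq_sym subr_eq0 eq_le yx xy.
exact: (congr1 fine H).
Qed.

(** By Lebesgue's differentiation theorem. *)
Lemma itg_ae_eq0 a g : 0 < a -> itg `]0, a[ g ->
  (forall x y, 0 < x -> x < y -> y < a -> \int[mu]_(t in `]x, y[) g t = 0) ->
  \forall x \ae mu, x \in `]0, a[ -> g x = 0.
Proof.
move=> a0 gi g0; pose G := g \_ `]0, a[.
have := lebesgue_differentiation (integrable_locally (measurable_itv `]0, a[) gi).
apply: ae_mono => p lp; rewrite in_itv/= => /andP[p0 pa].
have Gp : G p = g p by rewrite /G patchE mem_set//= in_itv/= p0 pa.
apply/eqP; rewrite -normr_le0; apply/ler_addgt0Pl => n n0; rewrite addr0.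
near (0:R)^'+ => e.
have e0 : 0 < e by [].
have ep : e < p by near: e; exact: nbhs_right_lt.
have pe : p < a - e.
  by rewrite ltrBrDr -ltrBrDl; near: e; apply: nbhs_right_lt; rewrite subr_gt0.
have sub : `]p - e, p + e[ `<=` `]0, a[.
  by move=> x /=; rewrite !in_itv/= => /andP[h1 h2]; apply/andP; split; lra.
have gie : itg `]p - e, p + e[ g by apply: integrableS gi.
have ci (c : R) : itg `]p - e, p + e[ (fun=> c).
  by apply: itg_continuous; apply: continuous_subspaceT => x; exact: cvg_cst.
have h : \int[mu]_(x in `]p - e, p + e[) `|G x - G p| <= n * e.
  by near: e; apply: lebesgue_pt_avg.
have : `|\int[mu]_(x in `]p - e, p + e[) (g x - g p)| <= n * e.
  apply: (le_trans (le_normr_Rintegral _ _)) => //; first exact: itgB.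
  apply: le_trans h; rewrite le_eqVlt; apply/orP; left; apply/eqP.
  apply: eq_Rintegral => x; rewrite inE => xe.
  by rewrite Gp /G patchE mem_set//; exact: sub.
rewrite RintegralB// g0; [|lra..].
rewrite Rintegral_cst_oo; last lra.
rewrite sub0r normrN normrM [X in _ * X]ger0_norm; last lra.
rewrite (_ : p + e - (p - e) = 2 * e); last ring.
rewrite mulrCA mulrA ler_pM2r// => h2.
by apply: le_trans h2; rewrite ler_peMl//; lra.
Unshelve. all: by end_near. Qed.

(** The hypothesis says that 0 is a weak derivative of the primitive of g, which
    is therefore constant. *)
Lemma fundamental_lemma a g : 0 < a -> itg `]0, a[ g ->
  (forall phi, test_fun a phi -> \int[mu]_(x in `]0, a[) (g x * phi x) = 0) ->
  \forall x \ae mu, x \in `]0, a[ -> g x = 0.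
Proof.
move=> a0 gi gphi.
have pi : itg `]0, a[ (prim g) by apply: itg_continuous; apply: prim_continuous => //; exact: ltW.
have [phi tphi|c H] := @du_bois_reymond R a (prim g) a0 pi.
  by rewrite prim_weak// gphi// oppr0.
have pc x : x \in `[0, a] -> prim g x = c.
  by apply: (ae_eq_everywhere a0) => //; apply: prim_continuous => //; exact: ltW.
apply: itg_ae_eq0 => // x y x0 xy ya.
by rewrite -(@primB _ g a) ?(ltW x0) ?ltW// !pc ?subrr// in_itv/=; apply/andP; split; lra.
Qed.

End weak_derivative_1d.

(** * The space L^2(0,L) *)

Section L2_theory.
Context {R : realType}.
Local Notation mu := (@lebesgue_measure R).
Local Notation itg D f := (mu.-integrable D (EFin \o f)).
Variable L : R.
Implicit Types (f g h : R -> R).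

(** Replaces the restriction to the interval and the exponent 2 of the L^p space by
    measurability and integrability of the square on the interval. *)
Lemma inL2P f : inL2 L f <-> measurable_fun `]0, L[ f /\ itg `]0, L[ (fun x => f x ^+ 2).
Proof.
rewrite /inL2/=; split=> [lf|[mf fi]].
  split.
    move: lf; rewrite inE => /andP[]; rewrite inE/= => mf _.
    by apply/(measurable_restrictT _ _).2.
  have := Lfun2_integrable_sqr lf.
  by apply: integrable_unpatch => // x xL; rewrite patchE xL.
have mF : measurable_fun setT (f \_ `]0, L[) by exact/(measurable_restrictT _ _).1.
rewrite inE; apply/andP; split; rewrite inE//= /finite_norm unlock.
apply: poweR_lty.
have := integrable_patch (measurable_itv `]0, L[) fi => /integrableP[_].
apply: le_lt_trans; rewrite le_eqVlt; apply/orP; left; apply/eqP.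
apply: eq_integral => x _ /=.
by rewrite !patchE; case: ifPn => _; rewrite ?normr0 ?powR0// normrX powR_mulrn.
Qed.

Lemma L2_measurable f : inL2 L f -> measurable_fun `]0, L[ f.
Proof. by case/inL2P. Qed.

Lemma L2_mul f g : inL2 L f -> inL2 L g -> itg `]0, L[ (fun x => f x * g x).
Proof.
move=> /inL2P[mf fi] /inL2P[mg gi].
apply: (@le_itg _ _ _ _ (fun x => f x ^+ 2 + g x ^+ 2)) => //.
- exact: measurable_funM.
- move=> x _; rewrite ler_norml; apply/andP; split; nra.
- exact: itgD.
Qed.

Lemma L2_le f g : measurable_fun `]0, L[ f -> inL2 L g ->
  (forall x, x \in `]0, L[ -> `|f x| <= `|g x|) -> inL2 L f.
Proof.
move=> mf /inL2P[mg gi] fg; apply/inL2P; split => //.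
apply: (@le_itg _ _ _ _ (fun x => g x ^+ 2)) => //.
  exact: measurable_funX.
move=> x xL; rewrite normrX -(@real_normK _ (g x)) ?num_real//.
by rewrite lerXn2r ?nnegrE ?normr_ge0 ?fg.
Qed.

Lemma L2_cst c : inL2 L (fun=> c).
Proof.
apply/inL2P; split; first exact: measurable_cst.
by apply: itg_continuous; apply: continuous_subspaceT => x; exact: cvg_cst.
Qed.

Lemma L2_bounded f C : measurable_fun `]0, L[ f ->
  (forall x, x \in `]0, L[ -> `|f x| <= C) -> inL2 L f.
Proof.
move=> mf fC; apply: (L2_le mf (L2_cst C)) => x /fC h.
by rewrite (le_trans h)// ler_norm.
Qed.

Lemma L2_continuous f : {within `[0, L], continuous f} -> inL2 L f.
Proof.
move=> cf; apply/inL2P; split; first by apply: itg_measurable => //; exact: itg_continuous.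
by apply: itg_continuous => x; apply: cvgM; exact: cf.
Qed.

Lemma L2_itg f : inL2 L f -> itg `]0, L[ f.
Proof.
move=> lf; have := L2_mul lf (L2_cst 1).
by apply: eq_itg => // x _; rewrite mulr1.
Qed.

Lemma L2_add f g : inL2 L f -> inL2 L g -> inL2 L (fun x => f x + g x).
Proof.
move=> lf lg; apply/inL2P; split.
  by apply: measurable_funD; exact: L2_measurable.
have H := itgD (measurable_itv `]0, L[) (L2_mul lf lf)
   (itgD (measurable_itv `]0, L[) (itgZl (measurable_itv `]0, L[) 2 (L2_mul lf lg)) (L2_mul lg lg)).
by apply: eq_itg H => // x _ /=; ring.
Qed.

Lemma L2_scale c f : inL2 L f -> inL2 L (fun x => c * f x).
Proof.
move=> lf; apply/inL2P; split.
  by apply: measurable_funM => //; exact: L2_measurable.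
have H := itgZl (measurable_itv `]0, L[) (c ^+ 2) (L2_mul lf lf).
by apply: eq_itg H => // x _ /=; ring.
Qed.

Lemma L2_opp f : inL2 L f -> inL2 L (fun x => - f x).
Proof.
move=> /(L2_scale (-1)); congr inL2; apply/funext => x; exact: mulN1r.
Qed.

Lemma L2_sub f g : inL2 L f -> inL2 L g -> inL2 L (fun x => f x - g x).
Proof. by move=> lf lg; exact: (L2_add lf (L2_opp lg)). Qed.

Lemma ipC f g : ip L f g = ip L g f.
Proof. by apply: eq_Rintegral => x _; rewrite mulrC. Qed.

Lemma ipDl f g h : inL2 L f -> inL2 L g -> inL2 L h ->
  ip L (fun x => f x + g x) h = ip L f h + ip L g h.
Proof.
move=> lf lg lh; rewrite /ip; under eq_Rintegral do rewrite mulrDl.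
by rewrite RintegralD//; exact: L2_mul.
Qed.

Lemma ipZl c f h : inL2 L f -> inL2 L h -> ip L (fun x => c * f x) h = c * ip L f h.
Proof.
move=> lf lh; rewrite /ip; under eq_Rintegral do rewrite -mulrA.
by rewrite RintegralZl//; exact: L2_mul.
Qed.

Lemma ipNl f h : inL2 L f -> inL2 L h -> ip L (fun x => - f x) h = - ip L f h.
Proof.
move=> lf lh; rewrite -mulN1r -ipZl//; congr ip; apply/funext => x.
by rewrite mulN1r.
Qed.

Lemma ipBl f g h : inL2 L f -> inL2 L g -> inL2 L h ->
  ip L (fun x => f x - g x) h = ip L f h - ip L g h.
Proof. by move=> lf lg lh; rewrite (ipDl lf (L2_opp lg) lh) ipNl. Qed.

Lemma ipDr f g h : inL2 L f -> inL2 L g -> inL2 L h ->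
  ip L h (fun x => f x + g x) = ip L h f + ip L h g.
Proof. by move=> *; rewrite ipC ipDl// !(ipC h). Qed.

Lemma ipBr f g h : inL2 L f -> inL2 L g -> inL2 L h ->
  ip L h (fun x => f x - g x) = ip L h f - ip L h g.
Proof. by move=> *; rewrite ipC ipBl// !(ipC h). Qed.

Lemma ipZr c f h : inL2 L f -> inL2 L h -> ip L h (fun x => c * f x) = c * ip L h f.
Proof. by move=> *; rewrite ipC ipZl// (ipC h). Qed.

Lemma ip_ge0 f : 0 <= ip L f f.
Proof. by apply: Rintegral_ge0 => x _; rewrite -expr2 sqr_ge0. Qed.

Lemma nrm_ge0 f : 0 <= nrm L f. Proof. exact: sqrtr_ge0. Qed.

Lemma sqr_nrm f : nrm L f ^+ 2 = ip L f f.
Proof. by rewrite sqr_sqrtr// ip_ge0. Qed.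

Lemma cauchy_schwarz f g : inL2 L f -> inL2 L g -> `|ip L f g| <= nrm L f * nrm L g.
Proof.
move=> lf lg; set A := ip L f f; set B := ip L f g; set C := ip L g g.
have A0 : 0 <= A by exact: ip_ge0.
have C0 : 0 <= C by exact: ip_ge0.
have H t : 0 <= A - 2 * t * B + t ^+ 2 * C.
  have := ip_ge0 (fun x => f x - t * g x).
  have ltg := L2_scale t lg; have lfg := L2_sub lf ltg.
  by rewrite ipBl// !ipBr// !ipZr// !ipZl// (ipC g f) -/A -/B -/C; lra.
have BAC : B ^+ 2 <= A * C.
  move: C0; rewrite le_eqVlt => /predU1P[C0|C0].
    have [->|B0] := eqVneq B 0; first by rewrite -C0 expr0n/= mulr0.
    have := H ((A + 1) / (2 * B)); rewrite -C0 mulr0 addr0.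
    rewrite (_ : 2 * ((A + 1) / (2 * B)) * B = A + 1); last by field; rewrite ?B0.
    by lra.
  have := H (B / C); rewrite (_ : _ + _ = (A * C - B ^+ 2) / C); last by field; rewrite gt_eqF.
  by rewrite pmulr_lge0 ?invr_gt0// subr_ge0.
rewrite -(@ler_pXn2r _ 2)// ?nnegrE ?mulr_ge0 ?nrm_ge0//.
by rewrite real_normK ?num_real// exprMn !sqr_nrm.
Qed.

Lemma nrm_triangle f g : inL2 L f -> inL2 L g ->
  nrm L (fun x => f x + g x) <= nrm L f + nrm L g.
Proof.
move=> lf lg; rewrite -(@ler_pXn2r _ 2)// ?nnegrE ?addr_ge0 ?nrm_ge0//.
have lfg := L2_add lf lg.
rewrite sqr_nrm ipDl// !ipDr// (ipC g f) sqrrD !sqr_nrm.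
have := ler_norm (ip L f g); have := cauchy_schwarz lf lg; lra.
Qed.

Lemma nrmZ c f : inL2 L f -> nrm L (fun x => c * f x) = `|c| * nrm L f.
Proof.
move=> lf; have lcf := L2_scale c lf.
rewrite /nrm ipZl// ipZr// mulrA sqrtrM; last by rewrite -expr2 sqr_ge0.
by rewrite -expr2 sqrtr_sqr.
Qed.

Lemma nrmN f : inL2 L f -> nrm L (fun x => - f x) = nrm L f.
Proof.
move=> lf; rewrite -[RHS]mul1r -(normr1 R) -normrN -nrmZ//.
by congr nrm; apply/funext => x; rewrite mulN1r.
Qed.

Lemma nrm_triangleB f g : inL2 L f -> inL2 L g ->
  nrm L (fun x => f x - g x) <= nrm L f + nrm L g.
Proof.
by move=> lf lg; rewrite -(nrmN lg); exact: (nrm_triangle lf (L2_opp lg)).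
Qed.

Lemma nrm_distC f g : nrm L (fun x => f x - g x) = nrm L (fun x => g x - f x).
Proof. by congr Num.sqrt; apply: eq_Rintegral => x _; ring. Qed.

Lemma eq_ae_refl f : eq_ae L f f. Proof. exact: ae_forall. Qed.

Lemma eq_ae_sym f g : eq_ae L f g -> eq_ae L g f.
Proof. by apply: ae_mono => x h /h ->. Qed.

Lemma eq_ae_trans f g h : eq_ae L f g -> eq_ae L g h -> eq_ae L f h.
Proof. by move=> fg gh; apply: ae_mono (ae_conj fg gh) => x [h1 h2] xL; rewrite h1// h2. Qed.

Lemma eq_ae_on f g : {in `]0, L[, f =1 g} -> eq_ae L f g.
Proof. by move=> fg; apply: ae_forall => x /fg. Qed.

Lemma eq_ae_ip f f' g g' : measurable_fun `]0, L[ f -> measurable_fun `]0, L[ f' ->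
  measurable_fun `]0, L[ g -> measurable_fun `]0, L[ g' ->
  eq_ae L f f' -> eq_ae L g g' -> ip L f g = ip L f' g'.
Proof.
move=> mf mf' mg mg' ff' gg'; congr fine; apply: ae_eq_integral => //.
- by apply/measurable_EFinP; exact: measurable_funM.
- by apply/measurable_EFinP; exact: measurable_funM.
- by apply: ae_mono (ae_conj ff' gg') => x [h1 h2] xL; rewrite h1// h2.
Qed.

Lemma eq_ae_nrm f f' : measurable_fun `]0, L[ f -> measurable_fun `]0, L[ f' ->
  eq_ae L f f' -> nrm L f = nrm L f'.
Proof. by move=> mf mf' ff'; congr Num.sqrt; exact: eq_ae_ip. Qed.

Lemma eq_ip f f' g g' : {in `]0, L[, f =1 f'} -> {in `]0, L[, g =1 g'} -> ip L f g = ip L f' g'.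
Proof. by move=> ff' gg'; apply: eq_Rintegral => x; rewrite inE => xL; rewrite ff'// gg'. Qed.

Lemma L2_eq f g : {in `]0, L[, f =1 g} -> inL2 L f -> inL2 L g.
Proof.
move=> fg; rewrite /inL2/= => lf; suff -> : g \_ `]0, L[ = f \_ `]0, L[ by [].
by apply/funext => x; rewrite !patchE; case: ifPn => //; rewrite inE => /fg.
Qed.

Lemma nrm_eq0 f : inL2 L f -> nrm L f = 0 -> eq_ae L f (fun=> 0).
Proof.
move=> lf f0; have ff0 : ip L f f = 0 by rewrite -sqr_nrm f0 expr0n.
have ffi := L2_mul lf lf.
have : (\int[mu]_(x in `]0%R, L[) `|(f x * f x)%R%:E| = 0)%E.
  transitivity (ip L f f)%:E; last by rewrite ff0.
  rewrite /ip /Rintegral fineK; last by apply: integrable_fin_num.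
  by apply: eq_integral => x _; rewrite gee0_abs// lee_fin -expr2 sqr_ge0.
move=> /(ae_eq_integral_abs mu (measurable_itv `]0, L[) (measurable_int _ ffi)).1 H.
apply: ae_mono H => x /= h xL; have /eqP := h xL.
by rewrite eqe mulf_eq0 orbb => /eqP.
Qed.

Lemma nrm_cst c : 0 < L -> nrm L (fun=> c) = `|c| * Num.sqrt L.
Proof.
move=> L0; rewrite /nrm /ip Rintegral_cst_oo ?ltW// subr0 sqrtrM -?expr2 ?sqr_ge0//.
by rewrite sqrtr_sqr.
Qed.

End L2_theory.

(** * Sobolev spaces on (0,L) *)

Section sobolev.
Context {R : realType}.
Local Notation mu := (@lebesgue_measure R).
Local Notation itg D f := (mu.-integrable D (EFin \o f)).
Variable L : R.
Hypothesis L0 : 0 < L.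
Implicit Types (f g h chi : R -> R).
Local Notation mI := (measurable_itv `]0, L[).

Lemma test_fun_L2 phi : test_fun L phi -> inL2 L phi /\ inL2 L (derive1 phi).
Proof.
move=> tphi; have [_ cd _] := tphi; split; apply: L2_continuous.
  by apply: continuous_subspaceT; exact: test_fun_cvg tphi.
exact: continuous_subspaceT.
Qed.

Lemma weak_deriv_eq_ae f f' g g' : inL2 L f -> inL2 L f' -> inL2 L g -> inL2 L g' ->
  eq_ae L f f' -> eq_ae L g g' -> weak_deriv L f g -> weak_deriv L f' g'.
Proof.
move=> /L2_measurable mf /L2_measurable mf' /L2_measurable mg /L2_measurable mg' ff' gg' fg phi tphi.
have [mp mdp] := test_fun_measurable tphi mI.
rewrite -(eq_ae_ip mf mf' mdp mdp ff' (eq_ae_refl L _)).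
by rewrite -(eq_ae_ip mg mg' mp mp gg' (eq_ae_refl L _)) fg.
Qed.

Lemma weak_deriv_uniq f g g' : inL2 L g -> inL2 L g' ->
  weak_deriv L f g -> weak_deriv L f g' -> eq_ae L g g'.
Proof.
move=> lg lg' fg fg'.
have := @fundamental_lemma R L (fun x => g x - g' x) L0 (L2_itg (L2_sub lg lg')).
have H phi : test_fun L phi -> \int[mu]_(x in `]0, L[) ((g x - g' x) * phi x) = 0.
  move=> tphi; have [lp _] := test_fun_L2 tphi.
  rewrite -/(ip L (fun x => g x - g' x) phi) ipBl//; apply/eqP.
  by rewrite subr_eq0 -eqr_opp -fg// -fg'.
by move=> /(_ H); apply: ae_mono => x h /h /eqP; rewrite subr_eq0 => /eqP.
Qed.

Lemma weak_deriv_add f g f' g' : inL2 L f -> inL2 L g -> inL2 L f' -> inL2 L g' ->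
  weak_deriv L f f' -> weak_deriv L g g' ->
  weak_deriv L (fun x => f x + g x) (fun x => f' x + g' x).
Proof.
move=> lf lg lf' lg' ff' gg' phi tphi; have [lp ldp] := test_fun_L2 tphi.
by rewrite !ipDl// ff'// gg'// opprD.
Qed.

Lemma weak_deriv_scale c f f' : inL2 L f -> inL2 L f' -> weak_deriv L f f' ->
  weak_deriv L (fun x => c * f x) (fun x => c * f' x).
Proof.
move=> lf lf' ff' phi tphi; have [lp ldp] := test_fun_L2 tphi.
by rewrite !ipZl// ff'// mulrN.
Qed.

Lemma H1_L2 f : inH1 L f -> inL2 L f. Proof. by case. Qed.

Lemma DxP f : inH1 L f -> inL2 L (Dx L f) /\ weak_deriv L f (Dx L f).
Proof. by case=> lf [g lg fg]; apply: (@xgetPex _ (fun=> 0) [set g | inL2 L g /\ weak_deriv L f g]); exists g. Qed.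

Lemma Dx_L2 f : inH1 L f -> inL2 L (Dx L f). Proof. by case/DxP. Qed.
Lemma Dx_weak f : inH1 L f -> weak_deriv L f (Dx L f). Proof. by case/DxP. Qed.

Lemma weak_H1 f g : inL2 L f -> inL2 L g -> weak_deriv L f g ->
  inH1 L f /\ eq_ae L (Dx L f) g.
Proof.
move=> lf lg fg; have hf : inH1 L f by split => //; exists g.
by split => //; apply: weak_deriv_uniq fg => //; [exact: Dx_L2|exact: Dx_weak].
Qed.

Lemma H1_add f g : inH1 L f -> inH1 L g ->
  inH1 L (fun x => f x + g x) /\ eq_ae L (Dx L (fun x => f x + g x)) (fun x => Dx L f x + Dx L g x).
Proof.
move=> hf hg; apply: weak_H1; [apply: L2_add; exact: H1_L2|apply: L2_add; exact: Dx_L2|].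
by apply: weak_deriv_add; [exact: H1_L2|exact: H1_L2|exact: Dx_L2|exact: Dx_L2|exact: Dx_weak..].
Qed.

Lemma H1_scale c f : inH1 L f ->
  inH1 L (fun x => c * f x) /\ eq_ae L (Dx L (fun x => c * f x)) (fun x => c * Dx L f x).
Proof.
move=> hf; apply: weak_H1; [apply: L2_scale; exact: H1_L2|apply: L2_scale; exact: Dx_L2|].
by apply: weak_deriv_scale; [exact: H1_L2|exact: Dx_L2|exact: Dx_weak].
Qed.

Lemma H1_sub f g : inH1 L f -> inH1 L g ->
  inH1 L (fun x => f x - g x) /\ eq_ae L (Dx L (fun x => f x - g x)) (fun x => Dx L f x - Dx L g x).
Proof.
move=> hf hg; have [hNg dNg] := H1_scale (-1) hg.
have [hfg dfg] := H1_add hf hNg.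
have -> : (fun x => f x - g x) = (fun x => f x + -1 * g x).
  by apply/funext => x; rewrite mulN1r.
split => //; apply: eq_ae_trans dfg _.
by apply: ae_mono dNg => x h /h ->; rewrite mulN1r.
Qed.

(** An equality of functions and not only almost everywhere: [Dx] selects an element
    from a set of candidates, which depends on the class of f only. *)
Lemma Dx_eq_ae f f' : inL2 L f -> inL2 L f' -> eq_ae L f f' -> Dx L f = Dx L f'.
Proof.
move=> lf lf' ff'; rewrite /Dx; congr xget; apply/seteqP; split=> g [lg fg]; split => //.
  exact: (weak_deriv_eq_ae lf lf' lg lg ff' (eq_ae_refl L _)).
exact: (weak_deriv_eq_ae lf' lf lg lg (eq_ae_sym ff') (eq_ae_refl L _)).
Qed.

Lemma H1_eq_ae f f' : inL2 L f' -> eq_ae L f f' -> inH1 L f -> inH1 L f'.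
Proof.
move=> lf' ff' [lf [g lg fg]]; split => //; exists g => //.
exact: (weak_deriv_eq_ae lf lf' lg lg ff' (eq_ae_refl L _)).
Qed.

Lemma prim_L2 g : inL2 L g -> inL2 L (prim g).
Proof. by move=> /L2_itg lg; apply: L2_continuous; apply: prim_continuous => //; exact: ltW. Qed.

Lemma prim_H1 c g : inL2 L g ->
  inH1 L (fun x => c + prim g x) /\ eq_ae L (Dx L (fun x => c + prim g x)) g.
Proof.
move=> lg; apply: weak_H1 => //; first by apply: L2_add; [exact: L2_cst|exact: prim_L2].
move=> phi tphi; have [lp ldp] := test_fun_L2 tphi.
rewrite ipDl//; [|exact: L2_cst|exact: prim_L2].
rewrite /ip (prim_weak L0 tphi) ?L2_itg//.
rewrite (_ : \int[mu]_(x in _) (c * _) = c * prim (derive1 phi) L); last first.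
  by rewrite RintegralZl//; exact: L2_itg.
by rewrite (test_fun_prim tphi) ?ltW// (test_fun_out tphi) ?ltxx ?andbF// mulr0 add0r.
Qed.

Lemma H1_prim f : inH1 L f -> exists c, eq_ae L f (fun x => c + prim (Dx L f) x).
Proof.
move=> hf; have [lf _] := hf; have [ldf wdf] := DxP hf.
by apply: weak_derivative_prim => //; exact: L2_itg.
Qed.

(** The conditions at 0 and L bear on the continuous representative, which is
    a primitive of the weak derivative; stated through that primitive they
    depend on the almost everywhere class of f only, unlike [inH10]. *)
Definition H10 f : Prop :=
  [/\ inH1 L f, eq_ae L f (prim (Dx L f)) & prim (Dx L f) L = 0].

Lemma inH10_prim f : inH10 L f ->
  [/\ inH1 L f, {in `[0, L], f =1 prim (Dx L f)} & prim (Dx L f) L = 0].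
Proof.
move=> [hf cf f0 fL]; have ldf := Dx_L2 hf; have [c fc] := H1_prim hf.
have cp : {within `[0, L], continuous (prim (Dx L f))}.
  by apply: prim_continuous; [exact: ltW|exact: L2_itg].
have fcE x : x \in `[0, L] -> f x - prim (Dx L f) x = c.
  apply: (@ae_eq_everywhere R (fun x => f x - prim (Dx L f) x) 0 L c) => //.
    by move=> y; apply: cvgB; [exact: cf|exact: cp].
  by apply: ae_mono fc => y h /h ->; rewrite addrK.
have p0 : prim (Dx L f) 0 = 0.
  by rewrite /prim set_itv_ge ?bnd_simp ?ltxx// Rintegral_set0.
have c0 : c = 0 by rewrite -(fcE 0) ?f0 ?p0 ?subr0// in_itv/= lexx ltW.
have fE x : x \in `[0, L] -> f x = prim (Dx L f) x.
  by move=> /fcE/eqP; rewrite c0 subr_eq0 => /eqP.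
by split => //; rewrite -fE ?fL// in_itv/= lexx ltW.
Qed.

Lemma inH10_H10 f : inH10 L f -> H10 f.
Proof.
move=> /inH10_prim [hf fE fL]; split => //; apply: eq_ae_on => x xL.
by apply: fE; exact: subset_itv_oo_cc.
Qed.

(** Both functions are primitives up to a constant; the constant contributes
    nothing because chi vanishes at the ends. *)
Lemma H1_ibp g chi : inH1 L g -> H10 chi -> ip L (Dx L g) chi = - ip L g (Dx L chi).
Proof.
move=> hg [hchi chiE chiL]; have [c gE] := H1_prim hg.
have ldg := Dx_L2 hg; have ldchi := Dx_L2 hchi.
have pg : inL2 L (fun x => c + prim (Dx L g) x).
  by apply: L2_add; [exact: L2_cst|exact: prim_L2].
rewrite (@eq_ae_ip _ _ _ (Dx L g) chi (prim (Dx L chi)));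
  [|exact: L2_measurable..| | |exact: eq_ae_refl|by []]; last 2 first.
  by apply: L2_measurable; exact: H1_L2.
  by apply: L2_measurable; exact: prim_L2.
rewrite (@eq_ae_ip _ _ g (fun x => c + prim (Dx L g) x) (Dx L chi) (Dx L chi));
  [|by apply: L2_measurable; exact: H1_L2|exact: L2_measurable..|by []|exact: eq_ae_refl].
rewrite ipDl//; [|exact: L2_cst|exact: prim_L2].
have : ip L (Dx L g) (prim (Dx L chi)) + ip L (Dx L chi) (prim (Dx L g)) = 0.
  by rewrite -(mulr0 (prim (Dx L g) L)) -chiL; exact: prim_ibp L0 (L2_itg ldg) (L2_itg ldchi).
rewrite [ip L (fun=> c) _](_ : _ = c * prim (Dx L chi) L); last first.
  by rewrite /ip RintegralZl//; exact: L2_itg.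
by rewrite chiL mulr0 add0r (ipC L (Dx L chi)) => /eqP; rewrite addr_eq0 => /eqP.
Qed.

Lemma sqr_Rintegral f x y : x <= y -> itg `]x, y[ f -> itg `]x, y[ (fun t => f t ^+ 2) ->
  (\int[mu]_(t in `]x, y[) f t) ^+ 2 <= (y - x) * \int[mu]_(t in `]x, y[) f t ^+ 2.
Proof.
rewrite le_eqVlt => /predU1P[<-|xy] fi f2i.
  by rewrite set_itv_ge ?bnd_simp ?ltxx// !Rintegral_set0 expr0n/= mulr0.
set A := \int[mu]_(t in _) f t; set B := \int[mu]_(t in _) f t ^+ 2.
have ci (c : R) : itg `]x, y[ (fun=> c).
  by apply: itg_continuous; apply: continuous_subspaceT => z; exact: cvg_cst.
(* The variance of f is nonnegative. *)
set m := A / (y - x).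
have : 0 <= \int[mu]_(t in `]x, y[) (f t ^+ 2 - 2 * m * f t + m ^+ 2).
  by apply: Rintegral_ge0 => t _; rewrite (_ : _ + _ = (f t - m) ^+ 2) ?sqr_ge0//; ring.
have mfi := itgZl (measurable_itv `]x, y[) (2 * m) fi.
have fmi := itgB (measurable_itv `]x, y[) f2i mfi.
rewrite RintegralD// RintegralB// RintegralZl// (Rintegral_cst_oo _ (ltW xy)) -/A -/B.
have yx : 0 < y - x by rewrite subr_gt0.
have -> : B - 2 * m * A + m ^+ 2 * (y - x) = ((y - x) * B - A ^+ 2) / (y - x).
  by rewrite /m; field; rewrite gt_eqF.
by rewrite pmulr_lge0 ?invr_gt0// subr_ge0.
Qed.

Lemma nrm_prim g : inL2 L g -> nrm L (prim g) <= L * nrm L g.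
Proof.
move=> ld; rewrite -(@ler_pXn2r _ 2)// ?nnegrE ?mulr_ge0 ?nrm_ge0 ?(ltW L0)//.
rewrite exprMn !sqr_nrm.
have d2 : itg `]0, L[ (fun x => g x ^+ 2) by case/inL2P : ld.
have -> : L ^+ 2 * ip L g g = \int[mu]_(_ in `]0, L[) (L * ip L g g).
  by rewrite (Rintegral_cst_oo _ (ltW L0)) subr0; ring.
apply: le_Rintegral => //.
- by apply: L2_mul; exact: prim_L2.
- exact: L2_itg (L2_cst L _).
- move=> x; rewrite /= in_itv/= => /andP[x0 xL]; rewrite -expr2.
  have sub : `]0, x[ `<=` `]0, L[ by apply: subset_itvl; rewrite bnd_simp ltW.
  apply: (le_trans (sqr_Rintegral (ltW x0) _ _)).
  + exact: integrableS (L2_itg ld).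
  + exact: integrableS d2.
  rewrite subr0; apply: ler_pM; [exact: ltW| |exact: ltW|].
    by apply: Rintegral_ge0 => t _; exact: sqr_ge0.
  rewrite /ip (Rintegral_cat (ltW x0) (ltW xL) (L2_mul ld ld)).
  rewrite -[X in X <= _]addr0 lerD//.
  by apply: Rintegral_ge0 => t _; rewrite -expr2 sqr_ge0.
Qed.

Lemma poincare chi : H10 chi -> nrm L chi <= L * nrm L (Dx L chi).
Proof.
move=> [hchi chiE _]; have ld := Dx_L2 hchi.
rewrite (@eq_ae_nrm _ _ _ (prim (Dx L chi))); first exact: nrm_prim.
- by apply: L2_measurable; exact: H1_L2.
- by apply: L2_measurable; exact: prim_L2.
- by [].
Qed.

Lemma itg_sub0 f x : x <= L -> itg `]0, L[ f -> itg `]0, x[ f.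
Proof. by move=> xL; exact: integrable_sub. Qed.

Lemma prim_eq_ae f g x : x <= L -> inL2 L f -> inL2 L g -> eq_ae L f g -> prim f x = prim g x.
Proof.
move=> xL lf lg fg; have sub : `]0, x[ `<=` `]0, L[ by apply: subset_itvl; rewrite bnd_simp.
rewrite /prim; congr fine; apply: ae_eq_integral.
- exact: measurable_itv.
- exact: measurable_int (itg_sub0 xL (L2_itg lf)).
- exact: measurable_int (itg_sub0 xL (L2_itg lg)).
- by apply: ae_mono fg => t h /sub /h ->.
Qed.

Lemma prim_sub f g x : x <= L -> inL2 L f -> inL2 L g ->
  prim (fun t => f t - g t) x = prim f x - prim g x.
Proof.
move=> xL lf lg; rewrite /prim RintegralB//; [exact: itg_sub0 (L2_itg lf)|exact: itg_sub0 (L2_itg lg)].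
Qed.

Lemma prim_scale c f x : x <= L -> inL2 L f -> prim (fun t => c * f t) x = c * prim f x.
Proof. by move=> xL lf; rewrite /prim RintegralZl//; exact: itg_sub0 (L2_itg lf). Qed.

Lemma H10_sub f g : H10 f -> H10 g -> H10 (fun x => f x - g x).
Proof.
move=> [hf fE fL] [hg gE gL]; have [hfg dfg] := H1_sub hf hg.
have lf := Dx_L2 hf; have lg := Dx_L2 hg; have lfg := Dx_L2 hfg.
have pE x : x <= L -> prim (Dx L (fun x => f x - g x)) x = prim (Dx L f) x - prim (Dx L g) x.
  move=> xL; rewrite -prim_sub//; apply: prim_eq_ae => //; exact: L2_sub.
split; [exact: hfg| |by rewrite (pE L (lexx L)) fL gL subr0].
apply: ae_mono (ae_conj fE gE) => x [h1 h2] /[dup] xL; rewrite in_itv/= => /andP[x0 x1].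
by rewrite (pE x (ltW x1)) h1// h2.
Qed.

Lemma H10_scale c f : H10 f -> H10 (fun x => c * f x).
Proof.
move=> [hf fE fL]; have [hcf dcf] := H1_scale c hf.
have lf := Dx_L2 hf; have lcf := Dx_L2 hcf.
have pE x : x <= L -> prim (Dx L (fun x => c * f x)) x = c * prim (Dx L f) x.
  move=> xL; rewrite -prim_scale//; apply: prim_eq_ae => //; exact: L2_scale.
split; [exact: hcf| |by rewrite (pE L (lexx L)) fL mulr0].
apply: ae_mono fE => x h /[dup] xL; rewrite in_itv/= => /andP[x0 x1].
by rewrite (pE x (ltW x1)) h.
Qed.

Lemma inH10_sub f g : inH10 L f -> inH10 L g -> inH10 L (fun x => f x - g x).
Proof.
move=> [hf cf f0 fL] [hg cg g0 gL]; split.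
- by have [] := H1_sub hf hg.
- by move=> x; apply: cvgB; [exact: cf|exact: cg].
- by rewrite f0 g0 subr0.
- by rewrite fL gL subr0.
Qed.

Lemma inH10_scale c f : inH10 L f -> inH10 L (fun x => c * f x).
Proof.
move=> [hf cf f0 fL]; split.
- by have [] := H1_scale c hf.
- by move=> x; apply: cvgM; [exact: cvg_cst|exact: cf].
- by rewrite f0 mulr0.
- by rewrite fL mulr0.
Qed.

Lemma inH10_eq f g : {in `[0, L], f =1 g} -> inH10 L f -> inH10 L g.
Proof.
move=> fg [hf cf f0 fL].
have fg' : {in `]0, L[, f =1 g} by move=> x xL; apply: fg; exact: subset_itv_oo_cc.
have lf := H1_L2 hf; have lg := L2_eq fg' lf.
split.
- exact: H1_eq_ae lg (eq_ae_on fg') hf.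
- by apply: subspace_eq_continuous cf => x; rewrite inE => /fg.
- by rewrite -fg// in_itv/= lexx ltW.
- by rewrite -fg// in_itv/= lexx ltW.
Qed.

Lemma prim_inH10 g : inL2 L g -> prim g L = 0 ->
  inH10 L (prim g) /\ eq_ae L (Dx L (prim g)) g.
Proof.
move=> lg gL; have [h d] := prim_H1 0 lg.
have E : (fun x => 0 + prim g x) = prim g by apply/funext => x; rewrite add0r.
rewrite E in h d; split => //; split => //.
- by apply: prim_continuous; [exact: ltW|exact: L2_itg].
- by rewrite /prim set_itv_ge ?bnd_simp ?ltxx// Rintegral_set0.
Qed.

End sobolev.

(** * Piecewise linear elements and the Ritz projection *)

Section finite_elements.
Context {R : realType}.
Local Notation mu := (@lebesgue_measure R).
Local Notation itg D f := (mu.-integrable D (EFin \o f)).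
Variables (L : R) (M : nat).
Hypothesis L0 : 0 < L.
Hypothesis M0 : (0 < M)%N.
Implicit Types (f g F G chi : R -> R) (c : nat -> R).
Local Notation h := (L / M%:R).
Local Notation node k := (k%:R * (L / M%:R)).
Local Notation cell k := `]node k, node k.+1[%R.
Local Notation Cell k := [set` `]node k, node k.+1[%R].

Lemma h_gt0 : 0 < h. Proof. by rewrite divr_gt0// ltr0n. Qed.

Lemma node0 : node 0%N = 0. Proof. by rewrite mul0r. Qed.

Lemma nodeM : node M = L.
Proof. by rewrite mulrC divfK// pnatr_eq0 -lt0n. Qed.

Lemma nodeS k : node k.+1 = node k + h.
Proof. by rewrite -natr1 mulrDl mul1r. Qed.

Lemma le_node k l : (k <= l)%N -> node k <= node l.
Proof. by move=> kl; rewrite ler_pM2r ?h_gt0// ler_nat. Qed.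

Lemma node_ge0 k : 0 <= node k. Proof. by rewrite mulr_ge0// ltW// h_gt0. Qed.

Lemma node_leL k : (k <= M)%N -> node k <= L.
Proof. by move=> /le_node; rewrite nodeM. Qed.

Lemma sub_cell k : (k < M)%N -> Cell k `<=` `]0, L[.
Proof.
move=> kM x /=; rewrite !in_itv/= => /andP[h1 h2].
by rewrite (le_lt_trans (node_ge0 k) h1) (lt_le_trans h2)// node_leL.
Qed.

Lemma in_some_cell x : x \in `[0, L] -> exists2 k, (k < M)%N & x \in `[node k, node k.+1].
Proof.
rewrite in_itv/= => /andP[x0 xL]; have xM : x <= node M by rewrite nodeM.
have H m : (0 < m)%N -> x <= node m -> exists2 k, (k < m)%N & x \in `[node k, node k.+1].
  elim: m => [//|m IHm] _ xm; have [xlt|xge] := ltP x (node m).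
    case: m IHm xm xlt => [|m] IHm xm xlt.
      by move: xlt; rewrite node0 ltNge x0.
    have [k km kx] := IHm isT (ltW xlt); exists k => //.
    exact: ltn_trans km _.
  by exists m => //; rewrite in_itv/= xge xm.
exact: H.
Qed.

Lemma Rintegral_cells F : itg `]0, L[ F ->
  \int[mu]_(x in `]0, L[) F x = \sum_(k < M) \int[mu]_(x in Cell k) F x.
Proof.
move=> Fi; rewrite -[in LHS]nodeM.
have H m : (m <= M)%N ->
    \int[mu]_(x in `]0, node m[) F x = \sum_(k < m) \int[mu]_(x in Cell k) F x.
  elim: m => [_|m IHm mM].
    by rewrite big_ord0 node0 set_itv_ge ?bnd_simp ?ltxx// Rintegral_set0.
  rewrite big_ord_recr/= -IHm ?(ltnW mM)// (@Rintegral_cat _ F 0 (node m.+1) (node m))//.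
  - exact: node_ge0.
  - exact: le_node.
  - exact: itg_sub0 (node_leL mM) Fi.
exact: H.
Qed.

Lemma Rintegral_cell_cst k (a : R) : \int[mu]_(x in Cell k) a = a * h.
Proof. by rewrite Rintegral_cst_oo ?le_node// nodeS addrAC subrr add0r. Qed.

Definition pc c x : R := \sum_(k < M) c k * \1_(Cell k) x.

Lemma pc_cell c k x : (k < M)%N -> x \in cell k -> pc c x = c k.
Proof.
move=> kM xk; rewrite /pc (bigD1 (Ordinal kM))//= indicE mem_set//= mulr1.
rewrite big1 ?addr0// => i ik; rewrite indicE memNset ?mulr0// => /= xi.
move: xk xi; rewrite !in_itv/= => /andP[h1 h2] /andP[h3 h4].
have [ki|ik'|ki] := ltngtP i k.
- by have := lt_le_trans h4 (le_node ki); rewrite ltNge (ltW h1).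
- by have := lt_le_trans h2 (le_node ik'); rewrite ltNge (ltW h3).
- by move/eqP: ik; apply; apply/val_inj.
Qed.

Lemma pc_L2 c : inL2 L (pc c).
Proof.
apply: (@L2_bounded _ _ _ (\sum_(k < M) `|c k|)).
  by apply: measurable_sum => k; apply: measurable_funM => //; exact: measurable_indic.
move=> x _; rewrite /pc; apply: (le_trans (ler_norm_sum _ _ _)).
apply: ler_sum => k _; rewrite normrM ler_piMr// indicE.
by case: (_ \in _); rewrite ?normr1 ?normr0.
Qed.

Lemma ip_pc F c : inL2 L F -> ip L F (pc c) = \sum_(k < M) c k * \int[mu]_(x in Cell k) F x.
Proof.
move=> lF; rewrite /ip Rintegral_cells; last by apply: L2_mul => //; exact: pc_L2.
apply: eq_bigr => k _; rewrite -RintegralZl//.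
  by apply: eq_Rintegral => x; rewrite inE => /(pc_cell c (ltn_ord k)) ->; rewrite mulrC.
by apply: integrableS (L2_itg lF) => //; exact: sub_cell.
Qed.

Lemma prim_pc c k x : (k < M)%N -> x \in `[node k, node k.+1] ->
  prim (pc c) x = prim (pc c) (node k) + c k * (x - node k).
Proof.
move=> kM; rewrite in_itv/= => /andP[kx xk].
apply/eqP; rewrite addrC -subr_eq; apply/eqP.
rewrite (primB (node_ge0 k) kx (le_trans xk (node_leL kM)) (L2_itg (pc_L2 c))).
rewrite -Rintegral_cst_oo//; apply: eq_Rintegral => y; rewrite inE/= => yx.
apply: pc_cell => //; move: yx; rewrite !in_itv/= => /andP[-> yx].
exact: lt_le_trans yx xk.
Qed.

Lemma prim_pc_Sh c : prim (pc c) L = 0 -> inSh L M (prim (pc c)).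
Proof.
move=> cL; split; first by have [] := prim_inH10 L0 (pc_L2 c) cL.
move=> k kM; exists ((prim (pc c) (node k) - c k * node k)%:P + c k *: 'X); split.
  apply: (leq_trans (size_polyD _ _)); rewrite geq_max.
  rewrite (leq_trans (size_polyC_leq1 _))//=.
  by rewrite (leq_trans (size_scale_leq _ _))// size_polyX.
move=> x xk; rewrite (prim_pc c kM xk) hornerD hornerC hornerZ hornerX; ring.
Qed.

Lemma horner_size2 (p : {poly R}) x : (size p <= 2)%N -> p.[x] = p`_0 + p`_1 * x.
Proof.
move=> p2; rewrite (horner_coef_wide x p2) !big_ord_recl big_ord0/= addr0.
by rewrite expr0 mulr1 expr1.
Qed.

(** Piecewise linear functions are the primitives of piecewise constant ones. *)
Lemma Sh_prim_pc chi : inSh L M chi ->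
  exists c, [/\ {in `[0, L], chi =1 prim (pc c)}, prim (pc c) L = 0 & eq_ae L (Dx L chi) (pc c)].
Proof.
move=> [hchi pw]; pose c k := (chi (node k.+1) - chi (node k)) / h.
have lin k x : (k < M)%N -> x \in `[node k, node k.+1] -> chi x = chi (node k) + c k * (x - node k).
  move=> kM xk; have [p [p2 px]] := pw k kM.
  have nk : node k <= node k.+1 by exact: le_node.
  have e1 := px _ xk; rewrite e1.
  have -> : chi (node k) = p.[node k] by apply: px; rewrite in_itv/= lexx nk.
  have -> : c k = p`_1.
    rewrite /c !px ?in_itv/= ?lexx ?nk// !horner_size2// nodeS.
    by field; rewrite pnatr_eq0 -lt0n M0 gt_eqF.
  by rewrite !horner_size2//; ring.
have nodeE k : (k <= M)%N -> chi (node k) = prim (pc c) (node k).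
  elim: k => [_|k IHk kM].
    have [_ _ chi0 _] := hchi; rewrite node0 chi0.
    by rewrite /prim set_itv_ge ?bnd_simp ?ltxx// Rintegral_set0.
  have kk : node k.+1 \in `[node k, node k.+1] by rewrite in_itv/= lexx le_node.
  by rewrite (lin _ _ kM kk) (prim_pc c kM kk) IHk// ltnW.
have chiE : {in `[0, L], chi =1 prim (pc c)}.
  move=> x /in_some_cell [k kM xk].
  by rewrite (lin _ _ kM xk) (prim_pc c kM xk) nodeE// ltnW.
have [h10 _ _ chiL] := hchi.
have cL : prim (pc c) L = 0 by rewrite -chiE// in_itv/= lexx ltW.
exists c; split => //.
have [hp dp] := prim_inH10 L0 (pc_L2 c) cL.
rewrite (@Dx_eq_ae _ _ chi (prim (pc c))) ?dp//.
- exact: H1_L2 h10.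
- by case: hp => /H1_L2.
- by apply: eq_ae_on => x xL; apply: chiE; exact: subset_itv_oo_cc.
Qed.

Lemma Sh_sub chi chi' : inSh L M chi -> inSh L M chi' -> inSh L M (fun x => chi x - chi' x).
Proof.
move=> [hc pc1] [hc' pc2]; split; first exact: inH10_sub.
move=> k kM; have [p [p2 px]] := pc1 k kM; have [q [q2 qx]] := pc2 k kM.
exists (p - q); split; last by move=> x xk; rewrite hornerD hornerN px// qx.
by rewrite (leq_trans (size_polyD _ _))// geq_max size_polyN p2 q2.
Qed.

Lemma Sh_scale (a : R) chi : inSh L M chi -> inSh L M (fun x => a * chi x).
Proof.
move=> [hc pc1]; split; first exact: inH10_scale.
move=> k kM; have [p [p2 px]] := pc1 k kM.
exists (a *: p); split; last by move=> x xk; rewrite hornerZ px.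
by rewrite (leq_trans (size_scale_leq _ _)).
Qed.

Lemma Sh_eq chi chi' : {in `[0, L], chi =1 chi'} -> inSh L M chi -> inSh L M chi'.
Proof.
move=> E [hc pc1]; split; first exact: inH10_eq E hc.
move=> k kM; have [p [p2 px]] := pc1 k kM; exists p; split => // x xk.
rewrite -E ?px//; move: xk; rewrite !in_itv/= => /andP[h1 h2].
by rewrite (le_trans (node_ge0 k) h1) (le_trans h2)// node_leL.
Qed.

Lemma Sh_add chi chi' : inSh L M chi -> inSh L M chi' -> inSh L M (fun x => chi x + chi' x).
Proof.
move=> hc /(Sh_scale (-1)) /(Sh_sub hc); apply: Sh_eq => x _.
by rewrite mulN1r opprK.
Qed.

(** The L^2 projection on piecewise constants. *)
Definition avg g : R -> R := pc (fun k => h^-1 * \int[mu]_(x in Cell k) g x).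

Lemma avg_L2 g : inL2 L (avg g). Proof. exact: pc_L2. Qed.

Lemma Rintegral_cell_avg g k : (k < M)%N -> inL2 L g ->
  \int[mu]_(x in Cell k) (g x - avg g x) = 0.
Proof.
move=> kM lg.
have sg : itg (Cell k) g by apply: integrableS (L2_itg lg) => //; exact: sub_cell.
have sa : itg (Cell k) (avg g) by apply: integrableS (L2_itg (avg_L2 g)) => //; exact: sub_cell.
rewrite RintegralB//; set A := \int[mu]_(x in _) g x.
rewrite [X in _ - X](_ : _ = A); first by rewrite subrr.
transitivity (\int[mu]_(x in Cell k) (h^-1 * A)).
  by apply: eq_Rintegral => x; rewrite inE => xk; rewrite /avg (pc_cell _ kM xk).
by rewrite Rintegral_cell_cst mulrAC mulVf ?mul1r// gt_eqF ?h_gt0.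
Qed.

Lemma avg_orth g c : inL2 L g -> ip L (fun x => g x - avg g x) (pc c) = 0.
Proof.
move=> lg; rewrite ip_pc; last by apply: L2_sub => //; exact: avg_L2.
by rewrite big1// => k _; rewrite Rintegral_cell_avg// mulr0.
Qed.

Lemma avg_le g : inL2 L g -> nrm L (fun x => g x - avg g x) <= nrm L g.
Proof.
move=> lg; have la := avg_L2 g; have lga := L2_sub lg la.
rewrite -(@ler_pXn2r _ 2)// ?nnegrE ?nrm_ge0// !sqr_nrm.
have o := avg_orth (fun k => h^-1 * \int[mu]_(x in Cell k) g x) lg.
rewrite -/(avg g) ipBl// in o.
rewrite ipBl// !ipBr// (ipC L (avg g) g).
have := ip_ge0 L (avg g); lra.
Qed.

(** The form in which a bound on each cell, obtained there by Cauchy and Schwarz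
    on an interval of length h, sums to a factor h over the whole interval. *)
Lemma cell_bound F G : inL2 L F -> inL2 L G ->
  (forall k x, (k < M)%N -> x \in cell k ->
     F x ^+ 2 <= h * \int[mu]_(y in Cell k) G y ^+ 2) ->
  nrm L F <= h * nrm L G.
Proof.
move=> lF lG FG; have h0 := h_gt0.
have hG := mulr_ge0 (ltW h0) (nrm_ge0 L G).
rewrite -(@ler_pXn2r _ 2)// ?nnegrE ?nrm_ge0//.
have G2 := L2_mul lG lG; have F2 := L2_mul lF lF.
rewrite exprMn !sqr_nrm /ip (Rintegral_cells F2) (Rintegral_cells G2) mulr_sumr.
apply: ler_sum => k _.
have -> : h ^+ 2 * \int[mu]_(x in Cell k) (G x * G x) =
   \int[mu]_(y in Cell k) (h * \int[mu]_(x in Cell k) (G x * G x)).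
  by rewrite Rintegral_cell_cst; ring.
apply: le_Rintegral => //.
- by apply: integrableS F2 => //; exact: sub_cell.
- by apply: integrableS (L2_itg (L2_cst L _)) => //; exact: sub_cell.
- by move=> x xk; exact: FG.
Qed.

Lemma prim_node g k : (k <= M)%N -> inL2 L g ->
  prim (fun x => g x - avg g x) (node k) = 0.
Proof.
move=> kM lg; have lga := L2_sub lg (avg_L2 g).
elim: k kM => [_|k IHk kM].
  by rewrite node0 /prim set_itv_ge ?bnd_simp ?ltxx// Rintegral_set0.
apply/eqP; rewrite -(subr0 (prim _ _)) -[X in _ - X](IHk (ltnW kM)).
by rewrite (primB (node_ge0 k) (le_node (leqnSn k)) (node_leL kM) (L2_itg lga)) Rintegral_cell_avg.
Qed.

(** The primitive vanishes at the nodes since the average is exact on every cell. *)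
Lemma prim_avg_le g : inL2 L g ->
  nrm L (prim (fun x => g x - avg g x)) <= h * nrm L (fun x => g x - avg g x).
Proof.
move=> lg; set d := fun x => g x - avg g x; have ld : inL2 L d := L2_sub lg (avg_L2 g).
apply: cell_bound => //; first exact: prim_L2.
move=> k x kM xk; move: (xk); rewrite in_itv/= => /andP[kx xk'].
have := primB (node_ge0 k) (ltW kx) (le_trans (ltW xk') (node_leL kM)) (L2_itg ld).
rewrite prim_node ?(ltnW kM)// subr0 => ->.
have s1 : `]node k, x[ `<=` Cell k by apply: subset_itvl; rewrite bnd_simp ltW.
have d2 : itg `]0, L[ (fun x => d x ^+ 2) by case/inL2P : ld.
have d2k : itg (Cell k) (fun x => d x ^+ 2) by apply: integrableS d2 => //; exact: sub_cell.
have dk : itg (Cell k) d by apply: integrableS (L2_itg ld) => //; exact: sub_cell.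
apply: (le_trans (sqr_Rintegral (ltW kx) _ _)).
- by apply: integrableS dk.
- by apply: integrableS d2k.
apply: ler_pM.
- by rewrite subr_ge0 ltW.
- by apply: Rintegral_ge0 => y _; exact: sqr_ge0.
- by rewrite lerBlDl -nodeS ltW.
- rewrite (Rintegral_cat (ltW kx) (ltW xk') d2k) lerDl.
  by apply: Rintegral_ge0 => y _; exact: sqr_ge0.
Qed.

(** On a cell a continuous g takes values that differ by at most the integral of
    its derivative in absolute value, so it differs from its average by no more. *)
Lemma avg_H1_le g : inH1 L g -> nrm L (fun x => g x - avg g x) <= h * nrm L (Dx L g).
Proof.
move=> hg; have lg := H1_L2 hg; have ld := Dx_L2 hg; have [a gE] := H1_prim L0 hg.
set g' := fun x => a + prim (Dx L g) x in gE.
have lg' : inL2 L g' by apply: L2_add; [exact: L2_cst|exact: prim_L2].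
have avgE : avg g = avg g'.
  apply/funext => x; rewrite /avg /pc; apply: eq_bigr => k _; congr (_ * _ * _).
  congr fine; apply: ae_eq_integral => //.
  - apply: (@measurable_int _ _ _ mu); apply: integrableS (L2_itg lg) => //; exact: sub_cell.
  - apply: (@measurable_int _ _ _ mu); apply: integrableS (L2_itg lg') => //; exact: sub_cell.
  - by apply: ae_mono gE => y e /(sub_cell (ltn_ord k)) /e ->.
rewrite avgE (@eq_ae_nrm _ _ _ (fun x => g' x - avg g' x)); last 3 first.
- by apply: L2_measurable; apply: L2_sub => //; exact: avg_L2.
- by apply: L2_measurable; apply: L2_sub => //; exact: avg_L2.
- by apply: ae_mono gE => y e /e ->.
apply: cell_bound => //; first by apply: L2_sub => //; exact: avg_L2.
move=> k x kM xk.
have h0 := h_gt0.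
have d2 : itg `]0, L[ (fun x => Dx L g x ^+ 2) by case/inL2P : ld.
have d2k : itg (Cell k) (fun x => Dx L g x ^+ 2) by apply: integrableS d2 => //; exact: sub_cell.
have dk : itg (Cell k) (Dx L g) by apply: integrableS (L2_itg ld) => //; exact: sub_cell.
have ndk : itg (Cell k) (fun x => `|Dx L g x|) by apply: itg_norm.
set B := \int[mu]_(y in Cell k) `|Dx L g y|.
have osc y z : y \in cell k -> z \in cell k -> y <= z -> `|g' y - g' z| <= B.
  rewrite !in_itv/= => /andP[y1 y2] /andP[z1 z2] yz.
  have -> : g' y - g' z = - (prim (Dx L g) z - prim (Dx L g) y) by rewrite /g'; ring.
  have y0 : 0 <= y by exact: le_trans (node_ge0 k) (ltW y1).
  have zL : z <= L by exact: le_trans (ltW z2) (node_leL kM).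
  rewrite normrN (primB y0 yz zL (L2_itg ld)).
  have s1 : `]y, z[ `<=` Cell k by apply: subset_itv; rewrite bnd_simp ltW.
  apply: (le_trans (le_normr_Rintegral _ _)) => //; first by apply: integrableS dk.
  have yk : itg `]y, node k.+1[ (fun x => `|Dx L g x|).
    by apply: integrableS ndk => //; apply: subset_itvr; rewrite bnd_simp ltW.
  rewrite /B (Rintegral_cat (ltW y1) (ltW y2) ndk) (Rintegral_cat yz (ltW z2) yk).
  have p1 : 0 <= \int[mu]_(t in `]node k, y[) `|Dx L g t| by apply: Rintegral_ge0.
  have p2 : 0 <= \int[mu]_(t in `]z, node k.+1[) `|Dx L g t| by apply: Rintegral_ge0.
  by rewrite addrCA lerDl addr_ge0.
have osc' y : y \in cell k -> `|g' x - g' y| <= B.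
  by move=> yk; case: (leP x y) => xy; [exact: osc|rewrite distrC; apply: osc => //; exact: ltW].
have B0 : 0 <= B by apply: Rintegral_ge0.
have gB : `|g' x - avg g' x| <= B.
  have g'k : itg (Cell k) g' by apply: integrableS (L2_itg lg') => //; exact: sub_cell.
  have ck (a1 : R) : itg (Cell k) (fun=> a1).
    by apply: integrableS (L2_itg (L2_cst L a1)) => //; exact: sub_cell.
  have -> : g' x - avg g' x = h^-1 * \int[mu]_(y in Cell k) (g' x - g' y).
    rewrite RintegralB// Rintegral_cell_cst /avg (pc_cell _ kM xk) mulrBr.
    by congr (_ - _); rewrite mulrC -mulrA divff ?mulr1// gt_eqF.
  rewrite normrM ger0_norm ?invr_ge0 ?(ltW h0)// ler_pdivrMl// (_ : h * B = \int[mu]_(y in Cell k) B); last by rewrite Rintegral_cell_cst mulrC.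
  apply: (le_trans (le_normr_Rintegral _ _)) => //; first by apply: itgB.
  apply: le_Rintegral => //.
    by apply: itg_norm => //; exact: itgB.
rewrite -(@real_normK _ (g' x - _)) ?num_real//.
apply: (@le_trans _ _ (B ^+ 2)).
  by rewrite lerXn2r ?nnegrE.
have nk : node k <= node k.+1 by exact: le_node.
apply: (le_trans (sqr_Rintegral nk ndk _)).
  by apply: eq_itg d2k => // y _; rewrite real_normK ?num_real.
rewrite (_ : node k.+1 - node k = h); last by rewrite nodeS addrAC subrr add0r.
rewrite ler_pM2l// le_eqVlt; apply/orP; left; apply/eqP.
by apply: eq_Rintegral => y _; rewrite real_normK ?num_real.
Qed.

(** The Ritz projection. In one dimension the derivatives of S_h are the
    piecewise constants of mean zero, so projecting the derivative in L^2 and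
    integrating is the same as projecting in H^1_0, and the result is the nodal
    interpolant. *)
Definition ritz f : R -> R := prim (avg (Dx L f)).

Lemma prim_avg_L g : inL2 L g -> prim (avg g) L = prim g L.
Proof.
move=> lg; apply/eqP; rewrite eq_sym -subr_eq0 -(prim_sub (lexx L) lg (avg_L2 g)).
by rewrite -[X in prim _ X]nodeM prim_node.
Qed.

Lemma ritz_Sh f : H10 L f -> inSh L M (ritz f).
Proof.
by move=> [hf _ fL]; apply: prim_pc_Sh; rewrite prim_avg_L//; exact: Dx_L2.
Qed.

Lemma Dx_ritz f : H10 L f -> eq_ae L (Dx L (ritz f)) (avg (Dx L f)).
Proof.
move=> [hf _ fL]; have ld := Dx_L2 hf.
by have [] := prim_inH10 L0 (avg_L2 (Dx L f)) (etrans (prim_avg_L ld) fL).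
Qed.

Lemma ritz_inH10 f : H10 L f -> inH10 L (ritz f).
Proof. by move=> /ritz_Sh []. Qed.

Lemma ritz_orth f chi : H10 L f -> inSh L M chi ->
  ip L (Dx L (ritz f)) (Dx L chi) = ip L (Dx L f) (Dx L chi).
Proof.
move=> hf schi; have [[hchi _ _ _] _] := schi.
have [c [_ _ dchi]] := Sh_prim_pc schi.
have [[hr _ _ _] _] := ritz_Sh hf.
have ldf : inL2 L (Dx L f) by case: hf => /Dx_L2.
have o := avg_orth c ldf.
have lr := Dx_L2 hr; have lchi := Dx_L2 hchi.
rewrite (ipBl ldf (avg_L2 _) (pc_L2 c)) in o.
rewrite (@eq_ae_ip _ _ _ (avg (Dx L f)) _ (pc c)); first last.
- exact: dchi.
- exact: Dx_ritz.
- exact: L2_measurable (pc_L2 c).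
- exact: L2_measurable.
- exact: L2_measurable (avg_L2 _).
- exact: L2_measurable.
rewrite [RHS](@eq_ae_ip _ _ _ (Dx L f) _ (pc c)); first last.
- exact: dchi.
- exact: eq_ae_refl.
- exact: L2_measurable (pc_L2 c).
- exact: L2_measurable.
- exact: L2_measurable.
- exact: L2_measurable.
by apply/eqP; rewrite eq_sym -subr_eq0 o.
Qed.

Lemma nrm_Dx_ritz f : H10 L f ->
  nrm L (fun x => Dx L f x - Dx L (ritz f) x) = nrm L (fun x => Dx L f x - avg (Dx L f) x).
Proof.
move=> hf; have [[hr _ _ _] _] := ritz_Sh hf.
have ldf : inL2 L (Dx L f) by case: hf => /Dx_L2.
apply: eq_ae_nrm.
- by apply: L2_measurable; apply: L2_sub => //; exact: Dx_L2.
- by apply: L2_measurable; apply: L2_sub => //; exact: avg_L2.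
- by apply: ae_mono (Dx_ritz hf) => x e /e ->.
Qed.

Lemma ritz_stable f : H10 L f -> nrm L (fun x => Dx L f x - Dx L (ritz f) x) <= nrm L (Dx L f).
Proof. by move=> hf; rewrite nrm_Dx_ritz//; apply: avg_le; case: hf => /Dx_L2. Qed.

Lemma ritz_err_H2 f : H10 L f -> inH1 L (Dx L f) ->
  nrm L (fun x => Dx L f x - Dx L (ritz f) x) <= h * nrm L (Dx L (Dx L f)).
Proof. by move=> hf hdf; rewrite nrm_Dx_ritz//; exact: avg_H1_le. Qed.

Lemma ritz_err f : H10 L f -> nrm L (fun x => f x - ritz f x) <= h * nrm L (Dx L f).
Proof.
move=> hf; have [h1 fE _] := hf; have ldf := Dx_L2 h1; have la := avg_L2 (Dx L f).
have [[hr _ _ _] _] := ritz_Sh hf.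
rewrite (@eq_ae_nrm _ _ _ (prim (fun x => Dx L f x - avg (Dx L f) x))); last 3 first.
- by apply: L2_measurable; apply: L2_sub; exact: H1_L2.
- by apply: L2_measurable; apply: prim_L2 => //; exact: L2_sub.
- by apply: ae_mono fE => x e xL; rewrite e//; move: xL; rewrite in_itv/= => /andP[_ /ltW xL]; rewrite (prim_sub xL ldf la).
apply: (le_trans (prim_avg_le ldf)).
by rewrite ler_pM2l ?h_gt0//; exact: avg_le.
Qed.

Lemma avg_eq_ae f g x : inL2 L f -> inL2 L g -> eq_ae L f g -> avg f x = avg g x.
Proof.
move=> lf lg fg; rewrite /avg /pc; apply: eq_bigr => k _; congr (_ * _ * _).
congr fine; apply: ae_eq_integral => //.
- apply: (@measurable_int _ _ _ mu); apply: integrableS (L2_itg lf) => //; exact: sub_cell.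
- apply: (@measurable_int _ _ _ mu); apply: integrableS (L2_itg lg) => //; exact: sub_cell.
- by apply: ae_mono fg => y e /(sub_cell (ltn_ord k)) /e ->.
Qed.

Lemma ritz_sub f g : H10 L f -> H10 L g ->
  {in `[0, L], ritz (fun x => f x - g x) =1 (fun x => ritz f x - ritz g x)}.
Proof.
move=> hf hg x; rewrite in_itv/= => /andP[_ xL].
have [h1f _ _] := hf; have [h1g _ _] := hg; have [h1 d1] := H1_sub L0 h1f h1g.
have lf := Dx_L2 h1f; have lg := Dx_L2 h1g.
rewrite /ritz -(prim_sub xL (avg_L2 _) (avg_L2 _)).
apply: eq_Rintegral => y _.
rewrite (avg_eq_ae _ (Dx_L2 h1) (L2_sub lf lg) d1) /avg /pc -sumrB.
apply: eq_bigr => k _; rewrite -mulrBl -mulrBr RintegralB//.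
- by apply: integrableS (L2_itg lf) => //; exact: sub_cell.
- by apply: integrableS (L2_itg lg) => //; exact: sub_cell.
Qed.

Lemma ritz_scale (a : R) f : H10 L f ->
  {in `[0, L], ritz (fun x => a * f x) =1 (fun x => a * ritz f x)}.
Proof.
move=> hf x; rewrite in_itv/= => /andP[_ xL].
have [h1f _ _] := hf; have [h1 d1] := H1_scale L0 a h1f.
have lf := Dx_L2 h1f.
rewrite /ritz -(prim_scale a xL (avg_L2 _)).
apply: eq_Rintegral => y _.
rewrite (avg_eq_ae _ (Dx_L2 h1) (L2_scale a lf) d1) /avg /pc mulr_sumr.
apply: eq_bigr => k _; rewrite RintegralZl//; first by ring.
by apply: integrableS (L2_itg lf) => //; exact: sub_cell.
Qed.

(** The difference of two solutions of the defining equations lies in S_h and its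
    derivative is orthogonal to itself. *)
Lemma is_Ph_ritz eta v : inH10 L eta -> is_Ph L M eta v -> {in `[0, L], v =1 ritz eta}.
Proof.
move=> heta [Sv orth]; have h10 := inH10_H10 L0 heta.
have Sr := ritz_Sh h10; have Sd := Sh_sub Sv Sr.
have [[hv _ _ _] _] := Sv; have [[hr _ _ _] _] := Sr; have [h1 _ _ _] := heta.
have [hd _] := Sd; have [h1d _ _ _] := hd.
have [_ dd] := H1_sub L0 hv hr; have [_ de] := H1_sub L0 hv h1.
have lv := Dx_L2 hv; have lr := Dx_L2 hr; have ld := Dx_L2 h1d; have le := Dx_L2 h1.
have d0 : ip L (Dx L (fun x => v x - ritz eta x)) (Dx L (fun x => v x - ritz eta x)) = 0.
  rewrite {1}(@eq_ae_ip _ _ _ _ _ _ (L2_measurable ld) (L2_measurable (L2_sub lv lr))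
    (L2_measurable ld) (L2_measurable ld) dd (eq_ae_refl L _)).
  rewrite ipBl// (ritz_orth h10 Sd) -ipBl// -(orth _ Sd).
  apply: eq_ae_ip; [| | | |exact: eq_ae_sym|exact: eq_ae_refl];
    apply: L2_measurable => //; [exact: L2_sub|].
  by apply: Dx_L2; have [] := H1_sub L0 hv h1.
have n0 : nrm L (Dx L (fun x => v x - ritz eta x)) = 0 by rewrite /nrm d0 sqrtr0.
have dae := nrm_eq0 ld n0.
have [_ dE _] := inH10_prim L0 hd.
move=> x xL; apply/eqP; rewrite -subr_eq0; have /= -> := dE x xL; apply/eqP.
move: xL; rewrite in_itv/= => /andP[x0 xL].
rewrite (@prim_eq_ae _ L _ (fun=> 0) _ xL ld (L2_cst L 0) dae).
by rewrite /prim Rintegral_cst_oo// mul0r.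
Qed.

End finite_elements.

(** * Lower integrals and bounded operators into L^2 *)

Section lower_integral.
Context {R : realType}.
Local Notation mu := (@lebesgue_measure R).
Local Notation itg D f := (mu.-integrable D (EFin \o f)).

Import HBNNSimple.

(** The norms of vector-valued functions of time that occur below are not known
    to be measurable. The integral of a nonnegative function is a supremum over
    simple functions below it, and such a function may be cut off on a null
    set without changing its integral; hence the monotony needs no measurability. *)
Lemma lower_integral_ae_le (D : set R) (F H : R -> \bar R) :
  measurable (D : set (measurableTypeR R)) ->
  (forall x, (0 <= F x)%E) -> (forall x, (0 <= H x)%E) ->
  (\forall x \ae mu, D x -> (F x <= H x)%E) ->
  (\int[mu]_(x in D) F x <= \int[mu]_(x in D) H x)%E.
Proof.
move=> mD F0 H0 [N [mN N0 sN]]; rewrite !ge0_integralE//.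
apply: ge_ereal_sup => _ [h hF <-].
have mCN : measurable (~` N) by exact: measurableC.
(* h cut off on the null set. *)
pose h' := proj_nnsfun h mCN.
have -> : sintegral mu h = sintegral mu h'.
  rewrite -!integralT_nnsfun; apply: ge0_ae_eq_integral => //.
  - by apply/measurable_EFinP.
  - by apply/measurable_EFinP.
  - by move=> x _; rewrite lee_fin fun_ge0.
  - by move=> x _; rewrite lee_fin fun_ge0.
  exists N; split => // x /= hx; apply: contrapT => Nx; apply: hx => _.
  by rewrite mindicE mem_set// mulr1.
apply: ereal_sup_ubound; exists h' => // x; rewrite /h'/= mindicE.
have [Nx|Nx] := boolP (x \in ~` N); last first.
  by rewrite mulr0 /patch; case: ifP.
rewrite mulr1 (le_trans (hF x))// /patch; case: ifPn => // Dx.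
rewrite inE in Dx; rewrite inE in Nx.
by apply: contrapT => FH; apply: Nx; apply: sN => /= /(_ Dx).
Qed.

(** The limit is modified on the null set where convergence fails. *)
Lemma ae_limit_measurable (D : set R) (F : nat -> R -> R) (G : R -> R) :
  measurable (D : set (measurableTypeR R)) ->
  (forall n, measurable_fun D (F n)) ->
  (\forall t \ae mu, D t -> F n t @[n --> \oo] --> G t) ->
  exists2 G', measurable_fun D G' & \forall t \ae mu, D t -> G t = G' t.
Proof.
move=> mD mF [N [mN N0 sN]].
exists (G \_ (~` N)); last first.
  exists N; split => // t /= h; apply: contrapT => Nt; apply: h => Dt.
  by rewrite patchE mem_set.
apply: (@measurable_fun_cvg _ _ _ _ (fun n => (F n) \_ (~` N))).
  move=> n; apply/measurable_restrict => //; first exact: measurableC.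
  by apply: measurable_funS (mF n) => // x [].
move=> t Dt; rewrite patchE; under eq_fun do rewrite patchE.
case: ifPn => Nt; last exact: cvg_cst.
rewrite inE in Nt; apply: contrapT => h; apply: Nt; apply: sN => /= /(_ Dt).
exact: h.
Qed.

End lower_integral.

Section operators.
Context {R : realType}.
Local Notation mu := (@lebesgue_measure R).
Variable L : R.

Definition vspace (X : fspace R) : Prop :=
  [/\ fmem X (fun=> 0), forall f g, fmem X f -> fmem X g -> fmem X (fun x => f x + g x) &
      forall c f, fmem X f -> fmem X (fun x => c * f x)].

(** Linear maps of norm at most 1 from X to L^2, such as the inclusions and the
    derivatives in x. Linearity holds almost everywhere only, because [Dx]
    chooses a representative. *)
Record bop (X : fspace R) (A : (R -> R) -> R -> R) : Prop := Bop {
  bopV : vspace X;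
  bop_L2 : forall f, fmem X f -> inL2 L (A f);
  bopD : forall f g, fmem X f -> fmem X g ->
    eq_ae L (A (fun x => f x + g x)) (fun x => A f x + A g x);
  bopZ : forall c f, fmem X f -> eq_ae L (A (fun x => c * f x)) (fun x => c * A f x);
  bop_le : forall f, fmem X f -> nrm L (A f) <= fnorm X f;
  fnorm_ge0 : forall f, 0 <= fnorm X f }.

Hypothesis L0 : 0 < L.

Lemma vspace_L2 : vspace (L2 L).
Proof. by split; [exact: L2_cst|exact: L2_add|exact: L2_scale]. Qed.

Lemma H1_cst c : inH1 L (fun=> c) /\ eq_ae L (Dx L (fun=> c)) (fun=> 0).
Proof.
have [h d] := prim_H1 L0 c (L2_cst L 0).
have E : (fun x : R => c + prim (fun=> 0) x) = fun=> c.
  apply/funext => x; rewrite /prim; case: (leP 0 x) => x0.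
    by rewrite Rintegral_cst_oo// mul0r addr0.
  by rewrite set_itv_ge ?Rintegral_set0 ?addr0// bnd_simp -leNgt ltW.
by rewrite E in h d.
Qed.

Lemma vspace_H1 : vspace (H1 L).
Proof.
split; first by case: (H1_cst 0).
  by move=> f g hf hg; have [] := H1_add L0 hf hg.
by move=> c f hf; have [] := H1_scale L0 c hf.
Qed.

Lemma H2_add f g : inH2 L f -> inH2 L g -> inH2 L (fun x => f x + g x) /\
  eq_ae L (Dx L (Dx L (fun x => f x + g x))) (fun x => Dx L (Dx L f) x + Dx L (Dx L g) x).
Proof.
move=> [hf hdf] [hg hdg]; have [h d] := H1_add L0 hf hg; have [h' d'] := H1_add L0 hdf hdg.
have e := eq_ae_sym d.
have E := Dx_eq_ae (Dx_L2 h) (H1_L2 h') d.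
split; last by rewrite E.
split; [exact: h|exact: H1_eq_ae (Dx_L2 h) e h'].
Qed.

Lemma H2_scale c f : inH2 L f -> inH2 L (fun x => c * f x) /\
  eq_ae L (Dx L (Dx L (fun x => c * f x))) (fun x => c * Dx L (Dx L f) x).
Proof.
move=> [hf hdf]; have [h d] := H1_scale L0 c hf; have [h' d'] := H1_scale L0 c hdf.
have E := Dx_eq_ae (Dx_L2 h) (H1_L2 h') d.
split; last by rewrite E.
split; [exact: h|exact: H1_eq_ae (Dx_L2 h) (eq_ae_sym d) h'].
Qed.

Lemma H2_cst0 : inH2 L (fun=> 0).
Proof.
have [h d] := H1_cst 0; split; first exact: h.
exact: H1_eq_ae (Dx_L2 h) (eq_ae_sym d) h.
Qed.

Lemma vspace_H2 : vspace (H2 L).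
Proof.
split; first exact: H2_cst0.
  by move=> f g hf hg; have [] := H2_add hf hg.
by move=> c f hf; have [] := H2_scale c hf.
Qed.

Lemma bop_L2_id : bop (L2 L) id.
Proof. by split => //; [exact: vspace_L2|move=> *; exact: eq_ae_refl..|move=> f; exact: sqrtr_ge0]. Qed.

Lemma le_sqrt_sqr (a s : R) : 0 <= a -> a ^+ 2 <= s -> a <= Num.sqrt s.
Proof. by move=> a0 h; rewrite -(ger0_norm a0) -sqrtr_sqr; apply: ler_wsqrtr. Qed.

Lemma bop_H1_id : bop (H1 L) id.
Proof.
split; [exact: vspace_H1|by move=> f []|move=> *; exact: eq_ae_refl|move=> *; exact: eq_ae_refl| |by move=> f; exact: sqrtr_ge0].
by move=> f hf /=; apply: le_sqrt_sqr; [exact: nrm_ge0|rewrite lerDl sqr_ge0].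
Qed.

Lemma bop_H1_Dx : bop (H1 L) (Dx L).
Proof.
split; [exact: vspace_H1|exact: Dx_L2| | | |by move=> f; exact: sqrtr_ge0].
- by move=> f g hf hg; have [] := H1_add L0 hf hg.
- by move=> c f hf; have [] := H1_scale L0 c hf.
- by move=> f hf /=; apply: le_sqrt_sqr; [exact: nrm_ge0|rewrite lerDr sqr_ge0].
Qed.

Lemma bop_H2_id : bop (H2 L) id.
Proof.
split; [exact: vspace_H2|by move=> f [[]]|move=> *; exact: eq_ae_refl|move=> *; exact: eq_ae_refl| |by move=> f; exact: sqrtr_ge0].
by move=> f hf /=; apply: le_sqrt_sqr; [exact: nrm_ge0|rewrite -addrA lerDl addr_ge0 ?sqr_ge0].
Qed.

Lemma bop_H2_Dx : bop (H2 L) (Dx L).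
Proof.
split; [exact: vspace_H2|by move=> f [/Dx_L2]| | | |by move=> f; exact: sqrtr_ge0].
- by move=> f g [hf _] [hg _]; have [] := H1_add L0 hf hg.
- by move=> c f [hf _]; have [] := H1_scale L0 c hf.
- by move=> f hf /=; apply: le_sqrt_sqr; [exact: nrm_ge0|rewrite addrAC lerDr addr_ge0 ?sqr_ge0].
Qed.

Lemma bop_H2_DxDx : bop (H2 L) (fun f => Dx L (Dx L f)).
Proof.
split; [exact: vspace_H2|by move=> f [_ /Dx_L2]| | | |by move=> f; exact: sqrtr_ge0].
- by move=> f g hf hg; have [] := H2_add hf hg.
- by move=> c f hf; have [] := H2_scale c hf.
- by move=> f hf /=; apply: le_sqrt_sqr; [exact: nrm_ge0|rewrite lerDr addr_ge0 ?sqr_ge0].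
Qed.

Lemma eq_ae_ipl f f' g : inL2 L f -> inL2 L f' -> inL2 L g -> eq_ae L f f' -> ip L f g = ip L f' g.
Proof.
move=> /L2_measurable mf /L2_measurable mf' /L2_measurable mg ff'.
exact: (eq_ae_ip mf mf' mg mg ff' (eq_ae_refl L g)).
Qed.

Section bop_theory.
Variables (X : fspace R) (A : (R -> R) -> R -> R).
Hypothesis hA : bop X A.

Lemma vspace_sub f g : fmem X f -> fmem X g -> fmem X (fun x => f x - g x).
Proof.
have [_ add scale] := bopV hA; move=> hf hg.
by have := add _ _ hf (scale (-1) _ hg); congr (fmem X); apply/funext => x; rewrite mulN1r.
Qed.

Lemma bopB f g : fmem X f -> fmem X g ->
  eq_ae L (A (fun x => f x - g x)) (fun x => A f x - A g x).
Proof.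
have [_ add scale] := bopV hA; move=> hf hg.
have -> : (fun x => f x - g x) = (fun x => f x + -1 * g x) by apply/funext => x; rewrite mulN1r.
apply: eq_ae_trans (bopD hA hf (scale (-1) _ hg)) _.
by apply: ae_mono (bopZ hA (-1) hg) => x e /e ->; rewrite mulN1r.
Qed.

Lemma ip_bopD f g chi : fmem X f -> fmem X g -> inL2 L chi ->
  ip L (A (fun x => f x + g x)) chi = ip L (A f) chi + ip L (A g) chi.
Proof.
have [_ add scale] := bopV hA; move=> hf hg lchi.
have lf := bop_L2 hA hf; have lg := bop_L2 hA hg.
rewrite -(ipDl lf lg lchi); apply: eq_ae_ipl => //.
- by apply: (bop_L2 hA); exact: add.
- exact: L2_add.
- exact: (bopD hA).
Qed.

Lemma ip_bopZ c f chi : fmem X f -> inL2 L chi ->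
  ip L (A (fun x => c * f x)) chi = c * ip L (A f) chi.
Proof.
have [_ add scale] := bopV hA; move=> hf lchi.
have lf := bop_L2 hA hf.
rewrite -(ipZl c lf lchi); apply: eq_ae_ipl => //.
- by apply: (bop_L2 hA); exact: scale.
- exact: L2_scale.
- exact: (bopZ hA).
Qed.

Lemma ip_bopB f g chi : fmem X f -> fmem X g -> inL2 L chi ->
  ip L (A (fun x => f x - g x)) chi = ip L (A f) chi - ip L (A g) chi.
Proof.
have [_ add scale] := bopV hA; move=> hf hg lchi.
have -> : (fun x => f x - g x) = (fun x => f x + -1 * g x) by apply/funext => x; rewrite mulN1r.
by rewrite ip_bopD ?ip_bopZ ?mulN1r//; exact: scale.
Qed.

Lemma ip_bop_le f chi : fmem X f -> inL2 L chi -> `|ip L (A f) chi| <= nrm L chi * fnorm X f.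
Proof.
move=> hf lchi; apply: (le_trans (cauchy_schwarz (bop_L2 hA hf) lchi)).
by rewrite mulrC ler_wpM2l ?nrm_ge0//; exact: bop_le.
Qed.

Lemma nrm_bopB f g : fmem X f -> fmem X g ->
  nrm L (A (fun x => f x - g x)) = nrm L (fun x => A f x - A g x).
Proof.
move=> hf hg; apply: eq_ae_nrm; [| |exact: bopB]; apply: L2_measurable.
  by apply: (bop_L2 hA); exact: vspace_sub.
by apply: L2_sub; exact: (bop_L2 hA).
Qed.

Lemma fmem_sum n (c : nat -> R) (f : nat -> R -> R) : (forall i, (i < n)%N -> fmem X (f i)) ->
  fmem X (fun x => \sum_(i < n) c i * f i x) /\
  forall chi, inL2 L chi ->
    ip L (A (fun x => \sum_(i < n) c i * f i x)) chi = \sum_(i < n) c i * ip L (A (f i)) chi.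
Proof.
have [m0 add scale] := bopV hA; elim: n => [_|n IHn hf].
  have E : (fun x : R => \sum_(i < 0) c i * f i x) = fun=> 0 by apply/funext => x; rewrite big_ord0.
  rewrite E; split => // chi lchi; rewrite big_ord0.
  have -> : (fun=> 0 : R) = (fun x : R => 0 * (fun=> 0) x) by apply/funext => x; rewrite mul0r.
  by rewrite ip_bopZ// mul0r.
have [|h1 h2] := IHn; first by move=> i /ltnW iN; exact: hf.
have fn := hf n (ltnSn n).
have E : (fun x : R => \sum_(i < n.+1) c i * f i x) =
   (fun x => (fun x => \sum_(i < n) c i * f i x) x + (fun x => c n * f n x) x).
  by apply/funext => x; rewrite big_ord_recr.
rewrite E; split; first by apply: add => //; exact: scale.
move=> chi lchi; rewrite ip_bopD//; last exact: scale.
by rewrite h2// ip_bopZ// big_ord_recr.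
Qed.

End bop_theory.

End operators.

(** * Bochner integrals tested against elements of L^2 *)

Section bochner_scalar.
Context {R : realType}.
Local Notation mu := (@lebesgue_measure R).
Local Notation itg D f := (mu.-integrable D (EFin \o f)).
Variables (L T : R).
Hypotheses (L0 : 0 < L) (T0 : 0 < T).
Let mT : measurable (`]0, T[%classic : set (measurableTypeR R)) := measurable_itv _.

Local Notation eint F := (integral mu (`]0, T[%classic) F).

Lemma ae_time_mono (P Q : R -> Prop) : (forall t, t \in `]0, T[ -> P t -> Q t) ->
  (\forall t \ae mu, t \in `]0, T[ -> P t) -> \forall t \ae mu, t \in `]0, T[ -> Q t.
Proof. by move=> PQ; apply: ae_mono => t h tT; apply: PQ => //; exact: h. Qed.

Lemma ae_time_mono2 (P1 P2 Q : R -> Prop) : (forall t, t \in `]0, T[ -> P1 t -> P2 t -> Q t) ->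
  (\forall t \ae mu, t \in `]0, T[ -> P1 t) -> (\forall t \ae mu, t \in `]0, T[ -> P2 t) ->
  \forall t \ae mu, t \in `]0, T[ -> Q t.
Proof.
by move=> PQ h1 h2; apply: ae_mono (ae_conj h1 h2) => t [h1' h2'] tT; apply: PQ => //; [exact: h1'|exact: h2'].
Qed.

Lemma Rintegral_sum_ord n (f : 'I_n -> R -> R) : (forall i, itg `]0, T[ (f i)) ->
  itg `]0, T[ (fun t => \sum_(i < n) f i t) /\
  \int[mu]_(t in `]0, T[) (\sum_(i < n) f i t) = \sum_(i < n) \int[mu]_(t in `]0, T[) f i t.
Proof.
move=> fi; have E : EFin \o (fun t => \sum_(i < n) f i t) = (fun t => \sum_(i < n) (f i t)%:E)%E.
  by apply/funext => t; rewrite /= sumEFin.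
split; first by rewrite E; apply: integrable_sum => // i _; exact: fi.
rewrite /Rintegral -/(EFin \o (fun t => \sum_(i < n) f i t)) E (integral_sum mT fi).
have -> : (\sum_(i < n) \int[mu]_(t in `]0%R, T[) (f i t)%:E =
   \sum_(i < n) (fine (\int[mu]_(t in `]0%R, T[) (f i t)%:E))%:E)%E.
  by apply: eq_bigr => i _; rewrite fineK//; apply: integrable_fin_num => //; exact: fi.
by rewrite sumEFin.
Qed.

Section op.
Variables (X : fspace R) (A : (R -> R) -> R -> R).
Hypothesis hA : bop L X A.

Section steps.
Variable s : step X T.

Let V (i : nat) : R -> R := if insub i is Some j then @step_val _ _ _ s j else fun=> 0.
Let S t (i : nat) : R := if insub i is Some j then \1_(@step_set _ _ _ s j) t else 0.

Let step_funE t : step_fun s t = fun x => \sum_(i < step_size s) S t i * V i x.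
Proof.
by apply/funext => x; apply: eq_bigr => i _; rewrite /S /V valK.
Qed.

Let VX i : (i < step_size s)%N -> fmem X (V i).
Proof. by move=> iN; rewrite /V insubT; exact: step_mem. Qed.

Lemma step_fun_mem t : fmem X (step_fun s t).
Proof. by rewrite step_funE; have [] := fmem_sum hA (S t) VX. Qed.

Lemma ip_step_fun chi t : inL2 L chi ->
  ip L (A (step_fun s t)) chi =
  \sum_(i < step_size s) \1_(@step_set _ _ _ s i) t * ip L (A (@step_val _ _ _ s i)) chi.
Proof.
move=> lchi; rewrite step_funE; have [_ ->//] := fmem_sum hA (S t) VX.
by apply: eq_bigr => i _; rewrite /S /V valK.
Qed.

Lemma step_int_mem_ip chi : inL2 L chi -> fmem X (step_int s) /\
  ip L (A (step_int s)) chi =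
  \sum_(i < step_size s) fine (mu (@step_set _ _ _ s i)) * ip L (A (@step_val _ _ _ s i)) chi.
Proof.
move=> lchi; pose c (i : nat) : R := if insub i is Some j then fine (mu (@step_set _ _ _ s j)) else 0.
have -> : step_int s = fun x => \sum_(i < step_size s) c i * V i x.
  by apply/funext => x; apply: eq_bigr => i _; rewrite /c /V valK.
have [h1 h2] := fmem_sum hA c VX; split => //.
by rewrite h2//; apply: eq_bigr => i _; rewrite /c /V valK.
Qed.

Lemma itg_ip_step chi : inL2 L chi ->
  itg `]0, T[ (fun t => ip L (A (step_fun s t)) chi) /\
  \int[mu]_(t in `]0, T[) ip L (A (step_fun s t)) chi = ip L (A (step_int s)) chi.
Proof.
move=> lchi; have [_ ->] := step_int_mem_ip lchi.
pose f i t := \1_(@step_set _ _ _ s i) t * ip L (A (@step_val _ _ _ s i)) chi.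
have E : (fun t => ip L (A (step_fun s t)) chi) = fun t => \sum_(i < step_size s) f i t.
  by apply/funext => t; exact: ip_step_fun.
have ind i : itg `]0, T[ (\1_(@step_set _ _ _ s i)).
  apply: (@L2_itg _ T); apply: (@L2_bounded _ _ _ 1).
    by apply: measurable_indic; exact: step_meas.
  by move=> t _; rewrite indicE; case: (_ \in _); rewrite ?normr1 ?normr0.
have [h1 h2] := @Rintegral_sum_ord _ f (fun i => itgZr mT _ (ind i)).
rewrite E; split => //; rewrite h2; apply: eq_bigr => i _.
rewrite RintegralZr//; congr (_ * _); rewrite /Rintegral integral_indic//; last exact: step_meas.
by congr (fine (mu _)); apply/setIidPl; exact: step_sub.
Qed.

Lemma measurable_nrm_step : measurable_fun `]0, T[ (fun t => nrm L (A (step_fun s t))).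
Proof.
have msqrt : measurable_fun setT (@Num.sqrt R).
  by apply: continuous_measurable_fun; exact: sqrt_continuous.
apply: (measurableT_comp msqrt).
have E t : ip L (A (step_fun s t)) (A (step_fun s t)) =
  \sum_(i < step_size s) \1_(@step_set _ _ _ s i) t *
    \sum_(j < step_size s) \1_(@step_set _ _ _ s j) t * ip L (A (@step_val _ _ _ s j)) (A (@step_val _ _ _ s i)).
  rewrite ip_step_fun; last exact: (bop_L2 hA (step_fun_mem t)).
  apply: eq_bigr => i _; congr (_ * _).
  by rewrite ipC ip_step_fun//; exact: (bop_L2 hA (step_mem i)).
suff H : measurable_fun `]0, T[ (fun t : R => \sum_(i < step_size s) \1_(@step_set _ _ _ s i) t *
    \sum_(j < step_size s) \1_(@step_set _ _ _ s j) t * ip L (A (@step_val _ _ _ s j)) (A (@step_val _ _ _ s i))).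
  by apply: eq_measurable_fun H => t _; rewrite -E.
have mind i : measurable_fun `]0, T[ (\1_(@step_set _ _ _ s i) : R -> R).
  by apply: measurable_indic; exact: step_meas.
apply: measurable_sum => i; apply: measurable_funM => //.
by apply: measurable_sum => j; apply: measurable_funM.
Qed.

End steps.

(** Pairings and norms converge along the approximating step functions, for which
    they are simple functions of time. *)
Lemma strongly_measurable_versions u : strongly_measurable X T u ->
  (forall chi, inL2 L chi -> exists2 G, measurable_fun `]0, T[ G &
     \forall t \ae mu, t \in `]0, T[ -> ip L (A (u t)) chi = G t) /\
  (exists2 G, measurable_fun `]0, T[ G &
     \forall t \ae mu, t \in `]0, T[ -> nrm L (A (u t)) = G t).
Proof.
move=> [s hs]; split=> [chi lchi|].
- apply: (@ae_limit_measurable _ `]0, T[ (fun n t => ip L (A (step_fun (s n) t)) chi)) => //.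
    by move=> n; have [h _] := itg_ip_step (s n) lchi; exact: itg_measurable h.
  apply: ae_time_mono hs => t tT [ut cvu].
  apply/cvgrPdist_le => e e0.
  have c0 : 0 < nrm L chi + 1 by rewrite ltr_wpDl ?nrm_ge0.
  have /cvgrPdist_le/(_ (e / (nrm L chi + 1))) := cvu.
  rewrite divr_gt0// => /(_ erefl); apply: filterS => n.
  have sn := step_fun_mem (s n) t; have usn := vspace_sub hA ut sn.
  rewrite sub0r normrN ger0_norm; last exact: (fnorm_ge0 hA).
  rewrite -(ip_bopB hA ut sn lchi) ler_pdivlMr// => h.
  apply: le_trans (le_trans _ h); first exact: (ip_bop_le hA usn lchi).
  by rewrite mulrC ler_wpM2l ?lerDl// (fnorm_ge0 hA).
- apply: (@ae_limit_measurable _ `]0, T[ (fun n t => nrm L (A (step_fun (s n) t)))) => //.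
    by move=> n; exact: measurable_nrm_step.
  apply: ae_time_mono hs => t tT [ut cvu].
  apply/cvgrPdist_le => e e0.
  have /cvgrPdist_le/(_ e e0) := cvu; apply: filterS => n.
  have sn := step_fun_mem (s n) t; have usn := vspace_sub hA ut sn.
  rewrite sub0r normrN ger0_norm; last exact: (fnorm_ge0 hA).
  have le := bop_le hA usn; rewrite (nrm_bopB hA ut sn) in le.
  have lu := bop_L2 hA ut; have ls := bop_L2 hA sn.
  move=> h; apply: le_trans h; apply: le_trans le.
  rewrite ler_norml; apply/andP; split.
    have := nrm_triangleB lu (L2_sub lu ls).
    have -> : (fun x => A (u t) x - (A (u t) x - A (step_fun (s n) t) x)) = A (step_fun (s n) t).
      by apply/funext => x; ring.
    lra.
  have := nrm_triangle (L2_sub lu ls) ls.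
  have -> : (fun x => A (u t) x - A (step_fun (s n) t) x + A (step_fun (s n) t) x) = A (u t).
    by apply/funext => x; ring.
  lra.
Qed.

(** A bounded operator passes through the integral of a step function, and the
    scalar error is dominated by the vector-valued one, which tends to 0. No
    measurability of the latter is at hand: the domination is between lower
    integrals. *)
Lemma bochner_scalar u y chi G : is_bochner_int X T u y -> inL2 L chi ->
  measurable_fun `]0, T[ G ->
  (\forall t \ae mu, t \in `]0, T[ -> ip L (A (u t)) chi = G t) ->
  itg `]0, T[ G /\ \int[mu]_(t in `]0, T[) G t = ip L (A y) chi.
Proof.
move=> [[s0 hs0] yX [s [cvu cvy]]] lchi mG uG.
pose S n t := ip L (A (step_fun (s n) t)) chi.
have Si n : itg `]0, T[ (S n) by have [] := itg_ip_step (s n) lchi.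
have SE n : \int[mu]_(t in `]0, T[) S n t = ip L (A (step_int (s n))) chi.
  by have [] := itg_ip_step (s n) lchi.
pose c := nrm L chi + 1.
have c0 : 0 < c by rewrite ltr_wpDl ?nrm_ge0.
(* A measurable minorant of the distance of u to the step functions. *)
pose F n t := c^-1 * `|G t - S n t|.
have mF n : measurable_fun `]0, T[ (F n).
  apply: measurable_funM => //; apply: measurableT_comp => //.
  by apply: measurable_funB => //; exact: itg_measurable (Si n).
pose H n t : \bar R := (fnorm X (fun x => u t x - step_fun (s n) t x))%:E.
have intH n : (eint (fun t => (F n t)%:E) <= eint (H n))%E.
  apply: lower_integral_ae_le => //.
  - by move=> t; rewrite lee_fin mulr_ge0// invr_ge0 ltW.
  - by move=> t; rewrite lee_fin (fnorm_ge0 hA).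
  - apply: (ae_time_mono2 _ hs0 uG) => t tT [ut _] gE; rewrite lee_fin.
    have sn := step_fun_mem (s n) t; have usn := vspace_sub hA ut sn.
    rewrite /F /S -gE -(ip_bopB hA ut sn lchi) ler_pdivrMl//.
    apply: (le_trans (ip_bop_le hA usn lchi)).
    by rewrite ler_wpM2r ?lerDl// (fnorm_ge0 hA).
have Fi n : itg `]0, T[ (fun t => `|G t - S n t|) -> eint (fun t => (F n t)%:E) =
    (c^-1 * \int[mu]_(t in `]0, T[) `|G t - S n t|)%:E.
  move=> h; rewrite -(RintegralZl _ mT h) /Rintegral fineK//.
  by apply: integrable_fin_num => //; exact: itgZl.
have small e : 0 < e -> \forall n \near \oo, itg `]0, T[ (fun t => `|G t - S n t|) /\
    \int[mu]_(t in `]0, T[) `|G t - S n t| <= e.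
  move=> e0; have ce0 : 0 < c^-1 * e by rewrite mulr_gt0// invr_gt0.
  move/fine_cvgP : cvu => [fin /cvgrPdist_le/(_ _ ce0)].
  move: fin; apply: filterS2 => n fin; rewrite sub0r normrN => hn.
  have lt : (eint (fun t => (F n t)%:E) < +oo)%E.
    apply: (le_lt_trans (intH n)); rewrite -ge0_fin_numE//.
    by apply: integral_ge0 => t _; rewrite lee_fin (fnorm_ge0 hA).
  have Fn : itg `]0, T[ (F n).
    apply/integrableP; split; first by apply/measurable_EFinP; exact: mF.
    apply: le_lt_trans lt; rewrite le_eqVlt; apply/orP; left; apply/eqP.
    by apply: eq_integral => t _; rewrite gee0_abs// lee_fin mulr_ge0// invr_ge0 ltW.
  have Dn : itg `]0, T[ (fun t => `|G t - S n t|).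
    have := itgZl mT c Fn; apply: eq_itg => // t _ /=.
    by rewrite mulrA mulfV ?mul1r// gt_eqF.
  split => //; rewrite -(@ler_pM2l _ c^-1) ?invr_gt0//.
  rewrite -lee_fin -Fi//; apply: (le_trans (intH n)).
  by rewrite -(fineK fin) lee_fin; apply: le_trans hn; exact: ler_norm.
have [n0 [Dn0 _]] : exists n, itg `]0, T[ (fun t => `|G t - S n t|) /\
    \int[mu]_(t in `]0, T[) `|G t - S n t| <= 1.
  by have [N _ /(_ N) h] := small 1 ltr01; exists N; apply: h => /=.
have Gi : itg `]0, T[ G.
  apply: (le_itg mT mG (g := fun t => `|G t - S n0 t| + `|S n0 t|)).
    by move=> t _; rewrite -[X in `|X| <= _](subrK (S n0 t)) ler_normD.
  by apply: itgD => //; exact: itg_norm.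
split => //; apply/eqP; rewrite -subr_eq0 -normr_le0; apply/ler_addgt0Pl => e e0; rewrite addr0.
have e2 : 0 < e / 2 by rewrite divr_gt0.
have cvy' : \forall n \near \oo, fnorm X (fun x => y x - step_int (s n) x) <= (e / 2) / c.
  have /cvgrPdist_le/(_ ((e / 2) / c)) := cvy; rewrite divr_gt0// => /(_ erefl).
  by apply: filterS => n; rewrite sub0r normrN ger0_norm// (fnorm_ge0 hA).
near \oo => n.
have [Dn hn] : itg `]0, T[ (fun t => `|G t - S n t|) /\
    \int[mu]_(t in `]0, T[) `|G t - S n t| <= e / 2 by near: n; exact: small.
have sy : `|ip L (A (step_int (s n))) chi - ip L (A y) chi| <= e / 2.
  have [sn _] := step_int_mem_ip (s n) lchi.
  rewrite distrC -(ip_bopB hA yX sn lchi).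
  apply: (le_trans (ip_bop_le hA (vspace_sub hA yX sn) lchi)).
  have : fnorm X (fun x => y x - step_int (s n) x) <= (e / 2) / c by near: n; exact: cvy'.
  rewrite ler_pdivlMr// => h; apply: le_trans h; rewrite mulrC.
  by rewrite ler_wpM2l ?lerDl// (fnorm_ge0 hA).
have -> : \int[mu]_(t in `]0, T[) G t - ip L (A y) chi =
    \int[mu]_(t in `]0, T[) (G t - S n t) + (ip L (A (step_int (s n))) chi - ip L (A y) chi).
  by rewrite RintegralB// SE addrA subrK.
apply: (le_trans (ler_normD _ _)); rewrite [leRHS](splitr e) lerD//.
apply: le_trans hn; apply: le_normr_Rintegral => //.
exact: itgB.
Unshelve. all: by end_near. Qed.

End op.
End bochner_scalar.

(** * Uniqueness of the derivative in time *)

Section more_test_functions.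
Context {R : realType}.

Lemma test_fun_mul (T : R) phi psi : test_fun T phi -> test_fun T psi ->
  test_fun T (fun t => phi t * psi t).
Proof.
move=> tphi tpsi; have [dp cp [c [d [c0 da out]]]] := tphi; have [dq cq _] := tpsi.
have D t : is_derive t (1 : R) (fun t => phi t * psi t) (phi t * derive1 psi t + psi t * derive1 phi t).
  have h1 : is_derive t (1 : R) phi (derive1 phi t) by rewrite derive1E; exact/derivableP.
  have h2 : is_derive t (1 : R) psi (derive1 psi t) by rewrite derive1E; exact/derivableP.
  exact: (is_deriveM h1 h2).
split.
- by move=> t; have [] := D t.
- rewrite (_ : derive1 _ = fun t => phi t * derive1 psi t + psi t * derive1 phi t); last first.
    by apply/funext => t; rewrite derive1E; have [_ ->] := D t.
  move=> t; apply: cvgD; apply: cvgM; try exact: (test_fun_cvg tphi); try exact: (test_fun_cvg tpsi).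
    exact: cq.
  exact: cp.
- by exists c, d; split => // x xcd; rewrite out// mul0r.
Qed.

(** Strict growth where the two points are not on the same constant part. *)
Lemma hump_lt_hump (e x y : R) : 0 < e -> x < y -> - e < y -> x < e -> hump e x < hump e y.
Proof.
move=> e0 xy ye xe; rewrite /hump !addr0.
rewrite (@pos_eq0 _ (x - e)) ?(@pos_id _ (y + e)); [|lra..].
case: (leP 0 (x + e)) => h1; [rewrite (pos_id h1)|rewrite (pos_eq0 (ltW h1))];
case: (leP 0 x) => h2; [rewrite (pos_id h2)|rewrite (pos_eq0 (ltW h2))|lra|rewrite (pos_eq0 (ltW h2))];
case: (leP 0 y) => h3; rewrite ?(pos_id h3) ?(pos_eq0 (ltW h3)); try lra;
case: (leP 0 (y - e)) => h4; rewrite ?(pos_id h4) ?(pos_eq0 (ltW h4)); try lra; nra.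
Qed.

(** Countably many cutoffs are enough to reach every time, so that statements
    which hold almost everywhere for each of them hold jointly. *)
Lemma test_fun_cover (T : R) : 0 < T -> exists phi : nat -> R -> R,
  (forall n, test_fun T (phi n)) /\ (forall t, t \in `]0, T[ -> exists n, phi n t != 0).
Proof.
move=> T0; pose e (n : nat) : R := T / (n + 6)%:R.
have n6 n : 0 < (n + 6)%:R :> R by rewrite ltr0n addn_gt0 orbT.
have e0 n : 0 < e n by rewrite divr_gt0.
have eT n : 6 * e n <= T.
  by rewrite /e mulrA ler_pdivrMr// mulrC ler_pM2l// ler_nat leq_addl.
(* Centres at 2 e from the ends, so that the support stays at distance e from them;
   the shift by 6 keeps the two centres at least 2 e apart. *)
exists (fun n t => hump (e n) (t - 2 * e n) - hump (e n) (t - (T - 2 * e n))); split.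
  by move=> n; have := e0 n; have := eT n => h1 h2; apply: test_fun_hump => //; lra.
move=> t; rewrite in_itv/= => /andP[t0 tT].
pose m := Num.min t (T - t); have m0 : 0 < m by rewrite lt_min t0 subr_gt0.
pose n := Num.bound (T / m); exists n.
have em : e n < m.
  rewrite /e ltr_pdivrMr// mulrC -ltr_pdivrMr//.
  apply: (lt_le_trans (archi_boundP _)); first by rewrite divr_ge0// ltW.
  by rewrite ler_nat leq_addr.
have [h1 h2] := (e0 n, eT n).
move: em; rewrite lt_min => /andP[h3 h4].
by rewrite subr_eq0 gt_eqF//; apply: hump_lt_hump => //; lra.
Qed.

End more_test_functions.

Section time_derivative.
Context {R : realType}.
Local Notation mu := (@lebesgue_measure R).
Local Notation itg D f := (mu.-integrable D (EFin \o f)).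
Variables (L T : R).
Hypotheses (L0 : 0 < L) (T0 : 0 < T).
Let mT : measurable (`]0, T[%classic : set (measurableTypeR R)) := measurable_itv _.
Local Notation aeT' P := (\forall t \ae mu, t \in `]0, T[ -> P t).

Lemma time_deriv_scalar X A u v chi a b : bop L X A -> time_deriv X T u v ->
  inL2 L chi -> aeT' (fun t => fmem X (u t)) -> aeT' (fun t => fmem X (v t)) ->
  measurable_fun `]0, T[ a -> measurable_fun `]0, T[ b ->
  aeT' (fun t => ip L (A (u t)) chi = a t) -> aeT' (fun t => ip L (A (v t)) chi = b t) ->
  forall phi, test_fun T phi ->
   \int[mu]_(t in `]0, T[) (a t * derive1 phi t) = - \int[mu]_(t in `]0, T[) (b t * phi t).
Proof.
move=> hA uv lchi uX vX ma mb ua vb phi tphi.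
have [y bu bv] := uv phi tphi.
have [mp mdp] := test_fun_measurable tphi mT.
have [_ e1] := bochner_scalar hA bu lchi (measurable_funM ma mdp)
  (ae_time_mono2 (fun t tT ut at_ => etrans (ip_bopZ hA _ ut lchi) (etrans (congr1 _ at_) (mulrC _ _))) uX ua).
have [_ e2] := bochner_scalar hA bv lchi (measurable_funM mb mp)
  (ae_time_mono2 (fun t tT ut at_ => etrans (ip_bopZ hA _ ut lchi) (etrans (congr1 _ at_) (mulrC _ _))) vX vb).
have yX : fmem X y by case: bu.
have Ny : (fun x => - y x) = (fun x => -1 * y x) by apply/funext => x; rewrite mulN1r.
rewrite -[LHS]/(\int[mu]_(t in `]0, T[) (a \* derive1 phi) t) e1.
by rewrite -[in RHS]/(\int[mu]_(t in `]0, T[) (b \* phi) t) e2 Ny (ip_bopZ hA _ yX lchi) mulN1r opprK.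
Qed.

(** For each chi the two pairings may differ on a null set depending on chi, but
    the values of f and f' are limits of vectors taken from a countable set:
    the values of the step functions. It is enough to exclude the null sets of
    these. *)
Lemma steps_separate (s s' : nat -> step (L2 L) T) (f f' : R -> R -> R) :
  aeT' (fun t => inL2 L (f t) /\ nrm L (fun x => f t x - step_fun (s n) t x) @[n --> \oo] --> (0 : R)) ->
  aeT' (fun t => inL2 L (f' t) /\ nrm L (fun x => f' t x - step_fun (s' n) t x) @[n --> \oo] --> (0 : R)) ->
  (forall chi, inL2 L chi -> aeT' (fun t => ip L (f t) chi = ip L (f' t) chi)) ->
  aeT' (fun t => eq_ae L (f t) (f' t)).
Proof.
move=> hf hf' ff'.
pose V (s : step (L2 L) T) (i : nat) : R -> R := if insub i is Some j then @step_val _ _ _ s j else fun=> 0.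
have VL2 s1 i : inL2 L (V s1 i).
  by rewrite /V; case: insubP => [j _ _|_]; [exact: (step_mem j)|exact: L2_cst].
have hA := bop_L2_id L.
have all (s1 : nat -> step (L2 L) T) : aeT' (fun t => forall n i, ip L (f t) (V (s1 n) i) = ip L (f' t) (V (s1 n) i)).
  have : \forall t \ae mu, forall n, forall i, t \in `]0, T[ ->
      ip L (f t) (V (s1 n) i) = ip L (f' t) (V (s1 n) i).
    by apply: ae_foralln => n; apply: ae_foralln => i; exact: ff'.
  by apply: ae_mono => t h tT n i; exact: h.
apply: ae_mono (ae_conj (ae_conj hf hf') (ae_conj (all s) (all s'))) => t [[h1 h2] [h3 h4]] tT.
have {h1}[lf cf] := h1 tT; have {h2}[lf' cf'] := h2 tT.
have {}h3 := h3 tT; have {}h4 := h4 tT.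
(* The difference d is orthogonal to the approximations of f and of f'. *)
set d := fun x => f t x - f' t x.
have ld : inL2 L d by exact: L2_sub.
have orth (s1 : nat -> step (L2 L) T) n : (forall n i, ip L (f t) (V (s1 n) i) = ip L (f' t) (V (s1 n) i)) ->
    ip L d (step_fun (s1 n) t) = 0.
  move=> h; rewrite ipC -[step_fun _ _]/(id (step_fun (s1 n) t)).
  rewrite (ip_step_fun hA (s1 n) t ld) big1// => i _.
  have := h n i; rewrite /V valK => E.
  by rewrite ipC /d (ipBl lf lf' (step_mem i)) E subrr mulr0.
have dn n : nrm L d <= nrm L (fun x => f t x - step_fun (s n) t x) + nrm L (fun x => f' t x - step_fun (s' n) t x).
  set p := fun x => f t x - step_fun (s n) t x; set q := fun x => f' t x - step_fun (s' n) t x.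
  have lsn : inL2 L (step_fun (s n) t) := step_fun_mem hA (s n) t.
  have lsn' : inL2 L (step_fun (s' n) t) := step_fun_mem hA (s' n) t.
  have lp : inL2 L p by exact: L2_sub.
  have lq : inL2 L q by exact: L2_sub.
  have e1 : nrm L d ^+ 2 = ip L d p - ip L d q.
    rewrite sqr_nrm /p /q (ipBr lf lsn ld) (ipBr lf' lsn' ld) !orth// !subr0.
    by rewrite -(ipBr lf lf' ld).
  have := cauchy_schwarz ld lp; have := cauchy_schwarz ld lq.
  rewrite !ler_norml => /andP[h5 h6] /andP[h7 h8].
  have := nrm_ge0 L d; rewrite le_eqVlt => /predU1P[<-|d0].
    by rewrite addr_ge0 ?nrm_ge0.
  by rewrite -(ler_pM2l d0) -expr2 e1 mulrDr; lra.
have d0 : nrm L d = 0.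
  apply/eqP; rewrite eq_le nrm_ge0 andbT; apply/ler_addgt0Pl => e e0; rewrite addr0.
  have e2 : 0 < e / 2 by rewrite divr_gt0.
  move/cvgrPdist_le/(_ _ e2) : cf; move/cvgrPdist_le/(_ _ e2) : cf' => cf' cf.
  near \oo => n.
  have h5 : `|0 - nrm L (fun x => f t x - step_fun (s n) t x)| <= e / 2 by near: n; exact: cf.
  have h6 : `|0 - nrm L (fun x => f' t x - step_fun (s' n) t x)| <= e / 2 by near: n; exact: cf'.
  apply: (le_trans (dn n)); rewrite [leRHS](splitr e); apply: lerD.
    by rewrite -(ger0_norm (nrm_ge0 _ _)) -normrN -sub0r.
  by rewrite -(ger0_norm (nrm_ge0 _ _)) -normrN -sub0r.
by apply: ae_mono (nrm_eq0 ld d0) => x h /h /eqP; rewrite subr_eq0 => /eqP.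
Unshelve. all: by end_near. Qed.

(** Testing with chi in L^2 reduces the claim to scalar functions of time, where the
    fundamental lemma applies. The derivatives v and v' are only known to be
    measurable after multiplication by a test function, so the argument is run on
    phi n t * v t for each cutoff phi n. *)
Lemma time_deriv_unique u v v' : time_deriv (L2 L) T u v -> time_deriv (L2 L) T u v' ->
  aeT' (fun t => [/\ inL2 L (v t), inL2 L (v' t) & eq_ae L (v t) (v' t)]).
Proof.
move=> uv uv'; have [phi [tphi cover]] := test_fun_cover T0.
have hA := bop_L2_id L.
suff H n : aeT' (fun t => [/\ inL2 L (fun x => phi n t * v t x), inL2 L (fun x => phi n t * v' t x) &
    eq_ae L (fun x => phi n t * v t x) (fun x => phi n t * v' t x)]).
  have : \forall t \ae mu, forall n, t \in `]0, T[ ->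
    [/\ inL2 L (fun x => phi n t * v t x), inL2 L (fun x => phi n t * v' t x) &
    eq_ae L (fun x => phi n t * v t x) (fun x => phi n t * v' t x)] by exact: ae_foralln.
  apply: ae_mono => t h tT; have [n pn] := cover t tT; have [l1 l2 e] := h n tT.
  have S (g : R -> R) : g = (fun x => (phi n t)^-1 * (phi n t * g x)).
    by apply/funext => x; rewrite mulrA mulVf// mul1r.
  split; [rewrite (S (v t)); exact: L2_scale|rewrite (S (v' t)); exact: L2_scale|].
  by apply: ae_mono e => x e /e /(mulfI pn).
have [y0 _ b0] := uv _ (tphi n); have [y0' _ b0'] := uv' _ (tphi n).
have [[s hs] _ _] := b0; have [[s' hs'] _ _] := b0'.
suff E chi : inL2 L chi ->
    aeT' (fun t => ip L (fun x => phi n t * v t x) chi = ip L (fun x => phi n t * v' t x) chi).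
  have K := steps_separate hs hs' E.
  apply: ae_mono (ae_conj (ae_conj hs hs') K) => t [[h1 h2] h3] tT.
  by have [l1 _] := h1 tT; have [l2 _] := h2 tT; split => //; exact: h3.
move=> lchi.
have [sm _ _] := b0; have [sm' _ _] := b0'.
have [/(_ chi lchi)[W mW WE] _] := strongly_measurable_versions hA sm.
have [/(_ chi lchi)[W' mW' WE'] _] := strongly_measurable_versions hA sm'.
have [Wi _] := bochner_scalar hA b0 lchi mW WE.
have [Wi' _] := bochner_scalar hA b0' lchi mW' WE'.
have l1 : aeT' (fun t => inL2 L (fun x => phi n t * v t x)) by apply: ae_time_mono hs => t _ [].
have l2 : aeT' (fun t => inL2 L (fun x => phi n t * v' t x)) by apply: ae_time_mono hs' => t _ [].
have WW' : aeT' (fun t => W t - W' t = 0).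
  apply: (fundamental_lemma T0); first exact: itgB.
  (* The product of psi and the cutoff is a test function for u, and the integrals of
     its derivative against u are the same for v and v'. *)
  move=> psi tpsi; have tpp := test_fun_mul tpsi (tphi n).
  have [mp mdp] := test_fun_measurable tpsi mT.
  have [y bu bv] := uv _ tpp; have [y' bu' bv'] := uv' _ tpp.
  have [smu _ _] := bu; have [/(_ chi lchi)[G mG GE] _] := strongly_measurable_versions hA smu.
  have [_ e1] := bochner_scalar hA bu lchi mG GE.
  have [_ e2] := bochner_scalar hA bu' lchi mG GE.
  have ver w V : aeT' (fun t => inL2 L (fun x => phi n t * w t x)) ->
      aeT' (fun t => ip L (id (fun x => phi n t * w t x)) chi = V t) ->
      aeT' (fun t => ip L (id (fun x => psi t * phi n t * w t x)) chi = V t * psi t).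
    apply: ae_time_mono2 => t tT lw <-; rewrite [RHS]mulrC; have <- := ipZl (psi t) lw lchi; congr ip.
    by apply/funext => x; rewrite mulrA.
  have [i1 e3] := bochner_scalar hA bv lchi (measurable_funM mW mp) (ver v W l1 WE).
  have [i2 e4] := bochner_scalar hA bv' lchi (measurable_funM mW' mp) (ver v' W' l2 WE').
  have Ly : inL2 L y by case: bu. have Ly' : inL2 L y' by case: bu'.
  under eq_Rintegral do rewrite mulrBl.
  rewrite RintegralB//.
  rewrite -[X in X - _]/(\int[mu]_(t in `]0, T[) (W \* psi) t) e3.
  rewrite -[X in _ - X]/(\int[mu]_(t in `]0, T[) (W' \* psi) t) e4.
  by rewrite (ipNl Ly lchi) (ipNl Ly' lchi) -e1 -e2 subrr.
apply: ae_mono (ae_conj WW' (ae_conj WE WE')) => t [h1 [h2 h3]] tT.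
rewrite -[LHS]/(ip L (id (fun x => phi n t * v t x)) chi) h2//.
by rewrite -[RHS]/(ip L (id (fun x => phi n t * v' t x)) chi) h3//; apply/eqP; rewrite -subr_eq0 h1.
Qed.

Section embedding.
Variable X : fspace R.
Hypothesis hX : bop L X id.

Definition L2_step (s : step X T) : step (L2 L) T :=
  @Step _ (L2 L) T (step_size s) (@step_set _ _ _ s) (@step_val _ _ _ s)
    (@step_meas _ _ _ s) (@step_sub _ _ _ s) (fun i => bop_L2 hX (step_mem i)).

Lemma strongly_measurable_L2 u : strongly_measurable X T u -> strongly_measurable (L2 L) T u.
Proof.
move=> [s hs]; exists (fun n => L2_step (s n)).
apply: ae_time_mono hs => t tT [ut cv]; split; first exact: (bop_L2 hX ut).
apply: squeeze_cvgr; [|exact: cvg_cst|exact: cv].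
apply: nearW => n; rewrite /= nrm_ge0/=.
have sn := step_fun_mem hX (s n) t.
exact: (bop_le hX (vspace_sub hX ut sn)).
Qed.

Lemma bochner_int_L2 u y : is_bochner_int X T u y -> is_bochner_int (L2 L) T u y.
Proof.
move=> [sm yX [s [cvu cvy]]]; split.
- exact: strongly_measurable_L2.
- exact: (bop_L2 hX yX).
- have [s0 hs0] := sm.
  exists (fun n => L2_step (s n)); split.
    apply: squeeze_cvge; [|exact: cvg_cst|exact: cvu].
    apply: nearW => n; apply/andP; split.
      by apply: integral_ge0 => t _; rewrite lee_fin; exact: nrm_ge0.
    apply: lower_integral_ae_le => //.
    + by move=> t; rewrite lee_fin; exact: nrm_ge0.
    + by move=> t; rewrite lee_fin; exact: (fnorm_ge0 hX).
    + apply: ae_time_mono hs0 => t tT [ut _]; rewrite lee_fin.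
      exact: (bop_le hX (vspace_sub hX ut (step_fun_mem hX (s n) t))).
  apply: squeeze_cvgr; [|exact: cvg_cst|exact: cvy].
  apply: nearW => n; rewrite /= nrm_ge0/=.
  have [sn _] := step_int_mem_ip hX (s n) (L2_cst L 0).
  exact: (bop_le hX (vspace_sub hX yX sn)).
Qed.

Lemma time_deriv_L2 u v : time_deriv X T u v -> time_deriv (L2 L) T u v.
Proof.
by move=> uv phi /uv[y bu bv]; exists y; exact: bochner_int_L2.
Qed.

End embedding.

(** A change on null sets of x, at almost every time, leaves the distances to step
    functions unchanged at almost every time. *)
Lemma bochner_int_eq_ae u u' y : is_bochner_int (L2 L) T u y ->
  aeT' (fun t => inL2 L (u t) -> inL2 L (u' t) /\ eq_ae L (u t) (u' t)) -> is_bochner_int (L2 L) T u' y.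
Proof.
move=> [[s0 hs0] yL [s [cvu cvy]]] uu'.
have hX := bop_L2_id L.
have E (s1 : step (L2 L) T) t : inL2 L (u t) -> inL2 L (u' t) -> eq_ae L (u t) (u' t) ->
    nrm L (fun x => u' t x - step_fun s1 t x) = nrm L (fun x => u t x - step_fun s1 t x).
  move=> l l' e; have sn : inL2 L (step_fun s1 t) := step_fun_mem hX s1 t.
  apply: eq_ae_nrm; [apply: L2_measurable; exact: L2_sub|apply: L2_measurable; exact: L2_sub|].
  by apply: ae_mono e => x h /h ->.
split => //.
- exists s0; apply: ae_time_mono2 hs0 uu' => t tT [ut cv] h; have [l' e] := h ut; split => //.
  suff -> : (fun n => fnorm (L2 L) (fun x => u' t x - step_fun (s0 n) t x)) =
    (fun n => fnorm (L2 L) (fun x => u t x - step_fun (s0 n) t x)) by [].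
  by apply/funext => n; exact: E.
- exists s; split; last exact: cvy.
  apply: squeeze_cvge; [|exact: cvg_cst|exact: cvu].
  apply: nearW => n; apply/andP; split.
    by apply: integral_ge0 => t _; rewrite lee_fin; exact: nrm_ge0.
  apply: lower_integral_ae_le => //.
  + by move=> t; rewrite lee_fin; exact: nrm_ge0.
  + by move=> t; rewrite lee_fin; exact: nrm_ge0.
  + apply: ae_time_mono2 hs0 uu' => t tT [ut _] h; have [l' e] := h ut.
    by rewrite lee_fin /= E.
Qed.

Lemma time_deriv_eq_ae (u u' v : R -> R -> R) : time_deriv (L2 L) T u v ->
  aeT' (fun t => inL2 L (u t)) -> aeT' (fun t => inL2 L (u' t)) ->
  aeT' (fun t => eq_ae L (u t) (u' t)) -> time_deriv (L2 L) T u' v.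
Proof.
move=> uv l l' e phi /[dup] tphi /uv[y bu bv]; exists y; last exact: bv.
apply: bochner_int_eq_ae bu _.
apply: ae_mono (ae_conj (ae_conj l l') e) => t [[h1 h2] h3] tT _; split.
  exact: L2_scale (h2 tT).
by apply: ae_mono (h3 tT) => x h /h ->.
Qed.

End time_derivative.

(** * Regularity in time *)

Section regularity_in_time.
Context {R : realType}.
Local Notation mu := (@lebesgue_measure R).
Local Notation itg D f := (mu.-integrable D (EFin \o f)).
Variables (L T : R).
Hypotheses (L0 : 0 < L) (T0 : 0 < T).
Let mT : measurable (`]0, T[%classic : set (measurableTypeR R)) := measurable_itv _.
Local Notation aeT' P := (\forall t \ae mu, t \in `]0, T[ -> P t).

(** The norm in X is not known to be measurable, but the norm of A (v t) in L^2
    equals a measurable function almost everywhere, whose square is integrable by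
    comparison of lower integrals. *)
Lemma bochner_L2_bound X A (v : R -> R -> R) : bop L X A -> bochner_Lp X T 2%:E v ->
  exists g : R -> R, [/\ measurable_fun `]0, T[ g, itg `]0, T[ (fun t => g t ^+ 2),
    forall t, 0 <= g t & aeT' (fun t => fmem X (v t) /\ nrm L (A (v t)) <= g t)].
Proof.
move=> hA [sm fin]; have [_ [G mG GE]] := strongly_measurable_versions hA sm.
have [s hs] := sm.
have vX : aeT' (fun t => fmem X (v t)) by apply: ae_time_mono hs => t _ [].
exists (fun t => `|G t|); split => //.
- exact: measurableT_comp.
- have mg2 : measurable_fun `]0, T[ (fun t => `|G t| ^+ 2).
    by apply: measurable_funX; exact: measurableT_comp.
  apply/integrableP; split; first by apply/measurable_EFinP.
  move: fin; rewrite unlock => fin.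
  have {}fin : (\int[mu]_x `|(EFin \o ((fun t => fnorm X (v t)) \_ `]0%R, T[)) x| `^ 2 < +oo)%E.
    by apply: lty_poweRy fin; rewrite invr_neq0.
  rewrite integral_mkcond; apply: le_lt_trans fin; apply: lower_integral_ae_le => //.
  + by move=> t; rewrite /patch; case: ifP.
  + by move=> t; exact: poweR_ge0.
  apply: ae_mono (ae_conj vX GE) => t [h1 h2] _.
  rewrite patchE; case: ifPn => [|_]; last exact: poweR_ge0.
  move=> tI; rewrite /= patchE tI; rewrite inE/= in tI; rewrite -h2// normrX !normr_id (ger0_norm (fnorm_ge0 hA _)).
  rewrite lee_fin powR_mulrn ?(fnorm_ge0 hA)//.
  rewrite lerXn2r ?nnegrE ?(fnorm_ge0 hA)// ger0_norm ?nrm_ge0//.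
  exact: (bop_le hA (h1 tI)).
- apply: ae_time_mono2 vX GE => t tT vt <-; split => //.
  by rewrite ger0_norm ?nrm_ge0.
Qed.

Lemma bochner_Linf_bound X A (v : R -> R -> R) : bop L X A -> bochner_Lp X T +oo%E v ->
  exists2 B, 0 <= B & aeT' (fun t => fmem X (v t) /\ nrm L (A (v t)) <= B).
Proof.
move=> hA [sm fin]; have [s hs] := sm.
have vX : aeT' (fun t => fmem X (v t)) by apply: ae_time_mono hs => t _ [].
(* The essential supremum over a null space would carry no information. *)
have muT : (0 < mu [set: R])%E.
  have : (mu `]0%R, 1%R[%classic <= mu [set: R])%E by apply: le_measure; rewrite ?inE.
  by apply: lt_le_trans; rewrite lebesgue_measure_itv/= lte_fin ltr01 oppr0 adde0 lte_fin.
move: fin; rewrite unlock muT => fin.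
have ge := ess_sup_ge mu (abse \o (EFin \o ((fun t => fnorm X (v t)) \_ `]0, T[))).
set S := ess_sup _ _ in fin ge.
exists `|fine S|; first by [].
apply: ae_mono (ae_conj vX ge) => t [h1 h2] tT; have vt := h1 tT; split => //.
apply: (le_trans (bop_le hA vt)).
move: h2; rewrite /= patchE mem_set//.
move: fin; case: (S) => [r _||_] //=; rewrite lee_fin => h.
by rewrite (le_trans (ler_norm _))// (le_trans h)// ler_norm.
Qed.

Lemma C0_ip_continuous U chi : C0 (L2 L) T U -> inL2 L chi ->
  {within `[0, T], continuous (fun t => ip L (U t) chi)}.
Proof.
move=> cU lchi; apply/subspace_continuousP => t tT; apply/cvgrPdist_le => e e0.
have c0 : 0 < nrm L chi + 1 by rewrite ltr_wpDl ?nrm_ge0.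
have [Ut /cvgrPdist_le/(_ (e / (nrm L chi + 1)))] := cU t tT.
rewrite divr_gt0// => /(_ erefl) cv.
near=> s.
have sT : s \in `[0, T] by near: s; exact: withinT.
have [Us _] := cU s sT.
have h : nrm L (fun x => U s x - U t x) <= e / (nrm L chi + 1).
  by rewrite -(ger0_norm (nrm_ge0 L _)) -normrN -sub0r; near: s; exact: cv.
rewrite -[X in `|X - _|]/(ip L (U t) chi) -[X in `|_ - X|]/(ip L (U s) chi).
rewrite distrC -(ipBl Us Ut lchi).
apply: (le_trans (cauchy_schwarz (L2_sub Us Ut) lchi)).
rewrite ler_pdivlMr// in h; apply: le_trans h.
by rewrite ler_wpM2l ?nrm_ge0// lerDl.
Unshelve. all: by end_near. Qed.

Lemma C0_op X A u : bop L X A -> C0 X T u -> C0 (L2 L) T (fun t => A (u t)).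
Proof.
move=> hA cu t tT; have [ut cv] := cu t tT; split; first exact: (bop_L2 hA ut).
apply: squeeze_cvgr; [|exact: cvg_cst|exact: cv].
near=> s; rewrite /= nrm_ge0/=.
have sT : s \in `[0, T] by near: s; exact: withinT.
have [us _] := cu s sT.
by rewrite -(nrm_bopB hA us ut); exact: (bop_le hA (vspace_sub hA us ut)).
Unshelve. all: by end_near. Qed.

Lemma measurable_within (a : R -> R) : {within `[0, T], continuous a} -> measurable_fun `]0, T[ a.
Proof. by move=> ca; apply: itg_measurable => //; exact: itg_continuous. Qed.

(** A weak primitive is a primitive almost everywhere, hence everywhere when both
    sides are continuous. *)
Lemma primitive_everywhere (a b : R -> R) : {within `[0, T], continuous a} -> itg `]0, T[ b ->
  (forall phi, test_fun T phi ->
   \int[mu]_(t in `]0, T[) (a t * derive1 phi t) = - \int[mu]_(t in `]0, T[) (b t * phi t)) ->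
  forall s t, 0 <= s -> s <= t -> t <= T -> a t - a s = \int[mu]_(r in `]s, t[) b r.
Proof.
move=> ca ib w s t s0 st tT.
have [c H] := weak_derivative_prim T0 (itg_continuous ca) ib w.
have cp := prim_continuous (ltW T0) ib.
have E r : r \in `[0, T] -> a r - prim b r = c.
  apply: (@ae_eq_everywhere R (fun r => a r - prim b r) 0 T c) => //.
    by move=> y; apply: cvgB; [exact: ca|exact: cp].
  by apply: ae_mono H => y h /h ->; rewrite addrK.
rewrite -(primB s0 st tT ib).
have := E t; have := E s; rewrite !in_itv/= s0 tT (le_trans s0 st) (le_trans st tT).
by move=> /(_ isT) e1 /(_ isT) e2; lra.
Qed.

(** The increment U t - U s is tested with itself: its pairing with U r is a
    primitive of the pairing with A (v r), which is bounded by g r times the norm of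
    the increment. Cauchy and Schwarz in time then brings out the square of g. *)
Lemma regularity X A (u v U : R -> R -> R) (g : R -> R) : bop L X A -> time_deriv X T u v ->
  strongly_measurable X T v ->
  measurable_fun `]0, T[ g -> itg `]0, T[ (fun t => g t ^+ 2) -> (forall t, 0 <= g t) ->
  aeT' (fun t => fmem X (v t) /\ nrm L (A (v t)) <= g t) ->
  aeT' (fun t => fmem X (u t) /\ eq_ae L (A (u t)) (U t)) ->
  C0 (L2 L) T U ->
  forall s t, 0 <= s -> s <= t -> t <= T ->
    nrm L (fun x => U t x - U s x) ^+ 2 <=
    (t - s) * (prim (fun r => g r ^+ 2) t - prim (fun r => g r ^+ 2) s).
Proof.
move=> hA uv smv mg g2i g0 vg uU cU s t s0 st tT.
have sT : s \in `[0, T] by rewrite in_itv/= s0 (le_trans st tT).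
have tT' : t \in `[0, T] by rewrite in_itv/= tT (le_trans s0 st).
have [Us _] := cU s sT; have [Ut _] := cU t tT'.
set chi := fun x => U t x - U s x; have lchi : inL2 L chi by exact: L2_sub.
have [/(_ chi lchi)[V mV VE] _] := strongly_measurable_versions hA smv.
have ca := C0_ip_continuous cU lchi.
have ma := measurable_within ca.
have vX : aeT' (fun t => fmem X (v t)) by apply: ae_time_mono vg => r _ [].
have uX : aeT' (fun t => fmem X (u t)) by apply: ae_time_mono uU => r _ [].
have ua : aeT' (fun r => ip L (A (u r)) chi = ip L (U r) chi).
  apply: ae_time_mono uU => r rT [ur e].
  have [Ur _] := cU r (subset_itv_oo_cc rT).
  exact: (eq_ae_ipl (bop_L2 hA ur) Ur lchi e).
have gi : itg `]0, T[ g by apply: (@L2_itg _ T); apply/inL2P.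
have Vg : aeT' (fun r => `|V r| <= nrm L chi * g r).
  apply: ae_time_mono2 vg VE => r rT [vr le] <-.
  apply: (le_trans (cauchy_schwarz (bop_L2 hA vr) lchi)).
  by rewrite mulrC ler_wpM2l ?nrm_ge0.
have iV : itg `]0, T[ V.
  apply/integrableP; split; first by apply/measurable_EFinP.
  have ig := itgZl mT (nrm L chi) gi.
  have /integrableP[_] := ig; apply: le_lt_trans.
  apply: lower_integral_ae_le => //; apply: ae_time_mono Vg => r rT h.
  by rewrite lee_fin (le_trans h)// ler_norm.
have H := primitive_everywhere ca iV (time_deriv_scalar hA uv lchi uX vX ma mV ua VE) s0 st tT.
have sub : `]s, t[ `<=` `]0, T[ by apply: subset_itv; rewrite bnd_simp.
have iVs : itg `]s, t[ V by apply: integrableS iV.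
have igs : itg `]s, t[ g by apply: integrableS gi.
have ig2s : itg `]s, t[ (fun r => g r ^+ 2) by apply: integrableS g2i.
have e1 : nrm L chi ^+ 2 = \int[mu]_(r in `]s, t[) V r.
  by rewrite sqr_nrm {1}/chi (ipBl Ut Us lchi) H.
have e2 : nrm L chi ^+ 2 <= nrm L chi * \int[mu]_(r in `]s, t[) g r.
  rewrite e1 -RintegralZl//; apply: (le_trans (ler_norm _)).
  apply: (le_trans (le_normr_Rintegral _ _)) => //.
  rewrite /Rintegral fine_le//.
  - by apply: integrable_fin_num => //; exact: itg_norm.
  - by apply: integrable_fin_num => //; exact: itgZl.
  - apply: lower_integral_ae_le => //.
    + by move=> r; rewrite lee_fin mulr_ge0 ?nrm_ge0.
    + by apply: ae_mono Vg => r h /sub /h; rewrite lee_fin.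
have e3 : nrm L chi <= \int[mu]_(r in `]s, t[) g r.
  have := nrm_ge0 L chi; rewrite le_eqVlt => /predU1P[<-|c0]; first exact: Rintegral_ge0.
  by rewrite -(ler_pM2l c0) -expr2.
rewrite (primB s0 st tT g2i); apply: le_trans (sqr_Rintegral st igs ig2s).
by rewrite lerXn2r ?nnegrE ?nrm_ge0// Rintegral_ge0.
Qed.

(** The scalar a is a primitive of F, so the difference quotient of a is the average
    of F. *)
Lemma average_bound X A (u v : R -> R -> R) (chi a F : _ -> R) : bop L X A -> time_deriv X T u v ->
  inL2 L chi -> aeT' (fun t => fmem X (u t)) -> aeT' (fun t => fmem X (v t)) ->
  {within `[0, T], continuous a} -> {within `[0, T], continuous F} ->
  aeT' (fun t => ip L (A (u t)) chi = a t) -> aeT' (fun t => ip L (A (v t)) chi = F t) ->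
  forall s t K, 0 <= s -> s <= t -> t <= T ->
  (forall r, s <= r <= t -> `|F r - F t| <= K) ->
  `|a t - a s - (t - s) * F t| <= (t - s) * K.
Proof.
move=> hA uv lchi uX vX ca cF ua vF s t K s0 st tT FK.
have iF := itg_continuous cF.
rewrite (primitive_everywhere ca iF (time_deriv_scalar hA uv lchi uX vX
  (measurable_within ca) (measurable_within cF) ua vF) s0 st tT).
have sub : `]s, t[ `<=` `]0, T[ by apply: subset_itv; rewrite bnd_simp.
have iFs : itg `]s, t[ F by apply: integrableS iF.
have ic (c : R) : itg `]s, t[ (fun=> c).
  by apply: itg_continuous; apply: continuous_subspaceT => z; exact: cvg_cst.
rewrite [X in _ - X]mulrC [leRHS]mulrC -!Rintegral_cst_oo// -RintegralB//.
apply: (le_trans (le_normr_Rintegral _ _)) => //; first exact: itgB.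
apply: le_Rintegral => //.
  by apply: itg_norm => //; exact: itgB.
by move=> r /=; rewrite in_itv/= => /andP[/ltW sr /ltW rt]; apply: FK; rewrite sr.
Qed.

End regularity_in_time.

(** * The discrete energy estimate *)

(** Summed up to the index where E is largest, every square root on the right is at
    most that of this maximum, and Young's inequality absorbs it: a quarter of the
    maximum for the sum over the steps, of total length T, and a quarter for the
    boundary term Z. The defects enter through their squares only. No exponential
    constant arises. *)
Lemma sum_bound {R : realType} (N : nat) (E Z sg : nat -> R) (T dt tau B a c d e : R) :
  0 < T -> N%:R * dt = T -> 0 <= dt -> 0 <= a -> 0 <= c -> 0 <= d -> 0 <= e -> 0 <= tau ->
  (forall n, 0 <= E n) -> (forall n, 0 <= sg n) -> E 0%N = 0 ->
  (forall n, (n < N)%N -> E n.+1 - E n <= dt * (a * sg n ^+ 2)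
     + dt * (c * sg n * Num.sqrt (E n.+1)) + dt * (d * sg n * Num.sqrt (E n))
     + (Z n.+1 - Z n)) ->
  (forall n, (n <= N)%N -> `|Z n| <= tau * e * Num.sqrt (E n)) ->
  dt * (\sum_(0 <= n < N) sg n ^+ 2) <= B -> tau ^+ 2 <= B ->
  forall n, (n <= N)%N -> E n <= 2 * (a + T * (c + d) ^+ 2 + e ^+ 2) * B.
Proof.
move=> T0 NT dt0 a0 c0 d0 e0 tau0 E0 sg0 E00 step Zle sgB tauB.
(* The index of the largest energy. *)
pose m : 'I_N.+1 := [arg max_(i > ord0) E i]%O.
have Em n : (n <= N)%N -> E n <= E m.
  rewrite /m; case: arg_maxP => // i _ Hi nN.
  by have := Hi (Ordinal (nN : (n < N.+1)%N)) isT.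
set X := Num.sqrt (E m).
have X0 : 0 <= X by exact: sqrtr_ge0.
have XX : X ^+ 2 = E m by rewrite sqr_sqrtr.
have EX n : (n <= N)%N -> Num.sqrt (E n) <= X by move=> nN; rewrite ler_wsqrtr// Em.
have Z0 : Z 0%N = 0 by have := Zle 0%N isT; rewrite E00 sqrtr0 mulr0 normr_le0 => /eqP.
pose D := c + d.
have D0 : 0 <= D by exact: addr_ge0.
have young k : D * sg k * X <= T * D ^+ 2 * sg k ^+ 2 + X ^+ 2 / (4 * T).
  rewrite -subr_ge0 (_ : _ - _ = (2 * T * D * sg k - X) ^+ 2 / (4 * T)).
    by rewrite divr_ge0 ?sqr_ge0// mulr_ge0// ltW.
  by field; rewrite gt_eqF.
have sum n : (n <= N)%N -> E n <= dt * ((a + T * D ^+ 2) * \sum_(0 <= k < n) sg k ^+ 2)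
    + n%:R * dt * (X ^+ 2 / (4 * T)) + Z n.
  elim: n => [|n IHn] nN.
    by rewrite E00 Z0 big_geq// mulr0 mulr0 !mul0r !addr0.
  have := IHn (ltnW nN); have := step n nN.
  have := young n; rewrite -subr_ge0 => /(mulr_ge0 dt0).
  have : c * sg n * Num.sqrt (E n.+1) <= c * sg n * X.
    by rewrite ler_wpM2l ?mulr_ge0// EX.
  rewrite -subr_ge0 => /(mulr_ge0 dt0).
  have : d * sg n * Num.sqrt (E n) <= d * sg n * X.
    by rewrite ler_wpM2l ?mulr_ge0// EX// ltnW.
  rewrite -subr_ge0 => /(mulr_ge0 dt0).
  rewrite big_nat_recr//= -natr1.
  move: (\sum_(0 <= k < n) _) (X ^+ 2 / (4 * T)) => S Y.
  rewrite /D; lra.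
have Bm : E m <= (a + T * D ^+ 2) * B + X ^+ 2 / 4 + tau * e * X.
  have mN : (m <= N)%N by rewrite -ltnS.
  apply: (le_trans (sum m mN)); apply: lerD; last first.
    by apply: (le_trans (ler_norm _)); exact: Zle.
  apply: lerD.
    rewrite mulrCA ler_wpM2l ?addr_ge0 ?mulr_ge0 ?sqr_ge0 ?(ltW T0)//.
    apply: le_trans sgB; rewrite ler_wpM2l// [leRHS](@big_cat_nat _ _ _ m)//=.
    by rewrite lerDl sumr_ge0// => i _; exact: sqr_ge0.
  apply: (@le_trans _ _ (T * (X ^+ 2 / (4 * T)))).
    rewrite ler_wpM2r ?divr_ge0 ?sqr_ge0// ?mulr_ge0// ?(ltW T0)//.
    by rewrite -NT ler_wpM2r// ler_nat.
  by rewrite le_eqVlt; apply/orP; left; apply/eqP; field; rewrite gt_eqF.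
have teX : tau * e * X <= e ^+ 2 * B + X ^+ 2 / 4.
  apply: (@le_trans _ _ (e ^+ 2 * tau ^+ 2 + X ^+ 2 / 4)).
    by have := sqr_ge0 (2 * e * tau - X); lra.
  by rewrite lerD2r ler_wpM2l// sqr_ge0.
move=> n nN; apply: (le_trans (Em n nN)).
move: Bm teX; rewrite -/D XX; lra.
Qed.

Section energy.
Context {R : realType} (V : lmodType R) (dot : V -> V -> R).
Hypothesis dotDl : forall x y z, dot (x + y) z = dot x z + dot y z.
Hypothesis dotZl : forall c x z, dot (c *: x) z = c * dot x z.
Hypothesis dotC : forall x y, dot x y = dot y x.
Hypothesis dot_ge0 : forall x, 0 <= dot x x.

Let dotNl x z : dot (- x) z = - dot x z.
Proof. by rewrite -scaleN1r dotZl mulN1r. Qed.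
Let dotBl x y z : dot (x - y) z = dot x z - dot y z.
Proof. by rewrite dotDl dotNl. Qed.
Let dotDr x y z : dot z (x + y) = dot z x + dot z y.
Proof. by rewrite dotC dotDl !(dotC z). Qed.
Let dotBr x y z : dot z (x - y) = dot z x - dot z y.
Proof. by rewrite dotC dotBl !(dotC z). Qed.
Let dotZr c x z : dot z (c *: x) = c * dot z x.
Proof. by rewrite dotC dotZl (dotC z). Qed.

Definition len x : R := Num.sqrt (dot x x).

Lemma len_ge0 x : 0 <= len x. Proof. exact: sqrtr_ge0. Qed.

Lemma sqr_len x : len x ^+ 2 = dot x x.
Proof. by rewrite sqr_sqrtr// dot_ge0. Qed.

Lemma dot_le x y : dot x y <= len x * len y.
Proof.
set A := dot x x; set B := dot x y; set C := dot y y.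
have A0 : 0 <= A by exact: dot_ge0.
have C0 : 0 <= C by exact: dot_ge0.
have H t : 0 <= A - 2 * t * B + t ^+ 2 * C.
  have := dot_ge0 (x - t *: y).
  by rewrite dotBl !dotBr !dotZr !dotZl (dotC y x) -/A -/B -/C; lra.
have BAC : B ^+ 2 <= A * C.
  move: C0; rewrite le_eqVlt => /predU1P[C0|C0].
    have [->|B0] := eqVneq B 0; first by rewrite -C0 expr0n/= mulr0.
    have := H ((A + 1) / (2 * B)); rewrite -C0 mulr0 addr0.
    rewrite (_ : 2 * ((A + 1) / (2 * B)) * B = A + 1); last by field; rewrite ?B0.
    by lra.
  have := H (B / C); rewrite (_ : _ + _ = (A * C - B ^+ 2) / C); last by field; rewrite gt_eqF.
  by rewrite pmulr_lge0 ?invr_gt0// subr_ge0.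
apply: (le_trans (ler_norm _)).
rewrite -(@ler_pXn2r _ 2)// ?nnegrE ?mulr_ge0 ?len_ge0//.
by rewrite real_normK ?num_real// exprMn !sqr_len.
Qed.

(** Convexity of the square: an implicit time step can only dissipate energy. *)
Lemma half_diff x y : dot x x / 2 - dot y y / 2 <= dot x (x - y).
Proof.
have := dot_ge0 (x - y); rewrite !dotBl !dotBr (dotC y x); lra.
Qed.

Section step.
Variables (rho alpha lambda mu rho1 K gamma b rho3 delta kappa beta dt sigma : R).
Hypotheses (rho_gt0 : 0 < rho) (alpha_gt0 : 0 < alpha) (lambda_gt0 : 0 < lambda)
  (mu_gt0 : 0 < mu) (rho1_gt0 : 0 < rho1) (K_gt0 : 0 < K)
  (gamma_gt0 : 0 < gamma) (b_gt0 : 0 < b) (rho3_gt0 : 0 < rho3)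
  (delta_gt0 : 0 < delta) (kappa_gt0 : 0 < kappa) (dt_gt0 : 0 < dt).

Definition energy (xi du pu Phi s dpsi theta dw : V) : R :=
  (rho * dot xi xi + alpha * dot du du + lambda * dot pu pu + rho1 * dot Phi Phi
   + K * dot s s + b * dot dpsi dpsi + rho3 * dot theta theta + delta * dot dw dw) / 2.

Lemma energy_ge0 xi du pu Phi s dpsi theta dw : 0 <= energy xi du pu Phi s dpsi theta dw.
Proof. by rewrite /energy divr_ge0// !addr_ge0// mulr_ge0// ltW. Qed.

(** A bound linear in the weight c, so that no square root of the coefficients enters
    the constants. *)
Lemma weighted_len c x E : 0 < c -> c * dot x x <= 2 * E -> c * len x <= (1 + 2 * c) * Num.sqrt E.
Proof.
move=> c0 h; have E0 : 0 <= E.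
  by have := mulr_ge0 (ltW c0) (dot_ge0 x); lra.
rewrite -(@ler_pXn2r _ 2)// ?nnegrE; last 2 first.
- by rewrite mulr_ge0 ?len_ge0// ltW.
- by rewrite mulr_ge0 ?sqrtr_ge0//; lra.
rewrite !exprMn sqr_len sqr_sqrtr//.
have : c * (c * dot x x) <= c * (2 * E) by rewrite ler_wpM2l// ltW.
nra.
Qed.

Lemma damp c s : 0 < c -> 0 <= s -> sigma * s - c * s ^+ 2 <= sigma ^+ 2 / (4 * c).
Proof.
move=> c0 s0; rewrite -subr_ge0.
rewrite (_ : _ - _ = (2 * c * s - sigma) ^+ 2 / (4 * c)); last by field; rewrite gt_eqF.
by rewrite divr_ge0 ?sqr_ge0// mulr_ge0// ltW.
Qed.

Variables (xi xi' dxi u u' du du' phi phi' dphi dphi' Phi Phi' dPhi psi psi' dpsi dpsi'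
  theta theta' dtheta dw dw' ru rpu rphi rw : V) (r3 : R).
Let pu := phi - u.
Let pu' := phi' - u'.
Let s := dphi + psi.
Let s' := dphi' + psi'.

Hypothesis du_step : du - du' = dt *: (dxi + ru).
Hypothesis pu_step : pu - pu' = dt *: (Phi - xi + rpu).
Hypothesis dphi_step : dphi - dphi' = dt *: (dPhi + rphi).
Hypothesis dw_step : dw - dw' = dt *: (dtheta + rw).
Hypotheses (ru_le : len ru <= sigma) (rpu_le : len rpu <= sigma)
  (rphi_le : len rphi <= sigma) (rw_le : len rw <= sigma).
Hypothesis skew : dot dtheta Phi = - dot dPhi theta.
Hypothesis eq1 : rho / dt * dot (xi - xi') xi + alpha * dot du dxi - lambda * dot pu xi
  + mu * dot xi xi <= sigma * len xi.
Hypothesis eq2 : rho1 / dt * dot (Phi - Phi') Phi + K * dot s dPhi + lambda * dot pu Phi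
  + gamma * dot Phi Phi + beta * dot dtheta Phi <= sigma * len Phi.
Hypothesis eq3 : b * dot dpsi (dpsi - dpsi') + K * dot s (psi - psi') <= r3.
Hypothesis eq4 : rho3 / dt * dot (theta - theta') theta + delta * dot dw dtheta
  + beta * dot dPhi theta + kappa * dot dtheta dtheta <= sigma * len dtheta.

Let E := energy xi du pu Phi s dpsi theta dw.
Let E' := energy xi' du' pu' Phi' s' dpsi' theta' dw'.

Definition c_damp : R := (4 * mu)^-1 + (4 * gamma)^-1 + (4 * kappa)^-1.
Definition c_slip : R := 4 + 2 * (alpha + lambda + K + delta).

(** The energy increment of each component is bounded by half_diff and turned into
    a rate by the kinematic relations; the sum of the four tested equations removes
    all the work terms. The dampings absorb sigma times the norms of the velocities,
    with the constant c_damp; the defects of the kinematic relations are paired with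
    components of the energy, with the constant c_slip. *)
Lemma energy_step :
  E - E' <= dt * (c_damp * sigma ^+ 2) + dt * (c_slip * sigma * Num.sqrt E) + r3.
Proof.
have E0 : 0 <= E by exact: energy_ge0.
have hdt : dt != 0 by rewrite gt_eqF.
have k1 : rho * dot (xi - xi') xi = dt * (rho / dt * dot (xi - xi') xi) by field.
have k2 : rho1 * dot (Phi - Phi') Phi = dt * (rho1 / dt * dot (Phi - Phi') Phi) by field.
have k3 : rho3 * dot (theta - theta') theta = dt * (rho3 / dt * dot (theta - theta') theta) by field.
have k4 : alpha * dot du (du - du') = dt * (alpha * dot du dxi) + dt * (alpha * dot du ru).
  by rewrite du_step dotZr dotDr; ring.
have k5 : lambda * dot pu (pu - pu') = dt * (lambda * dot pu Phi) - dt * (lambda * dot pu xi)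
    + dt * (lambda * dot pu rpu).
  by rewrite pu_step dotZr dotDr dotBr; ring.
have k6 : K * dot s (s - s') = dt * (K * dot s dPhi) + dt * (K * dot s rphi) + K * dot s (psi - psi').
  rewrite (_ : s - s' = (dphi - dphi') + (psi - psi')); last by rewrite /s /s' opprD addrACA.
  by rewrite dotDr dphi_step dotZr dotDr; ring.
have k7 : delta * dot dw (dw - dw') = dt * (delta * dot dw dtheta) + dt * (delta * dot dw rw).
  by rewrite dw_step dotZr dotDr; ring.
have e1 : dt * (rho / dt * dot (xi - xi') xi + alpha * dot du dxi - lambda * dot pu xi
  + mu * dot xi xi) <= dt * (sigma * len xi) by rewrite ler_pM2l.
have e2 : dt * (rho1 / dt * dot (Phi - Phi') Phi + K * dot s dPhi + lambda * dot pu Phi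
  + gamma * dot Phi Phi + beta * dot dtheta Phi) <= dt * (sigma * len Phi) by rewrite ler_pM2l.
have e4 : dt * (rho3 / dt * dot (theta - theta') theta + delta * dot dw dtheta
  + beta * dot dPhi theta + kappa * dot dtheta dtheta) <= dt * (sigma * len dtheta) by rewrite ler_pM2l.
have d1 : dt * (sigma * len xi - mu * dot xi xi) <= dt * (sigma ^+ 2 / (4 * mu)).
  by rewrite ler_pM2l// -sqr_len; apply: damp => //; exact: len_ge0.
have d2 : dt * (sigma * len Phi - gamma * dot Phi Phi) <= dt * (sigma ^+ 2 / (4 * gamma)).
  by rewrite ler_pM2l// -sqr_len; apply: damp => //; exact: len_ge0.
have d4 : dt * (sigma * len dtheta - kappa * dot dtheta dtheta) <= dt * (sigma ^+ 2 / (4 * kappa)).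
  by rewrite ler_pM2l// -sqr_len; apply: damp => //; exact: len_ge0.
have slip c x r : 0 < c -> len r <= sigma -> c * dot x x <= 2 * E ->
    dt * (c * dot x r) <= dt * ((1 + 2 * c) * Num.sqrt E * sigma).
  move=> c0 rs cx; rewrite ler_pM2l//.
  apply: (@le_trans _ _ (c * len x * len r)).
    by rewrite -mulrA ler_pM2l// dot_le.
  apply: ler_pM => //; [by rewrite mulr_ge0 ?len_ge0// ltW|exact: len_ge0|].
  exact: weighted_len.
have p1 := mulr_ge0 (ltW rho_gt0) (dot_ge0 xi).
have p2 := mulr_ge0 (ltW alpha_gt0) (dot_ge0 du).
have p3 := mulr_ge0 (ltW lambda_gt0) (dot_ge0 pu).
have p4 := mulr_ge0 (ltW rho1_gt0) (dot_ge0 Phi).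
have p5 := mulr_ge0 (ltW K_gt0) (dot_ge0 s).
have p6 := mulr_ge0 (ltW b_gt0) (dot_ge0 dpsi).
have p7 := mulr_ge0 (ltW rho3_gt0) (dot_ge0 theta).
have p8 := mulr_ge0 (ltW delta_gt0) (dot_ge0 dw).
have EE : 2 * E = rho * dot xi xi + alpha * dot du du + lambda * dot pu pu + rho1 * dot Phi Phi
   + K * dot s s + b * dot dpsi dpsi + rho3 * dot theta theta + delta * dot dw dw.
  by rewrite /E /energy; field.
have s1 : dt * (alpha * dot du ru) <= dt * ((1 + 2 * alpha) * Num.sqrt E * sigma).
  by apply: slip => //; rewrite EE; lra.
have s2 : dt * (lambda * dot pu rpu) <= dt * ((1 + 2 * lambda) * Num.sqrt E * sigma).
  by apply: slip => //; rewrite EE; lra.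
have s3 : dt * (K * dot s rphi) <= dt * ((1 + 2 * K) * Num.sqrt E * sigma).
  by apply: slip => //; rewrite EE; lra.
have s4 : dt * (delta * dot dw rw) <= dt * ((1 + 2 * delta) * Num.sqrt E * sigma).
  by apply: slip => //; rewrite EE; lra.
have h c x y : 0 < c -> (c * dot x x) / 2 - (c * dot y y) / 2 <= c * dot x (x - y).
  by move=> c0; have := half_diff x y; rewrite -(ler_pM2l c0); lra.
have h1 := h rho xi xi' rho_gt0; have h2 := h alpha du du' alpha_gt0.
have h3 := h lambda pu pu' lambda_gt0; have h4 := h rho1 Phi Phi' rho1_gt0.
have h5 := h K s s' K_gt0; have h6 := h b dpsi dpsi' b_gt0.
have h7 := h rho3 theta theta' rho3_gt0; have h8 := h delta dw dw' delta_gt0.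
rewrite (dotC xi (xi - xi')) k1 in h1; rewrite (dotC Phi (Phi - Phi')) k2 in h4.
rewrite (dotC theta (theta - theta')) k3 in h7.
rewrite k4 in h2; rewrite k5 in h3; rewrite k6 in h5; rewrite k7 in h8.
rewrite skew in e2.
have -> : E - E' = (rho * dot xi xi / 2 - rho * dot xi' xi' / 2)
    + (alpha * dot du du / 2 - alpha * dot du' du' / 2)
    + (lambda * dot pu pu / 2 - lambda * dot pu' pu' / 2)
    + (rho1 * dot Phi Phi / 2 - rho1 * dot Phi' Phi' / 2)
    + (K * dot s s / 2 - K * dot s' s' / 2)
    + (b * dot dpsi dpsi / 2 - b * dot dpsi' dpsi' / 2)
    + (rho3 * dot theta theta / 2 - rho3 * dot theta' theta' / 2)
    + (delta * dot dw dw / 2 - delta * dot dw' dw' / 2).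
  by rewrite /E /E' /energy; field.
have -> : dt * (c_damp * sigma ^+ 2) = dt * (sigma ^+ 2 / (4 * mu))
    + dt * (sigma ^+ 2 / (4 * gamma)) + dt * (sigma ^+ 2 / (4 * kappa)).
  by rewrite /c_damp; ring.
have -> : dt * (c_slip * sigma * Num.sqrt E) = dt * ((1 + 2 * alpha) * Num.sqrt E * sigma)
    + dt * ((1 + 2 * lambda) * Num.sqrt E * sigma)
    + dt * ((1 + 2 * K) * Num.sqrt E * sigma)
    + dt * ((1 + 2 * delta) * Num.sqrt E * sigma).
  by rewrite /c_slip; ring.
rewrite ?(mulrBr dt) ?(mulrDr dt) ?(mulrN) in h1 h2 h3 h4 h5 h7 h8 e1 e2 e4 d1 d2 d4 *.
rewrite ?mulrDr ?mulrN in e1 e2 e4.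
move: (rho * dot xi xi / 2) (rho * dot xi' xi' / 2) (alpha * dot du du / 2) (alpha * dot du' du' / 2)
  (lambda * dot pu pu / 2) (lambda * dot pu' pu' / 2) (rho1 * dot Phi Phi / 2) (rho1 * dot Phi' Phi' / 2)
  (K * dot s s / 2) (K * dot s' s' / 2) (b * dot dpsi dpsi / 2) (b * dot dpsi' dpsi' / 2)
  (rho3 * dot theta theta / 2) (rho3 * dot theta' theta' / 2) (delta * dot dw dw / 2)
  (delta * dot dw' dw' / 2) (dt * (rho / dt * dot (xi - xi') xi)) (dt * (rho1 / dt * dot (Phi - Phi') Phi))
  (dt * (rho3 / dt * dot (theta - theta') theta)) (dt * (alpha * dot du dxi))
  (dt * (lambda * dot pu xi)) (dt * (mu * dot xi xi)) (dt * (K * dot s dPhi)) (dt * (lambda * dot pu Phi))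
  (dt * (gamma * dot Phi Phi)) (dt * (beta * dot dPhi theta)) (dt * (delta * dot dw dtheta))
  (dt * (kappa * dot dtheta dtheta)) (dt * (alpha * dot du ru)) (dt * (lambda * dot pu rpu)) 
  (dt * (K * dot s rphi)) (dt * (delta * dot dw rw)) (dt * (sigma * len xi)) (dt * (sigma * len Phi))
  (dt * (sigma * len dtheta)) (dt * (sigma ^+ 2 / (4 * mu))) (dt * (sigma ^+ 2 / (4 * gamma))) (dt * (sigma ^+ 2 / (4 * kappa)))
  (dt * ((1 + 2 * alpha) * Num.sqrt E * sigma))
  (dt * ((1 + 2 * lambda) * Num.sqrt E * sigma))
  (dt * ((1 + 2 * K) * Num.sqrt E * sigma))
  (dt * ((1 + 2 * delta) * Num.sqrt E * sigma)) (K * dot s (psi - psi')) (b * dot dpsi (dpsi - dpsi'))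
  h1 h2 h3 h4 h5 h6 h7 h8 e1 e2 e4 d1 d2 d4 s1 s2 s3 s4 eq3.
move=> *.
lra.
Qed.

End step.

Section run.
Variables (rho alpha lambda mu rho1 K gamma b rho3 delta kappa beta : R).
Hypotheses (rho_gt0 : 0 < rho) (alpha_gt0 : 0 < alpha) (lambda_gt0 : 0 < lambda)
  (mu_gt0 : 0 < mu) (rho1_gt0 : 0 < rho1) (K_gt0 : 0 < K)
  (gamma_gt0 : 0 < gamma) (b_gt0 : 0 < b) (rho3_gt0 : 0 < rho3)
  (delta_gt0 : 0 < delta) (kappa_gt0 : 0 < kappa).
Variables (N : nat) (T dt tau B P : R) (sg : nat -> R).
Hypotheses (T_gt0 : 0 < T) (dt_gt0 : 0 < dt) (NT : N%:R * dt = T)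
  (tau_ge0 : 0 <= tau) (P_ge0 : 0 <= P) (sg_ge0 : forall n, 0 <= sg n).
Variables (xi u du phi dphi Phi psi dpsi theta dw dxi dPhi dtheta z : nat -> V).
Let pu n := phi n - u n.
Let s n := dphi n + psi n.

Hypothesis du_step : forall n, (n < N)%N ->
  len (du n.+1 - du n - dt *: dxi n.+1) <= dt * sg n.
Hypothesis pu_step : forall n, (n < N)%N ->
  len (pu n.+1 - pu n - dt *: (Phi n.+1 - xi n.+1)) <= dt * sg n.
Hypothesis dphi_step : forall n, (n < N)%N ->
  len (dphi n.+1 - dphi n - dt *: dPhi n.+1) <= dt * sg n.
Hypothesis dw_step : forall n, (n < N)%N ->
  len (dw n.+1 - dw n - dt *: dtheta n.+1) <= dt * sg n.
Hypothesis skew : forall n, (n < N)%N -> dot (dtheta n.+1) (Phi n.+1) = - dot (dPhi n.+1) (theta n.+1).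
Hypothesis eq1 : forall n, (n < N)%N ->
  rho / dt * dot (xi n.+1 - xi n) (xi n.+1) + alpha * dot (du n.+1) (dxi n.+1)
  - lambda * dot (pu n.+1) (xi n.+1) + mu * dot (xi n.+1) (xi n.+1) <= sg n * len (xi n.+1).
Hypothesis eq2 : forall n, (n < N)%N ->
  rho1 / dt * dot (Phi n.+1 - Phi n) (Phi n.+1) + K * dot (s n.+1) (dPhi n.+1)
  + lambda * dot (pu n.+1) (Phi n.+1) + gamma * dot (Phi n.+1) (Phi n.+1)
  + beta * dot (dtheta n.+1) (Phi n.+1) <= sg n * len (Phi n.+1).
Hypothesis eq3 : forall n, (n < N)%N ->
  b * dot (dpsi n.+1) (dpsi n.+1 - dpsi n) + K * dot (s n.+1) (psi n.+1 - psi n)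
  <= dot (z n.+1) (psi n.+1 - psi n).
Hypothesis eq4 : forall n, (n < N)%N ->
  rho3 / dt * dot (theta n.+1 - theta n) (theta n.+1) + delta * dot (dw n.+1) (dtheta n.+1)
  + beta * dot (dPhi n.+1) (theta n.+1) + kappa * dot (dtheta n.+1) (dtheta n.+1)
  <= sg n * len (dtheta n.+1).
Hypothesis psi_le : forall n, (n <= N)%N -> len (psi n) <= P * len (dpsi n).
Hypothesis z_le : forall n, (n <= N)%N -> len (z n) <= tau.
Hypothesis dz_le : forall n, (n < N)%N -> len (z n.+1 - z n) <= dt * sg n.

Let E n := energy rho alpha lambda rho1 K b rho3 delta
  (xi n) (du n) (pu n) (Phi n) (s n) (dpsi n) (theta n) (dw n).

Hypotheses (E_0 : E 0%N = 0) (sg_B : dt * (\sum_(0 <= n < N) sg n ^+ 2) <= B)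
  (tau_B : tau ^+ 2 <= B).

Let e := P * ((1 + 2 * b) / b).

(** The residual z of the elliptic equation is paired with an increment of psi, and
    z' (psi' - psi) = (z' psi' - z psi) - (z' - z) psi. The first bracket telescopes
    and plays the part of Z in sum_bound; the second is of the order of the other
    defects. *)
Lemma energy_bound n : (n <= N)%N ->
  E n <= 2 * (c_damp mu gamma kappa + T * (c_slip alpha lambda K delta + e) ^+ 2 + e ^+ 2) * B.
Proof.
have hdt : dt != 0 by rewrite gt_eqF.
have E0 k : 0 <= E k by exact: energy_ge0.
have e0 : 0 <= e by rewrite mulr_ge0// divr_ge0 ?(ltW b_gt0)//; have := b_gt0; lra.
have psiE k : (k <= N)%N -> len (psi k) <= e * Num.sqrt (E k).
  move=> kN; apply: (le_trans (psi_le kN)); rewrite /e -mulrA ler_wpM2l//.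
  rewrite mulrAC ler_pdivlMr// mulrC; apply: weighted_len => //.
  have := mulr_ge0 (ltW rho_gt0) (dot_ge0 (xi k)).
  have := mulr_ge0 (ltW alpha_gt0) (dot_ge0 (du k)).
  have := mulr_ge0 (ltW lambda_gt0) (dot_ge0 (pu k)).
  have := mulr_ge0 (ltW rho1_gt0) (dot_ge0 (Phi k)).
  have := mulr_ge0 (ltW K_gt0) (dot_ge0 (s k)).
  have := mulr_ge0 (ltW rho3_gt0) (dot_ge0 (theta k)).
  have := mulr_ge0 (ltW delta_gt0) (dot_ge0 (dw k)).
  by rewrite /E /energy; lra.
have dotle x y : `|dot x y| <= len x * len y.
  rewrite ler_norml dot_le andbT lerNl -dotNl (le_trans (dot_le _ _))//.
  by rewrite /len dotNl (dotC x) dotNl opprK.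
apply: (@sum_bound R N E (fun k => dot (z k) (psi k)) sg T dt tau B _ _ e e) => //.
- exact: ltW.
- by rewrite /c_damp !addr_ge0// invr_ge0 mulr_ge0// ltW.
- by rewrite /c_slip addr_ge0// mulr_ge0// !addr_ge0// ltW.
- move=> k kN.
  have lenV (x : V) y : len x <= dt * y -> len (dt^-1 *: x) <= y.
    move=> xy; rewrite /len dotZl dotZr mulrA -expr2 sqrtrM ?sqr_ge0//.
    rewrite sqrtr_sqr ger0_norm ?invr_ge0 ?(ltW dt_gt0)//.
    by rewrite ler_pdivrMl.
  (* Any increment is dt times the velocity plus a remainder, here the defect divided by dt. *)
  have rem (x x' y : V) : x - x' = dt *: (y + dt^-1 *: (x - x' - dt *: y)).
    by rewrite scalerDr scalerA divff// scale1r [RHS]addrC subrK.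
  have /= := @energy_step _ alpha lambda mu _ K gamma b _ delta kappa beta dt (sg k)
    rho_gt0 alpha_gt0 lambda_gt0 mu_gt0 rho1_gt0 K_gt0 gamma_gt0 b_gt0 rho3_gt0
    delta_gt0 kappa_gt0 dt_gt0 _ _ (dxi k.+1) (u k.+1) (u k) _ _
    (phi k.+1) (phi k) _ _ _ _ (dPhi k.+1) (psi k.+1) (psi k) _ _ _ _ (dtheta k.+1) _ _
    _ _ _ _ (dot (z k.+1) (psi k.+1 - psi k))
    (rem _ _ _) (rem _ _ _) (rem _ _ _) (rem _ _ _)
    (lenV _ _ (du_step kN)) (lenV _ _ (pu_step kN)) (lenV _ _ (dphi_step kN))
    (lenV _ _ (dw_step kN)) (skew kN) (eq1 kN) (eq2 kN) (eq3 kN) (eq4 kN).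
  rewrite -/(s _) -/(s _) -/(pu _) -/(pu _) -/(E _) -/(E _) => /le_trans; apply.
  rewrite -!addrA !lerD2l.
  have -> : dot (z k.+1) (psi k.+1 - psi k) = dot (z k.+1) (psi k.+1) - dot (z k) (psi k)
      - dot (z k.+1 - z k) (psi k) by rewrite dotBr dotBl; ring.
  rewrite [leLHS]addrC lerD2r.
  apply: (le_trans (ler_norm _)); rewrite normrN; apply: (le_trans (dotle _ _)).
  rewrite (_ : dt * (e * sg k * _) = (dt * sg k) * (e * Num.sqrt (E k))); last by ring.
  by apply: ler_pM; rewrite ?len_ge0 ?dz_le// psiE// ltnW.
- move=> k kN; apply: (le_trans (dotle _ _)).
  by rewrite -mulrA; apply: ler_pM; rewrite ?len_ge0 ?z_le// psiE.
Qed.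

End run.

End energy.

(** * Moduli of continuity in time *)

Section time_modulus.
Context {R : realType}.
Local Notation mu := (@lebesgue_measure R).
Local Notation itg D f := (mu.-integrable D (EFin \o f)).
Variables (L T : R).
Hypotheses (L0 : 0 < L) (T0 : 0 < T).
Local Notation aeT' P := (\forall t \ae mu, t \in `]0, T[ -> P t).

(** Absolute continuity with a square integrable rate, without reference to the
    rate: the bounds of all steps of a subdivision add up to a bounded quantity. *)
Definition modulus (G : R -> R) (f : R -> R -> R) : Prop :=
  forall s t, 0 <= s -> s <= t -> t <= T ->
    nrm L (fun x => f t x - f s x) ^+ 2 <= (t - s) * (G t - G s).

Lemma modulus_mono G f s t : modulus G f -> 0 <= s -> s <= t -> t <= T -> G s <= G t.
Proof.
move=> Gf s0; rewrite le_eqVlt => /predU1P[->//|st] tT.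
have := le_trans (sqr_ge0 _) (Gf s t s0 (ltW st) tT).
by rewrite pmulr_rge0 ?subr_gt0// subr_ge0.
Qed.

Lemma modulus_add G f H g : modulus G f -> modulus H g ->
  modulus (fun t => G t + H t) f /\ modulus (fun t => G t + H t) g.
Proof.
move=> Gf Hg; split=> s t s0 st tT.
  apply: (le_trans (Gf s t s0 st tT)); rewrite ler_wpM2l ?subr_ge0//.
  have := modulus_mono Hg s0 st tT; lra.
apply: (le_trans (Hg s t s0 st tT)); rewrite ler_wpM2l ?subr_ge0//.
have := modulus_mono Gf s0 st tT; lra.
Qed.

Lemma L2_modulus X A (u v U : R -> R -> R) : bop L X A -> time_deriv X T u v ->
  bochner_Lp X T 2%:E v -> aeT' (fun t => fmem X (u t) /\ eq_ae L (A (u t)) (U t)) ->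
  C0 (L2 L) T U -> exists G, modulus G U.
Proof.
move=> hA uv lv uU cU; have [g [mg g2 g0 vg]] := bochner_L2_bound hA lv.
have [sv _] := lv.
by exists (prim (fun r => g r ^+ 2)) => s t; exact: (regularity T0 hA uv sv mg g2 g0 vg uU cU).
Qed.

Lemma Linf_modulus X A (u v U : R -> R -> R) : bop L X A -> time_deriv X T u v ->
  bochner_Lp X T +oo%E v -> aeT' (fun t => fmem X (u t) /\ eq_ae L (A (u t)) (U t)) ->
  C0 (L2 L) T U -> exists G, modulus G U.
Proof.
move=> hA uv lv uU cU; have [B B0 vB] := bochner_Linf_bound hA lv.
have [sv _] := lv.
have mB : measurable_fun `]0, T[ (fun _ : R => B) by exact: measurable_cst.
have iB : itg `]0, T[ (fun _ : R => B ^+ 2) := L2_itg (L2_cst T (B ^+ 2)).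
by exists (prim (fun r => B ^+ 2)) => s t; exact: (regularity T0 hA uv sv mB iB (fun=> B0) vB uU cU).
Qed.

(** Convergence of the derivatives in L^2 implies that of the primitives, in L^2 and
    at the point L. *)
Lemma H10_closed f : inH1 L f ->
  (forall e, 0 < e -> exists g, [/\ H10 L g, nrm L (fun x => f x - g x) <= e &
     nrm L (fun x => Dx L f x - Dx L g x) <= e]) -> H10 L f.
Proof.
move=> hf approx; have lf := H1_L2 hf; have ld := Dx_L2 hf.
have lp := prim_L2 L0 ld; split => //.
  have lfp := L2_sub lf lp.
  have : nrm L (fun x => f x - prim (Dx L f) x) = 0.
    apply/eqP; rewrite eq_le nrm_ge0 andbT; apply/ler_addgt0Pl => e e0; rewrite addr0.
    have e1 : 0 < e / (1 + L) by rewrite divr_gt0// addr_gt0.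
    have [g [[hg gE _] fg dfg]] := approx _ e1.
    have lg := H1_L2 hg; have ldg := Dx_L2 hg.
    have ldd := L2_sub ldg ld; have lq := prim_L2 L0 ldd.
    have -> : nrm L (fun x => f x - prim (Dx L f) x) =
        nrm L (fun x => (f x - g x) + prim (fun y => Dx L g y - Dx L f y) x).
      apply: eq_ae_nrm; [exact: L2_measurable|exact: (L2_measurable (L2_add (L2_sub lf lg) lq))|].
      apply: ae_mono gE => x gx xL; rewrite (prim_sub _ ldg ld); last first.
        by move: xL; rewrite in_itv/= => /andP[_ /ltW].
      by rewrite -gx//; ring.
    apply: (le_trans (nrm_triangle (L2_sub lf lg) lq)).
    have := nrm_prim L0 ldd; rewrite nrm_distC => h.
    have : L * nrm L (fun x => Dx L f x - Dx L g x) <= L * (e / (1 + L)) by rewrite ler_pM2l.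
    have : e / (1 + L) + L * (e / (1 + L)) = e by field; rewrite gt_eqF// addr_gt0.
    lra.
  by move=> /(nrm_eq0 lfp); apply: ae_mono => x h /h /eqP; rewrite subr_eq0 => /eqP.
apply/eqP; rewrite -normr_le0; apply/ler_addgt0Pl => e e0; rewrite addr0.
have e1 : 0 < e / (nrm L (fun=> 1) + 1) by rewrite divr_gt0// ltr_wpDl ?nrm_ge0.
have [g [[hg _ gL] _ dfg]] := approx _ e1; have ldg := Dx_L2 hg.
have ldd := L2_sub ld ldg.
have -> : prim (Dx L f) L = ip L (fun x => Dx L f x - Dx L g x) (fun=> 1).
  rewrite -[LHS]subr0 -gL -(prim_sub (lexx L) ld ldg) /ip /prim.
  by apply: eq_Rintegral => x _; rewrite mulr1.
apply: (le_trans (cauchy_schwarz ldd (L2_cst L 1))).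
have n0 := nrm_ge0 L (fun=> 1 : R).
apply: (@le_trans _ _ (e / (nrm L (fun=> 1) + 1) * nrm L (fun=> 1))); first by rewrite ler_wpM2r.
rewrite mulrAC ler_pdivrMr; last by rewrite ltr_wpDl.
by rewrite ler_pM2l// lerDl.
Qed.

Lemma modulus_le G f s r t : modulus G f -> 0 <= s -> s <= r -> r <= t -> t <= T ->
  nrm L (fun x => f t x - f r x) <= Num.sqrt ((t - s) * (G t - G s)).
Proof.
move=> Gf s0 sr rt tT; apply: le_sqrt_sqr; first exact: nrm_ge0.
have r0 := le_trans s0 sr.
apply: (le_trans (Gf r t r0 rt tT)).
have m1 := modulus_mono Gf s0 sr (le_trans rt tT).
have m2 := modulus_mono Gf r0 rt tT.
by apply: ler_pM; rewrite ?subr_ge0// lerB.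
Qed.

(** The defect is tested with itself, which reduces the claim to the average of a
    scalar function over [s, t]. *)
Lemma mean_slope X A (u v U V : R -> R -> R) G : bop L X A -> time_deriv X T u v ->
  aeT' (fun t => fmem X (u t) /\ eq_ae L (A (u t)) (U t)) ->
  aeT' (fun t => fmem X (v t) /\ eq_ae L (A (v t)) (V t)) ->
  C0 (L2 L) T U -> C0 (L2 L) T V -> modulus G V ->
  forall s t, 0 <= s -> s <= t -> t <= T ->
    nrm L (fun x => U t x - U s x - (t - s) * V t x) <= (t - s) * Num.sqrt ((t - s) * (G t - G s)).
Proof.
move=> hA uv uU vV cU cV GV s t s0 st tT.
have t0 := le_trans s0 st.
have LU r : 0 <= r -> r <= T -> inL2 L (U r).
  by move=> r0 rT; have [] := cU r; rewrite ?in_itv/= ?r0.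
have LV r : 0 <= r -> r <= T -> inL2 L (V r).
  by move=> r0 rT; have [] := cV r; rewrite ?in_itv/= ?r0.
have lUt := LU t t0 tT; have lUs := LU s s0 (le_trans st tT); have lVt := LV t t0 tT.
have ltV := L2_scale (t - s) lVt; have lUU := L2_sub lUt lUs.
set chi := (X in nrm L X <= _); have lchi : inL2 L chi := L2_sub lUU ltV.
set S := Num.sqrt _; have S0 : 0 <= S by exact: sqrtr_ge0.
have uX : aeT' (fun t => fmem X (u t)) by apply: ae_time_mono uU => r _ [].
have vX : aeT' (fun t => fmem X (v t)) by apply: ae_time_mono vV => r _ [].
have ua : aeT' (fun r => ip L (A (u r)) chi = ip L (U r) chi).
  apply: ae_time_mono uU => r; rewrite in_itv/= => /andP[r0 rT] [ur e].
  exact: (eq_ae_ipl (bop_L2 hA ur) (LU r (ltW r0) (ltW rT)) lchi e).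
have va : aeT' (fun r => ip L (A (v r)) chi = ip L (V r) chi).
  apply: ae_time_mono vV => r; rewrite in_itv/= => /andP[r0 rT] [ur e].
  exact: (eq_ae_ipl (bop_L2 hA ur) (LV r (ltW r0) (ltW rT)) lchi e).
have := average_bound T0 hA uv lchi uX vX (C0_ip_continuous cU lchi)
  (C0_ip_continuous cV lchi) ua va s0 st tT.
move=> /(_ (S * nrm L chi)) H.
have {H} : nrm L chi ^+ 2 <= (t - s) * (S * nrm L chi).
  rewrite sqr_nrm {1}/chi (ipBl lUU ltV lchi) (ipBl lUt lUs lchi) (ipZl _ lVt lchi).
  apply: (le_trans (ler_norm _)); apply: H => r /andP[sr rt].
  have lVr := LV r (le_trans s0 sr) (le_trans rt tT).
  rewrite distrC -(ipBl lVt lVr lchi).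
  apply: (le_trans (cauchy_schwarz (L2_sub lVt lVr) lchi)).
  by rewrite ler_wpM2r ?nrm_ge0//; exact: (modulus_le GV s0 sr rt tT).
have := nrm_ge0 L chi; rewrite le_eqVlt => /predU1P[<- _|c0].
  by rewrite mulr_ge0// subr_ge0.
by rewrite mulrA expr2 ler_pM2r.
Qed.

End time_modulus.

(** * Displacements and velocities *)

Section evolution.
Context {R : realType}.
Local Notation mu := (@lebesgue_measure R).
Variables (L T : R).
Hypotheses (L0 : 0 < L) (T0 : 0 < T).
Local Notation aeT' P := (\forall t \ae mu, t \in `]0, T[ -> P t).
Local Notation modulus := (modulus L T).

Lemma nrm_split (f g k : R -> R) : inL2 L f -> inL2 L g -> inL2 L k ->
  eq_ae L f (fun x => g x + k x) -> nrm L f <= nrm L g + nrm L k.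
Proof.
move=> lf lg lk fE; have lgk := L2_add lg lk.
by rewrite (eq_ae_nrm (L2_measurable lf) (L2_measurable lgk) fE); exact: nrm_triangle.
Qed.

Lemma nrm_ae (f g : R -> R) : inL2 L f -> inL2 L g -> eq_ae L f g -> nrm L f = nrm L g.
Proof. by move=> /L2_measurable lf /L2_measurable lg; exact: eq_ae_nrm. Qed.

Lemma eq_ae_Dx (f g : R -> R) : inL2 L f -> inL2 L g -> eq_ae L f g -> eq_ae L (Dx L f) (Dx L g).
Proof. by move=> lf lg fg; rewrite (Dx_eq_ae lf lg fg); exact: eq_ae_refl. Qed.

Lemma Dx_ritz_sub M (f g : R -> R) : (0 < M)%N -> H10 L f -> H10 L g ->
  eq_ae L (Dx L (ritz L M (fun x => f x - g x))) (fun x => Dx L (ritz L M f) x - Dx L (ritz L M g) x).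
Proof.
move=> M0 hf hg; have [h1 _ _ _] := ritz_inH10 L0 M0 hf; have [h2 _ _ _] := ritz_inH10 L0 M0 hg.
have [h3 _ _ _] := ritz_inH10 L0 M0 (H10_sub L0 hf hg); have [h4 d] := H1_sub L0 h1 h2.
have E : eq_ae L (ritz L M (fun x => f x - g x)) (fun x => ritz L M f x - ritz L M g x).
  by apply: eq_ae_on => x xL; apply: (ritz_sub L0 M0 hf hg); exact: subset_itv_oo_cc.
exact: (eq_ae_trans (eq_ae_Dx (H1_L2 h3) (H1_L2 h4) E) d).
Qed.

Lemma small_step G f e : modulus G f -> 0 < e -> exists2 d, 0 < d &
  forall s t, 0 <= s -> s <= t -> t <= T -> t - s <= d -> Num.sqrt ((t - s) * (G t - G s)) <= e.
Proof.
move=> Gf e0; set D := G T - G 0.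
have D0 : 0 <= D by rewrite subr_ge0; exact: (modulus_mono Gf (lexx 0) (ltW T0) (lexx T)).
exists (e ^+ 2 / (D + 1)) => [|s t s0 st tT d]; first by rewrite divr_gt0 ?exprn_gt0// ltr_wpDl.
rewrite -(sqr_sqrtr (ltW e0)) -[leRHS]ger0_norm ?sqr_ge0// -sqrtr_sqr ler_wsqrtr//.
rewrite sqr_sqrtr ?(ltW e0)//.
have m0 := modulus_mono Gf (lexx 0) s0 (le_trans st tT).
have m1 := modulus_mono Gf s0 st tT.
have m2 := modulus_mono Gf (le_trans s0 st) tT (lexx T).
apply: (@le_trans _ _ (e ^+ 2 / (D + 1) * D)).
  by apply: ler_pM; rewrite ?subr_ge0// /D lerB.
rewrite mulrAC ler_pdivrMr ?ltr_wpDl//.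
by rewrite ler_pM2l ?exprn_gt0// lerDl.
Qed.

Lemma modulus_bounded G f : modulus G f -> (forall t, 0 <= t <= T -> inL2 L (f t)) ->
  exists2 B, 0 <= B & forall t, 0 <= t <= T -> nrm L (f t) <= B.
Proof.
move=> Gf lf; exists (nrm L (fun x => f T x) + Num.sqrt ((T - 0) * (G T - G 0))).
  by rewrite addr_ge0 ?nrm_ge0 ?sqrtr_ge0.
move=> t /andP[t0 tT]; have lT : inL2 L (f T) by apply: lf; rewrite (ltW T0) lexx.
have lt : inL2 L (f t) by apply: lf; rewrite t0 tT.
have lB := L2_sub lt lT.
have E : eq_ae L (f t) (fun x => f T x + (f t x - f T x)) by apply: eq_ae_on => x _; ring.
apply: (le_trans (nrm_split lt lT lB E)); rewrite lerD2l nrm_distC.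
exact: (modulus_le Gf (lexx 0) t0 tT (lexx T)).
Qed.

(** What the error analysis uses of a displacement U and its velocity V = U_t.
    The last field would follow from a bound on V(t) in H^2, which exists for
    almost every t only. *)
Record evolution (G : R -> R) (B : R) (U V : R -> R -> R) : Prop := Evolution {
  ev_H2 : forall t, 0 <= t <= T -> inH2 L (U t);
  ev_H10 : forall t, 0 <= t <= T -> H10 L (U t);
  ev_V : forall t, 0 <= t <= T -> H10 L (V t);
  ev_mU : modulus G U;
  ev_mDU : modulus G (fun t => Dx L (U t));
  ev_mDDU : modulus G (fun t => Dx L (Dx L (U t)));
  ev_mV : modulus G V;
  ev_mDV : modulus G (fun t => Dx L (V t));
  ev_slope : forall s t, 0 <= s -> s <= t -> t <= T ->
    nrm L (fun x => Dx L (U t) x - Dx L (U s) x - (t - s) * Dx L (V t) x)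
      <= (t - s) * Num.sqrt ((t - s) * (G t - G s));
  ev_bDU : forall t, 0 <= t <= T -> nrm L (Dx L (U t)) <= B;
  ev_bDDU : forall t, 0 <= t <= T -> nrm L (Dx L (Dx L (U t))) <= B;
  ev_bDV : forall t, 0 <= t <= T -> nrm L (Dx L (V t)) <= B;
  ev_ritz : forall t M, 0 <= t <= T -> (0 < M)%N ->
    nrm L (fun x => Dx L (V t) x - Dx L (ritz L M (V t)) x) <= L / M%:R * B }.

(** Only increments of G matter, so the functions G of several components can be
    added up to a common one. *)
Lemma modulus_weaken G G' f : modulus G f ->
  (forall s t, 0 <= s -> s <= t -> t <= T -> G t - G s <= G' t - G' s) -> modulus G' f.
Proof.
move=> Gf GG' s t s0 st tT; apply: (le_trans (Gf s t s0 st tT)).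
by rewrite ler_wpM2l ?subr_ge0// GG'.
Qed.

Lemma evolution_weaken G B G' B' U V : evolution G B U V -> B <= B' ->
  (forall s t, 0 <= s -> s <= t -> t <= T -> G t - G s <= G' t - G' s) ->
  evolution G' B' U V.
Proof.
move=> [e1 e2 e3 e4 e5 e6 e7 e8 e9 e10 e11 e12 e13] BB GG.
split; [exact: e1|exact: e2|exact: e3|exact: modulus_weaken e4 GG|exact: modulus_weaken e5 GG
 |exact: modulus_weaken e6 GG|exact: modulus_weaken e7 GG|exact: modulus_weaken e8 GG|
 |by move=> t /e10 h; exact: le_trans h BB|by move=> t /e11 h; exact: le_trans h BB
 |by move=> t /e12 h; exact: le_trans h BB|].
- move=> s t s0 st tT; apply: (le_trans (e9 s t s0 st tT)).
  by rewrite ler_wpM2l ?subr_ge0// ler_wsqrtr// ler_wpM2l ?subr_ge0// GG.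
- move=> t M ht M0; apply: (le_trans (e13 t M ht M0)).
  by rewrite ler_wpM2l// divr_ge0 ?ler0n// ltW.
Qed.

(** The derivatives supplied by the regularity of U are second derivatives for
    some choice of the first one; by uniqueness that choice agrees with V. *)
Lemma Dt_spec (U V : R -> R -> R) : Wkp (L2 L) T 3 2%:E U -> time_deriv (L2 L) T U V ->
  time_deriv (L2 L) T V (Dt L T V) /\
  aeT' (fun t => inL2 L (V t) /\ inL2 L (Dt L T V t)).
Proof.
move=> [_ [a1 Ua1 [_ [a2 a12 [la2 _]]]]] UV.
have u1 := time_deriv_unique T0 Ua1 UV.
have V2 : time_deriv (L2 L) T V a2.
  apply: (time_deriv_eq_ae a12); [by apply: ae_time_mono u1 => t _ []..].
have VD : time_deriv (L2 L) T V (Dt L T V).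
  by apply: (@xgetPex _ (fun _ _ => 0) [set v | time_deriv (L2 L) T V v]); exists a2.
split; first exact: VD.
by apply: ae_time_mono2 u1 (time_deriv_unique T0 V2 VD) => t _ [_ l2 _] [_ l3 _].
Qed.

Section existence.
Variables (U V : R -> R -> R).
Hypotheses (UH1 : Wkp (H1 L) T 2 2%:E U) (UH2 : Wkp (H2 L) T 1 +oo%E U).
Hypotheses (cU : C0 (H2 L) T U) (UV : time_deriv (L2 L) T U V) (cV : C0 (H1 L) T V).
Hypothesis bdU : forall t : R, t \in `[0, T] -> inH10 L (U t).

Let in0T t : 0 <= t <= T -> t \in `[0, T]. Proof. by rewrite in_itv. Qed.

(** The values and spatial derivatives of U have their rates in the space of
    essentially bounded functions with values in H^2, those of V in the space of
    square integrable functions with values in H^1. *)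
Lemma evolution_moduli : exists G, [/\ modulus G U, modulus G (fun t => Dx L (U t)),
  modulus G (fun t => Dx L (Dx L (U t))), modulus G V & modulus G (fun t => Dx L (V t))].
Proof.
have [_ [b1 Ub1 [lb1 [b2 b12 lb2]]]] := UH1; have [_ [c1 Uc1 lc1]] := UH2.
have cU0 : C0 (L2 L) T U := C0_op (bop_H2_id L0) cU.
have cU1 := C0_op (bop_H2_Dx L0) cU; have cU2 := C0_op (bop_H2_DxDx L0) cU.
have cV0 : C0 (L2 L) T V := C0_op (bop_H1_id L0) cV; have cV1 := C0_op (bop_H1_Dx L0) cV.
have UX : aeT' (fun t => inH2 L (U t)).
  by apply: ae_forall => t /subset_itv_oo_cc tT; have [] := cU tT.
have [G0 m0] : exists G, modulus G U.
  apply: (Linf_modulus T0 (bop_H2_id L0) Uc1 lc1 _ cU0).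
  by apply: ae_time_mono UX => t _ h; split; [exact: h|exact: eq_ae_refl].
have [G1 m1] : exists G, modulus G (fun t => Dx L (U t)).
  apply: (Linf_modulus T0 (bop_H2_Dx L0) Uc1 lc1 _ cU1).
  by apply: ae_time_mono UX => t _ h; split; [exact: h|exact: eq_ae_refl].
have [G2 m2] : exists G, modulus G (fun t => Dx L (Dx L (U t))).
  apply: (Linf_modulus T0 (bop_H2_DxDx L0) Uc1 lc1 _ cU2).
  by apply: ae_time_mono UX => t _ h; split; [exact: h|exact: eq_ae_refl].
have [g [_ _ _ hg]] := bochner_L2_bound (bop_H1_id L0) lb1.
have bV := time_deriv_unique T0 (time_deriv_L2 (bop_H1_id L0) Ub1) UV.
have [G3 m3] : exists G, modulus G V.
  apply: (L2_modulus T0 (bop_H1_id L0) b12 lb2 _ cV0).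
  by apply: ae_time_mono2 hg bV => t _ [h _] [_ _ e]; split; [exact: h|exact: e].
have [G4 m4] : exists G, modulus G (fun t => Dx L (V t)).
  apply: (L2_modulus T0 (bop_H1_Dx L0) b12 lb2 _ cV1).
  apply: ae_time_mono2 hg bV => t _ [h _] [l1 l2 e]; split; first exact: h.
  by rewrite (Dx_eq_ae l1 l2 e); exact: eq_ae_refl.
have [] := modulus_add m0 m1; set G01 := fun t => _ => m0' m1'.
have [] := modulus_add m2 m3; set G23 := fun t => _ => m2' m3'.
have [] := modulus_add m0' m2'; set G' := fun t => _ => m0'' _.
have [_ m4'] := modulus_add m0'' m4.
have m (f : R -> R -> R) : modulus G' f -> modulus (fun t => G' t + G4 t) f.
  by move=> h; exact: (proj1 (modulus_add h m4)).
exists (fun t => G' t + G4 t); split; [exact: (m _ m0'')| | | |exact: m4'].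
- exact: (m _ (proj1 (modulus_add m1' m2'))).
- exact: (m _ (proj2 (modulus_add m1' m2'))).
- exact: (m _ (proj2 (modulus_add m1' m3'))).
Qed.

Lemma velocity_ae_H2 : exists2 B, 0 <= B &
  aeT' (fun t => inH2 L (V t) /\ nrm L (Dx L (Dx L (V t))) <= B).
Proof.
have [_ [c1 Uc1 lc1]] := UH2.
have [B B0 hB] := bochner_Linf_bound (bop_H2_DxDx L0) lc1.
exists B; first exact: B0.
have cV' := time_deriv_unique T0 (time_deriv_L2 (bop_H2_id L0) Uc1) UV.
apply: ae_time_mono2 hB cV' => t _ [[h1 h2] le] [l1 l2 e].
have E := Dx_eq_ae l1 l2 e; rewrite E in h2 le; split; last exact: le.
by split; [exact: (H1_eq_ae l2 e h1)|exact: h2].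
Qed.

Lemma quotient_H10 s t : 0 <= s -> s < t -> t <= T ->
  let g := fun x => (t - s)^-1 * (U t x - U s x) in
  H10 L g /\ eq_ae L (Dx L g) (fun x => (t - s)^-1 * (Dx L (U t) x - Dx L (U s) x)).
Proof.
move=> s0 st tT g; have t0 := le_trans s0 (ltW st).
have ht : H10 L (U t) by apply: (inH10_H10 L0); apply: bdU; apply: in0T; rewrite t0 tT.
have hs : H10 L (U s).
  by apply: (inH10_H10 L0); apply: bdU; apply: in0T; rewrite s0 (le_trans (ltW st) tT).
have hts := H10_sub L0 ht hs; have [h1t _ _] := ht; have [h1s _ _] := hs.
split; first exact: (H10_scale L0 (t - s)^-1 hts).
have [h1 d1] := H1_sub L0 h1t h1s; have [h2 d2] := H1_scale L0 (t - s)^-1 h1.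
by apply: ae_mono (ae_conj d1 d2) => x [e1 e2] xL; rewrite e2// e1.
Qed.

Lemma quotient_le (f g k : R -> R) (d e : R) : 0 < d -> inL2 L f -> inL2 L g -> inL2 L k ->
  nrm L (fun x => f x - g x - d * k x) <= d * e ->
  nrm L (fun x => k x - d^-1 * (f x - g x)) <= e.
Proof.
move=> d0 lf lg lk h; have lD := L2_sub (L2_sub lf lg) (L2_scale d lk).
rewrite nrm_distC (_ : (fun x => _) = fun x => d^-1 * (f x - g x - d * k x)).
  by rewrite (nrmZ _ lD) gtr0_norm ?invr_gt0// ler_pdivrMl.
by apply/funext => x; field; rewrite gt_eqF.
Qed.

Lemma slopes G : modulus G V -> modulus G (fun t => Dx L (V t)) ->
  forall s t, 0 <= s -> s <= t -> t <= T ->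
    nrm L (fun x => U t x - U s x - (t - s) * V t x) <= (t - s) * Num.sqrt ((t - s) * (G t - G s)) /\
    nrm L (fun x => Dx L (U t) x - Dx L (U s) x - (t - s) * Dx L (V t) x)
      <= (t - s) * Num.sqrt ((t - s) * (G t - G s)).
Proof.
move=> mV mDV s t s0 st tT.
have [_ [b1 Ub1 [lb1 _]]] := UH1.
have [g [_ _ _ hg]] := bochner_L2_bound (bop_H1_id L0) lb1.
have bV := time_deriv_unique T0 (time_deriv_L2 (bop_H1_id L0) Ub1) UV.
have cU0 : C0 (L2 L) T U := C0_op (bop_H2_id L0) cU.
have cU1 := C0_op (bop_H2_Dx L0) cU.
have cV0 : C0 (L2 L) T V := C0_op (bop_H1_id L0) cV; have cV1 := C0_op (bop_H1_Dx L0) cV.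
have UX : aeT' (fun t => inH1 L (U t)).
  by apply: ae_forall => r /subset_itv_oo_cc rT; have [[]] := cU rT.
split.
  apply: (mean_slope T0 (bop_L2_id L) UV _ _ cU0 cV0 mV s0 st tT).
    by apply: ae_time_mono UX => r _ h; split; [exact: (H1_L2 h)|exact: eq_ae_refl].
  by apply: ae_time_mono bV => r _ [_ h _]; split; [exact: h|exact: eq_ae_refl].
apply: (mean_slope T0 (bop_H1_Dx L0) Ub1 _ _ cU1 cV1 mDV s0 st tT).
  by apply: ae_time_mono UX => r _ h; split; [exact: h|exact: eq_ae_refl].
apply: ae_time_mono2 hg bV => r _ [h _] [l1 l2 e]; split; first exact: h.
exact: (eq_ae_Dx l1 l2 e).
Qed.

(** At positive times V is the limit in H^1 of backward difference quotients of U,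
    which vanish at the ends; at time 0 it is the limit of its later values. *)
Lemma velocity_H10 t : 0 <= t <= T -> H10 L (V t).
Proof.
have [G [mU mDU _ mV mDV]] := evolution_moduli.
have H1V r : 0 <= r <= T -> inH1 L (V r) by move=> /in0T rT; have [] := cV rT.
have H1U r : 0 <= r <= T -> inH1 L (U r) by move=> /in0T rT; have [[]] := cU rT.
have pos s : 0 < s -> s <= T -> H10 L (V s).
  move=> s0 sT; have sT' : 0 <= s <= T by rewrite (ltW s0).
  apply: (H10_closed L0); first exact: (H1V _ sT').
  move=> e e0; have [d d0 hd] := small_step mV e0.
  pose r := Num.max 0 (s - d).
  have r0 : 0 <= r by rewrite le_max lexx.
  have rs : r < s by rewrite gt_max s0/= gtrBl.
  have rT : 0 <= r <= T by rewrite r0 (le_trans (ltW rs) sT).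
  have rd : s - r <= d by rewrite lerBlDr -lerBlDl le_max lexx orbT.
  have [q1 q2] := slopes mV mDV r0 (ltW rs) sT.
  have dg0 : 0 < s - r by rewrite subr_gt0.
  have le := hd r s r0 (ltW rs) sT rd.
  have [hg dg] := quotient_H10 r0 rs sT.
  exists (fun x => (s - r)^-1 * (U s x - U r x)); split; first exact: hg.
    apply: (quotient_le dg0 (H1_L2 (H1U _ sT')) (H1_L2 (H1U _ rT)) (H1_L2 (H1V _ sT'))).
    by apply: (le_trans q1); rewrite ler_pM2l.
  have lDg : inL2 L (Dx L (fun x => (s - r)^-1 * (U s x - U r x))).
    by have [h1 _ _] := hg; exact: (Dx_L2 h1).
  have lDV := Dx_L2 (H1V _ sT').
  have lq := L2_scale (s - r)^-1 (L2_sub (Dx_L2 (H1U _ sT')) (Dx_L2 (H1U _ rT))).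
  rewrite (nrm_ae (L2_sub lDV lDg) (L2_sub lDV lq)); last first.
    by apply: ae_mono dg => x h xL; rewrite h.
  apply: (quotient_le dg0 (Dx_L2 (H1U _ sT')) (Dx_L2 (H1U _ rT)) lDV).
  by apply: (le_trans q2); rewrite ler_pM2l.
move=> /andP[]; rewrite le_eqVlt => /predU1P[<- _|]; last exact: pos.
have T0' : 0 <= (0 : R) <= T by rewrite lexx ltW.
apply: (H10_closed L0); first exact: (H1V _ T0').
move=> e e0; have [d d0 hd] := small_step mV e0.
pose r := Num.min T d.
have r0 : 0 < r by rewrite lt_min T0.
have rT : r <= T by rewrite ge_min lexx.
have rd : r - 0 <= d by rewrite subr0 ge_min lexx orbT.
have le := hd 0 r (lexx 0) (ltW r0) rT rd.
exists (V r); split; first exact: pos.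
  rewrite nrm_distC; apply: le_trans le; exact: (modulus_le mV (lexx 0) (lexx 0) (ltW r0) rT).
rewrite nrm_distC; apply: le_trans le; exact: (modulus_le mDV (lexx 0) (lexx 0) (ltW r0) rT).
Qed.

(** At times where V is in H^2 this is the approximation property of the Ritz
    projection. These times are dense, and both V_x and its projection depend
    continuously on time. *)
Lemma velocity_ritz : exists2 B, 0 <= B & forall t M, 0 <= t <= T -> (0 < M)%N ->
  nrm L (fun x => Dx L (V t) x - Dx L (ritz L M (V t)) x) <= L / M%:R * B.
Proof.
have [B B0 hB] := velocity_ae_H2; exists B; first exact: B0.
have [G [_ _ _ _ mDV]] := evolution_moduli.
move=> t M tT M0; apply/ler_addgt0Pl => e e0.
have [d d0 hd] := small_step mDV e0.
have [y [yT yt [h2 le]]] := ae_dense T0 (in0T tT) d0 hB.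
have yT' : 0 <= y <= T by move: yT; rewrite in_itv/= => /andP[/ltW -> /ltW ->].
have ht := velocity_H10 tT; have hy := velocity_H10 yT'.
have [h1t _ _] := ht; have [h1y _ _] := hy.
have hf := H10_sub L0 ht hy; have [h1f df] := H1_sub L0 h1t h1y; have dr := Dx_ritz_sub M0 ht hy.
have [rt _ _ _] := ritz_inH10 L0 M0 ht; have [ry _ _ _] := ritz_inH10 L0 M0 hy.
have [rf _ _ _] := ritz_inH10 L0 M0 hf.
have lt := L2_sub (Dx_L2 h1t) (Dx_L2 rt); have ly := L2_sub (Dx_L2 h1y) (Dx_L2 ry).
have lf := L2_sub (Dx_L2 h1f) (Dx_L2 rf).
(* Split the error at t into that at the nearby time y and that of the difference. *)
have lin (a b c k p q : R) : p = a - b -> q = c - k -> a - c = b - k + (p - q).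
  by move=> -> ->; ring.
rewrite addrC; apply: (le_trans (nrm_split lt ly lf _)).
  apply: ae_mono (ae_conj df dr) => x [e1 e2] xL.
  exact: (lin _ _ _ _ _ _ (e1 xL) (e2 xL)).
apply: lerD.
  have [_ hh] := h2.
  apply: (le_trans (ritz_err_H2 L0 M0 hy hh)).
  by rewrite ler_wpM2l// divr_ge0 ?ler0n// ltW.
apply: (le_trans (ritz_stable L0 M0 hf)).
rewrite (nrm_ae (Dx_L2 h1f) (L2_sub (Dx_L2 h1t) (Dx_L2 h1y)) df).
have [/andP[t0 tT1] /andP[y0 yT1]] := (tT, yT').
have [ty|yt'] := leP t y.
  rewrite nrm_distC; apply: le_trans (hd t y t0 ty yT1 _).
    exact: (modulus_le mDV t0 (lexx t) ty yT1).
  by apply: ltW; apply: le_lt_trans yt; exact: ler_norm.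
apply: le_trans (hd y t y0 (ltW yt') tT1 _).
  exact: (modulus_le mDV y0 (lexx y) (ltW yt') tT1).
by apply: ltW; apply: le_lt_trans yt; rewrite distrC; exact: ler_norm.
Qed.

Lemma evolution_exists : exists G B, 0 <= B /\ evolution G B U V.
Proof.
have [G [mU mDU mDDU mV mDV]] := evolution_moduli.
have H2U t : 0 <= t <= T -> inH2 L (U t) by move=> /in0T tT; have [] := cU tT.
have [B1 B10 b1] := modulus_bounded mDU (fun t tT => Dx_L2 (proj1 (H2U t tT))).
have [B2 B20 b2] := modulus_bounded mDDU (fun t tT => Dx_L2 (proj2 (H2U t tT))).
have H1V t : 0 <= t <= T -> inH1 L (V t) by move=> /in0T tT; have [] := cV tT.
have [B3 B30 b3] := modulus_bounded mDV (fun t tT => Dx_L2 (H1V t tT)).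
have [B4 B40 b4] := velocity_ritz.
(* A common bound for the four quantities. *)
exists G, (B1 + B2 + B3 + B4); split; first by rewrite !addr_ge0.
split; [exact: H2U|by move=> t /in0T /bdU h; exact: (inH10_H10 L0 h)|exact: velocity_H10
  |exact: mU|exact: mDU|exact: mDDU|exact: mV|exact: mDV| | | | |].
- by move=> s t s0 st tT; have [] := slopes mV mDV s0 st tT.
- by move=> t /b1 h; apply: (le_trans h); lra.
- by move=> t /b2 h; apply: (le_trans h); lra.
- by move=> t /b3 h; apply: (le_trans h); lra.
- move=> t M tT M0; apply: (le_trans (b4 t M tT M0)).
  by rewrite ler_wpM2l ?divr_ge0 ?ler0n ?(ltW L0)//; lra.
Qed.

End existence.

End evolution.

(** * Consistency of difference quotients *)

Section consistency.
Context {R : realType}.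
Local Notation mu := (@lebesgue_measure R).
Variables (L T : R).
Hypotheses (L0 : 0 < L) (T0 : 0 < T).
Local Notation aeT' P := (\forall t \ae mu, t \in `]0, T[ -> P t).
Local Notation modulus := (modulus L T).
Local Notation onL2 f := (forall t : R, 0 <= t <= T -> inL2 L (f t)).

Variable G : R -> R.
Hypothesis G_mono : forall s t, 0 <= s -> s <= t -> t <= T -> G s <= G t.
Local Notation S s t := (Num.sqrt ((t - s) * (G t - G s))).

Lemma itvP0 t : 0 <= t <= T -> t \in `[0, T]. Proof. by rewrite in_itv. Qed.

(** The modulus with an explicit factor, needed because the right-hand sides of the
    equations combine several functions with coefficients. *)
Definition osc (a : R) (f : R -> R -> R) : Prop := forall s t, 0 <= s -> s <= t -> t <= T ->
  nrm L (fun x => f t x - f s x) <= a * S s t.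

Lemma modulus_osc f : modulus G f -> osc 1 f.
Proof. by move=> Gf s t s0 st tT; rewrite mul1r; exact: (modulus_le Gf s0 (lexx s) st tT). Qed.

Lemma osc_modulus a f : 0 <= a -> osc a f -> modulus (fun t => a ^+ 2 * G t) f.
Proof.
move=> a0 af s t s0 st tT; have h := af s t s0 st tT.
have P : 0 <= (t - s) * (G t - G s) by rewrite mulr_ge0 ?subr_ge0// G_mono.
apply: (@le_trans _ _ ((a * S s t) ^+ 2)).
  by rewrite lerXn2r// ?nnegrE ?nrm_ge0// mulr_ge0// sqrtr_ge0.
by rewrite exprMn sqr_sqrtr// -mulrBr mulrCA.
Qed.

Lemma osc_add a b f g : onL2 f -> onL2 g -> osc a f -> osc b g ->
  osc (a + b) (fun t x => f t x + g t x).
Proof.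
move=> lf lg af bg s t s0 st tT.
have sT : 0 <= s <= T by rewrite s0 (le_trans st).
have tT' : 0 <= t <= T by rewrite tT (le_trans s0).
have ft := lf t tT'; have fs := lf s sT; have gt := lg t tT'; have gs := lg s sT.
apply: (le_trans (nrm_split (L2_sub (L2_add ft gt) (L2_add fs gs)) (L2_sub ft fs) (L2_sub gt gs) _)).
  have lin (p q r z : R) : p + q - (r + z) = p - r + (q - z) by ring.
  by apply: eq_ae_on => x _; exact: lin.
by rewrite mulrDl; apply: lerD; [exact: af|exact: bg].
Qed.

Lemma osc_scale a c f : onL2 f -> osc a f -> osc (`|c| * a) (fun t x => c * f t x).
Proof.
move=> lf af s t s0 st tT.
have sT : 0 <= s <= T by rewrite s0 (le_trans st).
have tT' : 0 <= t <= T by rewrite tT (le_trans s0).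
have E : (fun x => c * f t x - c * f s x) = fun x => c * (f t x - f s x).
  by apply/funext => x; rewrite mulrBr.
rewrite E (nrmZ c (L2_sub (lf t tT') (lf s sT))) -mulrA ler_wpM2l//; exact: af.
Qed.

Lemma osc_C0 a f : 0 <= a -> onL2 f -> osc a f -> C0 (L2 L) T f.
Proof.
move=> a0 lf af t; rewrite in_itv/= => tT; split; first exact: lf.
apply/cvgrPdist_le => e e0.
have [d d0 hd] := small_step T0 (osc_modulus a0 af) e0.
have m := osc_modulus a0 af.
near=> s; rewrite sub0r normrN ger0_norm ?nrm_ge0//.
have sT : s \in `[0, T] by near: s; exact: withinT.
have st : `|t - s| < d by near: s; apply: cvg_within; exact: nbhsx_ballx.
move: sT tT; rewrite in_itv/= => /andP[s0 sT] /andP[t0 tT].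
have [h|h] := leP s t.
  rewrite nrm_distC; apply: le_trans (hd s t s0 h tT _); first exact: (modulus_le m s0 (lexx s) h tT).
  by apply: ltW; apply: le_lt_trans st; exact: ler_norm.
apply: le_trans (hd t s t0 (ltW h) sT _); first exact: (modulus_le m t0 (lexx t) (ltW h) sT).
by apply: ltW; apply: le_lt_trans st; rewrite distrC; exact: ler_norm.
Unshelve. all: by end_near. Qed.

Lemma mean_slope_osc a (V W V' : R -> R -> R) : 0 <= a -> time_deriv (L2 L) T V V' ->
  aeT' (fun t => inL2 L (V' t) /\ eq_ae L (V' t) (W t)) ->
  C0 (L2 L) T V -> onL2 W -> osc a W ->
  forall s t, 0 <= s -> s <= t -> t <= T ->
    nrm L (fun x => V t x - V s x - (t - s) * W t x) <= (t - s) * (a * S s t).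
Proof.
move=> a0 VV' VW cV lW aW s t s0 st tT.
have UX : aeT' (fun t => inL2 L (V t) /\ eq_ae L (V t) (V t)).
  apply: ae_forall => r /subset_itv_oo_cc rT; have [h _] := cV r rT.
  by split; [exact: h|exact: eq_ae_refl].
have := mean_slope T0 (bop_L2_id L) VV' UX VW cV (osc_C0 a0 lW aW) (osc_modulus a0 aW) s0 st tT.
by rewrite -mulrBr mulrCA sqrtrM ?sqr_ge0// sqrtr_sqr ger0_norm.
Qed.

(** Right-hand sides are kept as lists of coefficients and functions, which makes the
    constant in the consistency bounds the sum of the absolute values of the
    coefficients. *)
Fixpoint lincomb (s : seq (R * (R -> R -> R))) (t x : R) : R :=
  if s is (c, f) :: s' then c * f t x + lincomb s' t x else 0.

Fixpoint all_L2 (s : seq (R * (R -> R -> R))) (t : R) : Prop :=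
  if s is (_, f) :: s' then inL2 L (f t) /\ all_L2 s' t else True.

Fixpoint all_osc (s : seq (R * (R -> R -> R))) : Prop :=
  if s is (_, f) :: s' then osc 1 f /\ all_osc s' else True.

Lemma lincomb_L2 s t : all_L2 s t -> inL2 L (lincomb s t).
Proof.
elim: s => [_|[c f] s IHs /= [lf ls]]; first exact: L2_cst.
exact: (L2_add (L2_scale c lf) (IHs ls)).
Qed.

Lemma ip_lincomb s t chi : all_L2 s t -> inL2 L chi ->
  ip L (lincomb s t) chi = \sum_(p <- s) p.1 * ip L (p.2 t) chi.
Proof.
move=> + lchi; elim: s => [_|[c f] s IHs /= [lf ls]].
  rewrite big_nil -[RHS](mul0r (ip L (fun=> 0) chi)) -(ipZl 0 (L2_cst L 0) lchi).
  by congr ip; apply/funext => x /=; rewrite mul0r.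
rewrite big_cons -IHs// -(ipZl c lf lchi).
exact: (ipDl (L2_scale c lf) (lincomb_L2 ls) lchi).
Qed.

Lemma osc_lincomb s : (forall t, 0 <= t <= T -> all_L2 s t) -> all_osc s ->
  osc (\sum_(p <- s) `|p.1|) (lincomb s).
Proof.
elim: s => [_ _ a t a0 at' tT|[c f] s IHs ls os].
  rewrite big_nil mul0r.
  by rewrite (_ : (fun x => _) = fun=> 0) ?nrm_cst ?normr0 ?mul0r//; apply/funext => x /=; rewrite subrr.
case: os => o1 os; have lf : onL2 f by move=> t /ls [].
have ls' t : 0 <= t <= T -> all_L2 s t by move=> /ls [].
rewrite big_cons/=; apply: osc_add.
- by move=> t /lf; exact: L2_scale.
- by move=> t /ls'; exact: lincomb_L2.
- by rewrite -[`|c|]mulr1; exact: osc_scale.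
- exact: IHs.
Qed.

(** The equation r V' = lincomb s holds for almost every time, but its right-hand
    side is continuous, and mean_slope holds at every time. *)
Lemma rate_consistent (V V' : R -> R -> R) r s : 0 < r -> time_deriv (L2 L) T V V' ->
  aeT' (fun t => inL2 L (V' t) /\ eq_ae L (fun x => r * V' t x) (lincomb s t)) ->
  C0 (L2 L) T V -> (forall t, 0 <= t <= T -> all_L2 s t) -> all_osc s ->
  forall a t, 0 <= a -> a <= t -> t <= T ->
    nrm L (fun x => r * (V t x - V a x) - (t - a) * lincomb s t x)
      <= (t - a) * ((\sum_(p <- s) `|p.1|) * S a t).
Proof.
move=> r0 VV' VW cV ls os a t a0 at' tT.
have lW : onL2 (lincomb s) by move=> q /ls; exact: lincomb_L2.
have oW := osc_lincomb ls os.
pose W q x := r^-1 * lincomb s q x.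
have lW' : onL2 W by move=> q /lW; exact: L2_scale.
have VW' : aeT' (fun t => inL2 L (V' t) /\ eq_ae L (V' t) (W t)).
  apply: ae_time_mono VW => q _ [h e]; split; first exact: h.
  by apply: ae_mono e => x h' xL; rewrite /W -h'// mulKf// gt_eqF.
have A0 : 0 <= `|r^-1| * (\sum_(p <- s) `|p.1|) by rewrite mulr_ge0 ?sumr_ge0.
have := mean_slope_osc A0 VV' VW' cV lW' (osc_scale r^-1 lW oW) a0 at' tT.
have aT : 0 <= a <= T by rewrite a0 (le_trans at').
have tT' : 0 <= t <= T by rewrite tT (le_trans a0).
have [lVt _] := cV t (itvP0 tT'); have [lVa _] := cV a (itvP0 aT).
have lD := L2_sub (L2_sub lVt lVa) (L2_scale (t - a) (lW' _ tT')).
rewrite -(ler_pM2l r0) -[X in X * nrm _ _]gtr0_norm// -(nrmZ r lD) => H.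
have lin (p q w : R) : r * (p - q) - (t - a) * w = r * (p - q - (t - a) * (r^-1 * w)).
  by field; rewrite gt_eqF.
have -> : (fun x => r * (V t x - V a x) - (t - a) * lincomb s t x) =
    fun x => r * (V t x - V a x - (t - a) * W t x) by apply/funext => x; exact: lin.
apply: (le_trans H); rewrite gtr0_norm ?invr_gt0// le_eqVlt; apply/orP; left; apply/eqP.
by field; rewrite gt_eqF.
Qed.

(** The counterpart of rate_consistent when one part of the right-hand side acts on
    chi and another on eta, the derivative of chi in the application. *)
Lemma weak_rate_consistent (V V' : R -> R -> R) r s s' chi eta : 0 < r ->
  time_deriv (L2 L) T V V' -> inL2 L chi -> inL2 L eta ->
  aeT' (fun t => inL2 L (V' t) /\
    r * ip L (V' t) chi = ip L (lincomb s t) chi + ip L (lincomb s' t) eta) ->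
  C0 (L2 L) T V -> (forall t, 0 <= t <= T -> all_L2 s t) -> all_osc s ->
  (forall t, 0 <= t <= T -> all_L2 s' t) -> all_osc s' ->
  forall a t, 0 <= a -> a <= t -> t <= T ->
    `|r * ip L (fun x => V t x - V a x) chi
      - (t - a) * (ip L (lincomb s t) chi + ip L (lincomb s' t) eta)|
    <= (t - a) * (S a t * ((\sum_(p <- s) `|p.1|) * nrm L chi + (\sum_(p <- s') `|p.1|) * nrm L eta)).
Proof.
move=> r0 VV' lchi leta VW cV ls os ls' os' a t a0 at' tT.
have lW : onL2 (lincomb s) by move=> q /ls; exact: lincomb_L2.
have lW' : onL2 (lincomb s') by move=> q /ls'; exact: lincomb_L2.
have oW := osc_lincomb ls os; have oW' := osc_lincomb ls' os'.
set A := \sum_(p <- s) _; set A' := \sum_(p <- s') _.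
have A0 : 0 <= A by exact: sumr_ge0. have A'0 : 0 <= A' by exact: sumr_ge0.
have c1 := C0_ip_continuous (osc_C0 A0 lW oW) lchi.
have c2 := C0_ip_continuous (osc_C0 A'0 lW' oW') leta.
pose F q := r^-1 * (ip L (lincomb s q) chi + ip L (lincomb s' q) eta).
have cF : {within `[0, T], continuous F}.
  by move=> q; apply: cvgM; [exact: cvg_cst|apply: cvgD; [exact: c1|exact: c2]].
have UX : aeT' (fun t => inL2 L (V t)).
  by apply: ae_forall => q /subset_itv_oo_cc qT; have [] := cV q qT.
have VX : aeT' (fun t => inL2 L (V' t)) by apply: ae_time_mono VW => q _ [].
have UE : aeT' (fun t => ip L (V t) chi = ip L (V t) chi) by apply: ae_forall.
have VE : aeT' (fun t => ip L (V' t) chi = F t).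
  by apply: ae_time_mono VW => q _ [_ e]; rewrite /F -e mulKf// gt_eqF.
have aT : 0 <= a <= T by rewrite a0 (le_trans at').
have tT' : 0 <= t <= T by rewrite tT (le_trans a0).
have [lVt _] := cV t (itvP0 tT'); have [lVa _] := cV a (itvP0 aT).
have FK q : a <= q <= t -> `|F q - F t| <= r^-1 * (S a t * (A * nrm L chi + A' * nrm L eta)).
  move=> /andP[aq qt]; have q0 := le_trans a0 aq; have qT : 0 <= q <= T by rewrite q0 (le_trans qt tT).
  rewrite /F -mulrBr normrM gtr0_norm ?invr_gt0// ler_pM2l ?invr_gt0//.
  have -> (p p' z z' : R) : p + p' - (z + z') = (p - z) + (p' - z') by ring.
  rewrite -(ipBl (lW _ qT) (lW _ tT') lchi) -(ipBl (lW' _ qT) (lW' _ tT') leta).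
  apply: (le_trans (ler_normD _ _)); rewrite mulrDr.
  have m := modulus_le (osc_modulus A0 oW) a0 aq qt tT.
  have m' := modulus_le (osc_modulus A'0 oW') a0 aq qt tT.
  rewrite -mulrBr mulrCA sqrtrM ?sqr_ge0// sqrtr_sqr ger0_norm// nrm_distC in m.
  rewrite -mulrBr mulrCA sqrtrM ?sqr_ge0// sqrtr_sqr ger0_norm// nrm_distC in m'.
  apply: lerD.
    apply: (le_trans (cauchy_schwarz (L2_sub (lW _ qT) (lW _ tT')) lchi)).
    by rewrite mulrA (mulrC (S a t)) ler_wpM2r ?nrm_ge0.
  apply: (le_trans (cauchy_schwarz (L2_sub (lW' _ qT) (lW' _ tT')) leta)).
  by rewrite mulrA (mulrC (S a t)) ler_wpM2r ?nrm_ge0.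
have := average_bound T0 (bop_L2_id L) VV' lchi UX VX (C0_ip_continuous cV lchi) cF UE VE a0 at' tT FK.
rewrite -(ler_pM2l r0) -(ipBl lVt lVa lchi) -[X in X * `|_|]gtr0_norm// -normrM => H.
have lin (p y : R) : r * p - (t - a) * y = r * (p - (t - a) * (r^-1 * y)).
  by field; rewrite gt_eqF.
rewrite lin; apply: (le_trans H); rewrite le_eqVlt; apply/orP; left; apply/eqP.
by field; rewrite gt_eqF.
Qed.

End consistency.

(** * L^2 as a vector space *)

Section L2_lmodule.
Context {R : realType}.
Local Notation mu := (@lebesgue_measure R).
Variable L : R.

Lemma p1_2 : (1 <= 2%:E :> \bar R)%E. Proof. by rewrite lee_fin ler1n. Qed.

Definition L2V := LfunType mu p1_2.

(** Functions become vectors by restriction to the interval, which is exactly linear on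
    L^2; this lets the energy argument be carried out with vector identities. *)
Definition toV (f : R -> R) : L2V :=
  if pselect (inL2 L f) is left lf then Lfun_Sub p1_2 lf else 0.

Definition dot (a b : L2V) : R := ip L (\val a) (\val b).

Lemma toVE f : inL2 L f -> \val (toV f) = f \_ `]0, L[.
Proof. by rewrite /toV; case: pselect. Qed.

Lemma L2V_L2 (a : L2V) : inL2 L (\val a).
Proof.
have la : \val a \in Lfun mu 2%:E by exact: valP.
apply/inL2P; split.
  by move: la => /andP[]; rewrite inE/= => m _; exact: measurable_funTS.
by apply: integrableS (Lfun2_integrable_sqr la).
Qed.

Lemma dotDl a b c : dot (a + b) c = dot a c + dot b c.
Proof. exact: (ipDl (L2V_L2 a) (L2V_L2 b) (L2V_L2 c)). Qed.

Lemma dotZl k a c : dot (k *: a) c = k * dot a c.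
Proof. exact: (ipZl k (L2V_L2 a) (L2V_L2 c)). Qed.

Lemma dotC a b : dot a b = dot b a. Proof. exact: ipC. Qed.

Lemma dot_ge0 a : 0 <= dot a a. Proof. exact: ip_ge0. Qed.

Lemma toV_add f g : inL2 L f -> inL2 L g -> toV (fun x => f x + g x) = toV f + toV g.
Proof.
move=> lf lg; apply: val_inj; rewrite (toVE (L2_add lf lg)) [RHS]raddfD/= !toVE//.
apply/funext => x; transitivity ((f \_ `]0, L[) x + (g \_ `]0, L[) x) => //.
by rewrite !patchE; case: ifPn => // _; rewrite addr0.
Qed.

Lemma toV_scale c f : inL2 L f -> toV (fun x => c * f x) = c *: toV f.
Proof.
move=> lf; apply: val_inj; rewrite (toVE (L2_scale c lf)) [RHS]linearZ/= !toVE//.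
apply/funext => x; transitivity (c * (f \_ `]0, L[) x) => //.
by rewrite !patchE; case: ifPn => // _; rewrite mulr0.
Qed.

Lemma toV_sub f g : inL2 L f -> inL2 L g -> toV (fun x => f x - g x) = toV f - toV g.
Proof.
move=> lf lg; rewrite -scaleN1r -toV_scale// -toV_add//; last exact: L2_scale.
by congr toV; apply/funext => x; rewrite mulN1r.
Qed.

Lemma dot_toV f g : inL2 L f -> inL2 L g -> dot (toV f) (toV g) = ip L f g.
Proof.
by move=> lf lg; rewrite /dot !toVE//; apply: eq_ip => x xL; rewrite patchE mem_set.
Qed.

End L2_lmodule.

(** * The exact solution at every time *)

Section exact_solution.
Context {R : realType}.
Local Notation lebesgue := (@lebesgue_measure R).
Variables (L T : R).
Hypotheses (L0 : 0 < L) (T0 : 0 < T).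
Local Notation aeT' P := (\forall t \ae lebesgue, t \in `]0, T[ -> P t).
Variables (rho alpha lambda mu rho1 K gamma b rho3 delta kappa beta : R).
Hypotheses (rho_gt0 : 0 < rho) (rho1_gt0 : 0 < rho1) (rho3_gt0 : 0 < rho3).
Variables (u phi psi w xi Phi theta : R -> R -> R) (G : R -> R) (B : R).

(** What the error analysis uses of the component psi, which has no velocity in the
    equations. *)
Record elliptic (G : R -> R) (B : R) (psi : R -> R -> R) : Prop := Elliptic {
  el_H2 : forall t, 0 <= t <= T -> inH2 L (psi t);
  el_H10 : forall t, 0 <= t <= T -> H10 L (psi t);
  el_m : modulus L T G psi;
  el_mD : modulus L T G (fun t => Dx L (psi t));
  el_mDD : modulus L T G (fun t => Dx L (Dx L (psi t)));
  el_bD : forall t, 0 <= t <= T -> nrm L (Dx L (psi t)) <= B;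
  el_bDD : forall t, 0 <= t <= T -> nrm L (Dx L (Dx L (psi t))) <= B }.

Hypotheses (eu : evolution L T G B u xi) (ephi : evolution L T G B phi Phi)
  (ew : evolution L T G B w theta) (epsi : elliptic G B psi).
Hypotheses (xi_t : time_deriv (L2 L) T xi (Dt L T xi))
  (Phi_t : time_deriv (L2 L) T Phi (Dt L T Phi))
  (theta_t : time_deriv (L2 L) T theta (Dt L T theta))
  (xi_tL : aeT' (fun t => inL2 L (Dt L T xi t)))
  (Phi_tL : aeT' (fun t => inL2 L (Dt L T Phi t)))
  (theta_tL : aeT' (fun t => inL2 L (Dt L T theta t)))
  (theta_H2 : aeT' (fun t => inH2 L (theta t))).
Hypothesis pde : \forall t \ae lebesgue, t \in `]0, T[ ->
         \forall x \ae lebesgue, x \in `]0, L[ ->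
     [/\ rho * Dt L T xi t x - alpha * Dx L (Dx L (u t)) x
         - lambda * (phi t x - u t x) + mu * xi t x = 0,
         rho1 * Dt L T Phi t x
         - K * Dx L (fun z => Dx L (phi t) z + psi t z) x
         + lambda * (phi t x - u t x) + gamma * Phi t x
         + beta * Dx L (theta t) x = 0,
         - (b * Dx L (Dx L (psi t)) x) + K * (Dx L (phi t) x + psi t x) = 0
       & rho3 * Dt L T theta t x - delta * Dx L (Dx L (w t)) x
         + beta * Dx L (Phi t) x - kappa * Dx L (Dx L (theta t)) x = 0].

Local Notation S s t := (Num.sqrt ((t - s) * (G t - G s))).
Local Notation osc := (osc L T G).

Let G_mono s t : 0 <= s -> s <= t -> t <= T -> G s <= G t.
Proof. exact: modulus_mono (ev_mU eu). Qed.

Let evL U V : evolution L T G B U V -> forall t, 0 <= t <= T ->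
  [/\ inL2 L (U t), inL2 L (Dx L (U t)), inL2 L (Dx L (Dx L (U t))), inL2 L (V t) & inL2 L (Dx L (V t))].
Proof.
move=> e t tT; have [h1 h2] := ev_H2 e tT; have [h3 _ _] := ev_V e tT.
by split; [exact: (H1_L2 h1)|exact: (Dx_L2 h1)|exact: (Dx_L2 h2)|exact: (H1_L2 h3)|exact: (Dx_L2 h3)].
Qed.

Let elL t : 0 <= t <= T ->
  [/\ inL2 L (psi t), inL2 L (Dx L (psi t)) & inL2 L (Dx L (Dx L (psi t)))].
Proof.
move=> tT; have [h1 h2] := el_H2 epsi tT.
by split; [exact: (H1_L2 h1)|exact: (Dx_L2 h1)|exact: (Dx_L2 h2)].
Qed.

Let m1 f : modulus L T G f -> osc 1 f. Proof. exact: modulus_osc. Qed.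

Let inT t : t \in `]0, T[ -> 0 <= t <= T.
Proof. by rewrite in_itv/= => /andP[/ltW -> /ltW ->]. Qed.

Definition rate_u := [:: (alpha, fun t => Dx L (Dx L (u t))); (lambda, phi); (- lambda, u); (- mu, xi)].
Definition rate_phi := [:: (K, fun t => Dx L (Dx L (phi t))); (K, fun t => Dx L (psi t));
  (- lambda, phi); (lambda, u); (- gamma, Phi); (- beta, fun t => Dx L (theta t))].

Lemma rate_u_L2 t : 0 <= t <= T -> all_L2 L rate_u t.
Proof.
move=> tT; have [l1 _ l3 l4 _] := evL eu tT; have [l5 _ _ _ _] := evL ephi tT.
by split; [exact: l3|split; [exact: l5|split; [exact: l1|split; [exact: l4|]]]].
Qed.

Lemma rate_phi_L2 t : 0 <= t <= T -> all_L2 L rate_phi t.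
Proof.
move=> tT; have [l1 _ _ _ _] := evL eu tT; have [p1 _ p3 p4 _] := evL ephi tT.
have [_ _ _ _ l5] := evL ew tT; have [_ q _] := elL tT.
by split; [exact: p3|split; [exact: q|split; [exact: p1|split; [exact: l1|split; [exact: p4|split; [exact: l5|]]]]]].
Qed.

Lemma rate_u_consistent s t : 0 <= s -> s <= t -> t <= T ->
  nrm L (fun x => rho * (xi t x - xi s x) - (t - s) * lincomb rate_u t x)
    <= (t - s) * ((\sum_(p <- rate_u) `|p.1|) * S s t).
Proof.
apply: (rate_consistent L0 T0 G_mono rho_gt0 xi_t).
- have := ae_conj pde xi_tL; apply: ae_mono => r [h1 h2] rT; split; first exact: h2.
  have lin (d a p q z : R) : rho * d - alpha * a - lambda * (p - q) + mu * z = 0 ->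
      rho * d = alpha * a + (lambda * p + (- lambda * q + (- mu * z + 0))) by lra.
  by apply: ae_mono (h1 rT) => x h xL; have [e _ _ _] := h xL; exact: lin e.
- by apply: (osc_C0 T0 G_mono ler01 _ (m1 (ev_mV eu))) => r rT; have [_ _ _ h _] := evL eu rT.
- exact: rate_u_L2.
- split; [exact: (m1 (ev_mDDU eu))|split; [exact: (m1 (ev_mU ephi))|]].
  by split; [exact: (m1 (ev_mU eu))|split; [exact: (m1 (ev_mV eu))|]].
Qed.

(** The derivative of phi_x + psi is split, each summand having its own modulus. *)
Lemma rate_phi_consistent s t : 0 <= s -> s <= t -> t <= T ->
  nrm L (fun x => rho1 * (Phi t x - Phi s x) - (t - s) * lincomb rate_phi t x)
    <= (t - s) * ((\sum_(p <- rate_phi) `|p.1|) * S s t).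
Proof.
apply: (rate_consistent L0 T0 G_mono rho1_gt0 Phi_t).
- have := ae_conj pde Phi_tL; apply: ae_mono => r [h1 h2] rT; split; first exact: h2.
  have lin (d a q p v z y a' : R) : rho1 * d - K * a + lambda * (p - v) + gamma * z + beta * y = 0 ->
      a = a' + q ->
      rho1 * d = K * a' + (K * q + (- lambda * p + (lambda * v + (- gamma * z + (- beta * y + 0))))).
    by move=> e ea; rewrite ea in e; lra.
  have [_ hD] := ev_H2 ephi (inT rT); have [hp _] := el_H2 epsi (inT rT).
  have [_ d] := H1_add L0 hD hp.
  apply: ae_mono (ae_conj (h1 rT) d) => x [h h'] xL; have [_ e _ _] := h xL; exact: lin e (h' xL).
- by apply: (osc_C0 T0 G_mono ler01 _ (m1 (ev_mV ephi))) => r rT; have [_ _ _ h _] := evL ephi rT.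
- exact: rate_phi_L2.
- split; [exact: (m1 (ev_mDDU ephi))|split; [exact: (m1 (el_mD epsi))|]].
  split; [exact: (m1 (ev_mU ephi))|split; [exact: (m1 (ev_mU eu))|]].
  by split; [exact: (m1 (ev_mV ephi))|split; [exact: (m1 (ev_mDV ew))|]].
Qed.

(** The equation holds for almost every t, and both sides are continuous in t. *)
Lemma weak_psi t chi : 0 <= t <= T -> H10 L chi ->
  b * ip L (Dx L (psi t)) (Dx L chi) + K * ip L (fun x => Dx L (phi t) x + psi t x) chi = 0.
Proof.
move=> tT hchi; have [h1 _ _] := hchi; have lchi := H1_L2 h1.
pose s := [:: (- b, fun t => Dx L (Dx L (psi t))); (K, fun t => Dx L (phi t)); (K, psi)].
have ls r : 0 <= r <= T -> all_L2 L s r.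
  move=> rT; have [_ l2 _ _ _] := evL ephi rT; have [q1 q2 q3] := elL rT.
  by split; [exact: q3|split; [exact: l2|split; [exact: q1|]]].
have os : all_osc L T G s.
  split; [exact: (m1 (el_mDD epsi))|split; [exact: (m1 (ev_mDU ephi))|]].
  by split; [exact: (m1 (el_m epsi))|].
have c : {within `[0, T], continuous (fun r => ip L (lincomb s r) chi)}.
  apply: (C0_ip_continuous _ lchi); apply: (osc_C0 T0 G_mono _ _ (osc_lincomb L0 ls os)).
    by apply: sumr_ge0.
  by move=> r /ls; exact: lincomb_L2.
have z : aeT' (fun r => ip L (lincomb s r) chi = 0).
  apply: ae_mono pde => r h rT; rewrite -[RHS](mul0r (ip L (fun=> 0) chi)) -(ipZl 0 (L2_cst L 0) lchi).
  apply: (eq_ae_ipl (lincomb_L2 (ls r (inT rT))) (L2_scale 0 (L2_cst L 0)) lchi).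
  have lin (a p q : R) : - (b * a) + K * (p + q) = 0 -> - b * a + (K * p + (K * q + 0)) = 0 * 0 by lra.
  by apply: ae_mono (h rT) => x h' xL; have [_ _ e _] := h' xL; exact: lin e.
have := ae_eq_everywhere T0 c z (itvP0 tT).
rewrite (ip_lincomb (ls t tT) lchi) !big_cons big_nil /=.
have [_ hD] := el_H2 epsi tT; rewrite (H1_ibp L0 hD hchi).
have [_ l2 _ _ _] := evL ephi tT; have [q1 q2 q3] := elL tT.
rewrite (ipDl l2 q1 lchi); move: (ip L _ _) (ip L _ _) (ip L _ _) => x y z'; lra.
Qed.

Definition rate_w := [:: (- beta, fun t => Dx L (Phi t))].
Definition flux_w := [:: (- delta, fun t => Dx L (w t)); (- kappa, fun t => Dx L (theta t))].

(** The term w_xxt exists for almost every t only. Moved to the test function by an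
    integration by parts it becomes continuous in t. *)
Lemma weak_w_consistent s t chi : 0 <= s -> s <= t -> t <= T -> H10 L chi ->
  `|rho3 * ip L (fun x => theta t x - theta s x) chi
    - (t - s) * (ip L (lincomb rate_w t) chi + ip L (lincomb flux_w t) (Dx L chi))|
  <= (t - s) * (S s t * ((\sum_(p <- rate_w) `|p.1|) * nrm L chi
       + (\sum_(p <- flux_w) `|p.1|) * nrm L (Dx L chi))).
Proof.
move=> s0 st tT hchi; have [h1 _ _] := hchi; have lchi := H1_L2 h1; have ldchi := Dx_L2 h1.
have l4 r : 0 <= r <= T -> all_L2 L rate_w r.
  by move=> rT; have [_ _ _ _ h] := evL ephi rT; split; [exact: h|].
have f4 r : 0 <= r <= T -> all_L2 L flux_w r.
  by move=> rT; have [_ h _ _ h'] := evL ew rT; split; [exact: h|split; [exact: h'|]].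
apply: (weak_rate_consistent L0 T0 G_mono rho3_gt0 theta_t lchi ldchi _ _ l4 _ f4 _ s0 st tT).
- have := ae_conj pde (ae_conj theta_tL theta_H2); apply: ae_mono => r [h [h2 h3]] rT.
  have lD := h2 rT; have [hth hDth] := h3 rT; have rT' := inT rT.
  split; first exact: lD.
  have [_ lw lDw _ _] := evL ew rT'; have [_ hDw] := ev_H2 ew rT'.
  have [_ _ _ _ lDP] := evL ephi rT'.
  pose sD := [:: (rho3, fun _ : R => Dt L T theta r); (- delta, fun _ : R => Dx L (Dx L (w r)));
     (beta, fun _ : R => Dx L (Phi r)); (- kappa, fun _ : R => Dx L (Dx L (theta r)))].
  have lsD : all_L2 L sD r.
    by split; [exact: lD|split; [exact: lDw|split; [exact: lDP|split; [exact: (Dx_L2 hDth)|]]]].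
  have : ip L (lincomb sD r) chi = 0.
    rewrite -[RHS](mul0r (ip L (fun=> 0) chi)) -(ipZl 0 (L2_cst L 0) lchi).
    apply: (eq_ae_ipl (lincomb_L2 lsD) (L2_scale 0 (L2_cst L 0)) lchi).
    have lin (d a p q : R) : rho3 * d - delta * a + beta * p - kappa * q = 0 ->
       rho3 * d + (- delta * a + (beta * p + (- kappa * q + 0))) = 0 * 0 by lra.
    by apply: ae_mono (h rT) => x h' xL; have [_ _ _ e] := h' xL; exact: lin e.
  rewrite (ip_lincomb lsD lchi) (ip_lincomb (l4 r rT') lchi) (ip_lincomb (f4 r rT') ldchi).
  rewrite !big_cons !big_nil /=.
  have lin (d p y y' z z' : R) : y = - y' -> z = - z' ->
      rho3 * d + (- delta * y + (beta * p + (- kappa * z + 0))) = 0 ->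
      rho3 * d = - beta * p + 0 + (- delta * y' + (- kappa * z' + 0)).
    by move=> ey ez; rewrite ey ez; lra.
  exact: (lin _ _ _ _ _ _ (H1_ibp L0 hDw hchi) (H1_ibp L0 hDth hchi)).
- by apply: (osc_C0 T0 G_mono ler01 _ (m1 (ev_mV ew))) => r rT; have [_ _ _ h _] := evL ew rT.
- by split; [exact: (m1 (ev_mDV ephi))|].
- by split; [exact: (m1 (ev_mDU ew))|split; [exact: (m1 (ev_mDV ew))|]].
Qed.

End exact_solution.

(** * Residuals of the Galerkin equations *)

Section residual_arithmetic.
Context {R : realFieldType}.
Implicit Types rho dt : R.

Lemma divided_le rho dt b z q : 0 < dt -> `|rho * b - dt * z| <= dt * q -> `|rho / dt * b - z| <= q.
Proof.
move=> dt0; rewrite (_ : rho * b - dt * z = dt * (rho / dt * b - z)); last by field; rewrite gt_eqF.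
by rewrite normrM gtr0_norm// ler_pM2l.
Qed.

Lemma scaled_le (c x y q : R) : 0 <= c -> `|x - y| <= q ->
  [/\ c * x - c * y <= c * q & c * y - c * x <= c * q].
Proof.
move=> c0; rewrite ler_norml => /andP[h1 h2]; split; rewrite -mulrBr ler_wpM2l//; lra.
Qed.

(** Arithmetic of the consistency argument: A, U, F and X are pairings of the discrete
    solution, a, pf, pu and px those of the projections, and b, dd and the letters
    with 0 those of the exact solution. *)
Lemma residual_u rho dt (alpha lambda mu A a b U dd F pf pu f0 u0 X px x0 q1 q2 q3 q4 q5 : R) :
  0 < dt -> 0 < rho -> 0 < lambda -> 0 < mu ->
  rho / dt * A + alpha * U - lambda * F + mu * X = 0 ->
  `|rho * b - dt * (alpha * dd + (lambda * f0 + (- lambda * u0 + (- mu * x0 + 0))))| <= dt * q1 ->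
  `|a - b| <= q2 -> `|pf - f0| <= q3 -> `|pu - u0| <= q4 -> `|px - x0| <= q5 ->
  rho / dt * (A - a) + alpha * (U + dd) - lambda * (F - (pf - pu)) + mu * (X - px)
    <= q1 + rho / dt * q2 + lambda * q3 + lambda * q4 + mu * q5.
Proof.
move=> dt0 rho0 /ltW la0 /ltW mu0 H /(divided_le dt0) h1.
have r0 : 0 <= rho / dt by rewrite divr_ge0// ltW.
move=> /(scaled_le r0) [a1 a2] /(scaled_le la0) [f1 f2] /(scaled_le la0) [u1 u2] /(scaled_le mu0) [x1 x2].
move: h1; rewrite ler_norml => /andP[h1 h2].
rewrite mulrBr; lra.
Qed.

Lemma residual_phi rho dt (K lambda gamma beta A a b U dd pp p0 F pf pu f0 u0 X px x0 Th pth th0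
    q1 q2 q3 q4 q5 q6 q7 : R) :
  0 < dt -> 0 < rho -> 0 < lambda -> 0 < gamma -> 0 < K ->
  rho / dt * A + K * U + lambda * F + gamma * X + beta * Th = 0 ->
  `|rho * b - dt * (K * dd + (K * p0 + (- lambda * f0 + (lambda * u0 + (- gamma * x0
     + (- beta * th0 + 0))))))| <= dt * q1 ->
  `|a - b| <= q2 -> `|pf - f0| <= q3 -> `|pu - u0| <= q4 -> `|px - x0| <= q5 ->
  `|pp - p0| <= q6 -> `|pth - th0| <= q7 ->
  rho / dt * (A - a) + K * (U + dd + pp) + lambda * (F - (pf - pu)) + gamma * (X - px)
    + beta * (Th - pth)
    <= q1 + rho / dt * q2 + lambda * q3 + lambda * q4 + gamma * q5 + K * q6 + `|beta| * q7.
Proof.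
move=> dt0 rho0 /ltW la0 /ltW mu0 /ltW K0 H /(divided_le dt0) h1.
have r0 : 0 <= rho / dt by rewrite divr_ge0// ltW.
move=> /(scaled_le r0) [a1 a2] /(scaled_le la0) [f1 f2] /(scaled_le la0) [u1 u2] /(scaled_le mu0) [x1 x2].
move=> /(scaled_le K0) [p1 p2] t1.
have {}t1 : beta * th0 - beta * pth <= `|beta| * q7.
  rewrite -mulrBr (le_trans (ler_norm _))// normrM distrC ler_wpM2l//.
move: h1; rewrite ler_norml => /andP[h1 h2].
rewrite mulrBr; lra.
Qed.

Lemma residual_psi (b K p1 p1' p2 p3 fq f q y yf yq f' q' zz z z1 z2 f0 q0 e : R) :
  p1 = p2 - p1' -> p1' = p3 -> fq = f + q -> y = yf + yq -> yf = f - f' -> yq = q - q' ->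
  zz = K * z -> z = z1 + z2 -> z1 = f0 - f' -> z2 = q0 - q' -> e = f0 + q0 ->
  b * p3 + K * e = 0 -> b * p2 + K * fq = 0 -> b * p1 + K * y = zz.
Proof. by move=> -> -> -> -> -> -> -> -> -> -> -> h1 h2; lra. Qed.

Lemma residual_w rho dt (delta kappa beta A a b W w0 Th th0 P pP p0 q1 q2 q3 : R) :
  0 < dt -> 0 < rho ->
  rho / dt * A + delta * W + beta * P + kappa * Th = 0 ->
  `|rho * b - dt * (- beta * p0 + 0 + (- delta * w0 + (- kappa * th0 + 0)))| <= dt * q1 ->
  `|a - b| <= q2 -> `|pP - p0| <= q3 ->
  rho / dt * (A - a) + delta * (W - w0) + beta * (P - pP) + kappa * (Th - th0)
    <= q1 + rho / dt * q2 + `|beta| * q3.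
Proof.
move=> dt0 rho0 H /(divided_le dt0) h1.
have r0 : 0 <= rho / dt by rewrite divr_ge0// ltW.
move=> /(scaled_le r0) [a1 a2] t1.
have {}t1 : beta * p0 - beta * pP <= `|beta| * q3.
  rewrite -mulrBr (le_trans (ler_norm _))// normrM distrC ler_wpM2l//.
move: h1; rewrite ler_norml => /andP[h1 h2].
rewrite mulrBr; lra.
Qed.

Lemma residual_w_le (S a4 a5 r h L c d n n' : R) : 0 <= a4 -> 0 <= S -> 0 <= r -> 0 <= h -> n <= L * n' ->
  S * (a4 * n + a5 * n') + r * (h * S * n) + c * (d * n')
    <= (S * (a4 * L + a5) + r * (h * S * L) + c * d) * n'.
Proof.
move=> a40 S0 r0 h0; rewrite -subr_ge0 => p.
have := mulr_ge0 (mulr_ge0 a40 S0) p; have := mulr_ge0 (mulr_ge0 (mulr_ge0 r0 h0) S0) p; lra.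
Qed.

End residual_arithmetic.

Section galerkin.
Context {R : realType}.
Variables (L T : R) (M : nat).
Hypotheses (L0 : 0 < L) (M0 : (0 < M)%N).
Local Notation h := (L / M%:R).
Local Notation P := (ritz L M).

Let h0 : 0 <= h. Proof. by rewrite divr_ge0 ?ler0n// ltW. Qed.

Lemma Sh_regular (v : R -> R) : inSh L M v -> [/\ inL2 L v, inH1 L v, inL2 L (Dx L v) & H10 L v].
Proof.
move=> [hv _]; have hv' := inH10_H10 L0 hv; have [h1 _ _] := hv'.
by split; [exact: (H1_L2 h1)|exact: h1|exact: (Dx_L2 h1)|exact: hv'].
Qed.

Lemma ritz_ip (f chi : R -> R) : H10 L f -> inL2 L chi ->
  `|ip L (P f) chi - ip L f chi| <= h * nrm L (Dx L f) * nrm L chi.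
Proof.
move=> hf lchi; have [h1 _ _] := hf; have lf := H1_L2 h1.
have [lr _ _ _] := Sh_regular (ritz_Sh L0 M0 hf).
rewrite distrC -(ipBl lf lr lchi); apply: (le_trans (cauchy_schwarz (L2_sub lf lr) lchi)).
by rewrite ler_wpM2r ?nrm_ge0//; exact: (ritz_err L0 M0 hf).
Qed.

(** The error of the projection of an increment is h times the increment of the
    derivative, hence small both in h and in the time step. *)
Lemma ritz_ip_sub (f g chi : R -> R) : H10 L f -> H10 L g -> inL2 L chi ->
  `|ip L (fun x => P f x - P g x) chi - ip L (fun x => f x - g x) chi|
    <= h * nrm L (fun x => Dx L f x - Dx L g x) * nrm L chi.
Proof.
move=> hf hg lchi; have hfg := H10_sub L0 hf hg.
have [h1f _ _] := hf; have [h1g _ _] := hg; have [h1 d] := H1_sub L0 h1f h1g.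
rewrite -(nrm_ae (Dx_L2 h1) (L2_sub (Dx_L2 h1f) (Dx_L2 h1g)) d).
have := ritz_ip hfg lchi; congr (`|_ - _| <= _).
have [lr _ _ _] := Sh_regular (ritz_Sh L0 M0 hfg).
have [lrf _ _ _] := Sh_regular (ritz_Sh L0 M0 hf).
have [lrg _ _ _] := Sh_regular (ritz_Sh L0 M0 hg).
apply: (eq_ae_ipl lr (L2_sub lrf lrg) lchi); apply: eq_ae_on => x xL.
by apply: (ritz_sub L0 M0 hf hg); exact: subset_itv_oo_cc.
Qed.

Lemma ip_Dx_sub (v f eta : R -> R) : inSh L M v -> H10 L f -> inL2 L eta ->
  ip L (Dx L (fun x => v x - P f x)) eta = ip L (Dx L v) eta - ip L (Dx L (P f)) eta.
Proof.
move=> sv hf leta; have [_ h1 l1 _] := Sh_regular sv.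
have [_ h2 l2 _] := Sh_regular (ritz_Sh L0 M0 hf); have [h3 d] := H1_sub L0 h1 h2.
by rewrite -(ipBl l1 l2 leta); exact: (eq_ae_ipl (Dx_L2 h3) (L2_sub l1 l2) leta d).
Qed.

Lemma ip_diff4 (p q r z chi : R -> R) : inL2 L p -> inL2 L q -> inL2 L r -> inL2 L z -> inL2 L chi ->
  ip L (fun x => p x - q x - (r x - z x)) chi =
  ip L (fun x => p x - r x) chi - ip L (fun x => q x - z x) chi.
Proof.
move=> lp lq lr lz lchi; rewrite -(ipBl (L2_sub lp lr) (L2_sub lq lz) lchi).
have lin (a b c d : R) : a - b - (c - d) = a - c - (b - d) by ring.
by congr ip; apply/funext => x; exact: lin.
Qed.

Section steps.
Variables (G : R -> R) (B : R) (u phi psi w xi Phi theta : R -> R -> R).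
Hypotheses (eu : evolution L T G B u xi) (ephi : evolution L T G B phi Phi)
  (ew : evolution L T G B w theta) (epsi : elliptic L T G B psi).
Variables (rho alpha lambda mu rho1 K gamma b rho3 delta kappa beta : R).
Hypotheses (rho_gt0 : 0 < rho) (lambda_gt0 : 0 < lambda) (mu_gt0 : 0 < mu) (rho1_gt0 : 0 < rho1)
  (K_gt0 : 0 < K) (gamma_gt0 : 0 < gamma) (rho3_gt0 : 0 < rho3).
Variables (s t : R).
Hypotheses (s0 : 0 <= s) (st : s < t) (tT : t <= T).
Local Notation S := (Num.sqrt ((t - s) * (G t - G s))).
Local Notation dt := (t - s).

Let dt0 : 0 < dt. Proof. by rewrite subr_gt0. Qed.
Let sT : 0 <= s <= T. Proof. by rewrite s0 (le_trans (ltW st) tT). Qed.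
Let t0T : 0 <= t <= T. Proof. by rewrite tT (le_trans s0 (ltW st)). Qed.

Let vel_diff U V chi : evolution L T G B U V -> inL2 L chi ->
  `|ip L (fun x => P (V t) x - P (V s) x) chi - ip L (fun x => V t x - V s x) chi|
    <= h * S * nrm L chi.
Proof.
move=> e lchi; apply: (le_trans (ritz_ip_sub (ev_V e t0T) (ev_V e sT) lchi)).
rewrite ler_wpM2r ?nrm_ge0// ler_wpM2l//.
exact: (modulus_le (ev_mDV e) s0 (lexx s) (ltW st) tT).
Qed.

Let vel_err U V chi : evolution L T G B U V -> inL2 L chi ->
  `|ip L (P (V t)) chi - ip L (V t) chi| <= h * B * nrm L chi.
Proof.
move=> e lchi; apply: (le_trans (ritz_ip (ev_V e t0T) lchi)).
by rewrite ler_wpM2r ?nrm_ge0// ler_wpM2l//; exact: (ev_bDV e t0T).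
Qed.

Let dis_err U V chi : evolution L T G B U V -> inL2 L chi ->
  `|ip L (P (U t)) chi - ip L (U t) chi| <= h * B * nrm L chi.
Proof.
move=> e lchi; apply: (le_trans (ritz_ip (ev_H10 e t0T) lchi)).
by rewrite ler_wpM2r ?nrm_ge0// ler_wpM2l//; exact: (ev_bDU e t0T).
Qed.

Let exact_L2 U V : evolution L T G B U V -> [/\ inL2 L (U t), inL2 L (V t), inL2 L (V s) &
  [/\ inL2 L (P (U t)), inL2 L (P (V t)) & inL2 L (P (V s))]].
Proof.
move=> e; have [h1 _ _] := ev_H10 e t0T; have [h2 _ _] := ev_V e t0T; have [h3 _ _] := ev_V e sT.
have [p1 _ _ _] := Sh_regular (ritz_Sh L0 M0 (ev_H10 e t0T)).
have [p2 _ _ _] := Sh_regular (ritz_Sh L0 M0 (ev_V e t0T)).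
have [p3 _ _ _] := Sh_regular (ritz_Sh L0 M0 (ev_V e sT)).
split; [exact: (H1_L2 h1)|exact: (H1_L2 h2)|exact: (H1_L2 h3)|].
by split; [exact: p1|exact: p2|exact: p3].
Qed.

(** Orthogonality of the Ritz projection followed by an integration by parts: the stiffness
    terms leave no residual. *)
Lemma ip_Dx_ritz (f chi : R -> R) : H10 L f -> inH1 L (Dx L f) -> inSh L M chi ->
  ip L (Dx L (P f)) (Dx L chi) = - ip L (Dx L (Dx L f)) chi.
Proof.
move=> hf h2 schi; have [_ _ _ h10] := Sh_regular schi.
by rewrite (ritz_orth L0 M0 hf schi) (H1_ibp L0 h2 h10) opprK.
Qed.

(** The terms of the residual are the consistency error of the difference quotient, the
    projection error of the increment of the velocity, and the projection errors of
    the terms of order zero. *)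
Lemma galerkin_u a (x x' U F chi : R -> R) :
  inSh L M x -> inSh L M x' -> inSh L M U -> inSh L M F -> inSh L M chi ->
  nrm L (fun y => rho * (xi t y - xi s y) - dt * lincomb (rate_u L alpha lambda mu u phi xi) t y)
    <= dt * (a * S) ->
  rho / dt * ip L (fun y => x y - x' y) chi + alpha * ip L (Dx L U) (Dx L chi)
    - lambda * ip L (fun y => F y - U y) chi + mu * ip L x chi = 0 ->
  rho / dt * ip L (fun y => x y - P (xi t) y - (x' y - P (xi s) y)) chi
    + alpha * ip L (Dx L (fun y => U y - P (u t) y)) (Dx L chi)
    - lambda * ip L (fun y => F y - P (phi t) y - (U y - P (u t) y)) chi
    + mu * ip L (fun y => x y - P (xi t) y) chi
  <= (a * S + rho / dt * (h * S) + lambda * (h * B) + lambda * (h * B) + mu * (h * B)) * nrm L chi.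
Proof.
move=> sx sx' sU sF schi cons eq.
have [lchi _ ldchi h10] := Sh_regular schi.
have [lx _ _ _] := Sh_regular sx; have [lx' _ _ _] := Sh_regular sx'.
have [lU _ _ _] := Sh_regular sU; have [lF _ _ _] := Sh_regular sF.
have [lu lxt lxs [lPu lPxt lPxs]] := exact_L2 eu; have [lf _ _ [lPf _ _]] := exact_L2 ephi.
have [_ hDu] := ev_H2 eu t0T.
have ls : all_L2 L (rate_u L alpha lambda mu u phi xi) t.
  by split; [exact: (Dx_L2 hDu)|split; [exact: lf|split; [exact: lu|split; [exact: lxt|]]]].
have c : `|rho * ip L (fun y => xi t y - xi s y) chi - dt * (alpha * ip L (Dx L (Dx L (u t))) chi
    + (lambda * ip L (phi t) chi + (- lambda * ip L (u t) chi + (- mu * ip L (xi t) chi + 0))))|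
    <= dt * (a * S * nrm L chi).
  rewrite [X in _ <= X]mulrA; apply: le_trans (ler_wpM2r (nrm_ge0 L chi) cons).
  have lv := L2_sub lxt lxs; have ll := lincomb_L2 ls.
  apply: le_trans (cauchy_schwarz (L2_sub (L2_scale rho lv) (L2_scale dt ll)) lchi).
  rewrite (ipBl (L2_scale rho lv) (L2_scale dt ll) lchi) (ipZl rho lv lchi) (ipZl dt ll lchi).
  by rewrite (ip_lincomb ls lchi) !big_cons big_nil.
have e1 := ip_diff4 lx lPxt lx' lPxs lchi.
have e2 := ip_Dx_sub sU (ev_H10 eu t0T) ldchi.
have e2' := ip_Dx_ritz (ev_H10 eu t0T) hDu schi.
have e3 := ip_diff4 lF lPf lU lPu lchi; have e3' := ipBl lPf lPu lchi.
have e4 := ipBl lx lPxt lchi.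
have lin (r d d' f f' x1 x1' y y' y1 y1' z z' q : R) : x1 = x1' -> y = d - d' -> d' = - y' ->
    y1 = f - f' -> f' = y1' -> z = z' ->
    r * x1' + alpha * (d + y') - lambda * (f - y1') + mu * z' <= q ->
    r * x1 + alpha * y - lambda * y1 + mu * z <= q.
  by move=> -> -> -> -> -> ->; rewrite opprK.
apply: (lin _ _ _ _ _ _ _ _ _ _ _ _ _ _ e1 e2 e2' e3 e3' e4).
apply: (le_trans (residual_u dt0 rho_gt0 lambda_gt0 mu_gt0 eq c (vel_diff eu lchi)
  (dis_err ephi lchi) (dis_err eu lchi) (vel_err eu lchi))).
by move: (nrm L chi) S => n S'; rewrite le_eqVlt; apply/orP; left; apply/eqP; ring.
Qed.

Lemma galerkin_phi a (x x' U F Q Th chi : R -> R) :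
  inSh L M x -> inSh L M x' -> inSh L M U -> inSh L M F -> inSh L M Q -> inSh L M Th -> inSh L M chi ->
  nrm L (fun y => rho1 * (Phi t y - Phi s y)
      - dt * lincomb (rate_phi L lambda K gamma beta u phi psi Phi theta) t y) <= dt * (a * S) ->
  rho1 / dt * ip L (fun y => x y - x' y) chi + K * ip L (fun y => Dx L F y + Q y) (Dx L chi)
    + lambda * ip L (fun y => F y - U y) chi + gamma * ip L x chi + beta * ip L (Dx L Th) chi = 0 ->
  rho1 / dt * ip L (fun y => x y - P (Phi t) y - (x' y - P (Phi s) y)) chi
    + K * ip L (fun y => Dx L (fun z => F z - P (phi t) z) y + (Q y - P (psi t) y)) (Dx L chi)
    + lambda * ip L (fun y => F y - P (phi t) y - (U y - P (u t) y)) chi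
    + gamma * ip L (fun y => x y - P (Phi t) y) chi
    + beta * ip L (Dx L (fun y => Th y - P (theta t) y)) chi
  <= (a * S + rho1 / dt * (h * S) + lambda * (h * B) + lambda * (h * B) + gamma * (h * B)
      + K * (h * B) + `|beta| * (h * B)) * nrm L chi.
Proof.
move=> sx sx' sU sF sQ sTh schi cons eq.
have [lchi _ ldchi h10] := Sh_regular schi.
have [lx _ _ _] := Sh_regular sx; have [lx' _ _ _] := Sh_regular sx'.
have [lU _ _ _] := Sh_regular sU; have [lF hF ldF _] := Sh_regular sF.
have [lQ _ _ _] := Sh_regular sQ.
have [lu _ _ [lPu _ _]] := exact_L2 eu; have [lf lxt lxs [lPf lPxt lPxs]] := exact_L2 ephi.
have [_ lth _ _] := exact_L2 ew.
have [hth _ _] := ev_V ew t0T; have ldth := Dx_L2 hth.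
have [_ _ ldPth _] := Sh_regular (ritz_Sh L0 M0 (ev_V ew t0T)).
have [_ hDf] := ev_H2 ephi t0T; have [hp hDp] := el_H2 epsi t0T.
have hp10 := el_H10 epsi t0T.
have [lPp hPp ldPp _] := Sh_regular (ritz_Sh L0 M0 hp10); have ldp := Dx_L2 hp.
have ls : all_L2 L (rate_phi L lambda K gamma beta u phi psi Phi theta) t.
  split; [exact: (Dx_L2 hDf)|split; [exact: ldp|split; [exact: lf|]]].
  by split; [exact: lu|split; [exact: lxt|split; [exact: ldth|]]].
have c : `|rho1 * ip L (fun y => Phi t y - Phi s y) chi - dt * (K * ip L (Dx L (Dx L (phi t))) chi
    + (K * ip L (Dx L (psi t)) chi + (- lambda * ip L (phi t) chi + (lambda * ip L (u t) chi
    + (- gamma * ip L (Phi t) chi + (- beta * ip L (Dx L (theta t)) chi + 0))))))|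
    <= dt * (a * S * nrm L chi).
  rewrite [X in _ <= X]mulrA; apply: le_trans (ler_wpM2r (nrm_ge0 L chi) cons).
  have lv := L2_sub lxt lxs; have ll := lincomb_L2 ls.
  apply: le_trans (cauchy_schwarz (L2_sub (L2_scale rho1 lv) (L2_scale dt ll)) lchi).
  rewrite (ipBl (L2_scale rho1 lv) (L2_scale dt ll) lchi) (ipZl rho1 lv lchi) (ipZl dt ll lchi).
  by rewrite (ip_lincomb ls lchi) !big_cons big_nil.
have cpsi : `|ip L (Dx L (P (psi t))) chi - ip L (Dx L (psi t)) chi| <= h * B * nrm L chi.
  rewrite distrC -(ipBl ldp ldPp lchi); apply: (le_trans (cauchy_schwarz (L2_sub ldp ldPp) lchi)).
  rewrite ler_wpM2r ?nrm_ge0//; apply: (le_trans (ritz_err_H2 L0 M0 hp10 hDp)).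
  by rewrite ler_wpM2l//; exact: (el_bDD epsi t0T).
have cth : `|ip L (Dx L (P (theta t))) chi - ip L (Dx L (theta t)) chi| <= h * B * nrm L chi.
  rewrite distrC -(ipBl ldth ldPth lchi).
  apply: (le_trans (cauchy_schwarz (L2_sub ldth ldPth) lchi)).
  by rewrite ler_wpM2r ?nrm_ge0//; exact: (ev_ritz ew t0T M0).
have e1 := ip_diff4 lx lPxt lx' lPxs lchi.
have e2 := ipDl ldF lQ ldchi.
have [_ hD ldD _] := Sh_regular (Sh_sub L0 sF (ritz_Sh L0 M0 (ev_H10 ephi t0T))).
have e2a := ipDl ldD (L2_sub lQ lPp) ldchi.
have e2b := ip_Dx_sub sF (ev_H10 ephi t0T) ldchi.
have e2c := ip_Dx_ritz (ev_H10 ephi t0T) hDf schi.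
have e2d := ipBl lQ lPp ldchi.
have e2e := H1_ibp L0 hPp h10.
have e3 := ip_diff4 lF lPf lU lPu lchi; have e3' := ipBl lPf lPu lchi.
have e4 := ipBl lx lPxt lchi.
have e5 := ip_Dx_sub sTh (ev_V ew t0T) lchi.
have lin (r x1 x1' fq f q y yf yq f' f1 q' pq y1 y2 y2' z z' th th' o : R) :
    x1 = x1' -> fq = f + q -> y = yf + yq -> yf = f - f' -> f' = - f1 -> yq = q - q' -> pq = - q' ->
    y1 = y2 - y2' -> y2' = z -> z' = th -> th' = o ->
    forall bd, r * x1' + K * (fq + f1 + pq) + lambda * (y2 - z) + gamma * th + beta * o <= bd ->
    r * x1 + K * y + lambda * y1 + gamma * z' + beta * th' <= bd.
  move=> -> -> -> -> -> -> -> -> -> -> -> bd; apply: le_trans.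
  by rewrite le_eqVlt; apply/orP; left; apply/eqP; ring.
apply: (lin _ _ _ _ _ _ _ _ _ _ _ _ _ _ _ _ _ _ _ _ _ e1 e2 e2a e2b e2c e2d e2e e3 e3' e4 e5).
apply: (le_trans (residual_phi dt0 rho1_gt0 lambda_gt0 gamma_gt0 K_gt0 eq c (vel_diff ephi lchi)
  (dis_err ephi lchi) (dis_err eu lchi) (vel_err ephi lchi) cpsi cth)).
by move: (nrm L chi) S => n S'; rewrite le_eqVlt; apply/orP; left; apply/eqP; ring.
Qed.

(** The residual of the equation for psi as an element of L^2, so that its increments
    in time make sense. *)
Definition elliptic_defect (r y : R) : R :=
  K * (Dx L (phi r) y - Dx L (P (phi r)) y + (psi r y - P (psi r) y)).

Lemma galerkin_psi (F Q chi : R -> R) : inSh L M F -> inSh L M Q -> inSh L M chi ->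
  b * ip L (Dx L (psi t)) (Dx L chi) + K * ip L (fun y => Dx L (phi t) y + psi t y) chi = 0 ->
  b * ip L (Dx L Q) (Dx L chi) + K * ip L (fun y => Dx L F y + Q y) chi = 0 ->
  b * ip L (Dx L (fun y => Q y - P (psi t) y)) (Dx L chi)
    + K * ip L (fun y => Dx L (fun z => F z - P (phi t) z) y + (Q y - P (psi t) y)) chi
  = ip L (elliptic_defect t) chi.
Proof.
move=> sF sQ schi exact_eq eq.
have [lchi _ ldchi h10] := Sh_regular schi.
have [lF hF ldF _] := Sh_regular sF; have [lQ _ _ _] := Sh_regular sQ.
have [hp hDp] := el_H2 epsi t0T; have hp10 := el_H10 epsi t0T.
have hf10 := ev_H10 ephi t0T; have [hf _] := ev_H2 ephi t0T.
have [_ _ ldPf _] := Sh_regular (ritz_Sh L0 M0 hf10); have ldf := Dx_L2 hf.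
have [lPp _ ldPp _] := Sh_regular (ritz_Sh L0 M0 hp10); have lp := H1_L2 hp.
have [_ _ ldD _] := Sh_regular (Sh_sub L0 sF (ritz_Sh L0 M0 hf10)).
have e1 := ip_Dx_sub sQ hp10 ldchi; have e1' := ritz_orth L0 M0 hp10 schi.
have e2 := ipDl ldF lQ lchi.
have e2a := ipDl ldD (L2_sub lQ lPp) lchi.
have e2b := ip_Dx_sub sF hf10 lchi.
have e2d := ipBl lQ lPp lchi.
have e3 := ipZl K (L2_add (L2_sub ldf ldPf) (L2_sub lp lPp)) lchi.
have e3a := ipDl (L2_sub ldf ldPf) (L2_sub lp lPp) lchi.
have e3b := ipBl ldf ldPf lchi; have e3c := ipBl lp lPp lchi.
have e4 := ipDl ldf lp lchi.
exact: (residual_psi e1 e1' e2 e2a e2b e2d e3 e3a e3b e3c e4 exact_eq eq).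
Qed.

(** The residual is bounded by the norm of the derivative of chi, which the damping kappa
    controls; the terms of order zero are brought to that norm by Poincare's
    inequality. *)
Lemma galerkin_w a4 a5 (x x' W p chi : R -> R) : 0 <= a4 ->
  inSh L M x -> inSh L M x' -> inSh L M W -> inSh L M p -> inSh L M chi ->
  `|rho3 * ip L (fun y => theta t y - theta s y) chi
    - dt * (ip L (lincomb (rate_w L beta Phi) t) chi + ip L (lincomb (flux_w L delta kappa w theta) t) (Dx L chi))|
  <= dt * (S * (a4 * nrm L chi + a5 * nrm L (Dx L chi))) ->
  rho3 / dt * ip L (fun y => x y - x' y) chi + delta * ip L (Dx L W) (Dx L chi)
    + beta * ip L (Dx L p) chi + kappa * ip L (Dx L x) (Dx L chi) = 0 ->
  rho3 / dt * ip L (fun y => x y - P (theta t) y - (x' y - P (theta s) y)) chi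
    + delta * ip L (Dx L (fun y => W y - P (w t) y)) (Dx L chi)
    + beta * ip L (Dx L (fun y => p y - P (Phi t) y)) chi
    + kappa * ip L (Dx L (fun y => x y - P (theta t) y)) (Dx L chi)
  <= (S * (a4 * L + a5) + rho3 / dt * (h * S * L) + `|beta| * (h * B)) * nrm L (Dx L chi).
Proof.
move=> a40 sx sx' sW sp schi cons eq.
have [lchi _ ldchi h10] := Sh_regular schi.
have [lx _ _ _] := Sh_regular sx; have [lx' _ _ _] := Sh_regular sx'.
have [lw lth lths [lPw lPth lPths]] := exact_L2 ew.
have hw10 := ev_H10 ew t0T; have hth10 := ev_V ew t0T; have hP10 := ev_V ephi t0T.
have [hw _ _] := hw10; have [hth _ _] := hth10; have [hP _ _] := hP10.
have l4 : all_L2 L (rate_w L beta Phi) t by split; [exact: (Dx_L2 hP)|].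
have f4 : all_L2 L (flux_w L delta kappa w theta) t.
  by split; [exact: (Dx_L2 hw)|split; [exact: (Dx_L2 hth)|]].
have c : `|rho3 * ip L (fun y => theta t y - theta s y) chi
    - dt * (- beta * ip L (Dx L (Phi t)) chi + 0 + (- delta * ip L (Dx L (w t)) (Dx L chi)
     + (- kappa * ip L (Dx L (theta t)) (Dx L chi) + 0)))|
    <= dt * (S * (a4 * nrm L chi + a5 * nrm L (Dx L chi))).
  by move: cons; rewrite (ip_lincomb l4 lchi) (ip_lincomb f4 ldchi) !big_cons !big_nil.
have [_ hPP _ _] := Sh_regular (ritz_Sh L0 M0 hP10).
have cP : `|ip L (Dx L (P (Phi t))) chi - ip L (Dx L (Phi t)) chi| <= h * B * nrm L (Dx L chi).
  have neg (y y' z z' : R) : y = - z -> y' = - z' -> `|z - z'| <= h * B * nrm L (Dx L chi) ->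
      `|y - y'| <= h * B * nrm L (Dx L chi).
    by move=> -> ->; rewrite -opprD normrN.
  exact: (neg _ _ _ _ (H1_ibp L0 hPP h10) (H1_ibp L0 hP h10) (vel_err ephi ldchi)).
have e1 := ip_diff4 lx lPth lx' lPths lchi.
have e2 := ip_Dx_sub sW hw10 ldchi; have e2' := ritz_orth L0 M0 hw10 schi.
have e3 := ip_Dx_sub sp hP10 lchi.
have e4 := ip_Dx_sub sx hth10 ldchi; have e4' := ritz_orth L0 M0 hth10 schi.
have lin (r x1 x1' y y1 y' y2 z z1 v v1 v' v2 bd : R) : x1 = x1' -> y = y1 - y' -> y' = y2 ->
    z = z1 -> v = v1 - v' -> v' = v2 ->
    r * x1' + delta * (y1 - y2) + beta * z1 + kappa * (v1 - v2) <= bd ->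
    r * x1 + delta * y + beta * z + kappa * v <= bd.
  by move=> -> -> -> -> -> ->.
apply: (lin _ _ _ _ _ _ _ _ _ _ _ _ _ _ e1 e2 e2' e3 e4 e4').
apply: (le_trans (residual_w dt0 rho3_gt0 eq c (vel_diff ew lchi) cP)).
apply: residual_w_le; [exact: a40|exact: sqrtr_ge0|exact: (divr_ge0 (ltW rho3_gt0) (ltW dt0))|exact: h0|].
exact: (poincare L0 h10).
Qed.

Lemma nrm_Dx_ritz_le (f : R -> R) : H10 L f -> nrm L (Dx L (P f)) <= nrm L (Dx L f).
Proof.
move=> hf; have [h1 _ _] := hf; have ld := Dx_L2 h1.
have sP := ritz_Sh L0 M0 hf; have [_ _ lP _] := Sh_regular sP.
have : nrm L (Dx L (P f)) ^+ 2 <= nrm L (Dx L f) * nrm L (Dx L (P f)).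
  rewrite sqr_nrm (ritz_orth L0 M0 hf sP); apply: (le_trans (ler_norm _)).
  exact: cauchy_schwarz.
have := nrm_ge0 L (Dx L (P f)); rewrite le_eqVlt => /predU1P[<- _|p0]; first exact: nrm_ge0.
by rewrite expr2 ler_pM2r.
Qed.

(** The scheme satisfies u_h^n - u_h^(n-1) = dt xi_h^n exactly, so the defect is the
    projection of that of the exact solution. The bound on the values follows from
    the one on the derivatives by Poincare's inequality. *)
Lemma step_defect U V (x x' v : R -> R) : evolution L T G B U V ->
  inSh L M x -> inSh L M x' -> inSh L M v ->
  {in `[0, L], forall y, x y = x' y + dt * v y} ->
  nrm L (fun y => Dx L (fun z => x z - P (U t) z) y - Dx L (fun z => x' z - P (U s) z) y
           - dt * Dx L (fun z => v z - P (V t) z) y) <= dt * S /\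
  nrm L (fun y => x y - P (U t) y - (x' y - P (U s) y) - dt * (v y - P (V t) y)) <= L * (dt * S).
Proof.
move=> e sx sx' sv xE.
have hUt := ev_H10 e t0T; have hUs := ev_H10 e sT; have hV := ev_V e t0T.
have hD := H10_sub L0 hUt hUs; have hdV := H10_scale L0 dt hV.
have hf := H10_sub L0 hD hdV.
set f := (fun y => _) in hf.
have [h1t _ _] := hUt; have [h1s _ _] := hUs; have [h1V _ _] := hV.
have [h1D d1] := H1_sub L0 h1t h1s; have [h1dV d2] := H1_scale L0 dt h1V.
have [h1f d3] := H1_sub L0 h1D h1dV.
have lt := Dx_L2 h1t; have ls := Dx_L2 h1s; have lV := Dx_L2 h1V.
have Df : nrm L (Dx L f) <= dt * S.
  rewrite (nrm_ae (Dx_L2 h1f) (L2_sub (L2_sub lt ls) (L2_scale dt lV))).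
    exact: (ev_slope e s0 (ltW st) tT).
  have lin (p q r a a' : R) : p = q - r -> q = a -> r = a' -> p = a - a' by move=> -> -> ->.
  by apply: ae_mono (ae_conj d1 (ae_conj d2 d3)) => y [k1 [k2 k3]] yL; exact: (lin _ _ _ _ _ (k3 yL) (k1 yL) (k2 yL)).
have s1 := Sh_sub L0 sx (ritz_Sh L0 M0 hUt); have s2 := Sh_sub L0 sx' (ritz_Sh L0 M0 hUs).
have s3 := Sh_sub L0 sv (ritz_Sh L0 M0 hV).
have s4 := Sh_sub L0 (Sh_sub L0 s1 s2) (Sh_scale L0 dt s3).
set g := (X in inSh L M X) in s4.
have gE : {in `[0, L], g =1 fun y => -1 * P f y}.
  move=> y yL; have k1 := ritz_sub L0 M0 hD hdV yL; have k2 := ritz_sub L0 M0 hUt hUs yL.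
  have k3 := ritz_scale L0 M0 dt hV yL.
  have lin (p q r a a' b' c c' c'' : R) : p = q - r -> q = a - a' -> r = dt * b' -> c = c' + dt * c'' ->
    c - a - (c' - a') - dt * (c'' - b') = -1 * p by move=> -> -> -> ->; ring.
  exact: (lin _ _ _ _ _ _ _ _ _ k1 k2 k3 (xE y yL)).
have [lg hg ldg h10g] := Sh_regular s4.
have [lP hP ldP _] := Sh_regular (ritz_Sh L0 M0 hf).
have [hmP dmP] := H1_scale L0 (-1) hP.
have gE' : eq_ae L g (fun y => -1 * P f y).
  by apply: eq_ae_on => y yL; apply: gE; exact: subset_itv_oo_cc.
have Dg : nrm L (Dx L g) <= dt * S.
  rewrite (nrm_ae ldg (L2_scale (-1) ldP)); last first.
    exact: (eq_ae_trans (eq_ae_Dx lg (H1_L2 hmP) gE') dmP).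
  rewrite (nrmZ _ ldP) normrN1 mul1r; exact: (le_trans (nrm_Dx_ritz_le hf) Df).
split; last first.
  by apply: (le_trans (poincare L0 h10g)); rewrite ler_pM2l.
have [_ H1 l1 _] := Sh_regular s1; have [_ H2 l2 _] := Sh_regular s2; have [_ H3 l3 _] := Sh_regular s3.
have [H4 d4] := H1_sub L0 H1 H2; have [H5 d5] := H1_scale L0 dt H3; have [H6 d6] := H1_sub L0 H4 H5.
rewrite (nrm_ae (L2_sub (L2_sub l1 l2) (L2_scale dt l3)) ldg); first exact: Dg.
have lin (p q r a a' : R) : p = q - r -> q = a -> r = a' -> a - a' = p by move=> -> -> ->.
by apply: ae_mono (ae_conj d4 (ae_conj d5 d6)) => y [k1 [k2 k3]] yL; exact: (lin _ _ _ _ _ (k3 yL) (k1 yL) (k2 yL)).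
Qed.

Lemma elliptic_defect_L2 r : 0 <= r <= T -> inL2 L (elliptic_defect r).
Proof.
move=> rT; have [hf _] := ev_H2 ephi rT; have [hp _] := el_H2 epsi rT.
have [_ _ l1 _] := Sh_regular (ritz_Sh L0 M0 (ev_H10 ephi rT)).
have [l2 _ _ _] := Sh_regular (ritz_Sh L0 M0 (el_H10 epsi rT)).
exact: (L2_scale K (L2_add (L2_sub (Dx_L2 hf) l1) (L2_sub (H1_L2 hp) l2))).
Qed.

Lemma elliptic_defect_le r : 0 <= r <= T -> nrm L (elliptic_defect r) <= K * (h * B + h * B).
Proof.
move=> rT; have [hf hDf] := ev_H2 ephi rT; have [hp _] := el_H2 epsi rT.
have hf10 := ev_H10 ephi rT; have hp10 := el_H10 epsi rT.
have [_ _ l1 _] := Sh_regular (ritz_Sh L0 M0 hf10); have [l2 _ _ _] := Sh_regular (ritz_Sh L0 M0 hp10).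
have k1 := L2_sub (Dx_L2 hf) l1; have k2 := L2_sub (H1_L2 hp) l2.
rewrite (nrmZ K (L2_add k1 k2)) gtr0_norm// ler_pM2l//.
apply: (le_trans (nrm_triangle k1 k2)); apply: lerD.
  apply: (le_trans (ritz_err_H2 L0 M0 hf10 hDf)); rewrite ler_wpM2l//; exact: (ev_bDDU ephi rT).
apply: (le_trans (ritz_err L0 M0 hp10)); rewrite ler_wpM2l//; exact: (el_bD epsi rT).
Qed.

(** The projection is linear, so the increment of the defect is the projection error of
    an increment. *)
Lemma elliptic_defect_diff :
  nrm L (fun y => elliptic_defect t y - elliptic_defect s y) <= K * (h * S + h * S).
Proof.
have [hft hDft] := ev_H2 ephi t0T; have [hpt _] := el_H2 epsi t0T.
have [hfs hDfs] := ev_H2 ephi sT; have [hps _] := el_H2 epsi sT.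
have ft := ev_H10 ephi t0T; have fs := ev_H10 ephi sT.
have pt := el_H10 epsi t0T; have ps := el_H10 epsi sT.
have hf := H10_sub L0 ft fs; have hp := H10_sub L0 pt ps.
have [h1f df] := H1_sub L0 hft hfs; have [h1p dp] := H1_sub L0 hpt hps.
have Ht : fmem (H2 L) (phi t) := conj hft hDft; have Hs : fmem (H2 L) (phi s) := conj hfs hDfs.
have h2f := vspace_sub (bop_H2_DxDx L0) Ht Hs; have ddf := bopB (bop_H2_DxDx L0) Ht Hs.
have drf := Dx_ritz_sub L0 M0 ft fs.
have [_ _ l1 _] := Sh_regular (ritz_Sh L0 M0 hf); have [l2 _ _ _] := Sh_regular (ritz_Sh L0 M0 hp).
have k1 := L2_sub (Dx_L2 h1f) l1; have k2 := L2_sub (H1_L2 h1p) l2.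
rewrite (nrm_ae (L2_sub (elliptic_defect_L2 t0T) (elliptic_defect_L2 sT)) (L2_scale K (L2_add k1 k2))).
  rewrite (nrmZ K (L2_add k1 k2)) gtr0_norm// ler_pM2l//.
  apply: (le_trans (nrm_triangle k1 k2)); apply: lerD.
    have [_ hD] := h2f.
    apply: (le_trans (ritz_err_H2 L0 M0 hf hD)); rewrite ler_wpM2l//.
    rewrite (nrm_ae (Dx_L2 hD) (L2_sub (Dx_L2 hDft) (Dx_L2 hDfs)) ddf).
    exact: (modulus_le (ev_mDDU ephi) s0 (lexx s) (ltW st) tT).
  apply: (le_trans (ritz_err L0 M0 hp)); rewrite ler_wpM2l//.
  rewrite (nrm_ae (Dx_L2 h1p) (L2_sub (Dx_L2 hpt) (Dx_L2 hps)) dp).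
  exact: (modulus_le (el_mD epsi) s0 (lexx s) (ltW st) tT).
have lin (a a' v v' c c' d d' p q r : R) : p = a - a' -> q = v - v' -> r = d - d' ->
  K * (a - v + (c - d)) - K * (a' - v' + (c' - d')) = K * (p - q + (c - c' - r)).
  by move=> -> -> ->; ring.
apply: ae_mono (ae_conj df drf) => y [q1 q2] yL.
have q3 := ritz_sub L0 M0 pt ps (subset_itv_oo_cc yL).
exact: (lin _ _ _ _ _ _ _ _ _ _ _ (q1 yL) (q2 yL) q3).
Qed.

End steps.

End galerkin.

(** * The energy estimate for functions *)

Section energy_estimate.
Context {R : realType}.
Variable L : R.
Variables (rho alpha lambda mu rho1 K gamma b rho3 delta kappa beta : R).
Hypotheses (rho_gt0 : 0 < rho) (alpha_gt0 : 0 < alpha) (lambda_gt0 : 0 < lambda)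
  (mu_gt0 : 0 < mu) (rho1_gt0 : 0 < rho1) (K_gt0 : 0 < K)
  (gamma_gt0 : 0 < gamma) (b_gt0 : 0 < b) (rho3_gt0 : 0 < rho3)
  (delta_gt0 : 0 < delta) (kappa_gt0 : 0 < kappa).
Variables (N : nat) (T dt tau B P : R) (sg : nat -> R).
Hypotheses (T_gt0 : 0 < T) (dt_gt0 : 0 < dt) (NT : N%:R * dt = T)
  (tau_ge0 : 0 <= tau) (P_ge0 : 0 <= P) (sg_ge0 : forall n, 0 <= sg n).
Variables (xi u du phi dphi Phi psi dpsi theta dw dxi dPhi dtheta z : nat -> R -> R).
Local Notation Lok f := (forall n, (n <= N)%N -> inL2 L (f n)).
Hypotheses (lxi : Lok xi) (lu : Lok u) (ldu : Lok du) (lphi : Lok phi) (ldphi : Lok dphi)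
  (lPhi : Lok Phi) (lpsi : Lok psi) (ldpsi : Lok dpsi) (ltheta : Lok theta) (ldw : Lok dw)
  (ldxi : Lok dxi) (ldPhi : Lok dPhi) (ldtheta : Lok dtheta) (lz : Lok z).

Hypothesis du_step : forall n, (n < N)%N ->
  nrm L (fun y => du n.+1 y - du n y - dt * dxi n.+1 y) <= dt * sg n.
Hypothesis pu_step : forall n, (n < N)%N ->
  nrm L (fun y => phi n.+1 y - u n.+1 y - (phi n y - u n y)
    - dt * (Phi n.+1 y - xi n.+1 y)) <= dt * sg n.
Hypothesis dphi_step : forall n, (n < N)%N ->
  nrm L (fun y => dphi n.+1 y - dphi n y - dt * dPhi n.+1 y) <= dt * sg n.
Hypothesis dw_step : forall n, (n < N)%N ->
  nrm L (fun y => dw n.+1 y - dw n y - dt * dtheta n.+1 y) <= dt * sg n.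
Hypothesis skew : forall n, (n < N)%N -> ip L (dtheta n.+1) (Phi n.+1) = - ip L (dPhi n.+1) (theta n.+1).
Hypothesis eq1 : forall n, (n < N)%N ->
  rho / dt * ip L (fun y => xi n.+1 y - xi n y) (xi n.+1) + alpha * ip L (du n.+1) (dxi n.+1)
  - lambda * ip L (fun y => phi n.+1 y - u n.+1 y) (xi n.+1) + mu * ip L (xi n.+1) (xi n.+1)
  <= sg n * nrm L (xi n.+1).
Hypothesis eq2 : forall n, (n < N)%N ->
  rho1 / dt * ip L (fun y => Phi n.+1 y - Phi n y) (Phi n.+1)
  + K * ip L (fun y => dphi n.+1 y + psi n.+1 y) (dPhi n.+1)
  + lambda * ip L (fun y => phi n.+1 y - u n.+1 y) (Phi n.+1) + gamma * ip L (Phi n.+1) (Phi n.+1)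
  + beta * ip L (dtheta n.+1) (Phi n.+1) <= sg n * nrm L (Phi n.+1).
Hypothesis eq3 : forall n, (n < N)%N ->
  b * ip L (dpsi n.+1) (fun y => dpsi n.+1 y - dpsi n y)
  + K * ip L (fun y => dphi n.+1 y + psi n.+1 y) (fun y => psi n.+1 y - psi n y)
  = ip L (z n.+1) (fun y => psi n.+1 y - psi n y).
Hypothesis eq4 : forall n, (n < N)%N ->
  rho3 / dt * ip L (fun y => theta n.+1 y - theta n y) (theta n.+1)
  + delta * ip L (dw n.+1) (dtheta n.+1)
  + beta * ip L (dPhi n.+1) (theta n.+1) + kappa * ip L (dtheta n.+1) (dtheta n.+1)
  <= sg n * nrm L (dtheta n.+1).
Hypothesis psi_le : forall n, (n <= N)%N -> nrm L (psi n) <= P * nrm L (dpsi n).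
Hypothesis z_le : forall n, (n <= N)%N -> nrm L (z n) <= tau.
Hypothesis dz_le : forall n, (n < N)%N -> nrm L (fun y => z n.+1 y - z n y) <= dt * sg n.

Definition error_energy n : R :=
  (rho * nrm L (xi n) ^+ 2 + alpha * nrm L (du n) ^+ 2 + lambda * nrm L (fun y => phi n y - u n y) ^+ 2
   + rho1 * nrm L (Phi n) ^+ 2 + K * nrm L (fun y => dphi n y + psi n y) ^+ 2
   + b * nrm L (dpsi n) ^+ 2 + rho3 * nrm L (theta n) ^+ 2 + delta * nrm L (dw n) ^+ 2) / 2.

Hypotheses (E_0 : error_energy 0%N = 0) (sg_B : dt * (\sum_(0 <= n < N) sg n ^+ 2) <= B)
  (tau_B : tau ^+ 2 <= B).

Let e := P * ((1 + 2 * b) / b).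

Local Notation len := (len (dot L)).

Let len_toV f : inL2 L f -> len (toV L f) = nrm L f.
Proof. by move=> lf; rewrite /len dot_toV. Qed.

Let len_step f g k c : inL2 L f -> inL2 L g -> inL2 L k ->
  len (toV L f - toV L g - c *: toV L k) = nrm L (fun y => f y - g y - c * k y).
Proof.
move=> lf lg lk; have lfg := L2_sub lf lg; have lck := L2_scale c lk.
by rewrite -(toV_sub lf lg) -(toV_scale c lk) -(toV_sub lfg lck) (len_toV (L2_sub lfg lck)).
Qed.

Let dot_sub f g k : inL2 L f -> inL2 L g -> inL2 L k ->
  dot L (toV L f - toV L g) (toV L k) = ip L (fun y => f y - g y) k.
Proof. by move=> lf lg lk; rewrite -(toV_sub lf lg) (dot_toV (L2_sub lf lg) lk). Qed.

Let dot_subr f g k : inL2 L f -> inL2 L g -> inL2 L k ->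
  dot L (toV L k) (toV L f - toV L g) = ip L k (fun y => f y - g y).
Proof. by move=> lf lg lk; rewrite -(toV_sub lf lg) (dot_toV lk (L2_sub lf lg)). Qed.

Let dot_add f g k : inL2 L f -> inL2 L g -> inL2 L k ->
  dot L (toV L f + toV L g) (toV L k) = ip L (fun y => f y + g y) k.
Proof. by move=> lf lg lk; rewrite -(toV_add lf lg) (dot_toV (L2_add lf lg) lk). Qed.

Let energyE n : (n <= N)%N ->
  energy (dot L) rho alpha lambda rho1 K b rho3 delta (toV L (xi n)) (toV L (du n))
   (toV L (phi n) - toV L (u n)) (toV L (Phi n)) (toV L (dphi n) + toV L (psi n))
   (toV L (dpsi n)) (toV L (theta n)) (toV L (dw n)) = error_energy n.
Proof.
move=> nN; rewrite /energy /error_energy -(toV_sub (lphi nN) (lu nN)) -(toV_add (ldphi nN) (lpsi nN)).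
have D f : inL2 L f -> dot L (toV L f) (toV L f) = nrm L f ^+ 2.
  by move=> lf; rewrite (dot_toV lf lf) sqr_nrm.
rewrite (D _ (lxi nN)) (D _ (ldu nN)) (D _ (L2_sub (lphi nN) (lu nN))) (D _ (lPhi nN)).
by rewrite (D _ (L2_add (ldphi nN) (lpsi nN))) (D _ (ldpsi nN)) (D _ (ltheta nN)) (D _ (ldw nN)).
Qed.

(** Transports energy_bound from vectors to functions. The kinematic relations enter
    as bounds on defects, so that only the linearity of the restriction is used. *)
Lemma error_energy_bound n : (n <= N)%N -> error_energy n <=
  2 * (c_damp mu gamma kappa + T * (c_slip alpha lambda K delta + e) ^+ 2 + e ^+ 2) * B.
Proof.
move=> nN; rewrite -(energyE nN).
have S k : (k < N)%N -> (k <= N)%N by exact: ltnW.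
refine (@energy_bound R (@L2V R) (dot L) (@dotDl R L) (@dotZl R L) (@dotC R L) (@dot_ge0 R L)
  rho alpha lambda mu rho1 K gamma b rho3 delta kappa beta
  rho_gt0 alpha_gt0 lambda_gt0 mu_gt0 rho1_gt0 K_gt0 gamma_gt0 b_gt0 rho3_gt0 delta_gt0 kappa_gt0
  N T dt tau B P sg T_gt0 dt_gt0 NT tau_ge0 P_ge0 sg_ge0
  (fun k => toV L (xi k)) (fun k => toV L (u k)) (fun k => toV L (du k)) (fun k => toV L (phi k))
  (fun k => toV L (dphi k)) (fun k => toV L (Phi k)) (fun k => toV L (psi k))
  (fun k => toV L (dpsi k)) (fun k => toV L (theta k)) (fun k => toV L (dw k))
  (fun k => toV L (dxi k)) (fun k => toV L (dPhi k)) (fun k => toV L (dtheta k)) (fun k => toV L (z k))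
  _ _ _ _ _ _ _ _ _ _ _ _ _ _ _ n nN).
- by move=> k kN; rewrite (len_step _ (ldu kN) (ldu (S k kN)) (ldxi kN)); exact: du_step.
- move=> k kN; have k' := S k kN.
  rewrite -(toV_sub (lphi kN) (lu kN)) -(toV_sub (lphi k') (lu k')) -(toV_sub (lPhi kN) (lxi kN)).
  rewrite (len_step _ (L2_sub (lphi kN) (lu kN)) (L2_sub (lphi k') (lu k')) (L2_sub (lPhi kN) (lxi kN))).
  exact: pu_step.
- by move=> k kN; rewrite (len_step _ (ldphi kN) (ldphi (S k kN)) (ldPhi kN)); exact: dphi_step.
- by move=> k kN; rewrite (len_step _ (ldw kN) (ldw (S k kN)) (ldtheta kN)); exact: dw_step.
- by move=> k kN; rewrite (dot_toV (ldtheta kN) (lPhi kN)) (dot_toV (ldPhi kN) (ltheta kN)); exact: skew.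
- move=> k kN; have k' := S k kN; rewrite (dot_sub (lxi kN) (lxi k') (lxi kN)) (dot_toV (ldu kN) (ldxi kN)).
  rewrite (dot_sub (lphi kN) (lu kN) (lxi kN)) (dot_toV (lxi kN) (lxi kN)) (len_toV (lxi kN)).
  exact: eq1.
- move=> k kN; have k' := S k kN; rewrite (dot_sub (lPhi kN) (lPhi k') (lPhi kN)).
  rewrite (dot_add (ldphi kN) (lpsi kN) (ldPhi kN)) (dot_sub (lphi kN) (lu kN) (lPhi kN)).
  rewrite (dot_toV (lPhi kN) (lPhi kN)) (dot_toV (ldtheta kN) (lPhi kN)) (len_toV (lPhi kN)).
  exact: eq2.
- move=> k kN; have k' := S k kN; rewrite (dot_subr (ldpsi kN) (ldpsi k') (ldpsi kN)).
  rewrite -(toV_sub (lpsi kN) (lpsi k')) (dot_add (ldphi kN) (lpsi kN) (L2_sub (lpsi kN) (lpsi k'))).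
  rewrite (dot_toV (lz kN) (L2_sub (lpsi kN) (lpsi k'))) eq3//.
- move=> k kN; have k' := S k kN; rewrite (dot_sub (ltheta kN) (ltheta k') (ltheta kN)).
  rewrite (dot_toV (ldw kN) (ldtheta kN)) (dot_toV (ldPhi kN) (ltheta kN)).
  rewrite (dot_toV (ldtheta kN) (ldtheta kN)) (len_toV (ldtheta kN)).
  exact: eq4.
- by move=> k kN; rewrite (len_toV (lpsi kN)) (len_toV (ldpsi kN)); exact: psi_le.
- by move=> k kN; rewrite (len_toV (lz kN)); exact: z_le.
- move=> k kN; rewrite -(toV_sub (lz kN) (lz (S k kN))) (len_toV (L2_sub (lz kN) (lz (S k kN)))).
  exact: dz_le.
- by rewrite (energyE (leq0n N)).
- exact: sg_B.
- exact: tau_B.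
Qed.

End energy_estimate.

(** * One time step *)

(** The size of all residuals over one step, with q the increment of the exact
    solution: consistency in time, projection error of a difference quotient, and
    projection error of the values. *)
Definition mesh_rate {R : realFieldType} (h dt q : R) : R := q + h * q / dt + h.

Lemma mesh_rate_ge0 {R : realFieldType} (h dt q : R) : 0 <= h -> 0 <= dt -> 0 <= q ->
  0 <= mesh_rate h dt q.
Proof. by move=> h0 d0 q0; rewrite !addr_ge0// divr_ge0// mulr_ge0. Qed.

(** Collects the three kinds of residuals, with their constants a, r and m, under a
    single constant c. *)
Lemma mesh_rate_le {R : realFieldType} (h dt q a r m c : R) : 0 <= h -> 0 < dt -> 0 <= q ->
  0 <= a -> 0 <= r -> 0 <= m -> a + r + m <= c ->
  a * q + r / dt * (h * q) + m * h <= c * mesh_rate h dt q.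
Proof.
move=> h0 d0 q0 a0 r0 m0 arm.
have p0 : 0 <= h * q / dt by rewrite divr_ge0 ?mulr_ge0// ltW.
apply: (@le_trans _ _ ((a + r + m) * mesh_rate h dt q)).
  have -> : r / dt * (h * q) = r * (h * q / dt) by field; rewrite gt_eqF.
  rewrite /mesh_rate; move: (h * q / dt) p0 => p p0.
  have := mulr_ge0 a0 p0; have := mulr_ge0 a0 h0; have := mulr_ge0 r0 q0.
  have := mulr_ge0 r0 h0; have := mulr_ge0 m0 q0; have := mulr_ge0 m0 p0; lra.
by rewrite ler_wpM2r// mesh_rate_ge0// ltW.
Qed.

Section one_step.
Context {R : realType}.
Variables (L T : R) (M : nat).
Hypotheses (L0 : 0 < L) (M0 : (0 < M)%N).
Local Notation h := (L / M%:R).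
Local Notation P := (ritz L M).
Variables (G : R -> R) (B : R) (u phi psi w xi Phi theta : R -> R -> R).
Hypotheses (B0 : 0 <= B) (eu : evolution L T G B u xi) (ephi : evolution L T G B phi Phi)
  (ew : evolution L T G B w theta) (epsi : elliptic L T G B psi).
Variables (rho alpha lambda mu rho1 K gamma b rho3 delta kappa beta : R).
Hypotheses (rho_gt0 : 0 < rho) (lambda_gt0 : 0 < lambda) (mu_gt0 : 0 < mu) (rho1_gt0 : 0 < rho1)
  (K_gt0 : 0 < K) (gamma_gt0 : 0 < gamma) (rho3_gt0 : 0 < rho3).
Variables (a1 a2 a4 a5 : R).
Hypotheses (a10 : 0 <= a1) (a20 : 0 <= a2) (a40 : 0 <= a4) (a50 : 0 <= a5).
Variables (s t : R).
Hypotheses (s0 : 0 <= s) (st : s < t) (tT : t <= T).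

Let h0 : 0 <= h. Proof. by rewrite divr_ge0 ?ler0n// ltW. Qed.
Let d0 : 0 < t - s. Proof. by rewrite subr_gt0. Qed.

Definition increment (dt : R) : R := Num.sqrt (dt * (G t - G s)).

Let q0 dt : 0 <= increment dt. Proof. exact: sqrtr_ge0. Qed.

Lemma one_step_u c dt (x x' U F chi : R -> R) : a1 + rho + (lambda + lambda + mu) * B <= c ->
  t - s = dt ->
  inSh L M x -> inSh L M x' -> inSh L M U -> inSh L M F -> inSh L M chi ->
  nrm L (fun y => rho * (xi t y - xi s y) - (t - s) * lincomb (rate_u L alpha lambda mu u phi xi) t y)
    <= (t - s) * (a1 * Num.sqrt ((t - s) * (G t - G s))) ->
  rho / dt * ip L (fun y => x y - x' y) chi + alpha * ip L (Dx L U) (Dx L chi)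
    - lambda * ip L (fun y => F y - U y) chi + mu * ip L x chi = 0 ->
  rho / dt * ip L (fun y => x y - P (xi t) y - (x' y - P (xi s) y)) chi
    + alpha * ip L (Dx L (fun y => U y - P (u t) y)) (Dx L chi)
    - lambda * ip L (fun y => F y - P (phi t) y - (U y - P (u t) y)) chi
    + mu * ip L (fun y => x y - P (xi t) y) chi
  <= c * mesh_rate h dt (increment dt) * nrm L chi.
Proof.
move=> hc <- sx sx' sU sF schi cons eq.
apply: (le_trans (galerkin_u L0 M0 eu ephi rho_gt0 lambda_gt0 mu_gt0 s0 st tT sx sx' sU sF schi cons eq)).
rewrite ler_wpM2r ?nrm_ge0//.
apply: le_trans (mesh_rate_le h0 d0 (q0 _) a10 (ltW rho_gt0) _ hc); last first.
  by rewrite mulr_ge0// !addr_ge0// ltW.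
by rewrite -/(increment _) le_eqVlt; apply/orP; left; apply/eqP; ring.
Qed.

Lemma one_step_phi c dt (x x' U F Q Th chi : R -> R) :
  a2 + rho1 + (lambda + lambda + gamma + K + `|beta|) * B <= c -> t - s = dt ->
  inSh L M x -> inSh L M x' -> inSh L M U -> inSh L M F -> inSh L M Q -> inSh L M Th -> inSh L M chi ->
  nrm L (fun y => rho1 * (Phi t y - Phi s y)
      - (t - s) * lincomb (rate_phi L lambda K gamma beta u phi psi Phi theta) t y)
    <= (t - s) * (a2 * Num.sqrt ((t - s) * (G t - G s))) ->
  rho1 / dt * ip L (fun y => x y - x' y) chi + K * ip L (fun y => Dx L F y + Q y) (Dx L chi)
    + lambda * ip L (fun y => F y - U y) chi + gamma * ip L x chi + beta * ip L (Dx L Th) chi = 0 ->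
  rho1 / dt * ip L (fun y => x y - P (Phi t) y - (x' y - P (Phi s) y)) chi
    + K * ip L (fun y => Dx L (fun z => F z - P (phi t) z) y + (Q y - P (psi t) y)) (Dx L chi)
    + lambda * ip L (fun y => F y - P (phi t) y - (U y - P (u t) y)) chi
    + gamma * ip L (fun y => x y - P (Phi t) y) chi
    + beta * ip L (Dx L (fun y => Th y - P (theta t) y)) chi
  <= c * mesh_rate h dt (increment dt) * nrm L chi.
Proof.
move=> hc <- sx sx' sU sF sQ sTh schi cons eq.
apply: (le_trans (galerkin_phi L0 M0 eu ephi ew epsi lambda_gt0 rho1_gt0 K_gt0 gamma_gt0 s0 st tT
  sx sx' sU sF sQ sTh schi cons eq)).
rewrite ler_wpM2r ?nrm_ge0//.
apply: le_trans (mesh_rate_le h0 d0 (q0 _) a20 (ltW rho1_gt0) _ hc); last first.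
  by rewrite mulr_ge0// !addr_ge0// ltW.
by rewrite -/(increment _) le_eqVlt; apply/orP; left; apply/eqP; ring.
Qed.

Lemma one_step_w c dt (x x' W p chi : R -> R) :
  (a4 * L + a5) + rho3 * L + `|beta| * B <= c -> t - s = dt ->
  inSh L M x -> inSh L M x' -> inSh L M W -> inSh L M p -> inSh L M chi ->
  `|rho3 * ip L (fun y => theta t y - theta s y) chi
    - (t - s) * (ip L (lincomb (rate_w L beta Phi) t) chi
      + ip L (lincomb (flux_w L delta kappa w theta) t) (Dx L chi))|
  <= (t - s) * (Num.sqrt ((t - s) * (G t - G s)) * (a4 * nrm L chi + a5 * nrm L (Dx L chi))) ->
  rho3 / dt * ip L (fun y => x y - x' y) chi + delta * ip L (Dx L W) (Dx L chi)
    + beta * ip L (Dx L p) chi + kappa * ip L (Dx L x) (Dx L chi) = 0 ->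
  rho3 / dt * ip L (fun y => x y - P (theta t) y - (x' y - P (theta s) y)) chi
    + delta * ip L (Dx L (fun y => W y - P (w t) y)) (Dx L chi)
    + beta * ip L (Dx L (fun y => p y - P (Phi t) y)) chi
    + kappa * ip L (Dx L (fun y => x y - P (theta t) y)) (Dx L chi)
  <= c * mesh_rate h dt (increment dt) * nrm L (Dx L chi).
Proof.
move=> hc <- sx sx' sW sp schi cons eq.
apply: (le_trans (galerkin_w L0 M0 ephi ew rho3_gt0 s0 st tT a40 sx sx' sW sp schi cons eq)).
rewrite ler_wpM2r ?nrm_ge0//.
apply: le_trans (mesh_rate_le h0 d0 (q0 _) _ _ _ hc); last first.
- by rewrite mulr_ge0.
- by rewrite mulr_ge0// ltW.
- by rewrite addr_ge0// mulr_ge0// ltW.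
by rewrite -/(increment _) le_eqVlt; apply/orP; left; apply/eqP; ring.
Qed.

Let slip c dt q : 0 <= q -> 0 < dt -> 1 <= c -> dt * q <= dt * (c * mesh_rate h dt q).
Proof.
move=> q1 dt0 c1; rewrite ler_pM2l//.
have := mesh_rate_le h0 dt0 q1 ler01 (lexx 0) (lexx 0); rewrite !addr0 !mul0r !addr0 mul1r.
exact.
Qed.

Lemma one_step_slip U V c dt (x x' v : R -> R) : 1 <= c -> t - s = dt -> evolution L T G B U V ->
  inSh L M x -> inSh L M x' -> inSh L M v ->
  {in `[0, L], forall y, x y = x' y + dt * v y} ->
  nrm L (fun y => Dx L (fun z => x z - P (U t) z) y - Dx L (fun z => x' z - P (U s) z) y
           - dt * Dx L (fun z => v z - P (V t) z) y) <= dt * (c * mesh_rate h dt (increment dt)).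
Proof.
move=> c1 <- e sx sx' sv xE; have [k _] := step_defect L0 M0 s0 st tT e sx sx' sv xE.
by apply: (le_trans k); exact: (slip (q0 _) d0 c1).
Qed.

(** Both unknowns phi and u move, whence the two contributions L. *)
Lemma one_step_slip_difference c dt (x x' v X X' v' : R -> R) : L + L <= c -> t - s = dt ->
  inSh L M x -> inSh L M x' -> inSh L M v -> inSh L M X -> inSh L M X' -> inSh L M v' ->
  {in `[0, L], forall y, x y = x' y + dt * v y} ->
  {in `[0, L], forall y, X y = X' y + dt * v' y} ->
  nrm L (fun y => X y - P (phi t) y - (x y - P (u t) y) - (X' y - P (phi s) y - (x' y - P (u s) y))
           - dt * (v' y - P (Phi t) y - (v y - P (xi t) y)))
  <= dt * (c * mesh_rate h dt (increment dt)).
Proof.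
move=> c1 <- sx sx' sv sX sX' sv' xE XE.
have [_ k1] := step_defect L0 M0 s0 st tT eu sx sx' sv xE.
have [_ k2] := step_defect L0 M0 s0 st tT ephi sX sX' sv' XE.
have sT : 0 <= s <= T by rewrite s0 (le_trans (ltW st) tT).
have t0T : 0 <= t <= T by rewrite tT (le_trans s0 (ltW st)).
have err U V (y y' z : R -> R) : evolution L T G B U V -> inSh L M y -> inSh L M y' -> inSh L M z ->
    inL2 L (fun a => y a - P (U t) a - (y' a - P (U s) a) - (t - s) * (z a - P (V t) a)).
  move=> e sy sy' sz.
  have r1 := Sh_sub L0 sy (ritz_Sh L0 M0 (ev_H10 e t0T)).
  have r2 := Sh_sub L0 sy' (ritz_Sh L0 M0 (ev_H10 e sT)).
  have r3 := Sh_sub L0 sz (ritz_Sh L0 M0 (ev_V e t0T)).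
  by have [] := Sh_regular L0 (Sh_sub L0 (Sh_sub L0 r1 r2) (Sh_scale L0 (t - s) r3)).
have l1 := err _ _ _ _ _ eu sx sx' sv; have l2 := err _ _ _ _ _ ephi sX sX' sv'.
have E : forall y : R, X y - P (phi t) y - (x y - P (u t) y) - (X' y - P (phi s) y - (x' y - P (u s) y))
           - (t - s) * (v' y - P (Phi t) y - (v y - P (xi t) y)) =
   X y - P (phi t) y - (X' y - P (phi s) y) - (t - s) * (v' y - P (Phi t) y)
   - (x y - P (u t) y - (x' y - P (u s) y) - (t - s) * (v y - P (xi t) y)).
  have lin (p p' q q' k z z' m m' o o' r r' : R) : p - p' - (q - q') - (z - z' - (m - m')) -
    k * (o - o' - (r - r')) = p - p' - (z - z') - k * (o - o') - (q - q' - (m - m') - k * (r - r')) by ring.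
  by move=> y; exact: lin.
under [X in nrm L X]eq_fun do rewrite E.
apply: (le_trans (nrm_triangleB l2 l1)).
apply: (@le_trans _ _ ((t - s) * ((L + L) * increment (t - s)))).
  apply: (le_trans (lerD k2 k1)).
  by rewrite -/(increment _) le_eqVlt; apply/orP; left; apply/eqP; ring.
rewrite ler_pM2l//.
have c1' : L + L + 0 + 0 <= c by rewrite !addr0.
have := mesh_rate_le h0 d0 (q0 (t - s)) (addr_ge0 (ltW L0) (ltW L0)) (lexx 0) (lexx 0) c1'.
by rewrite !mul0r !addr0.
Qed.

Lemma one_step_elliptic c dt : K + K <= c -> t - s = dt ->
  nrm L (fun y => elliptic_defect L M phi psi K t y - elliptic_defect L M phi psi K s y)
    <= dt * (c * mesh_rate h dt (increment dt)).
Proof.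
move=> c1 <-; apply: (le_trans (elliptic_defect_diff L0 M0 ephi epsi K_gt0 s0 st tT)).
have c1' : 0 + (K + K) + 0 <= c by rewrite add0r addr0.
have K2 : 0 <= K + K by rewrite addr_ge0// ltW.
have := mesh_rate_le h0 d0 (q0 (t - s)) (lexx 0) K2 (lexx 0) c1'.
rewrite !mul0r add0r addr0 -(ler_pM2l d0) => k; apply: le_trans k.
rewrite -/(increment _) le_eqVlt; apply/orP; left; apply/eqP.
have lin (k d z : R) : d != 0 -> k * (z + z) = d * ((k + k) / d * z) by move=> dn0; field.
by apply: lin; rewrite gt_eqF.
Qed.

End one_step.

(** * Distance between the scheme and the Ritz projection *)

(** With q^2 = dt (G t - G s) the terms q^2, (h q / dt)^2 and h^2, multiplied by dt, sum
    to dt^2 (G T - G 0), h^2 (G T - G 0) and h^2 T. *)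
Lemma sum_mesh_rate {R : realType} (N : nat) (T h dt c : R) (G : R -> R) :
  0 <= h -> 0 < dt -> N%:R * dt = T ->
  (forall s t, 0 <= s -> s <= t -> t <= T -> G s <= G t) ->
  dt * (\sum_(0 <= n < N) (c * mesh_rate h dt (Num.sqrt (dt * (G (n.+1%:R * dt) - G (n%:R * dt))))) ^+ 2)
  <= 3 * c ^+ 2 * (G T - G 0 + T) * (h ^+ 2 + dt ^+ 2).
Proof.
move=> h0 dt0 NT Gm.
have T0 : 0 <= T by rewrite -NT mulr_ge0 ?ler0n// ltW.
have H k : (k <= N)%N -> dt * (\sum_(0 <= n < k) (c * mesh_rate h dt
      (Num.sqrt (dt * (G (n.+1%:R * dt) - G (n%:R * dt))))) ^+ 2)
    <= 3 * c ^+ 2 * ((dt ^+ 2 + h ^+ 2) * (G (k%:R * dt) - G 0) + k%:R * dt * h ^+ 2).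
  elim: k => [_|k IHk kN]; first by rewrite big_geq// mul0r subrr !mulr0 mul0r addr0 mulr0.
  rewrite big_nat_recr//= mulrDr; apply: (le_trans (lerD (IHk (ltnW kN)) (lexx _))).
  have k0 : 0 <= k%:R * dt by rewrite mulr_ge0 ?ler0n// ltW.
  have kS : k%:R * dt <= k.+1%:R * dt by rewrite ler_pM2r// ler_nat.
  have kT : k.+1%:R * dt <= T by rewrite -NT ler_pM2r// ler_nat.
  have DG := Gm _ _ k0 kS kT.
  set g := G (k.+1%:R * dt) in DG *; set g' := G (k%:R * dt) in DG *.
  have E : Num.sqrt (dt * (g - g')) ^+ 2 = dt * (g - g').
    by rewrite sqr_sqrtr// mulr_ge0 ?subr_ge0// ltW.
  set q := Num.sqrt _ in E *.
  have le3 (x y z : R) : (x + y + z) ^+ 2 <= 3 * (x ^+ 2 + y ^+ 2 + z ^+ 2).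
    have := sqr_ge0 (x - y); have := sqr_ge0 (y - z); have := sqr_ge0 (x - z); lra.
  have : dt * (c * mesh_rate h dt q) ^+ 2 <=
      dt * (c ^+ 2 * (3 * (q ^+ 2 + (h * q / dt) ^+ 2 + h ^+ 2))).
    by rewrite exprMn ler_pM2l// ler_wpM2l ?sqr_ge0//; exact: le3.
  have -> : (h * q / dt) ^+ 2 = h ^+ 2 * q ^+ 2 / dt ^+ 2 by rewrite !exprMn exprVn.
  rewrite E => le; apply: (le_trans (lerD (lexx _) le)).
  rewrite -natr1 le_eqVlt; apply/orP; left; apply/eqP.
  by field; rewrite gt_eqF.
apply: (le_trans (H N (leqnn N))); rewrite NT.
have DG := Gm _ _ (lexx 0) T0 (lexx T).
rewrite -[leRHS]mulrA; apply: ler_wpM2l; first by rewrite mulr_ge0// sqr_ge0.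
have := mulr_ge0 T0 (sqr_ge0 dt); move: (G T) (G 0) DG => g g' _; lra.
Qed.

Section discrete_error.
Context {R : realType}.
Variables (L T rho alpha lambda mu rho1 K gamma b rho3 delta kappa beta : R).
Hypotheses (L0 : 0 < L) (T0 : 0 < T) (rho_gt0 : 0 < rho) (alpha_gt0 : 0 < alpha) (lambda_gt0 : 0 < lambda)
  (mu_gt0 : 0 < mu) (rho1_gt0 : 0 < rho1) (K_gt0 : 0 < K)
  (gamma_gt0 : 0 < gamma) (b_gt0 : 0 < b) (rho3_gt0 : 0 < rho3)
  (delta_gt0 : 0 < delta) (kappa_gt0 : 0 < kappa).
Variables (G : R -> R) (B : R) (u phi psi w xi Phi theta : R -> R -> R).
Hypotheses (B0 : 0 <= B) (eu : evolution L T G B u xi) (ephi : evolution L T G B phi Phi)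
  (ew : evolution L T G B w theta) (epsi : elliptic L T G B psi).
Variables (a1 a2 a4 a5 : R).
Hypotheses (a10 : 0 <= a1) (a20 : 0 <= a2) (a40 : 0 <= a4) (a50 : 0 <= a5).
Local Notation S s t := (Num.sqrt ((t - s) * (G t - G s))).
Hypothesis cons1 : forall s t, 0 <= s -> s <= t -> t <= T ->
  nrm L (fun y => rho * (xi t y - xi s y) - (t - s) * lincomb (rate_u L alpha lambda mu u phi xi) t y)
    <= (t - s) * (a1 * S s t).
Hypothesis cons2 : forall s t, 0 <= s -> s <= t -> t <= T ->
  nrm L (fun y => rho1 * (Phi t y - Phi s y)
      - (t - s) * lincomb (rate_phi L lambda K gamma beta u phi psi Phi theta) t y)
    <= (t - s) * (a2 * S s t).
Hypothesis cons3 : forall t chi, 0 <= t <= T -> H10 L chi ->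
  b * ip L (Dx L (psi t)) (Dx L chi) + K * ip L (fun x => Dx L (phi t) x + psi t x) chi = 0.
Hypothesis cons4 : forall s t chi, 0 <= s -> s <= t -> t <= T -> H10 L chi ->
  `|rho3 * ip L (fun y => theta t y - theta s y) chi
    - (t - s) * (ip L (lincomb (rate_w L beta Phi) t) chi
      + ip L (lincomb (flux_w L delta kappa w theta) t) (Dx L chi))|
  <= (t - s) * (S s t * (a4 * nrm L chi + a5 * nrm L (Dx L chi))).

(** The sum of the constants required by the lemmas on one step, so that each is below it. *)
Definition rate_cst : R := 1 + (L + L) + (K + K) + (a1 + rho + (lambda + lambda + mu) * B)
  + (a2 + rho1 + (lambda + lambda + gamma + K + `|beta|) * B)
  + ((a4 * L + a5) + rho3 * L + `|beta| * B).

Variables (M N : nat).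
Hypotheses (M0 : (0 < M)%N) (N0 : (0 < N)%N).
Local Notation h := (L / M%:R).
Local Notation dt := (T / N%:R).
Local Notation tn n := (n%:R * (T / N%:R)).
Local Notation P := (ritz L M).
Variables (uh xih phih Phih psih wh thetah : nat -> R -> R).
Hypotheses (Su : forall n, (n <= N)%N -> inSh L M (uh n)) (Sxi : forall n, (n <= N)%N -> inSh L M (xih n))
  (Sphi : forall n, (n <= N)%N -> inSh L M (phih n)) (SPhi : forall n, (n <= N)%N -> inSh L M (Phih n))
  (Spsi : forall n, (n <= N)%N -> inSh L M (psih n)) (Sw : forall n, (n <= N)%N -> inSh L M (wh n))
  (Sth : forall n, (n <= N)%N -> inSh L M (thetah n)).
Hypotheses (iu : {in `[0, L], uh 0%N =1 P (u (tn 0%N))}) (ixi : {in `[0, L], xih 0%N =1 P (xi (tn 0%N))})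
  (iphi : {in `[0, L], phih 0%N =1 P (phi (tn 0%N))}) (iPhi : {in `[0, L], Phih 0%N =1 P (Phi (tn 0%N))})
  (ipsi : {in `[0, L], psih 0%N =1 P (psi (tn 0%N))}) (iw : {in `[0, L], wh 0%N =1 P (w (tn 0%N))})
  (ith : {in `[0, L], thetah 0%N =1 P (theta (tn 0%N))}).
Hypotheses (uS : forall n, (n < N)%N -> {in `[0, L], forall y, uh n.+1 y = uh n y + dt * xih n.+1 y})
  (phiS : forall n, (n < N)%N -> {in `[0, L], forall y, phih n.+1 y = phih n y + dt * Phih n.+1 y})
  (wS : forall n, (n < N)%N -> {in `[0, L], forall y, wh n.+1 y = wh n y + dt * thetah n.+1 y}).
Hypothesis d1 : forall n chi, (n < N)%N -> inSh L M chi ->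
  rho / dt * ip L (fun x => xih n.+1 x - xih n x) chi + alpha * ip L (Dx L (uh n.+1)) (Dx L chi)
  - lambda * ip L (fun x => phih n.+1 x - uh n.+1 x) chi + mu * ip L (xih n.+1) chi = 0.
Hypothesis d2 : forall n chi, (n < N)%N -> inSh L M chi ->
  rho1 / dt * ip L (fun x => Phih n.+1 x - Phih n x) chi
  + K * ip L (fun x => Dx L (phih n.+1) x + psih n.+1 x) (Dx L chi)
  + lambda * ip L (fun x => phih n.+1 x - uh n.+1 x) chi + gamma * ip L (Phih n.+1) chi
  + beta * ip L (Dx L (thetah n.+1)) chi = 0.
Hypothesis d3 : forall n chi, (n < N)%N -> inSh L M chi ->
  b * ip L (Dx L (psih n.+1)) (Dx L chi) + K * ip L (fun x => Dx L (phih n.+1) x + psih n.+1 x) chi = 0.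
Hypothesis d4 : forall n chi, (n < N)%N -> inSh L M chi ->
  rho3 / dt * ip L (fun x => thetah n.+1 x - thetah n x) chi + delta * ip L (Dx L (wh n.+1)) (Dx L chi)
  + beta * ip L (Dx L (Phih n.+1)) chi + kappa * ip L (Dx L (thetah n.+1)) (Dx L chi) = 0.

Local Notation err vh v := (fun n y => vh n y - P (v (tn n)) y).

Let dt0 : 0 < dt. Proof. by rewrite divr_gt0// ltr0n. Qed.
Let h0 : 0 <= h. Proof. by rewrite divr_ge0 ?ler0n// ltW. Qed.
Let NT : N%:R * dt = T. Proof. by rewrite mulrC divfK// pnatr_eq0 -lt0n. Qed.
Let t0 n : 0 <= tn n. Proof. by rewrite mulr_ge0 ?ler0n// ltW. Qed.
Let tT n : (n <= N)%N -> tn n <= T. Proof. by move=> nN; rewrite -[leRHS]NT ler_pM2r// ler_nat. Qed.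
Let tI n : (n <= N)%N -> 0 <= tn n <= T. Proof. by move=> nN; rewrite t0 tT. Qed.
Let tS n : tn n < tn n.+1. Proof. by rewrite ltr_pM2r// ltr_nat. Qed.
Let tdt n : tn n.+1 - tn n = dt. Proof. by rewrite -natr1 mulrDl mul1r addrAC subrr add0r. Qed.

Let Sfield (vh : nat -> R -> R) (v : R -> R -> R) n :
  (forall n, (n <= N)%N -> inSh L M (vh n)) -> (forall t, 0 <= t <= T -> H10 L (v t)) ->
  (n <= N)%N -> inSh L M (fun y => vh n y - P (v (tn n)) y).
Proof. by move=> sv hv nN; exact: (Sh_sub L0 (sv n nN) (ritz_Sh L0 M0 (hv _ (tI nN)))). Qed.

Let zero (f : R -> R) : inSh L M f -> {in `[0, L], forall y, f y = 0} ->
  nrm L f = 0 /\ nrm L (Dx L f) = 0.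
Proof.
move=> sf f0; have [lf _ ldf _] := Sh_regular L0 sf.
have e : eq_ae L f (fun=> 0) by apply: eq_ae_on => y yL; apply: f0; exact: subset_itv_oo_cc.
have n0 : nrm L (fun=> 0 : R) = 0 by rewrite nrm_cst// normr0 mul0r.
have [_ k] := H1_cst L0 (0 : R).
split; first by rewrite (nrm_ae lf (L2_cst L 0) e).
by rewrite (nrm_ae ldf (L2_cst L 0) (eq_ae_trans (eq_ae_Dx lf (L2_cst L 0) e) k)).
Qed.

Let c := rate_cst.
Let c_ge : [/\ 1 <= c, L + L <= c, K + K <= c, a1 + rho + (lambda + lambda + mu) * B <= c &
  a2 + rho1 + (lambda + lambda + gamma + K + `|beta|) * B <= c /\
  (a4 * L + a5) + rho3 * L + `|beta| * B <= c].
Proof.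
have p1 : 0 <= a1 + rho + (lambda + lambda + mu) * B.
  by rewrite !addr_ge0 ?mulr_ge0 ?addr_ge0// ltW.
have p2 : 0 <= a2 + rho1 + (lambda + lambda + gamma + K + `|beta|) * B.
  by rewrite !addr_ge0 ?mulr_ge0 ?addr_ge0// ltW.
have p3 : 0 <= (a4 * L + a5) + rho3 * L + `|beta| * B.
  by rewrite !addr_ge0 ?mulr_ge0 ?addr_ge0// ltW.
have L0' := ltW L0; have K0' := ltW K_gt0.
rewrite /c /rate_cst; move: (a1 + _ + _) (a2 + _ + _) (a4 * _ + _ + _ + _) p1 p2 p3 => x y z *.
by split; [lra..|split; lra].
Qed.

(** The hypotheses of error_energy_bound for the differences between the scheme and the
    projection of the exact solution. The coupling terms are skew because the errors of
    the velocities vanish at the ends; the errors vanish at the initial time because the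
    scheme starts from the projections of the data. *)
Lemma discrete_error n : (n <= N)%N ->
  error_energy L rho alpha lambda rho1 K b rho3 delta (err xih xi) (err uh u)
   (fun n => Dx L (err uh u n)) (err phih phi) (fun n => Dx L (err phih phi n)) (err Phih Phi)
   (err psih psi) (fun n => Dx L (err psih psi n)) (err thetah theta) (fun n => Dx L (err wh w n)) n
  <= 2 * (c_damp mu gamma kappa + T * (c_slip alpha lambda K delta + L * ((1 + 2 * b) / b)) ^+ 2
        + (L * ((1 + 2 * b) / b)) ^+ 2)
     * ((3 * c ^+ 2 * (G T - G 0 + T) + 4 * K ^+ 2 * B ^+ 2) * (h ^+ 2 + dt ^+ 2)).
Proof.
have [c1 c2 c3 c4 [c5 c6]] := c_ge.
have Eu k := Sfield (n := k) Su (ev_H10 eu); have Exi k := Sfield (n := k) Sxi (ev_V eu).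
have Ephi k := Sfield (n := k) Sphi (ev_H10 ephi); have EPhi k := Sfield (n := k) SPhi (ev_V ephi).
have Ew k := Sfield (n := k) Sw (ev_H10 ew); have Eth k := Sfield (n := k) Sth (ev_V ew).
have Epsi k := Sfield (n := k) Spsi (el_H10 epsi).
have fL (f : R -> R) : inSh L M f -> inL2 L f by move=> /(Sh_regular L0) [].
have fD (f : R -> R) : inSh L M f -> inL2 L (Dx L f) by move=> /(Sh_regular L0) [].
pose sg k := c * mesh_rate h dt (increment G (tn k) (tn k.+1) dt).
have sk (f g : R -> R) : inH1 L f -> H10 L g -> ip L (Dx L f) g = - ip L (Dx L g) f.
  by move=> hf hg; rewrite (H1_ibp L0 hf hg) ipC.
have sg0 k : 0 <= sg k.
  by rewrite /sg mulr_ge0 ?(le_trans ler01 c1)// mesh_rate_ge0 ?(ltW dt0)// sqrtr_ge0.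
have hB : 0 <= h * B by rewrite mulr_ge0.
have KB0 : 0 <= 4 * K ^+ 2 * B ^+ 2 by have := mulr_ge0 (sqr_ge0 K) (sqr_ge0 B); lra.
have tau0 : 0 <= K * (h * B + h * B) by rewrite mulr_ge0 ?addr_ge0// ltW.
have Gm s t : 0 <= s -> s <= t -> t <= T -> G s <= G t by exact: modulus_mono (ev_mU eu).
apply: (error_energy_bound rho_gt0 alpha_gt0 lambda_gt0 mu_gt0 rho1_gt0 K_gt0 gamma_gt0 b_gt0
  rho3_gt0 delta_gt0 kappa_gt0 (N := N) (T := T) (dt := dt) T0 dt0 NT tau0 (ltW L0) sg0
  (dxi := fun k => Dx L (err xih xi k)) (dPhi := fun k => Dx L (err Phih Phi k))
  (dtheta := fun k => Dx L (err thetah theta k))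
  (z := fun k => elliptic_defect L M phi psi K (tn k)) (beta := beta)).
- by move=> k kN; exact: fL (Exi k kN).
- by move=> k kN; exact: fL (Eu k kN).
- by move=> k kN; exact: fD (Eu k kN).
- by move=> k kN; exact: fL (Ephi k kN).
- by move=> k kN; exact: fD (Ephi k kN).
- by move=> k kN; exact: fL (EPhi k kN).
- by move=> k kN; exact: fL (Epsi k kN).
- by move=> k kN; exact: fD (Epsi k kN).
- by move=> k kN; exact: fL (Eth k kN).
- by move=> k kN; exact: fD (Ew k kN).
- by move=> k kN; exact: fD (Exi k kN).
- by move=> k kN; exact: fD (EPhi k kN).
- by move=> k kN; exact: fD (Eth k kN).
- by move=> k kN; exact: (elliptic_defect_L2 L0 M0 ephi epsi K (tI kN)).
- move=> k kN; have k' := ltnW kN.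
  exact: (one_step_slip L0 M0 (t0 k) (tS k) (tT kN) c1 (tdt k) eu (Su kN) (Su k') (Sxi kN) (uS kN)).
- move=> k kN; have k' := ltnW kN.
  exact: (one_step_slip_difference L0 M0 eu ephi (t0 k) (tS k) (tT kN) c2 (tdt k) (Su kN) (Su k') (Sxi kN)
    (Sphi kN) (Sphi k') (SPhi kN) (uS kN) (phiS kN)).
- move=> k kN; have k' := ltnW kN.
  exact: (one_step_slip L0 M0 (t0 k) (tS k) (tT kN) c1 (tdt k) ephi (Sphi kN) (Sphi k') (SPhi kN) (phiS kN)).
- move=> k kN; have k' := ltnW kN.
  exact: (one_step_slip L0 M0 (t0 k) (tS k) (tT kN) c1 (tdt k) ew (Sw kN) (Sw k') (Sth kN) (wS kN)).
- move=> k kN; have [_ h1 _ _] := Sh_regular L0 (Eth _ kN); have [_ _ _ h2] := Sh_regular L0 (EPhi _ kN).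
  exact: (sk _ _ h1 h2).
- move=> k kN; have k' := ltnW kN.
  exact: (one_step_u L0 M0 B0 eu ephi rho_gt0 lambda_gt0 mu_gt0 a10 (t0 k) (tS k) (tT kN) c4 (tdt k)
    (Sxi kN) (Sxi k') (Su kN) (Sphi kN) (Exi _ kN) (cons1 (t0 k) (ltW (tS k)) (tT kN))
    (d1 kN (Exi _ kN))).
- move=> k kN; have k' := ltnW kN.
  exact: (one_step_phi L0 M0 B0 eu ephi ew epsi lambda_gt0 rho1_gt0 K_gt0 gamma_gt0 a20 (t0 k) (tS k)
    (tT kN) c5 (tdt k) (SPhi kN) (SPhi k') (Su kN) (Sphi kN) (Spsi kN) (Sth kN) (EPhi _ kN)
    (cons2 (t0 k) (ltW (tS k)) (tT kN)) (d2 kN (EPhi _ kN))).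
- move=> k kN; have k' := ltnW kN.
  have sD := Sh_sub L0 (Epsi _ kN) (Epsi _ k'); have [_ hD lD h10] := Sh_regular L0 sD.
  have [_ h1 l1 _] := Sh_regular L0 (Epsi _ kN); have [_ h2 l2 _] := Sh_regular L0 (Epsi _ k').
  have [_ dd] := H1_sub L0 h1 h2.
  have <- := galerkin_psi L0 M0 ephi epsi (t0 k) (tS k) (tT kN) (Sphi kN) (Spsi kN) sD
    (cons3 (tI kN) h10) (d3 kN sD).
  have lin (p q r : R) : p = q -> b * q + r = b * p + r by move=> ->.
  by apply: lin; rewrite ipC [RHS]ipC; exact: (eq_ae_ipl lD (L2_sub l1 l2) l1 dd).
- move=> k kN; have k' := ltnW kN.
  have [_ _ _ h10] := Sh_regular L0 (Eth _ kN).
  exact: (one_step_w L0 M0 B0 ephi ew rho3_gt0 a40 a50 (t0 k) (tS k) (tT kN) c6 (tdt k)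
    (Sth kN) (Sth k') (Sw kN) (SPhi kN) (Eth _ kN) (cons4 (t0 k) (ltW (tS k)) (tT kN) h10)
    (d4 kN (Eth _ kN))).
- by move=> k kN; have [_ _ _ h10] := Sh_regular L0 (Epsi _ kN); exact: poincare.
- by move=> k kN; exact: (elliptic_defect_le L0 M0 ephi epsi K_gt0 (tI kN)).
- by move=> k kN; exact: (one_step_elliptic L0 M0 ephi epsi K_gt0 (t0 k) (tS k) (tT kN) c3 (tdt k)).
- have Z (vh : nat -> R -> R) v : {in `[0, L], vh 0%N =1 P (v (tn 0%N))} ->
      {in `[0, L], forall y, vh 0%N y - P (v (tn 0%N)) y = 0}.
    by move=> E y yL; rewrite (E y yL) subrr.
  have [z1 _] := zero (Exi _ (leq0n N)) (Z _ _ ixi); have [_ z2] := zero (Eu _ (leq0n N)) (Z _ _ iu).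
  have [z4 _] := zero (EPhi _ (leq0n N)) (Z _ _ iPhi); have [z5 z6] := zero (Epsi _ (leq0n N)) (Z _ _ ipsi).
  have [_ z3'] := zero (Ephi _ (leq0n N)) (Z _ _ iphi).
  have [z7 _] := zero (Eth _ (leq0n N)) (Z _ _ ith); have [_ z8] := zero (Ew _ (leq0n N)) (Z _ _ iw).
  have [z3 _] : nrm L (fun y => phih 0%N y - P (phi (tn 0%N)) y - (uh 0%N y - P (u (tn 0%N)) y)) = 0 /\ True.
    split => //; have [] // := zero (Sh_sub L0 (Ephi _ (leq0n N)) (Eu _ (leq0n N))).
    by move=> y yL; rewrite (Z _ _ iphi y yL) (Z _ _ iu y yL) subrr.
  have z9 : nrm L (fun y => Dx L (err phih phi 0%N) y + err psih psi 0%N y) = 0.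
    apply/eqP; rewrite eq_le nrm_ge0 andbT.
    apply: (le_trans (nrm_triangle (fD _ (Ephi _ (leq0n N))) (fL _ (Epsi _ (leq0n N))))).
    by rewrite z3' z5 addr0.
  have lin (x1 x2 x3 x4 x5 x6 x7 x8 : R) : x1 = 0 -> x2 = 0 -> x3 = 0 -> x4 = 0 -> x5 = 0 ->
    x6 = 0 -> x7 = 0 -> x8 = 0 ->
    (rho * x1 ^+ 2 + alpha * x2 ^+ 2 + lambda * x3 ^+ 2 + rho1 * x4 ^+ 2 + K * x5 ^+ 2 + b * x6 ^+ 2
      + rho3 * x7 ^+ 2 + delta * x8 ^+ 2) / 2 = 0.
    by do 8 move=> ->; rewrite expr0n/= !mulr0 !addr0 mul0r.
  exact: lin z1 z2 z3 z4 z9 z6 z7 z8.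
- apply: (le_trans (sum_mesh_rate c h0 dt0 NT Gm)).
  apply: ler_wpM2r; first by rewrite addr_ge0// sqr_ge0.
  by rewrite lerDl; exact: KB0.
- have D0 : 0 <= G T - G 0 by rewrite subr_ge0; exact: (Gm _ _ (lexx 0) (ltW T0) (lexx T)).
  have E (k h' B' : R) : (k * (h' * B' + h' * B')) ^+ 2 = 4 * k ^+ 2 * B' ^+ 2 * h' ^+ 2 by ring.
  rewrite E; apply: ler_pM; [exact: KB0|exact: sqr_ge0| |by rewrite lerDl sqr_ge0].
  rewrite lerDr mulr_ge0//; first by rewrite mulr_ge0// sqr_ge0.
  exact: (addr_ge0 D0 (ltW T0)).
Qed.

End discrete_error.

(** * The error estimate *)

Section final_estimate.
Context {R : realType}.
Variables (L : R) (M : nat) (B : R).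
Hypotheses (L0 : 0 < L) (M0 : (0 < M)%N).
Local Notation h := (L / M%:R).
Local Notation P := (ritz L M).
Implicit Types v f q g : R -> R.

Let h0 : 0 <= h. Proof. by rewrite divr_ge0 ?ler0n// ltW. Qed.

Lemma ritz_value_le f : H10 L f -> nrm L (Dx L f) <= B -> nrm L (fun y => P f y - f y) <= h * B.
Proof.
move=> hf fB; rewrite nrm_distC; apply: (le_trans (ritz_err L0 M0 hf)).
by rewrite ler_wpM2l.
Qed.

Lemma ritz_slope_le f : H10 L f -> inH1 L (Dx L f) -> nrm L (Dx L (Dx L f)) <= B ->
  nrm L (fun y => Dx L (P f) y - Dx L f y) <= h * B.
Proof.
move=> hf hD fB; rewrite nrm_distC; apply: (le_trans (ritz_err_H2 L0 M0 hf hD)).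
by rewrite ler_wpM2l.
Qed.

Lemma value_error v f : inSh L M v -> H10 L f -> nrm L (Dx L f) <= B ->
  nrm L (fun y => v y - f y) <= nrm L (fun y => v y - P f y) + h * B.
Proof.
move=> sv hf fB; have [h1 _ _] := hf; have lf := H1_L2 h1.
have [lv _ _ _] := Sh_regular L0 sv; have [lP _ _ _] := Sh_regular L0 (ritz_Sh L0 M0 hf).
have lin (a b c : R) : a - b = a - c + (c - b) by ring.
have E : eq_ae L (fun y => v y - f y) (fun y => v y - P f y + (P f y - f y)).
  by apply: eq_ae_on => y _; exact: lin.
apply: (le_trans (nrm_split (L2_sub lv lf) (L2_sub lv lP) (L2_sub lP lf) E)).
by rewrite lerD2l; exact: (ritz_value_le hf fB).
Qed.

Lemma slope_error v f : inSh L M v -> H10 L f -> inH1 L (Dx L f) -> nrm L (Dx L (Dx L f)) <= B ->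
  nrm L (fun y => Dx L v y - Dx L f y) <= nrm L (Dx L (fun y => v y - P f y)) + h * B.
Proof.
move=> sv hf hD fB; have lf := H1_L2 hD.
have [_ h1 lv _] := Sh_regular L0 sv; have [_ h2 lP _] := Sh_regular L0 (ritz_Sh L0 M0 hf).
have [_ _ lE _] := Sh_regular L0 (Sh_sub L0 sv (ritz_Sh L0 M0 hf)).
have [_ d] := H1_sub L0 h1 h2.
have lin (a b c e : R) : e = a - c -> a - b = e + (c - b) by move=> ->; ring.
have E : eq_ae L (fun y => Dx L v y - Dx L f y)
    (fun y => Dx L (fun y => v y - P f y) y + (Dx L (P f) y - Dx L f y)).
  by apply: ae_mono d => y k yL; exact: (lin _ _ _ _ (k yL)).
apply: (le_trans (nrm_split (L2_sub lv lf) lE (L2_sub lP lf) E)).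
by rewrite lerD2l; exact: (ritz_slope_le hf hD fB).
Qed.

Lemma difference_error v f q g : inSh L M v -> inSh L M q -> H10 L f -> H10 L g ->
  nrm L (Dx L f) <= B -> nrm L (Dx L g) <= B ->
  nrm L (fun y => v y - q y - (f y - g y))
    <= nrm L (fun y => v y - P f y - (q y - P g y)) + (h * B + h * B).
Proof.
move=> sv sq hf hg fB gB; have [h1 _ _] := hf; have lf := H1_L2 h1.
have [h1' _ _] := hg; have lg := H1_L2 h1'.
have [lv _ _ _] := Sh_regular L0 sv; have [lP _ _ _] := Sh_regular L0 (ritz_Sh L0 M0 hf).
have [lq _ _ _] := Sh_regular L0 sq; have [lQ _ _ _] := Sh_regular L0 (ritz_Sh L0 M0 hg).
have lin (a b c a' b' c' : R) : a - a' - (b - b') = a - c - (a' - c') + (c - b - (c' - b')) by ring.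
have E : eq_ae L (fun y => v y - q y - (f y - g y))
    (fun y => v y - P f y - (q y - P g y) + (P f y - f y - (P g y - g y))).
  by apply: eq_ae_on => y _; exact: lin.
have k1 := L2_sub lP lf; have k2 := L2_sub lQ lg.
apply: (le_trans (nrm_split (L2_sub (L2_sub lv lq) (L2_sub lf lg))
  (L2_sub (L2_sub lv lP) (L2_sub lq lQ)) (L2_sub k1 k2) E)).
rewrite lerD2l; apply: (le_trans (nrm_triangleB k1 k2)); exact: (lerD (ritz_value_le hf fB) (ritz_value_le hg gB)).
Qed.

Lemma shear_error v f q g : inSh L M v -> inSh L M q -> H10 L f -> H10 L g -> inH1 L (Dx L f) ->
  nrm L (Dx L (Dx L f)) <= B -> nrm L (Dx L g) <= B ->
  nrm L (fun y => Dx L v y + q y - (Dx L f y + g y))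
    <= nrm L (fun y => Dx L (fun y => v y - P f y) y + (q y - P g y)) + (h * B + h * B).
Proof.
move=> sv sq hf hg hD fB gB; have lf := H1_L2 hD.
have [h1' _ _] := hg; have lg := H1_L2 h1'.
have [_ h1 lv _] := Sh_regular L0 sv; have [_ h2 lP _] := Sh_regular L0 (ritz_Sh L0 M0 hf).
have [lq _ _ _] := Sh_regular L0 sq; have [lQ _ _ _] := Sh_regular L0 (ritz_Sh L0 M0 hg).
have [_ _ lE _] := Sh_regular L0 (Sh_sub L0 sv (ritz_Sh L0 M0 hf)).
have [_ d] := H1_sub L0 h1 h2.
have lin (a b c a' b' c' e : R) : e = a - c ->
  a + a' - (b + b') = e + (a' - c') + (c - b + (c' - b')) by move=> ->; ring.
have E : eq_ae L (fun y => Dx L v y + q y - (Dx L f y + g y))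
    (fun y => Dx L (fun y => v y - P f y) y + (q y - P g y) + (Dx L (P f) y - Dx L f y + (P g y - g y))).
  by apply: ae_mono d => y k yL; exact: (lin _ _ _ _ _ _ _ (k yL)).
have k1 := L2_sub lP lf; have k2 := L2_sub lQ lg.
apply: (le_trans (nrm_split (L2_sub (L2_add lv lq) (L2_add lf lg))
  (L2_add lE (L2_sub lq lQ)) (L2_add k1 k2) E)).
rewrite lerD2l; apply: (le_trans (nrm_triangle k1 k2)); exact: (lerD (ritz_slope_le hf hD fB) (ritz_value_le hg gB)).
Qed.

(** The data agree with the exact solution almost everywhere, and the projection depends
    on the almost everywhere class only. *)
Lemma initial_ritz (v : R -> R -> R) v0 vh (t : R) : t = 0 -> inH10 L v0 -> is_Ph L M v0 vh ->
  inL2 L (v 0) -> eq_ae L (v 0) v0 -> {in `[0, L], vh =1 P (v t)}.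
Proof.
move=> -> h10 ph lv e y yL; rewrite (is_Ph_ritz L0 M0 h10 ph yL).
by have [h1 _ _ _] := h10; rewrite /ritz (Dx_eq_ae lv (H1_L2 h1) e).
Qed.

Lemma iterate_Sh (N : nat) (dt : R) (vh Vh : nat -> R -> R) : inSh L M (vh 0%N) ->
  (forall n, (0 < n <= N)%N -> inSh L M (Vh n)) ->
  (forall n, (n < N)%N -> {in `[0, L], forall y, vh n.+1 y = vh n y + dt * Vh n.+1 y}) ->
  forall n, (n <= N)%N -> inSh L M (vh n).
Proof.
move=> s0 sV up; elim=> [|n IHn] nN; first exact: s0.
have sS := Sh_add L0 M0 (IHn (ltnW nN)) (Sh_scale L0 dt (sV n.+1 nN)).
apply: (Sh_eq L0 M0 _ sS) => y yL.
by rewrite (up n nN y yL).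
Qed.

End final_estimate.

(** Passes from the energy bound on one component of the discrete error e to the total
    error f <= e + r, with r the projection error. *)
Lemma square_split {R : realFieldType} (f e r c Q : R) : 0 < c -> 0 <= f -> 0 <= e -> 0 <= r ->
  f <= e + r -> c * e ^+ 2 <= 2 * Q -> f ^+ 2 <= 4 * Q / c + 2 * r ^+ 2.
Proof.
move=> c0 f0 e0 r0 fe ce.
have e2 : e ^+ 2 <= 2 * Q / c by rewrite ler_pdivlMr// mulrC.
have : f ^+ 2 <= (e + r) ^+ 2 by rewrite lerXn2r// ?nnegrE// addr_ge0.
have := sqr_ge0 (e - r).
have -> : 4 * Q / c = 2 * (2 * Q / c) by ring.
move: (2 * Q / c) e2 => z e2; lra.
Qed.

Lemma weighted_terms {R : realFieldType} (c1 c2 c3 c4 c5 c6 c7 c8 x1 x2 x3 x4 x5 x6 x7 x8 Q : R) :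
  0 < c1 -> 0 < c2 -> 0 < c3 -> 0 < c4 -> 0 < c5 -> 0 < c6 -> 0 < c7 -> 0 < c8 ->
  (c1 * x1 ^+ 2 + c2 * x2 ^+ 2 + c3 * x3 ^+ 2 + c4 * x4 ^+ 2 + c5 * x5 ^+ 2 + c6 * x6 ^+ 2
     + c7 * x7 ^+ 2 + c8 * x8 ^+ 2) / 2 <= Q ->
  [/\ c1 * x1 ^+ 2 <= 2 * Q, c2 * x2 ^+ 2 <= 2 * Q, c3 * x3 ^+ 2 <= 2 * Q, c4 * x4 ^+ 2 <= 2 * Q &
    [/\ c5 * x5 ^+ 2 <= 2 * Q, c6 * x6 ^+ 2 <= 2 * Q, c7 * x7 ^+ 2 <= 2 * Q & c8 * x8 ^+ 2 <= 2 * Q]].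
Proof.
have pos (x c : R) : 0 < c -> 0 <= c * x ^+ 2 by move=> c0; rewrite mulr_ge0 ?sqr_ge0// ltW.
move=> /(pos x1) p1 /(pos x2) p2 /(pos x3) p3 /(pos x4) p4 /(pos x5) p5 /(pos x6) p6
  /(pos x7) p7 /(pos x8) p8 H.
by split; [lra..|split; lra].
Qed.

Lemma total_error {R : realFieldType} (c1 c2 c3 c4 c5 c6 c7 c8 x1 x2 x3 x4 x5 x6 x7 x8 A A' B h dt : R) :
  let Q := A * (A' * (h ^+ 2 + dt ^+ 2)) in
  x1 <= 4 * Q / c1 + 2 * (h * B) ^+ 2 -> x2 <= 4 * Q / c2 + 2 * (h * B) ^+ 2 ->
  x3 <= 4 * Q / c3 + 2 * (h * B + h * B) ^+ 2 -> x4 <= 4 * Q / c4 + 2 * (h * B) ^+ 2 ->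
  x5 <= 4 * Q / c5 + 2 * (h * B + h * B) ^+ 2 -> x6 <= 4 * Q / c6 + 2 * (h * B) ^+ 2 ->
  x7 <= 4 * Q / c7 + 2 * (h * B) ^+ 2 -> x8 <= 4 * Q / c8 + 2 * (h * B) ^+ 2 ->
  x1 + x2 + x3 + x4 + x5 + x6 + x7 + x8 <=
    (`|4 * (A * A') * (c1^-1 + c2^-1 + c3^-1 + c4^-1 + c5^-1 + c6^-1 + c7^-1 + c8^-1)|
     + 28 * B ^+ 2 + 1) * (h ^+ 2 + dt ^+ 2).
Proof.
set m := h ^+ 2 + dt ^+ 2 => Q h1 h2 h3 h4 h5 h6 h7 h8.
set W := _ + c8^-1.
have m0 : 0 <= m by rewrite addr_ge0 ?sqr_ge0.
have W1 : 4 * (A * A') * W * m <= `|4 * (A * A') * W| * m by rewrite ler_wpM2r// ler_norm.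
have W2 : 28 * B ^+ 2 * h ^+ 2 <= 28 * B ^+ 2 * m.
  by apply: ler_wpM2l; [rewrite mulr_ge0// sqr_ge0|rewrite lerDl sqr_ge0].
have WE : 4 * (A * A') * W * m = 4 * Q / c1 + 4 * Q / c2 + 4 * Q / c3 + 4 * Q / c4 + 4 * Q / c5
    + 4 * Q / c6 + 4 * Q / c7 + 4 * Q / c8 by rewrite /W /Q; ring.
have H : (h * B) ^+ 2 = B ^+ 2 * h ^+ 2 by ring.
have H' : (h * B + h * B) ^+ 2 = 4 * (B ^+ 2 * h ^+ 2) by ring.
rewrite H H' in h1 h2 h3 h4 h5 h6 h7 h8.
rewrite WE in W1; rewrite !(mulrDl _ _ m) mul1r.
have {}W2 : 28 * (B ^+ 2 * h ^+ 2) <= 28 * B ^+ 2 * m by rewrite mulrA.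
move: (4 * Q / c1) (4 * Q / c2) (4 * Q / c3) (4 * Q / c4) (4 * Q / c5) (4 * Q / c6) (4 * Q / c7)
  (4 * Q / c8) (`|_| * m) (28 * _ * m) (B ^+ 2 * h ^+ 2) h1 h2 h3 h4 h5 h6 h7 h8 W1 W2 => *.
lra.
Qed.

Section regularity.
Context {R : realType}.
Variables (L T : R).
Hypotheses (L0 : 0 < L) (T0 : 0 < T).

Lemma elliptic_weaken G B G' B' psi : elliptic L T G B psi -> B <= B' ->
  (forall s t, 0 <= s -> s <= t -> t <= T -> G t - G s <= G' t - G' s) -> elliptic L T G' B' psi.
Proof.
move=> [e1 e2 e3 e4 e5 e6 e7] BB GG.
split; [exact: e1|exact: e2|exact: modulus_weaken e3 GG|exact: modulus_weaken e4 GG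
 |exact: modulus_weaken e5 GG|by move=> t /e6 k; exact: le_trans k BB|by move=> t /e7 k; exact: le_trans k BB].
Qed.

(** The values and the derivatives of psi are primitives of square integrable functions
    of time. *)
Lemma elliptic_exists (psi : R -> R -> R) : Wkp (H2 L) T 1 2%:E psi -> C0 (H2 L) T psi ->
  (forall t : R, t \in `[0, T] -> inH10 L (psi t)) -> exists G B, 0 <= B /\ elliptic L T G B psi.
Proof.
move=> [_ [v psiv lv]] cpsi bd.
have H2U t : 0 <= t <= T -> inH2 L (psi t) by move=> tT; have [] := cpsi t (itvP0 tT).
have UX : \forall t \ae (@lebesgue_measure R), t \in `]0, T[ -> inH2 L (psi t).
  by apply: ae_forall => t /subset_itv_oo_cc tT; have [] := cpsi t tT.
have [G0 m0] : exists G, modulus L T G psi.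
  apply: (L2_modulus T0 (bop_H2_id L0) psiv lv _ (C0_op (bop_H2_id L0) cpsi)).
  by apply: ae_time_mono UX => t _ k; split; [exact: k|exact: eq_ae_refl].
have [G1 m1] : exists G, modulus L T G (fun t => Dx L (psi t)).
  apply: (L2_modulus T0 (bop_H2_Dx L0) psiv lv _ (C0_op (bop_H2_Dx L0) cpsi)).
  by apply: ae_time_mono UX => t _ k; split; [exact: k|exact: eq_ae_refl].
have [G2 m2] : exists G, modulus L T G (fun t => Dx L (Dx L (psi t))).
  apply: (L2_modulus T0 (bop_H2_DxDx L0) psiv lv _ (C0_op (bop_H2_DxDx L0) cpsi)).
  by apply: ae_time_mono UX => t _ k; split; [exact: k|exact: eq_ae_refl].
have [] := modulus_add m0 m1; set G01 := fun t => _ => m0' m1'.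
have [m0'' m2'] := modulus_add m0' m2; have [m1'' _] := modulus_add m1' m2.
have [B1 B10 b1] := modulus_bounded T0 m1 (fun t tT => Dx_L2 (proj1 (H2U t tT))).
have [B2 B20 b2] := modulus_bounded T0 m2 (fun t tT => Dx_L2 (proj2 (H2U t tT))).
exists (fun t => G01 t + G2 t), (B1 + B2); split; first by rewrite addr_ge0.
split; [exact: H2U|by move=> t /itvP0 /bd k; exact: (inH10_H10 L0 k)|exact: m0''|exact: m1''|exact: m2'| |].
- by move=> t /b1 k; apply: (le_trans k); rewrite lerDl.
- by move=> t /b2 k; apply: (le_trans k); rewrite lerDr.
Qed.

End regularity.

Theorem theorem5p2 (R : realType)
  (L T rho alpha lambda mu rho1 K gamma b rho3 delta kappa beta : R)
  (L_gt0 : 0 < L) (T_gt0 : 0 < T)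
  (rho_gt0 : 0 < rho) (alpha_gt0 : 0 < alpha) (lambda_gt0 : 0 < lambda)
  (mu_gt0 : 0 < mu) (rho1_gt0 : 0 < rho1) (K_gt0 : 0 < K)
  (gamma_gt0 : 0 < gamma) (b_gt0 : 0 < b) (rho3_gt0 : 0 < rho3)
  (delta_gt0 : 0 < delta) (kappa_gt0 : 0 < kappa) (beta_neq0 : beta != 0)
  (u phi psi w xi Phi theta : R -> R -> R)
  (u0 u1 phi0 phi1 psi0 w0 w1 : R -> R)
  (u_reg : [/\ Wkp (L2 L) T 3 2%:E u, Wkp (H1 L) T 2 2%:E u
             & Wkp (H2 L) T 1 +oo%E u])
  (phi_reg : [/\ Wkp (L2 L) T 3 2%:E phi, Wkp (H1 L) T 2 2%:E phi
               & Wkp (H2 L) T 1 +oo%E phi])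
  (w_reg : [/\ Wkp (L2 L) T 3 2%:E w, Wkp (H1 L) T 2 2%:E w
             & Wkp (H2 L) T 1 +oo%E w])
  (psi_reg : Wkp (H2 L) T 1 2%:E psi)
  (* u, phi, w, psi and xi = u_t, Phi = phi_t, theta = w_t are the
     representatives that are continuous in time *)
  (u_cont : C0 (H2 L) T u) (phi_cont : C0 (H2 L) T phi)
  (w_cont : C0 (H2 L) T w) (psi_cont : C0 (H2 L) T psi)
  (xi_def : time_deriv (L2 L) T u xi) (xi_cont : C0 (H1 L) T xi)
  (Phi_def : time_deriv (L2 L) T phi Phi) (Phi_cont : C0 (H1 L) T Phi)
  (theta_def : time_deriv (L2 L) T w theta) (theta_cont : C0 (H1 L) T theta)
  (boundary : forall t : R, t \in `[0, T] ->
     [/\ inH10 L (u t), inH10 L (phi t), inH10 L (psi t) & inH10 L (w t)])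
  (data_H10 : [/\ inH10 L u0, inH10 L phi0, inH10 L psi0 & inH10 L w0])
  (data_H10_t : [/\ inH10 L u1, inH10 L phi1 & inH10 L w1])
  (initial : [/\ eq_ae L (u 0) u0,
                 eq_ae L (phi 0) phi0,
                 eq_ae L (psi 0) psi0
               & eq_ae L (w 0) w0])
  (initial_t : [/\ eq_ae L (xi 0) u1,
                   eq_ae L (Phi 0) phi1
                 & eq_ae L (theta 0) w1])
  (pde : \forall t \ae lebesgue_measure, t \in `]0, T[ ->
         \forall x \ae lebesgue_measure, x \in `]0, L[ ->
     [/\ rho * Dt L T xi t x - alpha * Dx L (Dx L (u t)) x
         - lambda * (phi t x - u t x) + mu * xi t x = 0,
         rho1 * Dt L T Phi t x
         - K * Dx L (fun z => Dx L (phi t) z + psi t z) x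
         + lambda * (phi t x - u t x) + gamma * Phi t x
         + beta * Dx L (theta t) x = 0,
         - (b * Dx L (Dx L (psi t)) x) + K * (Dx L (phi t) x + psi t x) = 0
       & rho3 * Dt L T theta t x - delta * Dx L (Dx L (w t)) x
         + beta * Dx L (Phi t) x - kappa * Dx L (Dx L (theta t)) x = 0]) :
  exists2 C : R, 0 < C &
  forall M N : nat, (0 < M)%N -> (0 < N)%N ->
  let h := L / M%:R in
  let dt := T / N%:R in
  let tn := fun n : nat => n%:R * dt in
  forall uh xih phih Phih psih wh thetah : nat -> R -> R,
  [/\ is_Ph L M u0 (uh 0%N), is_Ph L M phi0 (phih 0%N),
      is_Ph L M psi0 (psih 0%N) & is_Ph L M w0 (wh 0%N)] ->
  [/\ is_Ph L M u1 (xih 0%N), is_Ph L M phi1 (Phih 0%N)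
    & is_Ph L M w1 (thetah 0%N)] ->
  (forall n, (1 <= n <= N)%N ->
     [/\ inSh L M (xih n), inSh L M (Phih n), inSh L M (psih n)
       & inSh L M (thetah n)] /\
     (forall x : R, x \in `[0, L] ->
        [/\ uh n x = uh n.-1 x + dt * xih n x,
            phih n x = phih n.-1 x + dt * Phih n x
          & wh n x = wh n.-1 x + dt * thetah n x]) /\
     (forall ub phib psib wb,
        inSh L M ub -> inSh L M phib -> inSh L M psib -> inSh L M wb ->
        [/\ rho / dt * ip L (fun x => xih n x - xih n.-1 x) ub
            + alpha * ip L (Dx L (uh n)) (Dx L ub)
            - lambda * ip L (fun x => phih n x - uh n x) ub
            + mu * ip L (xih n) ub = 0,
            rho1 / dt * ip L (fun x => Phih n x - Phih n.-1 x) phib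
            + K * ip L (fun x => Dx L (phih n) x + psih n x) (Dx L phib)
            + lambda * ip L (fun x => phih n x - uh n x) phib
            + gamma * ip L (Phih n) phib
            + beta * ip L (Dx L (thetah n)) phib = 0,
            b * ip L (Dx L (psih n)) (Dx L psib)
            + K * ip L (fun x => Dx L (phih n) x + psih n x) psib = 0
          & rho3 / dt * ip L (fun x => thetah n x - thetah n.-1 x) wb
            + delta * ip L (Dx L (wh n)) (Dx L wb)
            + beta * ip L (Dx L (Phih n)) wb
            + kappa * ip L (Dx L (thetah n)) (Dx L wb) = 0])) ->
  forall n, (1 <= n <= N)%N ->
    nrm L (fun x => xih n x - xi (tn n) x) ^+ 2
    + nrm L (fun x => Dx L (uh n) x - Dx L (u (tn n)) x) ^+ 2
    + nrm L (fun x => phih n x - uh n x - (phi (tn n) x - u (tn n) x)) ^+ 2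
    + nrm L (fun x => Phih n x - Phi (tn n) x) ^+ 2
    + nrm L (fun x => Dx L (phih n) x + psih n x
                      - (Dx L (phi (tn n)) x + psi (tn n) x)) ^+ 2
    + nrm L (fun x => Dx L (psih n) x - Dx L (psi (tn n)) x) ^+ 2
    + nrm L (fun x => thetah n x - theta (tn n) x) ^+ 2
    + nrm L (fun x => Dx L (wh n) x - Dx L (w (tn n)) x) ^+ 2
    <= C * (h ^+ 2 + dt ^+ 2).
Proof.
have [Gu [Bu [Bu0 eu0]]] := evolution_exists L_gt0 T_gt0 (let: And3 _ a _ := u_reg in a)
  (let: And3 _ _ a := u_reg in a) u_cont xi_def xi_cont (fun t tT => let: And4 a _ _ _ := boundary t tT in a).
have [Gf [Bf [Bf0 ef0]]] := evolution_exists L_gt0 T_gt0 (let: And3 _ a _ := phi_reg in a)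
  (let: And3 _ _ a := phi_reg in a) phi_cont Phi_def Phi_cont (fun t tT => let: And4 _ a _ _ := boundary t tT in a).
have [Gw [Bw [Bw0 ew0]]] := evolution_exists L_gt0 T_gt0 (let: And3 _ a _ := w_reg in a)
  (let: And3 _ _ a := w_reg in a) w_cont theta_def theta_cont (fun t tT => let: And4 _ _ _ a := boundary t tT in a).
have [Gp [Bp [Bp0 ep0]]] := elliptic_exists L_gt0 T_gt0 psi_reg psi_cont
  (fun t tT => let: And4 _ _ a _ := boundary t tT in a).
(* A common function G and a common bound B for all components. *)
pose G t := Gu t + Gf t + Gw t + Gp t.
pose B := Bu + Bf + Bw + Bp.
have B0 : 0 <= B by rewrite !addr_ge0.
have mu_ s t (a : 0 <= s) (b' : s <= t) (c : t <= T) := modulus_mono (ev_mU eu0) a b' c.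
have mf_ s t (a : 0 <= s) (b' : s <= t) (c : t <= T) := modulus_mono (ev_mU ef0) a b' c.
have mw_ s t (a : 0 <= s) (b' : s <= t) (c : t <= T) := modulus_mono (ev_mU ew0) a b' c.
have mp_ s t (a : 0 <= s) (b' : s <= t) (c : t <= T) := modulus_mono (el_m ep0) a b' c.
have eu : evolution L T G B u xi.
  apply: (evolution_weaken L_gt0 eu0) => [|s t s0 st tT]; first by rewrite /B; lra.
  by have := mf_ s t s0 st tT; have := mw_ s t s0 st tT; have := mp_ s t s0 st tT; rewrite /G; lra.
have ephi : evolution L T G B phi Phi.
  apply: (evolution_weaken L_gt0 ef0) => [|s t s0 st tT]; first by rewrite /B; lra.
  by have := mu_ s t s0 st tT; have := mw_ s t s0 st tT; have := mp_ s t s0 st tT; rewrite /G; lra.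
have ew : evolution L T G B w theta.
  apply: (evolution_weaken L_gt0 ew0) => [|s t s0 st tT]; first by rewrite /B; lra.
  by have := mu_ s t s0 st tT; have := mf_ s t s0 st tT; have := mp_ s t s0 st tT; rewrite /G; lra.
have epsi : elliptic L T G B psi.
  apply: (elliptic_weaken ep0) => [|s t s0 st tT]; first by rewrite /B; lra.
  by have := mu_ s t s0 st tT; have := mf_ s t s0 st tT; have := mw_ s t s0 st tT; rewrite /G; lra.
have [xi_t xi_L] := Dt_spec T_gt0 (let: And3 a _ _ := u_reg in a) xi_def.
have [Phi_t Phi_L] := Dt_spec T_gt0 (let: And3 a _ _ := phi_reg in a) Phi_def.
have [theta_t theta_L] := Dt_spec T_gt0 (let: And3 a _ _ := w_reg in a) theta_def.
have [Bt _ theta_H2] := velocity_ae_H2 L_gt0 T_gt0 (let: And3 _ _ a := w_reg in a) theta_def.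
have {}xi_L := ae_time_mono (fun t _ => @proj2 _ _) xi_L.
have {}Phi_L := ae_time_mono (fun t _ => @proj2 _ _) Phi_L.
have {}theta_L := ae_time_mono (fun t _ => @proj2 _ _) theta_L.
have {}theta_H2 := ae_time_mono (fun t _ => @proj1 _ _) theta_H2.
have cons1 s t := rate_u_consistent L_gt0 T_gt0 rho_gt0 eu ephi xi_t xi_L pde (s := s) (t := t).
have cons2 s t := rate_phi_consistent L_gt0 T_gt0 rho1_gt0 eu ephi ew epsi Phi_t Phi_L pde (s := s) (t := t).
have cons3 t chi := weak_psi L_gt0 T_gt0 eu ephi epsi pde (t := t) (chi := chi).
have cons4 s t chi := weak_w_consistent L_gt0 T_gt0 rho3_gt0 eu ephi ew theta_t theta_L theta_H2 pde
  (s := s) (t := t) (chi := chi).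
set a1 := \sum_(p <- rate_u _ _ _ _ _ _ _) _ in cons1.
set a2 := \sum_(p <- rate_phi _ _ _ _ _ _ _ _ _ _) _ in cons2.
set a4 := \sum_(p <- rate_w _ _ _) _ in cons4.
set a5 := \sum_(p <- flux_w _ _ _ _ _) _ in cons4.
have a10 : 0 <= a1 by exact: sumr_ge0.
have a20 : 0 <= a2 by exact: sumr_ge0.
have a40 : 0 <= a4 by exact: sumr_ge0.
have a50 : 0 <= a5 by exact: sumr_ge0.
pose c := rate_cst L rho lambda mu rho1 K gamma rho3 beta B a1 a2 a4 a5.
pose C1 := 2 * (c_damp mu gamma kappa + T * (c_slip alpha lambda K delta + L * ((1 + 2 * b) / b)) ^+ 2
        + (L * ((1 + 2 * b) / b)) ^+ 2) * (3 * c ^+ 2 * (G T - G 0 + T) + 4 * K ^+ 2 * B ^+ 2).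
pose weights := rho^-1 + alpha^-1 + lambda^-1 + rho1^-1 + K^-1 + b^-1 + rho3^-1 + delta^-1.
(* The energy controls each square up to its weight; the projection errors contribute
   6 terms 2 (h B)^2 and 2 terms 2 (2 h B)^2, that is 28 (h B)^2. *)
exists (`|4 * C1 * weights| + 28 * B ^+ 2 + 1).
  by rewrite ltr_wpDl// addr_ge0// mulr_ge0// sqr_ge0.
move=> M N M0 N0; cbv zeta => uh xih phih Phih psih wh thetah [pu pf pp pw] [px pF pt] disc n /andP[n1 nN].
have Vxi k : (0 < k <= N)%N -> inSh L M (xih k) by move=> /disc [[]].
have VPhi k : (0 < k <= N)%N -> inSh L M (Phih k) by move=> /disc [[]].
have Vpsi k : (0 < k <= N)%N -> inSh L M (psih k) by move=> /disc [[]].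
have Vth k : (0 < k <= N)%N -> inSh L M (thetah k) by move=> /disc [[]].
have all0 (v : nat -> R -> R) : inSh L M (v 0%N) -> (forall k, (0 < k <= N)%N -> inSh L M (v k)) ->
    forall k, (k <= N)%N -> inSh L M (v k).
  by move=> v0 vS [_|k kN]; [exact: v0|exact: vS].
have [[su _] [sf _] [sp _] [sw _]] := And4 pu pf pp pw.
have [[sx _] [sF _] [sh _]] := And3 px pF pt.
have Sxi := all0 _ sx Vxi; have SPhi := all0 _ sF VPhi.
have Spsi := all0 _ sp Vpsi; have Sth := all0 _ sh Vth.
have uS k : (k < N)%N -> {in `[0, L], forall y, uh k.+1 y = uh k y + T / N%:R * xih k.+1 y}.
  by move=> kN y yL; have [_ [up _]] := disc k.+1 kN; have [e _ _] := up y yL.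
have phiS k : (k < N)%N -> {in `[0, L], forall y, phih k.+1 y = phih k y + T / N%:R * Phih k.+1 y}.
  by move=> kN y yL; have [_ [up _]] := disc k.+1 kN; have [_ e _] := up y yL.
have wS k : (k < N)%N -> {in `[0, L], forall y, wh k.+1 y = wh k y + T / N%:R * thetah k.+1 y}.
  by move=> kN y yL; have [_ [up _]] := disc k.+1 kN; have [_ _ e] := up y yL.
have Su := iterate_Sh L_gt0 M0 su Vxi uS; have Sphi := iterate_Sh L_gt0 M0 sf VPhi phiS.
have Sw := iterate_Sh L_gt0 M0 sw Vth wS.
have [hu0 hf0 hp0 hw0] := data_H10; have [hu1 hf1 hw1] := data_H10_t.
have [iu0 if0 ip0 iw0] := initial; have [iu1 if1 iw1] := initial_t.
have T00 : 0 <= (0 : R) <= T by rewrite lexx ltW.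
have l0 v : C0 (H2 L) T v -> inL2 L (v 0) by move=> cv; have [[h1 _] _] := cv 0 (itvP0 T00); exact: (H1_L2 h1).
have l1 v : C0 (H1 L) T v -> inL2 L (v 0) by move=> cv; have [h1 _] := cv 0 (itvP0 T00); exact: (H1_L2 h1).
have t00 : 0%:R * (T / N%:R) = 0 :> R by rewrite mul0r.
have D := discrete_error L_gt0 T_gt0 rho_gt0 alpha_gt0 lambda_gt0 mu_gt0 rho1_gt0 K_gt0 gamma_gt0
  b_gt0 rho3_gt0 delta_gt0 kappa_gt0 B0 eu ephi ew epsi a10 a20 a40 a50 cons1 cons2 cons3 cons4 M0 N0
  Su Sxi Sphi SPhi Spsi Sw Sth
  (initial_ritz L_gt0 M0 t00 hu0 pu (l0 _ u_cont) iu0)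
  (initial_ritz L_gt0 M0 t00 hu1 px (l1 _ xi_cont) iu1)
  (initial_ritz L_gt0 M0 t00 hf0 pf (l0 _ phi_cont) if0)
  (initial_ritz L_gt0 M0 t00 hf1 pF (l1 _ Phi_cont) if1)
  (initial_ritz L_gt0 M0 t00 hp0 pp (l0 _ psi_cont) ip0)
  (initial_ritz L_gt0 M0 t00 hw0 pw (l0 _ w_cont) iw0)
  (initial_ritz L_gt0 M0 t00 hw1 pt (l1 _ theta_cont) iw1)
  uS phiS wS.
have {}D := D
  (fun k chi kN sc => let: And4 e _ _ _ := (proj2 (proj2 (disc k.+1 kN))) chi chi chi chi sc sc sc sc in e)
  (fun k chi kN sc => let: And4 _ e _ _ := (proj2 (proj2 (disc k.+1 kN))) chi chi chi chi sc sc sc sc in e)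
  (fun k chi kN sc => let: And4 _ _ e _ := (proj2 (proj2 (disc k.+1 kN))) chi chi chi chi sc sc sc sc in e)
  (fun k chi kN sc => let: And4 _ _ _ e := (proj2 (proj2 (disc k.+1 kN))) chi chi chi chi sc sc sc sc in e)
  n nN.
have h0 : 0 <= L / M%:R by rewrite divr_ge0 ?ler0n// ltW.
have dt0 : 0 <= T / N%:R by rewrite divr_ge0 ?ler0n// ltW.
have tI : 0 <= n%:R * (T / N%:R) <= T.
  rewrite mulr_ge0 ?ler0n//= mulrCA ler_piMr ?(ltW T_gt0)//.
  by rewrite ler_pdivrMr ?ltr0n// mul1r ler_nat.
have hB : 0 <= L / M%:R * B by rewrite mulr_ge0.
have [] := weighted_terms rho_gt0 alpha_gt0 lambda_gt0 rho1_gt0 K_gt0 b_gt0 rho3_gt0 delta_gt0 D.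
move=> w1' w2' w3' w4' [w5' w6' w7' w8'].
have [_ Du] := ev_H2 eu tI; have [_ Df] := ev_H2 ephi tI; have [_ Dw] := ev_H2 ew tI.
have [_ Dp] := el_H2 epsi tI.
have k1 := value_error L_gt0 M0 (Sxi _ nN) (ev_V eu tI) (ev_bDV eu tI).
have k2 := slope_error L_gt0 M0 (Su _ nN) (ev_H10 eu tI) Du (ev_bDDU eu tI).
have k3 := difference_error L_gt0 M0 (Sphi _ nN) (Su _ nN) (ev_H10 ephi tI) (ev_H10 eu tI)
  (ev_bDU ephi tI) (ev_bDU eu tI).
have k4 := value_error L_gt0 M0 (SPhi _ nN) (ev_V ephi tI) (ev_bDV ephi tI).
have k5 := shear_error L_gt0 M0 (Sphi _ nN) (Spsi _ nN) (ev_H10 ephi tI) (el_H10 epsi tI) Df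
  (ev_bDDU ephi tI) (el_bD epsi tI).
have k6 := slope_error L_gt0 M0 (Spsi _ nN) (el_H10 epsi tI) Dp (el_bDD epsi tI).
have k7 := value_error L_gt0 M0 (Sth _ nN) (ev_V ew tI) (ev_bDV ew tI).
have k8 := slope_error L_gt0 M0 (Sw _ nN) (ev_H10 ew tI) Dw (ev_bDDU ew tI).
have hB2 : 0 <= L / M%:R * B + L / M%:R * B by rewrite addr_ge0.
have q1 := square_split rho_gt0 (nrm_ge0 _ _) (nrm_ge0 _ _) hB k1 w1'.
have q2 := square_split alpha_gt0 (nrm_ge0 _ _) (nrm_ge0 _ _) hB k2 w2'.
have q3 := square_split lambda_gt0 (nrm_ge0 _ _) (nrm_ge0 _ _) hB2 k3 w3'.
have q4 := square_split rho1_gt0 (nrm_ge0 _ _) (nrm_ge0 _ _) hB k4 w4'.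
have q5 := square_split K_gt0 (nrm_ge0 _ _) (nrm_ge0 _ _) hB2 k5 w5'.
have q6 := square_split b_gt0 (nrm_ge0 _ _) (nrm_ge0 _ _) hB k6 w6'.
have q7 := square_split rho3_gt0 (nrm_ge0 _ _) (nrm_ge0 _ _) hB k7 w7'.
have q8 := square_split delta_gt0 (nrm_ge0 _ _) (nrm_ge0 _ _) hB k8 w8'.
exact: (total_error q1 q2 q3 q4 q5 q6 q7 q8).
Qed.
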